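(* Let $(M,g)$ be a complete Kähler manifold of real dimension $2n$ satisfying, for some $\nu>2$ and some constant $C_S>0$, the Sobolev type inequality $$\left(\int_M |\phi|^{\frac{2\nu}{\nu-2}}\right)^{\frac{\nu-2}{\nu}}\leq C_S\int_M|\nabla\phi|^2$$ for every compactly supported smooth function $\phi$ on $M$. Denote by $\mu_1\leq\dots\leq\mu_{n^2}$ the eigenvalues of the Kähler curvature operator of $(M,g)$. Suppose that there exists a function $\kappa:M\to\mathbb{R}$ such that $\kappa\leq 0$ and $$\frac{\mu_1(x)+\cdots+\mu_n(x)}{n+1}\geq\kappa(x)$$ at every point $x\in M$. Let $p>1$. Then every (real-valued) pluriharmonic function $u$ on $M$ is constant, provided that $|\nabla u|\in L^p$, that $\|\kappa\|_{\nu/2}<\frac{4}{pC_S(n+1)}$ if $p\geq2$, and that $\|\kappa\|_{\nu/2}<\frac{4p}{(4-p)^2C_S(n+1)}$ if $1<p<2$, where $$\|\kappa\|_{\nu/2}:=\left(\int_M|\kappa|^{\frac{\nu}{2}}\right)^{\frac{2}{\nu}}.$$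
   Context: Manifolds are connected. Integrals are with respect to the Riemannian volume. A function $u$ is pluriharmonic if $\partial\bar\partial u=0$. The curvature operator $\mathfrak{R}:\Lambda^2TM\to\Lambda^2TM$ is the self-adjoint operator defined by $g(\mathfrak{R}(X\wedge Y),Z\wedge W)=Rm(X,Y,Z,W)$, where $\Lambda^2$ carries the inner product for which $e_i\wedge e_j$ ($i<j$) is orthonormal whenever $(e_i)$ is, and the sign of $Rm$ is such that $g(\mathfrak{R}(X\wedge Y),X\wedge Y)$ is the sectional curvature of the plane spanned by orthonormal $X,Y$. Identifying $\Lambda^2T_xM=\mathfrak{so}(T_xM)$, on a Kähler manifold of complex dimension $n$ the operator $\mathfrak{R}$ vanishes on the orthogonal complement of $\mathfrak{u}(n)\subset\mathfrak{so}(2n)$ and so induces $\mathfrak{R}_{\mathfrak{u}(n)}:\mathfrak{u}(n)\to\mathfrak{u}(n)$, called the Kähler curvature operator; since $\dim_{\mathbb{R}}\mathfrak{u}(n)=n^2$ it has $n^2$ eigenvalues at each point. *)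

(* Defs.v *)
From HB Require Import structures.
From mathcomp Require Import all_boot all_order all_algebra.
From mathcomp Require Import complex.
From mathcomp Require Import all_classical all_reals all_analysis.
From mathcomp Require Import ring.

Set Implicit Arguments.
Unset Strict Implicit.
Unset Printing Implicit Defensive.

Import Order.TTheory GRing.Theory Num.Theory.
Import numFieldNormedType.Exports.

Local Open Scope classical_set_scope.
Local Open Scope ring_scope.

Definition basis_vec (R : realType) (m : nat) (a : 'I_m) : 'rV[R]_m :=
  delta_mx 0 a.

Definition partial (R : realType) (m : nat) (a : 'I_m) (f : 'rV[R]_m -> R)
    (p : 'rV[R]_m) : R :=
  'D_(basis_vec R a) f p.

Fixpoint iter_partial (R : realType) (m : nat) (s : seq 'I_m)
    (f : 'rV[R]_m -> R) : 'rV[R]_m -> R :=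
  if s is a :: s' then partial a (iter_partial s' f) else f.

(* C^infty on an open set [U]: all iterated partial derivatives exist and are
   differentiable (hence continuous) at every point of [U] *)
Definition smooth_on (R : realType) (m : nat) (U : set 'rV[R]_m)
    (f : 'rV[R]_m -> R) : Prop :=
  forall (s : seq 'I_m) (p : 'rV[R]_m),
    U p -> differentiable (iter_partial s f) p.

(* Lebesgue integral over R^m of a nonnegative Borel function, computed by
   iterated integration (Tonelli) *)
Fixpoint integral_rV (R : realType) (m : nat) :
    ('rV[R]_m -> \bar R) -> \bar R :=
  match m with
  | 0 => fun f => f 0
  | k.+1 => fun f =>
      (\int[@lebesgue_measure R]_t
         integral_rV (fun v : 'rV[R]_k => f (row_mx (t%:M : 'rV[R]_1) v)))%E
  end.

(* Complex structure of C^n = R^(n + n), where (x, y) stands for z = x + i y,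
   so that multiplication by i is (x, y) |-> (- y, x).  Linear maps act on row
   vectors on the right *)
Definition Jmx (R : realType) (n : nat) : 'M[R]_(n + n) :=
  block_mx 0 1%:M (- 1%:M) 0.

Definition partialC (R : realType) (m : nat) (a : 'I_m)
    (f : 'rV[R]_m -> R[i]) (p : 'rV[R]_m) : R[i] :=
  (partial a (fun q => complex.Re (f q)) p
     +i* partial a (fun q => complex.Im (f q)) p)%C.

Definition dz (R : realType) (n : nat) (j : 'I_n)
    (f : 'rV[R]_(n + n) -> R[i]) (p : 'rV[R]_(n + n)) : R[i] :=
  2^-1 * (partialC (lshift n j) f p - 'i%C * partialC (rshift n j) f p).

Definition dzbar (R : realType) (n : nat) (j : 'I_n)
    (f : 'rV[R]_(n + n) -> R[i]) (p : 'rV[R]_(n + n)) : R[i] :=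
  2^-1 * (partialC (lshift n j) f p + 'i%C * partialC (rshift n j) f p).

(* Connected complex manifolds of complex dimension n, given by a holomorphic
   atlas.  [chart_inv i] is only meaningful on the image of [chart i];
   [chart_at] selects a chart around each point *)
Record complexManifold (R : realType) (n : nat) (M : topologicalType) :=
ComplexManifold {
  chart_index : Type;
  chart_dom : chart_index -> set M;
  chart : chart_index -> M -> 'rV[R]_(n + n);
  chart_inv : chart_index -> 'rV[R]_(n + n) -> M;
  chart_at : M -> chart_index;
  manifold_hausdorff : hausdorff_space M;
  manifold_second_countable : @second_countable M;
  manifold_connected : connected [set: M];
  chart_dom_open : forall i, open (chart_dom i);
  chart_dom_at : forall x, chart_dom (chart_at x) x;
  chart_im_open : forall i, open (chart i @` chart_dom i);
  chartK : forall i x, chart_dom i x -> chart_inv i (chart i x) = x;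
  chart_continuous : forall i x,
    chart_dom i x -> {for x, continuous (chart i)};
  chart_inv_continuous : forall i x,
    chart_dom i x -> {for chart i x, continuous (chart_inv i)};
  transition_smooth : forall i j (a : 'I_(n + n)),
    smooth_on (chart i @` (chart_dom i `&` chart_dom j))
      (fun p => chart j (chart_inv i p) 0 a);
  (* Cauchy-Riemann: the differential of a transition commutes with J *)
  transition_holomorphic : forall i j p,
    (chart i @` (chart_dom i `&` chart_dom j)) p ->
    Jmx R n *m jacobian (chart j \o chart_inv i) p
      = jacobian (chart j \o chart_inv i) p *m Jmx R n
}.

Definition chart_im (R : realType) (n : nat) (M : topologicalType)
    (X : complexManifold R n M) (i : chart_index X) : set 'rV[R]_(n + n) :=
  chart i @` chart_dom i.

Definition transition (R : realType) (n : nat) (M : topologicalType)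
    (X : complexManifold R n M) (i j : chart_index X) :
    'rV[R]_(n + n) -> 'rV[R]_(n + n) :=
  chart j \o chart_inv i.

Definition smooth (R : realType) (n : nat) (M : topologicalType)
    (X : complexManifold R n M) (f : M -> R) : Prop :=
  forall i : chart_index X, smooth_on (chart_im i) (f \o chart_inv i).

(* d dbar u = \sum_(j, k) (d^2 u / dz_j dzbar_k) dz_j /\ dzbar_k *)
Definition pluriharmonic (R : realType) (n : nat) (M : topologicalType)
    (X : complexManifold R n M) (u : M -> R) : Prop :=
  smooth X u /\
  forall (i : chart_index X) (p : 'rV[R]_(n + n)), chart_im i p ->
  forall j k : 'I_n,
    dz j (dzbar k (fun q => (u (chart_inv i q))%:C%C)) p = 0.

(* A Kaehler metric: [metric i p] is the Gram matrix of g in the chart [i] at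
   the point of coordinates [p]; the Kaehler form is omega(v, w) = g(Jv, w),
   of Gram matrix [Jmx *m metric i p], and is required to be closed *)
Record kahlerMetric (R : realType) (n : nat) (M : topologicalType)
    (X : complexManifold R n M) := KahlerMetric {
  metric : chart_index X -> 'rV[R]_(n + n) -> 'M[R]_(n + n);
  metric_smooth : forall i a b,
    smooth_on (chart_im i) (fun p => metric i p a b);
  metric_sym : forall i p, chart_im i p -> (metric i p)^T = metric i p;
  metric_pos : forall i p (v : 'rV[R]_(n + n)), chart_im i p -> v != 0 ->
    0 < (v *m metric i p *m v^T) 0 0;
  metric_transition : forall i j p,
    (chart i @` (chart_dom i `&` chart_dom j)) p ->
    metric i p = jacobian (transition i j) p *m metric j (transition i j p)
                   *m (jacobian (transition i j) p)^T;
  metric_hermitian : forall i p, chart_im i p ->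
    Jmx R n *m metric i p *m (Jmx R n)^T = metric i p;
  kahler_form_closed : forall i p (a b c : 'I_(n + n)), chart_im i p ->
    partial a (fun q => (Jmx R n *m metric i q) b c) p
      + partial b (fun q => (Jmx R n *m metric i q) c a) p
      + partial c (fun q => (Jmx R n *m metric i q) a b) p = 0
}.

(* [piecewise_C1_curve g x y l]: there is a piecewise C^1 curve of length [l]
   from [x] to [y], subdivided so that each piece lies in a chart *)
Inductive piecewise_C1_curve (R : realType) (n : nat) (M : topologicalType)
    (X : complexManifold R n M) (g : kahlerMetric X) : M -> M -> R -> Prop :=
| curve_nil : forall x : M, piecewise_C1_curve g x x 0
| curve_cons : forall (i : chart_index X) (c : R -> 'rV[R]_(n + n))
      (y : M) (l : R),
    (forall t : R, derivable c t 1) ->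
    continuous (derive1 c) ->
    (forall t : R, 0 <= t <= 1 -> chart_im i (c t)) ->
    piecewise_C1_curve g (chart_inv i (c 1)) y l ->
    piecewise_C1_curve g (chart_inv i (c 0)) y
      ((\int[@lebesgue_measure R]_(t in `[0, 1])
          Num.sqrt ((derive1 c t *m metric g i (c t) *m (derive1 c t)^T) 0 0))
       + l).

Definition riemannian_dist (R : realType) (n : nat) (M : topologicalType)
    (X : complexManifold R n M) (g : kahlerMetric X) (x y : M) : R :=
  inf [set l | piecewise_C1_curve g x y l].

Definition complete_metric (R : realType) (n : nat) (M : topologicalType)
    (X : complexManifold R n M) (g : kahlerMetric X) : Prop :=
  forall s : nat -> M,
    (forall e : R, 0 < e -> exists N : nat, forall j k : nat,
       (N <= j)%N -> (N <= k)%N -> riemannian_dist g (s j) (s k) < e) ->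
    exists x : M, riemannian_dist g (s k) x @[k --> \oo] --> (0 : R).

(* |nabla f| = |df|, computed with the inverse of the Gram matrix *)
Definition grad_norm (R : realType) (n : nat) (M : topologicalType)
    (X : complexManifold R n M) (g : kahlerMetric X) (f : M -> R) (x : M) : R :=
  let i := chart_at X x in
  let p := chart i x in
  let df : 'rV[R]_(n + n) := \row_a partial a (f \o chart_inv i) p in
  Num.sqrt ((df *m invmx (metric g i p) *m df^T) 0 0).

Definition borel (M : ptopologicalType) := g_sigma_algebraType (@open M).

(* These conditions determine [vol], since countably many charts cover M *)
Definition riemannian_volume (R : realType) (n : nat) (M : ptopologicalType)
    (X : complexManifold R n M) (g : kahlerMetric X)
    (vol : {measure set (borel M) -> \bar R}) : Prop :=
  forall (i : chart_index X) (A : set (borel M)),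
    measurable A -> A `<=` chart_dom i ->
    vol A = integral_rV (fun p =>
      ((Num.sqrt (\det (metric g i p)))%:E * (\1_(chart i @` A) p)%:E)%E).

(* Gamma^c_{ab} for the metric on R^m with Gram matrix [G] *)
Definition christoffel (R : realType) (m : nat) (G : 'rV[R]_m -> 'M[R]_m)
    (c a b : 'I_m) (p : 'rV[R]_m) : R :=
  2^-1 * \sum_(d < m) invmx (G p) c d *
    (partial a (fun q => G q b d) p + partial b (fun q => G q a d) p
       - partial d (fun q => G q a b) p).

(* coefficient along d_d of R(d_a, d_b) d_c, where
   R(X, Y) = [nabla_X, nabla_Y] - nabla_[X, Y] *)
Definition riemann_endo (R : realType) (m : nat) (G : 'rV[R]_m -> 'M[R]_m)
    (a b c d : 'I_m) (p : 'rV[R]_m) : R :=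
  partial a (christoffel G d b c) p - partial b (christoffel G d a c) p
  + \sum_(e < m) (christoffel G e b c p * christoffel G d a e p
                  - christoffel G e a c p * christoffel G d b e p).

(* Rm(d_a, d_b, d_c, d_d) = g(R(d_a, d_b) d_d, d_c), so that Rm(X, Y, X, Y) is
   the sectional curvature when X, Y are orthonormal *)
Definition Rm (R : realType) (m : nat) (G : 'rV[R]_m -> 'M[R]_m)
    (a b c d : 'I_m) (p : 'rV[R]_m) : R :=
  \sum_(e < m) riemann_endo G a b d e p * G p e c.

(* A bivector is encoded by the skew matrix of its contravariant components.
   The following three definitions are normalised on decomposable bivectors,
   see [bivector_inner_wedge] and [curvature_operatorE] *)

Definition wedge (R : realType) (m : nat) (X Y : 'rV[R]_m) : 'M[R]_m :=
  X^T *m Y - Y^T *m X.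

Definition bivector_inner (R : realType) (m : nat) (G A B : 'M[R]_m) : R :=
  2^-1 * \tr (G *m A *m G *m B^T).

(* the 2-form Rm(A, .), for A = 1/2 \sum_(a, b) A^{ab} d_a /\ d_b *)
Definition Rm_bivector (R : realType) (m : nat) (G : 'rV[R]_m -> 'M[R]_m)
    (p : 'rV[R]_m) (A : 'M[R]_m) : 'M[R]_m :=
  \matrix_(c < m, d < m)
    (2^-1 * \sum_(a < m) \sum_(b < m) A a b * Rm G a b c d p).

(* raising both indices of Rm(A, .) *)
Definition curvature_operator (R : realType) (m : nat)
    (G : 'rV[R]_m -> 'M[R]_m) (p : 'rV[R]_m) (A : 'M[R]_m) : 'M[R]_m :=
  invmx (G p) *m Rm_bivector G p A *m invmx (G p).

Lemma bivector_inner_wedge (R : realType) (m : nat) (G : 'M[R]_m)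
    (X Y Z W : 'rV[R]_m) : G^T = G ->
  bivector_inner G (wedge X Y) (wedge Z W)
    = (X *m G *m Z^T) 0 0 * (Y *m G *m W^T) 0 0
      - (X *m G *m W^T) 0 0 * (Y *m G *m Z^T) 0 0.
Proof.
move=> Gs.
have sym (U V : 'rV[R]_m) : (U *m G *m V^T) 0 0 = (V *m G *m U^T) 0 0.
  by rewrite -[in LHS](trmxK (U *m G *m V^T)) mxE !trmx_mul trmxK Gs mulmxA.
have tr1 (U V S T : 'rV[R]_m) :
    \tr (G *m (U^T *m V) *m G *m (S^T *m T)^T)
      = (U *m G *m S^T) 0 0 * (V *m G *m T^T) 0 0.
  rewrite trmx_mul trmxK.
  have -> : G *m (U^T *m V) *m G *m (T^T *m S)
            = (G *m U^T) *m ((V *m G *m T^T) *m S) by rewrite !mulmxA.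
  rewrite mxtrace_mulC -[_ *m S *m _]mulmxA trace_mx11 mulmxA.
  rewrite -mulmxA [LHS]mxE big_ord1 [S *m _]mulmxA.
  by rewrite [(S *m G *m U^T) 0 0]sym mulrC.
rewrite /bivector_inner /wedge [X in _ *m X]raddfB /=.
rewrite ?(mulmxDr, mulmxDl, mulmxN, mulNmx, mxtraceD, raddfN) /=.
rewrite !tr1.
by field.
Qed.

Lemma curvature_operatorE (R : realType) (m : nat) (G : 'rV[R]_m -> 'M[R]_m)
    (p : 'rV[R]_m) (A B : 'M[R]_m) : G p \in unitmx ->
  bivector_inner (G p) (curvature_operator G p A) B
    = 4^-1 * \sum_(a < m) \sum_(b < m) \sum_(c < m) \sum_(d < m)
        A a b * B c d * Rm G a b c d p.
Proof.
move=> Gu; rewrite /bivector_inner /curvature_operator !mulmxA mulmxV // mul1mx.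
rewrite mulmxKV // /mxtrace.
have -> : \sum_a \sum_b \sum_c \sum_d A a b * B c d * Rm G a b c d p
    = \sum_c \sum_d \sum_a \sum_b A a b * B c d * Rm G a b c d p.
  under eq_bigr => a _ do rewrite exchange_big /=.
  rewrite exchange_big; apply: eq_bigr => c _ /=.
  under eq_bigr => a _ do rewrite exchange_big /=.
  exact: exchange_big.
rewrite !mulr_sumr; apply: eq_bigr => c _.
rewrite mxE !mulr_sumr; apply: eq_bigr => d _.
rewrite !mxE.
rewrite [RHS](_ : _ = 2^-1 * (2^-1 * (B c d *
  \sum_a \sum_b A a b * Rm G a b c d p))); last first.
  rewrite mulrA -invfM -natrM; congr (_ * _); rewrite mulr_sumr.
  apply: eq_bigr => a _; rewrite mulr_sumr; apply: eq_bigr => b _.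
  by rewrite mulrCA mulrA.
by ring.
Qed.


Lemma curvature_operator_is_linear (R : realType) (m : nat)
    (G : 'rV[R]_m -> 'M[R]_m) (p : 'rV[R]_m) :
  linear (curvature_operator G p).
Proof.
have lin : linear (Rm_bivector G p).
  move=> k A B; apply/matrixP => c d; rewrite !mxE mulrCA -mulrDr; congr (_ * _).
  rewrite mulr_sumr -big_split; apply: eq_bigr => a _ /=.
  rewrite mulr_sumr -big_split; apply: eq_bigr => b _ /=.
  by rewrite !mxE mulrDl mulrA.
move=> k A B; rewrite /curvature_operator lin.
by rewrite mulmxDr mulmxDl -scalemxAr -scalemxAl.
Qed.

HB.instance Definition _ (R : realType) (m : nat)
    (G : 'rV[R]_m -> 'M[R]_m) (p : 'rV[R]_m) :=
  GRing.isLinear.Build R 'M[R]_m 'M[R]_m _ (curvature_operator G p)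
    (curvature_operator_is_linear G p).

(* Lambda^2 T_x M = so(T_x M): the bivector A acts on row vectors by
   v |-> v *m (G *m A), so that X /\ Y is v |-> g(v, X) Y - g(v, Y) X.
   [so_defect] and [J_commutator] vanish exactly on so(T_x M) and on the
   endomorphisms commuting with J *)

Definition so_defect (R : realType) (m : nat) (A : 'M[R]_m) : 'M[R]_m :=
  A + A^T.

Definition J_commutator (R : realType) (n : nat) (G A : 'M[R]_(n + n)) :
    'M[R]_(n + n) :=
  Jmx R n *m (G *m A) - (G *m A) *m Jmx R n.

Lemma so_defect_is_linear (R : realType) (m : nat) :
  linear (@so_defect R m).
Proof.
by move=> k A B; rewrite /so_defect linearP scalerDr addrACA.
Qed.

HB.instance Definition _ (R : realType) (m : nat) :=
  GRing.isLinear.Build R 'M[R]_m 'M[R]_m _ (@so_defect R m)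
    (@so_defect_is_linear R m).

Lemma J_commutator_is_linear (R : realType) (n : nat) (G : 'M[R]_(n + n)) :
  linear (J_commutator G).
Proof.
move=> k A B; rewrite /J_commutator !mulmxDr mulmxDl -!scalemxAr -!scalemxAl.
by rewrite opprD addrACA -scalerBr.
Qed.

HB.instance Definition _ (R : realType) (n : nat) (G : 'M[R]_(n + n)) :=
  GRing.isLinear.Build R 'M[R]_(n + n) 'M[R]_(n + n) _ (J_commutator G)
    (J_commutator_is_linear G).

(* u(n) inside Lambda^2 T_x M = so(T_x M), for the inner product of Gram
   matrix [G] *)
Definition u_space (R : realType) (n : nat) (G : 'M[R]_(n + n)) :
    {vspace 'M[R]_(n + n)} :=
  (lker (linfun (@so_defect R (n + n))) :&: lker (linfun (J_commutator G)))%VS.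

Lemma u_spaceP (R : realType) (n : nat) (G A : 'M[R]_(n + n)) :
  A \in u_space G <->
  A^T = - A /\ Jmx R n *m (G *m A) = (G *m A) *m Jmx R n.
Proof.
rewrite memv_cap !memv_ker !lfunE /= /so_defect /J_commutator subr_eq0.
split=> [/andP[/eqP sA /eqP cA]|[sA cA]].
  by split=> //; apply/eqP; rewrite -addr_eq0 addrC sA.
by rewrite cA sA subrr !eqxx.
Qed.

(* The endomorphism of u(n) induced by the curvature operator.  For a Kaehler
   metric the curvature operator maps u(n) into itself, and the projection
   [vsproj] onto u(n) only serves to retype its values *)
Definition kahler_curvature_operator (R : realType) (n : nat)
    (G : 'rV[R]_(n + n) -> 'M[R]_(n + n)) (p : 'rV[R]_(n + n)) :
    'End(subvs_of (u_space (G p))) :=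
  linfun (vsproj (u_space (G p)) \o curvature_operator G p \o vsval).

(* [s] lists the eigenvalues of [f] in nondecreasing order, repeated according
   to multiplicity.  The dimension of the eigenspace is the relevant
   multiplicity since f is self-adjoint in the intended use *)
Definition ordered_eigenvalues (R : realType) (V : vectType R)
    (f : 'End(V)) (s : seq R) : Prop :=
  sorted <=%R s /\ forall a : R, count_mem a s = \dim (passmx.leigenspace f a).

Definition kahler_eigenvalues (R : realType) (n : nat) (M : topologicalType)
    (X : complexManifold R n M) (g : kahlerMetric X) (x : M)
    (s : (n ^ 2).-tuple R) : Prop :=
  let i := chart_at X x in
  ordered_eigenvalues (kahler_curvature_operator (metric g i) (chart i x)) s.

Definition sobolev_inequality (R : realType) (n : nat) (M : ptopologicalType)
    (X : complexManifold R n M) (g : kahlerMetric X)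
    (vol : {measure set (borel M) -> \bar R}) (nu CS : R) : Prop :=
  forall phi : M -> R,
    smooth X phi -> compact (closure [set x | phi x != 0]) ->
    ((\int[vol]_x (`|phi x| `^ (2 * nu / (nu - 2)))%:E) `^ ((nu - 2) / nu)
       <= CS%:E * \int[vol]_x (grad_norm g phi x ^+ 2)%:E)%E.

(* ||kappa||_{nu/2}; the integral of a nonnegative function is total, with value
   in [0, +oo], and no measurability of [kappa] is required *)
Definition kappa_norm (R : realType) (M : ptopologicalType)
    (vol : {measure set (borel M) -> \bar R}) (nu : R) (kappa : M -> R) :
    \bar R :=
  ((\int[vol]_x (`|kappa x| `^ (nu / 2))%:E) `^ (2 / nu))%E.

(* Main.v *)
Require Import Defs.
From HB Require Import structures.
From mathcomp Require Import all_boot all_order all_algebra.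
From mathcomp Require Import complex.
From mathcomp Require Import all_classical all_reals all_analysis.
From mathcomp Require Import measurable_realfun.
From mathcomp Require Import ring lra.

Set Implicit Arguments.
Unset Strict Implicit.
Unset Printing Implicit Defensive.

Import Order.TTheory GRing.Theory Num.Theory.
Import numFieldNormedType.Exports.

Local Open Scope classical_set_scope.
Local Open Scope ring_scope.

(* Put f = |grad u|^2 and W = f + eps.  For a pluriharmonic u the Hessian anticommutes with J, so
   the refined Kato inequality and the Bochner formula give
     lap f / 2 >= |grad f|^2 / (2 W) + Ric(grad u, grad u),
   and Ric(v, v) is a combination of the mu_j with weights in [0, |v|^2] of total n |v|^2, hence
   is at least (mu_1 + ... + mu_n) |v|^2 >= (n + 1) kappa |v|^2.  Testing this against
   phi^2 W^(p/2 - 1) for a cutoff phi and using the Hoelder and Sobolev inequalities, the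
   smallness of kappa absorbs the curvature term and leaves, for H = phi W^(p/4),
     ||H||^2_(2 nu / (nu - 2)) <= C int W^(p/2) |grad phi|^2
   with C independent of phi and eps.  For both ranges of p the assumption implies
   ||kappa|| < 4 / (p CS (n + 1)), which is what the absorption needs.  Completeness yields
   cutoffs that are at least 1 near a given point with |grad phi| arbitrarily small: Ekeland's
   principle shows that compactly supported functions of slope at most 1 take arbitrarily large
   values at any point.  As |grad u| is in L^p, the right-hand side tends to 0, so grad u = 0. *)

(** * Calculus on R^m *)

(** The complex structure enters three times. It halves the constant of Kato's inequality, |grad
    f|^2 <= 2 f |Hess u|^2 instead of 4 f |Hess u|^2; differentiating W^(p/2 - 1) costs p/2 - 1,
    Kato returns 1, and the remaining p/2 is positive even for p < 2. It confines curvature to u(n):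
    an orthonormal basis of u(n) gives v weights of at most |v|^2 each and n |v|^2 in total, which
    is why exactly n eigenvalues are summed. Finally, traces of J-anti-invariant forms vanish, so
    holomorphic coordinates are harmonic and the Laplacian is g^(ab) d_a d_b in every chart. Three
    obstacles shape the analysis. [kappa] need not be measurable, so a continuous function below (n
    + 1) |kappa| takes its place in the integrals. The distance is not smooth and its balls are not
    known to be compact, so cutoffs are found by a variational argument. Where grad u vanishes the
    powers of f are not smooth: eps > 0 repairs this, and it is fixed only after the cutoff, so that
    eps^(p/2) times the volume of the support stays bounded. *)

Section PartialDerivatives.
Context (R : realType) (m : nat).
Implicit Types (f g : 'rV[R]_m -> R) (p v : 'rV[R]_m) (a b : 'I_m).

Lemma partialE a f p : differentiable f p -> partial a f p = 'd f p (basis_vec R a).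
Proof. by move=> df; rewrite /partial deriveE. Qed.

Lemma diff_partial f p v : differentiable f p ->
  'd f p v = \sum_a v 0 a * partial a f p.
Proof.
move=> df; rewrite {1}(row_sum_delta v) linear_sum; apply: eq_bigr => a _.
by rewrite linearZ /= partialE.
Qed.

Lemma near_partial a f g p : {near p, f =1 g} -> partial a f p = partial a g p.
Proof. by move=> h; rewrite /partial (near_eq_derive _ h). Qed.

Lemma near_differentiable f g p :
  {near p, f =1 g} -> differentiable f p -> differentiable g p.
Proof.
move=> h df; have fg : f p = g p by apply: (nbhs_singleton h).
case: (df) => -[cf ef].
apply/diffP.
(* The differential of [f] is supplied as a witness for [g], since [differentiable] speaks of a
   chosen differential; [lim (nbhs p)] stands for [p]. *)
apply: (@getPex _ (fun (dg : {linear 'rV[R]_m -> R}) => continuous dg /\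
  forall y, g y = g (lim (nbhs p)) + dg (y - lim (nbhs p))
                  +o_(y \near p) (y - lim (nbhs p)))).
exists ('d f p); split=> //.
apply/eqaddoEx => z; rewrite lim_id// -fg.
pose F := nbhs_filter_on p.
have ez : g = (cst (f p) + 'd f p \o center p) +o_F (center p).
  apply/eqaddoP => e e0.
  have /eqaddoP/(_ e e0) hf : f = (cst (f p) + 'd f p \o center p) +o_F (center p).
    by rewrite {1}ef lim_id.
  near=> x.
  rewrite /= (_ : (g - _) x = (f - (cst (f p) + 'd f p \o center p)) x); last first.
    by rewrite !fctE (_ : g x = f x)//; apply/esym; near: x; exact: h.
  by near: x; exact: hf.
by rewrite {1}ez.
Unshelve. all: by end_near. Qed.

Lemma partialD a f g p : differentiable f p -> differentiable g p ->
  partial a (fun q => f q + g q) p = partial a f p + partial a g p.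
Proof.
move=> df dg; rewrite /partial.
by rewrite (deriveD (@diff_derivable _ _ _ _ _ _ df) (@diff_derivable _ _ _ _ _ _ dg)).
Qed.

Lemma partialN a f p : differentiable f p ->
  partial a (fun q => - f q) p = - partial a f p.
Proof. by move=> df; rewrite /partial (deriveN (@diff_derivable _ _ _ _ _ _ df)). Qed.

Lemma partialB a f g p : differentiable f p -> differentiable g p ->
  partial a (fun q => f q - g q) p = partial a f p - partial a g p.
Proof.
move=> df dg; rewrite /partial.
by rewrite (deriveB (@diff_derivable _ _ _ _ _ _ df) (@diff_derivable _ _ _ _ _ _ dg)).
Qed.

Lemma partialM a f g p : differentiable f p -> differentiable g p ->
  partial a (fun q => f q * g q) p = partial a f p * g p + f p * partial a g p.
Proof.
move=> df dg; rewrite /partial.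
rewrite (deriveM (@diff_derivable _ _ _ _ _ _ df) (@diff_derivable _ _ _ _ _ _ dg)) addrC.
by rewrite [_ *: 'D__ f p]mulrC.
Qed.

Lemma partial_cst a (c : R) p : partial a (fun=> c) p = 0.
Proof. by rewrite /partial derive_cst. Qed.

Lemma partialZ a (c : R) f p : differentiable f p ->
  partial a (fun q => c * f q) p = c * partial a f p.
Proof.
by move=> df; rewrite partialM// ?partial_cst ?mul0r ?add0r//; apply: differentiable_cst.
Qed.

Lemma differentiable_bigsum (I : Type) (r : seq I) (P : pred I) (F : I -> 'rV[R]_m -> R) p :
  (forall i, differentiable (F i) p) ->
  differentiable (fun q => \sum_(i <- r | P i) F i q) p.
Proof.
move=> dF; elim: r => [|i r ih].
  rewrite (_ : (fun=> _) = cst 0); first exact: differentiable_cst.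
  by apply: funext => q; rewrite big_nil.
case Pi : (P i); last first.
  by rewrite (_ : (fun=> _) = (fun q => \sum_(j <- r | P j) F j q))//;
     apply: funext => q; rewrite big_cons Pi.
rewrite (_ : (fun=> _) = F i + (fun q => \sum_(j <- r | P j) F j q)).
  exact: differentiableD.
by apply: funext => q; rewrite big_cons Pi.
Qed.

Lemma partial_sum (I : Type) (r : seq I) (P : pred I) a (F : I -> 'rV[R]_m -> R) p :
  (forall i, differentiable (F i) p) ->
  partial a (fun q => \sum_(i <- r | P i) F i q) p = \sum_(i <- r | P i) partial a (F i) p.
Proof.
move=> dF; elim: r => [|i r ih].
  rewrite big_nil (_ : (fun=> _) = (fun=> 0)) ?partial_cst//.
  by apply: funext => q; rewrite big_nil.
rewrite big_cons; case Pi : (P i); last first.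
  rewrite -ih; congr partial.
  by apply: funext => q; rewrite big_cons Pi.
rewrite -ih -partialD//; last exact: differentiable_bigsum.
by congr partial; apply: funext => q; rewrite big_cons Pi.
Qed.

Lemma differentiable_comp1 (phi : R -> R) (d : R) f p : differentiable f p ->
  is_derive (f p) 1 phi d -> differentiable (fun q => phi (f q)) p.
Proof.
move=> df dphi; apply: (@differentiable_comp _ _ _ _ f phi) => //.
by apply/derivable1_diffP; apply: (@ex_derive _ _ _ _ _ _ _ dphi).
Qed.

Lemma partial_comp1 a (phi : R -> R) (d : R) f p : differentiable f p ->
  is_derive (f p) 1 phi d -> partial a (fun q => phi (f q)) p = d * partial a f p.
Proof.
move=> df dphi; have dc := differentiable_comp1 df dphi.
have dphi' : differentiable phi (f p).
  by apply/derivable1_diffP; apply: (@ex_derive _ _ _ _ _ _ _ dphi).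
rewrite partialE// (diff_comp df dphi')//= partialE//.
by rewrite diff1E// derive1E (@derive_val _ _ _ _ _ _ _ dphi) /= [LHS]mulrC.
Qed.

Lemma differentiable_mx k (T : 'rV[R]_m -> 'rV[R]_k) p :
  (forall c, differentiable (fun q => T q 0 c) p) -> differentiable T p.
Proof.
move=> dT; rewrite (_ : T = \sum_c (fun q => T q 0 c *: delta_mx 0 c)).
  by apply: differentiable_sum => c; apply: differentiableZl.
apply: funext => q; rewrite [LHS]row_sum_delta.
by elim/big_ind2: _ => // ? ? ? ? -> ->.
Qed.

Lemma diff_mx_coord k (T : 'rV[R]_m -> 'rV[R]_k) p v c : differentiable T p ->
  ('d T p v) 0 c = 'd (fun q => T q 0 c) p v.
Proof.
move=> dT.
have dc : differentiable (fun N : 'rV[R]_k => N 0 c) (T p).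
  exact: differentiable_coord.
rewrite (_ : (fun q => T q 0 c) = (fun N : 'rV[R]_k => N 0 c) \o T)//.
rewrite (diff_comp dT dc) /=.
have lc : linear (fun N : 'rV[R]_k => N 0 c : R) by move=> x N P; rewrite !mxE.
pose l := GRing.isLinear.Build _ _ _ _ _ lc.
pose F : {linear 'rV[R]_k -> R} := HB.pack (fun N : 'rV[R]_k => N 0 c : R) l.
rewrite (_ : (fun N : 'rV[R]_k => N 0 c) = F)// diff_lin//.
by move=> N; apply: differentiable_continuous; exact: differentiable_coord.
Qed.

Lemma differentiable_comp_mx k (T : 'rV[R]_m -> 'rV[R]_k) (f : 'rV[R]_k -> R) p :
  (forall c, differentiable (fun q => T q 0 c) p) -> differentiable f (T p) ->
  differentiable (fun q => f (T q)) p.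
Proof. by move=> /differentiable_mx dT df; exact: (@differentiable_comp _ _ _ _ T f). Qed.

Lemma partial_coord a c p : partial a (fun q => q 0 c) p = (basis_vec R a) 0 c.
Proof.
rewrite partialE; last exact: differentiable_coord.
have h : differentiable (id : 'rV[R]_m -> 'rV[R]_m) p by apply: ex_diff.
by rewrite -(diff_mx_coord _ _ h) (@diff_val _ _ _ _ _ _ _ (is_diff_id p)).
Qed.

Lemma partial_comp k a (T : 'rV[R]_m -> 'rV[R]_k) (f : 'rV[R]_k -> R) p :
  (forall c, differentiable (fun q => T q 0 c) p) -> differentiable f (T p) ->
  partial a (fun q => f (T q)) p
    = \sum_c partial c f (T p) * partial a (fun q => T q 0 c) p.
Proof.
move=> dTc df; have dT := differentiable_mx dTc.
have dc := differentiable_comp_mx dTc df.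
rewrite partialE// (diff_comp dT df)//=.
rewrite -[LHS](_ : 'd f (T p) ('d T p (basis_vec R a)) = _)//.
have -> (w : 'rV_k) : 'd f (T p) w = \sum_c w 0 c * partial c f (T p).
  rewrite {1}(row_sum_delta w) linear_sum; apply: eq_bigr => c _.
  by rewrite linearZ /= /partial deriveE.
by apply: eq_bigr => c _; rewrite diff_mx_coord// mulrC partialE.
Qed.

Lemma is_derive_along (c : R -> 'rV[R]_m) f t : derivable c t 1 ->
  differentiable f (c t) ->
  is_derive t 1 (fun s => f (c s)) (\sum_a (c^`()%classic t) 0 a * partial a f (c t)).
Proof.
move=> dc df; have dc' : differentiable c t by exact/derivable1_diffP.
have dfc : differentiable (f \o c) t by exact: differentiable_comp.
apply: DeriveDef; first exact/derivable1_diffP.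
rewrite deriveE// diff_comp//= diff1E//= scale1r.
by rewrite diff_partial.
Qed.

Lemma is_derive_line f p v (t : R) : differentiable f (p + t *: v) ->
  is_derive t 1 (fun s => f (p + s *: v)) (\sum_a v 0 a * partial a f (p + t *: v)).
Proof.
move=> df.
have dl : is_derive t 1 (fun s : R => p + s *: v) v.
  have h1 : is_derive t 1 (fun s : R => s *: v) v.
    apply: DeriveDef.
      by apply/derivable1_diffP; apply: differentiableZl.
    rewrite deriveE; last exact: differentiableZl.
    by rewrite (@diff_val _ _ _ _ _ _ _ (is_diff_scalel t v)) scale1r.
  by have := is_deriveD (is_derive_cst p t 1) h1; rewrite add0r.
have := @is_derive_along (fun s : R => p + s *: v) f t (@ex_derive _ _ _ _ _ _ _ dl) df.
by rewrite derive1E (@derive_val _ _ _ _ _ _ _ dl).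
Qed.

End PartialDerivatives.

Opaque partial.

(** * Finite orders of differentiability and symmetry of second derivatives *)

Section SmoothFunctions.
Context (R : realType).

(** [iter_partial] peels derivatives from the outside, whereas product and chain rules act on the
    innermost one. Counting from the inside lets the closure properties go by induction on [k]. *)
Fixpoint Cn (m k : nat) (U : set 'rV[R]_m) (f : 'rV[R]_m -> R) : Prop :=
  (forall p, U p -> differentiable f p) /\
  (if k is k'.+1 then forall a, Cn k' U (partial a f) else True).

Lemma CnS m k (U : set 'rV[R]_m) f : Cn k.+1 U f <->
  (forall p, U p -> differentiable f p) /\ (forall a, Cn k U (partial a f)).
Proof. by []. Qed.

Lemma iter_partial_rcons m (s : seq 'I_m) a (f : 'rV[R]_m -> R) :
  iter_partial (rcons s a) f = iter_partial s (partial a f).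
Proof. by elim: s => //= b s ->. Qed.

Lemma smooth_on_Cn m (U : set 'rV[R]_m) (f : 'rV[R]_m -> R) :
  smooth_on U f <-> forall k, Cn k U f.
Proof.
split=> [h k|h s p Up].
  elim: k f h => [|k ih] f h; split=> //; try by move=> p Up; exact: (h [::]).
  by move=> a; apply: ih => s p Up; rewrite -iter_partial_rcons; exact: h.
elim/last_ind: s f h => [|s a ih] f h; first by case: (h 0%N) => /(_ p Up).
rewrite iter_partial_rcons; apply: ih => k.
by case: (h k.+1) => _ /(_ a).
Qed.

Lemma smooth_on_partial m (U : set 'rV[R]_m) (f : 'rV[R]_m -> R) a :
  smooth_on U f -> smooth_on U (partial a f).
Proof. by move=> h s p Up; rewrite -iter_partial_rcons; exact: h. Qed.

Lemma smooth_on_diff m (U : set 'rV[R]_m) (f : 'rV[R]_m -> R) p :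
  smooth_on U f -> U p -> differentiable f p.
Proof. by move=> h Up; exact: (h [::]). Qed.

Lemma smooth_on_sub m (U V : set 'rV[R]_m) (f : 'rV[R]_m -> R) :
  U `<=` V -> smooth_on V f -> smooth_on U f.
Proof. by move=> UV h s p /UV; exact: h. Qed.

Section Fixed.
Context (m : nat) (U : set 'rV[R]_m) (Uo : open U).
Implicit Types f g : 'rV[R]_m -> R.

Lemma Cn_diff k f p : Cn k U f -> U p -> differentiable f p.
Proof. by case: k => [|k] [h _]; exact: h. Qed.

Lemma Cn_pred k f : Cn k.+1 U f -> Cn k U f.
Proof. by elim: k f => [|k ih] f [h1 h2]; split=> // a; exact: (ih _ (h2 a)). Qed.

Lemma near_open p (P : 'rV[R]_m -> Prop) : U p -> (forall q, U q -> P q) ->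
  \forall q \near p, P q.
Proof.
move=> Up h; have : nbhs p U by exact: open_nbhs_nbhs.
by apply: filterS.
Qed.

Lemma Cn_ext k f g : (forall p, U p -> f p = g p) -> Cn k U f -> Cn k U g.
Proof.
elim: k f g => [|k ih] f g fg.
  case=> h1 _; split=> // p Up.
  by apply: (near_differentiable _ (h1 p Up)); exact: near_open.
move=> /CnS[h1 h2]; apply/CnS; split=> [p Up|a].
  by apply: (near_differentiable _ (h1 p Up)); exact: near_open.
apply: (ih (partial a f)) (h2 a) => p Up.
by apply: near_partial; exact: near_open.
Qed.

Lemma Cn_cst k (c : R) : Cn k U (fun=> c).
Proof.
elim: k c => [|k ih] c; split=> //; try by move=> p _; exact: differentiable_cst.
move=> a; rewrite (_ : partial a _ = fun=> 0)//.
by apply: funext => p; rewrite partial_cst.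
Qed.

Lemma CnD k f g : Cn k U f -> Cn k U g -> Cn k U (fun q => f q + g q).
Proof.
elim: k f g => [|k ih] f g.
  by case=> f1 _ [g1 _]; split=> // p Up; apply: differentiableD; [exact: f1|exact: g1].
move=> /CnS[f1 f2] /CnS[g1 g2]; apply/CnS; split=> [p Up|a].
  by apply: differentiableD; [exact: f1|exact: g1].
apply: (@Cn_ext k (fun q => partial a f q + partial a g q)).
  by move=> p Up; rewrite partialD//; [exact: f1|exact: g1].
by apply: ih; [exact: f2|exact: g2].
Qed.

Lemma CnM k f g : Cn k U f -> Cn k U g -> Cn k U (fun q => f q * g q).
Proof.
elim: k f g => [|k ih] f g.
  by case=> f1 _ [g1 _]; split=> // p Up; apply: differentiableM; [exact: f1|exact: g1].
move=> hf hg; move/CnS: (hf) => [f1 f2]; move/CnS: (hg) => [g1 g2].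
apply/CnS; split=> [p Up|a].
  by apply: differentiableM; [exact: f1|exact: g1].
apply: (@Cn_ext k (fun q => partial a f q * g q + f q * partial a g q)).
  by move=> p Up; rewrite partialM//; [exact: f1|exact: g1].
by apply: CnD; apply: ih; [exact: f2|exact: Cn_pred|exact: Cn_pred|exact: g2].
Qed.

Lemma CnN k f : Cn k U f -> Cn k U (fun q => - f q).
Proof.
move=> h; apply: (@Cn_ext k (fun q => -1 * f q)); first by move=> p _; rewrite mulN1r.
by apply: CnM => //; exact: Cn_cst.
Qed.

Lemma Cn_sum k (I : Type) (r : seq I) (P : pred I) (F : I -> 'rV[R]_m -> R) :
  (forall i, Cn k U (F i)) -> Cn k U (fun q => \sum_(i <- r | P i) F i q).
Proof.
move=> h; elim: r => [|i r ih].
  by apply: Cn_ext (Cn_cst k 0) => q _; rewrite big_nil.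
case Pi : (P i).
  by apply: Cn_ext (CnD (h i) ih) => q _; rewrite big_cons Pi.
by apply: Cn_ext ih => q _; rewrite big_cons Pi.
Qed.

(** The whole tower of derivatives is needed at once: differentiating the composite turns [phi j]
    into [phi j.+1], so the induction must cover every [j]. The set [I] admits functions such as
    powers, differentiable only on part of the line. *)
Lemma Cn_comp1 k (I : set R) (phi : nat -> R -> R) f :
  (forall j t, I t -> is_derive t 1 (phi j) (phi j.+1 t)) ->
  (forall p, U p -> I (f p)) -> Cn k U f -> forall j, Cn k U (fun q => phi j (f q)).
Proof.
move=> dphi fI; elim: k => [|k ih] hf j.
  case: hf => f1 _; split=> // p Up.
  exact: (differentiable_comp1 (f1 p Up) (dphi j _ (fI p Up))).
move/CnS: (hf) => [f1 f2]; apply/CnS; split=> [p Up|a].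
  exact: (differentiable_comp1 (f1 p Up) (dphi j _ (fI p Up))).
apply: (@Cn_ext k (fun q => phi j.+1 (f q) * partial a f q)).
  by move=> p Up; rewrite (partial_comp1 a (f1 p Up) (dphi j _ (fI p Up))).
by apply: CnM => //; apply: ih; exact: Cn_pred.
Qed.

Lemma Cn_comp k l (V : set 'rV[R]_l) (T : 'rV[R]_m -> 'rV[R]_l) (f : 'rV[R]_l -> R) :
  (forall c, Cn k U (fun q => T q 0 c)) -> (forall p, U p -> V (T p)) ->
  Cn k V f -> Cn k U (fun q => f (T q)).
Proof.
elim: k f => [|k ih] f hT TV.
  case=> f1 _; split=> // p Up; apply: differentiable_comp_mx; last exact/f1/TV.
  by move=> c; exact: (Cn_diff (hT c)).
move=> /CnS[f1 f2]; apply/CnS.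
have dT p c : U p -> differentiable (fun q => T q 0 c) p.
  by move=> Up; exact: (Cn_diff (hT c)).
split=> [p Up|a].
  by apply: differentiable_comp_mx => [c|]; [exact: dT|exact/f1/TV].
apply: (@Cn_ext k (fun q => \sum_c partial c f (T q) * partial a (fun q => T q 0 c) q)).
  by move=> p Up; rewrite (@partial_comp _ _ _ a)// => [c|]; [exact: dT|exact/f1/TV].
apply: Cn_sum => c; apply: CnM; first by apply: ih => // d; exact: Cn_pred.
by case/CnS: (hT c) => _ /(_ a).
Qed.

Lemma smooth_on_ext f g : (forall p, U p -> f p = g p) -> smooth_on U f -> smooth_on U g.
Proof. by move=> fg /smooth_on_Cn h; apply/smooth_on_Cn => k; exact: Cn_ext (h k). Qed.

Lemma smooth_on_cst (c : R) : smooth_on U (fun=> c).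
Proof. by apply/smooth_on_Cn => k; exact: Cn_cst. Qed.

Lemma smooth_onD f g : smooth_on U f -> smooth_on U g -> smooth_on U (fun q => f q + g q).
Proof. by move=> /smooth_on_Cn hf /smooth_on_Cn hg; apply/smooth_on_Cn => k; exact: CnD. Qed.

Lemma smooth_onN f : smooth_on U f -> smooth_on U (fun q => - f q).
Proof. by move=> /smooth_on_Cn hf; apply/smooth_on_Cn => k; exact: CnN. Qed.

Lemma smooth_onM f g : smooth_on U f -> smooth_on U g -> smooth_on U (fun q => f q * g q).
Proof. by move=> /smooth_on_Cn hf /smooth_on_Cn hg; apply/smooth_on_Cn => k; exact: CnM. Qed.

Lemma smooth_on_sum (I : Type) (r : seq I) (P : pred I) (F : I -> 'rV[R]_m -> R) :
  (forall i, smooth_on U (F i)) -> smooth_on U (fun q => \sum_(i <- r | P i) F i q).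
Proof.
move=> h; apply/smooth_on_Cn => k; apply: Cn_sum => i.
by move/smooth_on_Cn: (h i); apply.
Qed.

Lemma smooth_on_prod (I : Type) (r : seq I) (F : I -> 'rV[R]_m -> R) :
  (forall i, smooth_on U (F i)) -> smooth_on U (fun q => \prod_(i <- r) F i q).
Proof.
move=> h; elim: r => [|i r ih].
  by apply: smooth_on_ext (smooth_on_cst 1) => q _; rewrite big_nil.
by apply: smooth_on_ext (smooth_onM (h i) ih) => q _; rewrite big_cons.
Qed.

Lemma smooth_on_comp1 (I : set R) (phi : nat -> R -> R) f :
  (forall j t, I t -> is_derive t 1 (phi j) (phi j.+1 t)) ->
  (forall p, U p -> I (f p)) -> smooth_on U f -> smooth_on U (fun q => phi 0%N (f q)).
Proof.
move=> dphi fI /smooth_on_Cn hf; apply/smooth_on_Cn => k.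
exact: (@Cn_comp1 k I phi f).
Qed.

Lemma smooth_on_comp l (V : set 'rV[R]_l) (T : 'rV[R]_m -> 'rV[R]_l) (f : 'rV[R]_l -> R) :
  (forall c, smooth_on U (fun q => T q 0 c)) -> (forall p, U p -> V (T p)) ->
  smooth_on V f -> smooth_on U (fun q => f (T q)).
Proof.
move=> hT TV /smooth_on_Cn hf; apply/smooth_on_Cn => k; apply: (@Cn_comp k l V) => // c.
by move/smooth_on_Cn: (hT c); apply.
Qed.

Lemma smooth_on_continuous f p : smooth_on U f -> U p -> {for p, continuous f}.
Proof. by move=> h Up; exact: differentiable_continuous (smooth_on_diff h Up). Qed.

Lemma smooth_on_coord (c : 'I_m) : smooth_on U (fun q => q 0 c).
Proof.
apply/smooth_on_Cn => k; case: k => [|k].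
  by split=> // p _; exact: differentiable_coord.
apply/CnS; split=> [p _|a]; first exact: differentiable_coord.
apply: (@Cn_ext k (fun=> (basis_vec R a) 0 c)); last exact: Cn_cst.
by move=> p _; rewrite partial_coord.
Qed.
End Fixed.

Lemma MVT_line m (f : 'rV[R]_m -> R) p (a : 'I_m) (h : R) : 0 < h ->
  (forall s, 0 <= s <= h -> differentiable f (p + s *: basis_vec R a)) ->
  exists2 s, 0 <= s <= h &
    f (p + h *: basis_vec R a) - f p = h * partial a f (p + s *: basis_vec R a).
Proof.
move=> h0 df.
pose F s := f (p + s *: basis_vec R a).
have dF s : 0 <= s <= h -> is_derive s 1 F (partial a f (p + s *: basis_vec R a)).
  move=> /df hs; have := is_derive_line hs.
  rewrite (bigD1 a)//= big1 ?addr0 => [|b /negbTE ba]; last by rewrite mxE ba mul0r.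
  by rewrite mxE !eqxx mul1r.
have [s||s sI e] := @MVT_segment R F (fun s => partial a f (p + s *: basis_vec R a)) 0 h (ltW h0).
- by rewrite in_itv/= => /andP[s0 sh]; apply: dF; rewrite !ltW.
- apply: derivable_within_continuous => s; rewrite in_itv/= => hs.
  by apply: (@ex_derive _ _ _ _ _ _ _ (dF s hs)).
exists s; first by rewrite in_itv/= in sI.
by move: e; rewrite /F scale0r addr0 subr0 mulrC.
Qed.

(** The mean value theorem is used twice: in direction a on the increment of f in direction b, then
    in direction b on [partial a f]. Exchanging a and b leaves the left-hand side unchanged. *)
Lemma second_difference m (U : set 'rV[R]_m) (f : 'rV[R]_m -> R) p (a b : 'I_m) (h : R) :
  0 < h -> Cn 1 U f ->
  (forall s t, 0 <= s <= h -> 0 <= t <= h ->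
     U (p + s *: basis_vec R a + t *: basis_vec R b)) ->
  exists s t, [/\ 0 <= s <= h, 0 <= t <= h &
    f (p + h *: basis_vec R a + h *: basis_vec R b) - f (p + h *: basis_vec R a)
      - f (p + h *: basis_vec R b) + f p
    = h * h * partial b (partial a f) (p + s *: basis_vec R a + t *: basis_vec R b)].
Proof.
move=> h0 /CnS[f1 f2] hU.
pose F q := f (q + h *: basis_vec R b) - f q.
have hh : 0 <= h <= h by rewrite lexx ltW.
have h00 : (0 : R) <= 0 <= h by rewrite lexx ltW.
have U0 s : 0 <= s <= h -> U (p + s *: basis_vec R a).
  by move=> hs; have := hU s 0 hs h00; rewrite scale0r addr0.
have T1 q c : differentiable (fun q' : 'rV[R]_m => (q' + h *: basis_vec R b) 0 c) q.
  rewrite (_ : (fun _ => _) = (fun q' : 'rV[R]_m => q' 0 c) + cst ((h *: basis_vec R b) 0 c)).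
    by apply: differentiableD => //; exact: differentiable_coord.
  by apply: funext => q'; rewrite !fctE !mxE.
have dsh q : U (q + h *: basis_vec R b) ->
    differentiable (fun q' => f (q' + h *: basis_vec R b)) q.
  by move=> Uq; apply: (@differentiable_comp_mx R m m (fun q' => q' + h *: basis_vec R b)) => //; exact: f1.
have dF q : U q -> U (q + h *: basis_vec R b) -> differentiable F q.
  by move=> Uq Uq'; apply: differentiableB; [exact: dsh|exact: f1].
have pF q : U q -> U (q + h *: basis_vec R b) ->
    partial a F q = partial a f (q + h *: basis_vec R b) - partial a f q.
  move=> Uq Uq'; rewrite partialB; [|exact: dsh|exact: f1].
  congr (_ - _); rewrite (@partial_comp R m m a (fun q' => q' + h *: basis_vec R b))//; last exact: f1.
  have pc c : partial a (fun q' : 'rV[R]_m => (q' + h *: basis_vec R b) 0 c) q = (c == a)%:R.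
    rewrite (_ : (fun _ => _) = (fun q' : 'rV[R]_m => q' 0 c + (h *: basis_vec R b) 0 c)).
      rewrite partialD ?partial_cst ?addr0 ?partial_coord; first by rewrite mxE eqxx.
      - exact: differentiable_coord.
      - exact: differentiable_cst.
    by apply: funext => q'; rewrite mxE.
  under eq_bigr do rewrite pc.
  by rewrite (bigD1 a)//= eqxx mulr1 big1 ?addr0// => c /negbTE ->; rewrite mulr0.
have [|s hs es] := @MVT_line m F p a h h0.
  by move=> s hs; apply: dF; [exact: U0|exact: hU].
have [|t ht et] := @MVT_line m (partial a f) (p + s *: basis_vec R a) b h h0.
  by move=> t ht; case: (f2 a) => g1 _; apply: g1; exact: hU.
exists s, t; split=> //.
rewrite -mulrA -et -pF; [|exact: U0|exact: hU].
rewrite -es /F opprB addrA; lra.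
Qed.

Lemma half_distance (x y z e : R) : `|x - z| < e / 2 -> `|y - z| < e / 2 -> `|y - x| <= e.
Proof.
move=> A B; rewrite (_ : y - x = (y - z) - (x - z)); last by ring.
by rewrite (le_trans (ler_normB _ _))// [leRHS]splitr lerD// ltW.
Qed.

(* Both iterated partials are values of the same second difference quotient at nearby points. *)
Lemma partial_comm m (U : set 'rV[R]_m) (f : 'rV[R]_m -> R) p (a b : 'I_m) :
  open U -> Cn 2 U f -> U p ->
  partial a (partial b f) p = partial b (partial a f) p.
Proof.
move=> Uo Cf Up.
have C1 c : Cn 1 U (partial c f) by case/CnS: Cf.
have C0 c d : Cn 0 U (partial c (partial d f)) by case/CnS: (C1 d).
have cont c d : {for p, continuous (partial c (partial d f))}.
  by apply: differentiable_continuous; exact: (Cn_diff (C0 c d)).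
apply/eqP; rewrite -subr_eq0 -normr_eq0 eq_le normr_ge0 andbT.
apply/ler_addgt0Pr => e e0; rewrite add0r.
have e20 : 0 < e / 2 by rewrite divr_gt0.
have near_cont c d : \forall q \near p,
    `|partial c (partial d f) p - partial c (partial d f) q| < e / 2.
  by move/cvgrPdist_lt: (cont c d) => /(_ _ e20).
have n1 : \forall q \near p, U q /\
    `|partial b (partial a f) p - partial b (partial a f) q| < e / 2 /\
    `|partial a (partial b f) p - partial a (partial b f) q| < e / 2.
  apply: filterI; first exact: open_nbhs_nbhs (conj Uo Up).
  by apply: filterI; [exact: (near_cont b a)|exact: (near_cont a b)].
move/nbhs_ballP: n1 => [r /= r0 hr].
pose h := r / 3.
have h0 : 0 < h by rewrite divr_gt0.
have nb c : `|basis_vec R c| <= 1 :> R.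
  rewrite [`|_|]mx_normrE; apply: bigmax_le => // -[i j] _ /=.
  by rewrite mxE; case: (_ && _); rewrite ?normr1 ?normr0.
have inb c d s t : 0 <= s <= h -> 0 <= t <= h ->
    ball p r (p + s *: basis_vec R c + t *: basis_vec R d).
  move=> /andP[s0 sh] /andP[t0 th]; rewrite -ball_normE /= -addrA opprD addrA subrr sub0r normrN.
  rewrite (le_lt_trans (ler_normD _ _))// !normrZ !ger0_norm//.
  apply: (@le_lt_trans _ _ (h * 1 + h * 1)); last by rewrite /h; lra.
  by apply: lerD; apply: ler_pM => //; exact: nb.
have C1f := Cn_pred Cf.
have [|s [t [hs ht est]]] := @second_difference m U f p a b h h0 C1f.
  by move=> s t hs ht; case: (hr _ (inb a b s t hs ht)).
have [|s' [t' [hs' ht' est']]] := @second_difference m U f p b a h h0 C1f.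
  by move=> s' t' hs' ht'; case: (hr _ (inb b a s' t' hs' ht')).
have eq : partial b (partial a f) (p + s *: basis_vec R a + t *: basis_vec R b)
        = partial a (partial b f) (p + s' *: basis_vec R b + t' *: basis_vec R a).
  have hn0 : h * h != 0 by rewrite mulf_neq0// gt_eqF.
  apply: (mulfI hn0); apply: etrans (esym est) (etrans _ est').
  congr (_ + _); rewrite [LHS]addrAC; congr (f _ - _ - _); exact: addrAC.
have [_ [A _]] := hr _ (inb a b s t hs ht).
have [_ [_ B]] := hr _ (inb b a s' t' hs' ht').
rewrite eq in A; exact: half_distance A B.
Qed.
End SmoothFunctions.

(** * Smooth powers and the flat function exp(-1/t) *)

Section OneVariable.
Context (R : realType).

Lemma smooth_on_powR m (U : set 'rV[R]_m) (f : 'rV[R]_m -> R) (r : R) : open U ->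
  smooth_on U f -> (forall p, U p -> 0 < f p) -> smooth_on U (fun p => f p `^ r).
Proof.
move=> Uo sf f0.
(* [phi j] is the j-th derivative of t^r; its coefficient is the falling factorial of r. *)
pose phi j (t : R) := (\prod_(i < j) (r - i%:R)) * t `^ (r - j%:R).
have := @smooth_on_comp1 R m U Uo [set t | 0 < t] phi f _ f0 sf.
rewrite /phi; under [X in smooth_on U X]eq_fun do rewrite big_ord0 mul1r subr0.
apply=> j t /= t0; rewrite big_ord_recr/= -mulrA.
have -> : r - j.+1%:R = (r - j%:R) - 1 by rewrite -natr1 opprD addrA.
have d := is_derive1_powR (r - j%:R) t0.
have := is_deriveZ (\prod_(i < j) (r - i%:R)) d; exact.
Qed.

Lemma smooth_on_inv m (U : set 'rV[R]_m) (f : 'rV[R]_m -> R) : open U ->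
  smooth_on U f -> (forall p, U p -> 0 < f p) -> smooth_on U (fun p => (f p)^-1).
Proof.
move=> Uo sf f0; apply: smooth_on_ext (smooth_on_powR (-1) Uo sf f0) => //.
by move=> p /f0/ltW h; rewrite powR_inv1.
Qed.

Lemma smooth_on_sqrt m (U : set 'rV[R]_m) (f : 'rV[R]_m -> R) : open U ->
  smooth_on U f -> (forall p, U p -> 0 < f p) -> smooth_on U (fun p => Num.sqrt (f p)).
Proof.
move=> Uo sf f0; apply: smooth_on_ext (smooth_on_powR (2^-1) Uo sf f0) => //.
by move=> p /f0/ltW h; rewrite powR12_sqrt.
Qed.

(** P(1/t) exp(-1/t) extended by zero. Letting P vary closes the family under differentiation, P
    becoming (P - P') X^2, so the case P = 1 has derivatives of every order. *)
Definition flat (P : {poly R}) (t : R) : R :=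
  if 0 < t then P.[t^-1] * expR (- t^-1) else 0.

(** Term by term, x^k exp(-x) <= k! by one term of the exponential series. *)
Lemma horner_expR_bounded (P : {poly R}) :
  exists C, forall x, 0 < x -> `|P.[x]| * expR (- x) <= C.
Proof.
exists (\sum_(i < size P) `|P`_i| * i`!%:R) => x x0.
rewrite horner_coef (le_trans (ler_wpM2r (expR_ge0 _) (ler_norm_sum _ _ _)))//.
rewrite mulr_suml; apply: ler_sum => i _.
rewrite normrM -mulrA; apply: ler_wpM2l => //.
rewrite (ger0_norm (exprn_ge0 _ (ltW x0))) expRN ler_pdivrMr ?expR_gt0//.
case: (val i) => [|k].
  by rewrite expr0 fact0 mul1r (le_trans _ (expR_ge1Dx _))// lerDl ltW.
have := expR_ge1Dxn k (ltW x0).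
have f0 : 0 < (k.+1)`!%:R :> R by rewrite ltr0n fact_gt0.
move=> h; rewrite mulrC -ler_pdivrMr//; apply: le_trans h.
by rewrite lerDr.
Qed.

Lemma is_derive_flat (P : {poly R}) (t : R) :
  is_derive t 1 (flat P) (flat ((P - P^`()) * 'X^2) t).
Proof.
have [t0|t0|->] := ltgtP t 0.
- have -> : flat ((P - P^`()) * 'X^2) t = 0 by rewrite /flat ltNge ltW.
  have n : {near t, (fun=> 0 : R) =1 flat P}.
    by near=> s; rewrite /flat ltNge ltW//; near: s; exact: lt_nbhsl.
  by apply: (near_eq_is_derive n).
- have -> : flat ((P - P^`()) * 'X^2) t =
      P^`().[t^-1] * (- t ^- 2) * expR (- t^-1) + P.[t^-1] * (expR (- t^-1) * t ^- 2).
    rewrite /flat t0 hornerM hornerD hornerN hornerXn -exprVn.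
    by move: (P.[_]) (P^`().[_]) (expR _) => a b c; ring.
  have n : {near t, (fun s => P.[s^-1] * expR (- s^-1)) =1 flat P}.
    by near=> s; rewrite /flat ifT//; near: s; exact: lt_nbhsr.
  apply: (near_eq_is_derive n).
  have dV : is_derive t 1 (fun s : R => s^-1) (- t ^- 2).
    have tn0 : id t != 0 by rewrite gt_eqF.
    apply: DeriveDef; first exact: derivableV.
    by rewrite (@deriveV R R id t 1 tn0)// derive_id [_ *: _]mulr1.
  have dVN : is_derive t 1 (fun s : R => - s^-1) (t ^- 2).
    by rewrite -[t ^- 2]opprK; apply: is_deriveN.
  have d1 : is_derive t 1 (fun s : R => P.[s^-1]) (P^`().[t^-1] * (- t ^- 2)).
    exact: (@is_derive1_comp _ (horner P) (fun s => s^-1) t _ _ (is_derive_poly _ _) dV).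
  have d2 : is_derive t 1 (fun s : R => expR (- s^-1)) (expR (- t^-1) * t ^- 2).
    exact: (@is_derive1_comp _ expR (fun s => - s^-1) t _ _ (is_derive_expR _) dVN).
  apply: is_derive_eq (is_deriveM d1 d2) _.
  by rewrite addrC [expR _ *: _]mulrC.
- have -> : flat ((P - P^`()) * 'X^2) 0 = 0 by rewrite /flat ltxx.
  (* For h > 0 the difference quotient at 0 is h times h^-2 P(1/h) exp(-1/h), hence at most C h,
     where C bounds X^2 P. *)
  have [C hC] := horner_expR_bounded ('X^2 * P).
  have C0 : 0 <= C by apply: le_trans (hC 1 ltr01); rewrite mulr_ge0// expR_ge0.
  have c : (fun h : R => h^-1 *: ((flat P \o shift 0) (h *: 1) - flat P 0)) @ 0^' --> (0 : R).
    apply/cvgrPdist_le => e e0; near=> h.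
    have -> : flat P 0 = 0 by rewrite /flat ltxx.
    rewrite sub0r normrN /= addr0 subr0 [h *: 1]mulr1 /flat.
    case: ifP => h0; last by rewrite scaler0 normr0 ltW.
    have := hC h^-1; rewrite invr_gt0 => /(_ h0); rewrite !hornerE.
    rewrite [`|h^-1 *: _|](_ : _ = h * (`|h^-1 ^+ 2 * P.[h^-1]| * expR (- h^-1))); last first.
      rewrite normrM normrM (ger0_norm (expR_ge0 _)) normrM normrX !(@ger0_norm _ h^-1) ?invr_ge0 ?(ltW h0)//.
      by field; rewrite gt_eqF.
    move=> h1; apply: (@le_trans _ _ (h * C)); first by rewrite ler_wpM2l// ltW.
    have hle : `|h| <= e / (C + 1).
      near: h; apply: dnbhs0_le; rewrite divr_gt0//.
      by rewrite ltr_wpDl.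
    rewrite (ger0_norm (ltW h0)) in hle.
    apply: (@le_trans _ _ (e / (C + 1) * C)); first by rewrite ler_wpM2r.
    rewrite -mulrA ger_pMr// mulrC ler_pdivrMr ?mul1r ?lerDl//.
    by rewrite ltr_wpDl.
  apply: DeriveDef; first exact: cvgP c.
  exact: cvg_lim c.
Unshelve. all: by end_near. Qed.

Lemma smooth_on_flat m (U : set 'rV[R]_m) (f : 'rV[R]_m -> R) : open U ->
  smooth_on U f -> smooth_on U (fun p => flat 1 (f p)).
Proof.
move=> Uo sf.
pose phi j := flat (iter j (fun P : {poly R} => (P - P^`()) * 'X^2) 1).
apply: (@smooth_on_comp1 R m U Uo setT phi f) => // j t _.
exact: is_derive_flat.
Qed.

Lemma flat1_gt0 (t : R) : 0 < t -> 0 < flat 1 t.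
Proof. by move=> t0; rewrite /flat t0 hornerE mul1r expR_gt0. Qed.

Lemma flat_le0 P (t : R) : t <= 0 -> flat P t = 0.
Proof. by move=> t0; rewrite /flat ltNge t0. Qed.

Lemma flat1_ge0 (t : R) : 0 <= flat 1 t.
Proof. by have [/flat_le0 ->//|/flat1_gt0/ltW] := leP t 0. Qed.
End OneVariable.

(** * Positive definite matrices and smooth matrix functions *)

Section PositiveDefinite.
Context (R : realType).

Definition posdef m (A : 'M[R]_m) := forall v : 'rV[R]_m, v != 0 -> 0 < (v *m A *m v^T) 0 0.

Lemma posdef_det_neq0 m (A : 'M[R]_m) : posdef A -> \det A != 0.
Proof.
move=> hA; apply/negP => /det0P[v v0 vA].
by have := hA v v0; rewrite vA mul0mx mxE ltxx.
Qed.

Lemma posdef_unit m (A : 'M[R]_m) : posdef A -> A \in unitmx.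
Proof. by move=> /posdef_det_neq0; rewrite unitmxE unitfE. Qed.

Lemma sqr_norm_gt0 m (v : 'rV[R]_m) : v != 0 -> 0 < (v *m v^T) 0 0.
Proof.
move=> v0; rewrite mxE; under eq_bigr do rewrite mxE.
rewrite lt_neqAle sumr_ge0 ?andbT => [|i _]; last by rewrite -expr2 sqr_ge0.
apply: contra v0; rewrite eq_sym psumr_eq0 => [/allP h|i _]; last by rewrite -expr2 sqr_ge0.
apply/eqP/rowP => i; have := h i; rewrite mem_index_enum -expr2 sqrf_eq0 => /(_ isT)/eqP ->.
by rewrite mxE.
Qed.

(* det (1 + t (A - 1)) has no root on [0, 1] and equals 1 at t = 0. *)
Lemma posdef_det_gt0 m (A : 'M[R]_m) : posdef A -> 0 < \det A.
Proof.
move=> hA.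
pose P := \det (map_mx polyC 1%:M + 'X *: map_mx polyC (A - 1%:M) : 'M[{poly R}]_m).
have hP t : P.[t] = \det (1%:M + t *: (A - 1%:M)).
  rewrite -horner_evalE -det_map_mx; congr determinant.
  apply/matrixP => i j; rewrite !mxE /= /horner_eval.
  rewrite hornerD hornerM hornerX.
  by rewrite !hornerC.
rewrite lt_neqAle eq_sym posdef_det_neq0//= leNgt; apply/negP => d0.
have [||t /andP[t0 t1]] := @poly_ivt R (- P) 0 1; first exact: ler01.
  rewrite !hornerN !hP scale0r addr0 det1 scale1r addrC subrK oppr_le0 ler01/=.
  by rewrite oppr_ge0 ltW.
rewrite rootN /root hP; apply/negP; apply: posdef_det_neq0 => v v0.
rewrite scalerBr addrCA -[X in t *: A + (X - _)]scale1r -scalerBl scalemx1.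
rewrite mulmxDr mulmxDl mul_mx_scalar -scalemxAl -scalemxAr -scalemxAl 2!mxE.
rewrite [X in _ + X]mxE.
have v1 := hA v v0; have v2 := sqr_norm_gt0 v0.
have [->|tn0] := eqVneq t 0; first by rewrite mul0r add0r subr0 mul1r.
apply: ltr_pwDl; first by rewrite mulr_gt0// lt_neqAle eq_sym tn0.
by rewrite mulr_ge0 ?subr_ge0// ltW.
Qed.
End PositiveDefinite.

HB.lock Definition mpartial (R : realType) (m k l : nat) (a : 'I_m)
    (F : 'rV[R]_m -> 'M[R]_(k, l)) (p : 'rV[R]_m) : 'M[R]_(k, l) :=
  \matrix_(i, j) partial a (fun q => F q i j) p.

Lemma mpartialE (R : realType) m k l a (F : 'rV[R]_m -> 'M[R]_(k, l)) p i j :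
  mpartial a F p i j = partial a (fun q => F q i j) p.
Proof. by rewrite mpartial.unlock mxE. Qed.

Section MatrixFunctions.
Context (R : realType) (m : nat).
Implicit Types (U : set 'rV[R]_m) (p : 'rV[R]_m).

Definition smooth_mx k l U (F : 'rV[R]_m -> 'M[R]_(k, l)) :=
  forall i j, smooth_on U (fun p => F p i j).

Lemma smooth_on_det k U (F : 'rV[R]_m -> 'M[R]_k) : open U ->
  smooth_mx U F -> smooth_on U (fun p => \det (F p)).
Proof.
move=> Uo sF; rewrite /determinant; apply: smooth_on_sum => // s.
by apply: smooth_onM; [|exact: smooth_on_cst|apply: smooth_on_prod => // i; exact: sF].
Qed.

(** By Cramer's formula the entries are cofactors over the determinant, which positive definiteness
    keeps positive. *)
Lemma smooth_mx_inv k U (F : 'rV[R]_m -> 'M[R]_k) : open U ->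
  (forall p, U p -> posdef (F p)) -> smooth_mx U F -> smooth_mx U (fun p => invmx (F p)).
Proof.
move=> Uo hF sF i j.
have d0 p : U p -> 0 < \det (F p) by move=> /hF; exact: posdef_det_gt0.
apply: (@smooth_on_ext R m U Uo (fun p => (\det (F p))^-1 * cofactor (F p) j i)).
  by move=> p Up; rewrite /invmx posdef_unit; [rewrite !mxE|exact: hF].
apply: smooth_onM => //; first by apply: smooth_on_inv => //; exact: smooth_on_det.
apply: smooth_onM => //; first exact: smooth_on_cst.
apply: smooth_on_det => // a b.
by apply: smooth_on_ext (sF (lift j a) (lift i b)) => // p _; rewrite !mxE.
Qed.

Lemma smooth_mx_mul k l n U (F : 'rV[R]_m -> 'M[R]_(k, l)) (H : 'rV[R]_m -> 'M[R]_(l, n)) :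
  open U -> smooth_mx U F -> smooth_mx U H -> smooth_mx U (fun p => F p *m H p).
Proof.
move=> Uo sF sH i j.
apply: (@smooth_on_ext R m U Uo (fun p => \sum_c F p i c * H p c j)).
  by move=> p _; rewrite mxE.
by apply: smooth_on_sum => // c; apply: smooth_onM.
Qed.

Lemma smooth_mx_tr k l U (F : 'rV[R]_m -> 'M[R]_(k, l)) :
  open U -> smooth_mx U F -> smooth_mx U (fun p => (F p)^T).
Proof. by move=> Uo sF i j; apply: smooth_on_ext (sF j i) => // p _; rewrite mxE. Qed.

Definition diff_mx k l (F : 'rV[R]_m -> 'M[R]_(k, l)) p :=
  forall i j, differentiable (fun q => F q i j) p.

Lemma smooth_mx_diff k l U (F : 'rV[R]_m -> 'M[R]_(k, l)) p :
  smooth_mx U F -> U p -> diff_mx F p.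
Proof. by move=> sF Up i j; exact: smooth_on_diff (sF i j) Up. Qed.

Lemma smooth_mx_partial k l U (F : 'rV[R]_m -> 'M[R]_(k, l)) a : open U ->
  smooth_mx U F -> smooth_mx U (mpartial a F).
Proof.
by move=> Uo sF i j; apply: smooth_on_ext (smooth_on_partial a (sF i j)) => // p _; rewrite mpartialE.
Qed.

Lemma diff_mx_mul k l n (F : 'rV[R]_m -> 'M[R]_(k, l)) (H : 'rV[R]_m -> 'M[R]_(l, n)) p :
  diff_mx F p -> diff_mx H p -> diff_mx (fun q => F q *m H q) p.
Proof.
move=> dF dH i j; under [X in differentiable X _]eq_fun do rewrite mxE.
by apply: differentiable_bigsum => c; apply: differentiableM.
Qed.

Lemma mpartial_mul k l n a (F : 'rV[R]_m -> 'M[R]_(k, l)) (H : 'rV[R]_m -> 'M[R]_(l, n)) p :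
  diff_mx F p -> diff_mx H p ->
  mpartial a (fun q => F q *m H q) p = mpartial a F p *m H p + F p *m mpartial a H p.
Proof.
move=> dF dH; apply/matrixP => i j; rewrite mpartialE !mxE.
under eq_fun do rewrite mxE.
rewrite partial_sum => [|c]; last exact: differentiableM.
by rewrite -big_split; apply: eq_bigr => c _; rewrite partialM// !mpartialE.
Qed.

Lemma diff_mx_tr k l (F : 'rV[R]_m -> 'M[R]_(k, l)) p :
  diff_mx F p -> diff_mx (fun q => (F q)^T) p.
Proof. by move=> dF i j; under [X in differentiable X _]eq_fun do rewrite mxE. Qed.

Lemma mpartial_tr k l a (F : 'rV[R]_m -> 'M[R]_(k, l)) p :
  mpartial a (fun q => (F q)^T) p = (mpartial a F p)^T.
Proof. by apply/matrixP => i j; rewrite mpartialE mxE mpartialE; under eq_fun do rewrite mxE. Qed.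

Lemma mpartial_cst k l a (A : 'M[R]_(k, l)) p : mpartial a (fun=> A) p = 0.
Proof. by apply/matrixP => i j; rewrite mpartialE partial_cst mxE. Qed.

Lemma near_mpartial k l a (F H : 'rV[R]_m -> 'M[R]_(k, l)) p :
  {near p, F =1 H} -> mpartial a F p = mpartial a H p.
Proof.
move=> h; apply/matrixP => i j; rewrite !mpartialE; apply: near_partial.
by near=> q; congr (fun_of_matrix _ i j); near: q; exact: h.
Unshelve. all: by end_near. Qed.

Lemma mpartial_inv k a U (F : 'rV[R]_m -> 'M[R]_k) p : open U ->
  (forall q, U q -> posdef (F q)) -> smooth_mx U F -> U p ->
  mpartial a (fun q => invmx (F q)) p = - (invmx (F p) *m mpartial a F p *m invmx (F p)).
Proof.
move=> Uo hF sF Up; have sI := smooth_mx_inv Uo hF sF.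
have u q : U q -> F q \in unitmx by move=> /hF/posdef_unit.
have e := mpartial_mul a (smooth_mx_diff sF Up) (smooth_mx_diff sI Up).
have z : mpartial a (fun q => F q *m invmx (F q)) p = 0.
  rewrite -(mpartial_cst a 1%:M p); apply: near_mpartial.
  by apply: (near_open Uo) => // q Uq; rewrite mulmxV// u.
rewrite z in e; apply/eqP; rewrite -addr_eq0; apply/eqP.
have := congr1 (mulmx (invmx (F p))) e; rewrite mulmx0 mulmxDr !mulmxA mulVmx ?u// mul1mx.
by move=> ->; rewrite addrC.
Qed.
End MatrixFunctions.

(** * Kaehler metrics in a chart *)

Section ComplexStructure.
Context (R : realType) (n : nat).
Local Notation J := (Jmx R n).
Implicit Types G A S : 'M[R]_(n + n).

Lemma JmxJ : J *m J = - 1%:M.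
Proof.
rewrite /Jmx mulmx_block !mul0mx !mulmx0 !mulmx1 !mul1mx !addr0 !add0r.
by rewrite scalar_mx_block opp_block_mx !oppr0.
Qed.

Lemma trmx_Jmx : J^T = - J.
Proof.
by rewrite /Jmx tr_block_mx !trmx0 trmx1 linearN/= trmx1 opp_block_mx !oppr0 opprK.
Qed.

Lemma herm_commJ G : J *m G *m J^T = G -> J *m G = G *m J.
Proof.
rewrite trmx_Jmx mulmxN => h; rewrite -[in RHS]h mulNmx -mulmxA JmxJ.
by rewrite mulmxN mulmx1 opprK.
Qed.

Lemma commJ_herm G : J *m G = G *m J -> J *m G *m J^T = G.
Proof. by move=> ->; rewrite trmx_Jmx mulmxN -mulmxA JmxJ mulmxN mulmx1 opprK. Qed.

Lemma invmx_commJ G : G \in unitmx -> J *m G = G *m J -> J *m invmx G = invmx G *m J.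
Proof.
move=> Gu h; apply: (can_inj (mulKmx Gu)); rewrite !mulmxA mulmxV// mul1mx.
by rewrite -h -mulmxA mulmxV// mulmx1.
Qed.

(** Conjugation by J does not change the trace against a J-invariant G but reverses the sign of S.
    This one fact makes pluriharmonic functions harmonic, holomorphic coordinates harmonic, and
    second derivatives of transitions invisible to the Laplacian. *)
Lemma trace_antiinvariant G S : J *m G = G *m J -> J *m S *m J^T = - S -> \tr (G *m S) = 0.
Proof.
move=> hG hS; have h : \tr (G *m S) = - \tr (G *m S).
  rewrite -[in LHS](commJ_herm hG) -!mulmxA mxtrace_mulC -!mulmxA.
  rewrite -(raddfN (@mxtrace R _)) /= -mulmxN -hS trmx_Jmx.
  by rewrite !(mulmxN, mulNmx) !mulmxA.
lra.
Qed.

(* [T X Y Z] stands for the derivative of g(Y, Z) along X, and the three-term combination in the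
   conclusion for twice the Christoffel form g(nabla_X Y, Z). *)
Lemma christoffel_form_J (T : 'rV[R]_(n + n) -> 'rV[R]_(n + n) -> 'rV[R]_(n + n) -> R) :
  (forall X Y Z, T X Y Z = T X Z Y) ->
  (forall X Y Z, T (- X) Y Z = - T X Y Z) ->
  (forall X Y Z, T X (- Y) Z = - T X Y Z) ->
  (forall X Y Z, T X (Y *m J) (Z *m J) = T X Y Z) ->
  (forall X Y Z, T X (Y *m J) Z + T Y (Z *m J) X + T Z (X *m J) Y = 0) ->
  forall X Y Z,
    T X (Y *m J) Z + T (Y *m J) X Z - T Z X (Y *m J)
    = - (T X Y (Z *m J) + T Y X (Z *m J) - T (Z *m J) X Y).
Proof.
move=> Ts TN1 TN2 TJ TC X Y Z.
have JJ (V : 'rV[R]_(n + n)) : V *m J *m J = - V by rewrite -mulmxA JmxJ mulmxN mulmx1.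
have sk (A B C : 'rV[R]_(n + n)) : T A (B *m J) C = - T A B (C *m J).
  by rewrite -TJ JJ TN2.
(* Closedness at (X, Y, Z) and at (X, JY, JZ): the claim is a linear combination of the two. *)
have c1 := TC X Y Z; have c2 := TC X (Y *m J) (Z *m J).
rewrite !JJ !TN2 TJ in c2.
rewrite (sk Z X Y) (Ts Y (Z *m J) X) in c1.
rewrite (Ts (Y *m J) Z X) in c2.
move: c1 c2; rewrite (sk X Y Z).
move: (T X Y _) (T Y X _) (T Z X _) (T _ X Z) (T _ X Y) => a b c d e h1 h2; lra.
Qed.
End ComplexStructure.

(** Row b holds the components of nabla_a d_b, so the matrix is the connection form in direction a,
    acting on row vectors from the right. *)
HB.lock Definition chris (R : realType) (m : nat) (G : 'rV[R]_m -> 'M[R]_m) (a : 'I_m)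
    (p : 'rV[R]_m) : 'M[R]_m :=
  \matrix_(b, c) christoffel G c a b p.

Lemma chrisE (R : realType) m (G : 'rV[R]_m -> 'M[R]_m) a p b c :
  chris G a p b c = christoffel G c a b p.
Proof. by rewrite chris.unlock mxE. Qed.

Section KahlerChart.
Context (R : realType) (n : nat).
Local Notation J := (Jmx R n).

(** The axioms of a Kaehler metric on an open set of coordinates, so that local tensor computations
    can be made without reference to a manifold. *)
Record kahler_on (U : set 'rV[R]_(n + n)) (G : 'rV[R]_(n + n) -> 'M[R]_(n + n)) : Prop :=
KahlerOn {
  kahler_open : open U;
  kahler_smooth : smooth_mx U G;
  kahler_sym : forall p, U p -> (G p)^T = G p;
  kahler_pos : forall p, U p -> posdef (G p);
  kahler_herm : forall p, U p -> J *m G p *m J^T = G p;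
  kahler_closed : forall p a b c, U p ->
    partial a (fun q => (J *m G q) b c) p + partial b (fun q => (J *m G q) c a) p
      + partial c (fun q => (J *m G q) a b) p = 0
}.

Context (U : set 'rV[R]_(n + n)) (G : 'rV[R]_(n + n) -> 'M[R]_(n + n)) (kG : kahler_on U G).
Local Notation m := (n + n)%N.
Implicit Types (p : 'rV[R]_m) (a b c d : 'I_m).

Lemma kahler_unit p : U p -> G p \in unitmx.
Proof. by move=> /(kahler_pos kG)/posdef_unit. Qed.

Lemma kahler_commJ p : U p -> J *m G p = G p *m J.
Proof. by move=> /(kahler_herm kG)/herm_commJ. Qed.

Lemma kahler_inv_commJ p : U p -> J *m invmx (G p) = invmx (G p) *m J.
Proof. by move=> Up; apply: invmx_commJ; [exact: kahler_unit|exact: kahler_commJ]. Qed.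

Lemma kahler_inv_sym p : U p -> (invmx (G p))^T = invmx (G p).
Proof. by move=> Up; rewrite trmx_inv (kahler_sym kG). Qed.

Lemma kahler_inv_smooth : smooth_mx U (fun p => invmx (G p)).
Proof. exact: (smooth_mx_inv (kahler_open kG) (kahler_pos kG) (kahler_smooth kG)). Qed.

Lemma kahler_diff p : U p -> diff_mx G p.
Proof. exact: (smooth_mx_diff (kahler_smooth kG)). Qed.

Local Notation chris := (chris G).

Lemma kahler_near (P : 'rV[R]_m -> Prop) p : U p -> (forall q, U q -> P q) ->
  \forall q \near p, P q.
Proof. exact: near_open (kahler_open kG) p P. Qed.

Lemma mpartial_sym a p : U p -> (mpartial a G p)^T = mpartial a G p.
Proof.
move=> Up; rewrite -mpartial_tr; apply: near_mpartial.
by apply: kahler_near => // q Uq; exact: (kahler_sym kG).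
Qed.

Lemma mpartial_symE a b c p : U p -> partial a (fun q => G q b c) p = partial a (fun q => G q c b) p.
Proof. by move=> Up; have /matrixP/(_ c b) := mpartial_sym a Up; rewrite mxE !mpartialE. Qed.

(** Koszul's formula: with the index lowered, only first derivatives of the metric remain, to which
    the symmetry, the hermitian condition and the closed Kaehler form apply. *)
Lemma chris_lower a p : U p -> chris a p *m G p =
  \matrix_(b, d) (2^-1 * (mpartial a G p b d + mpartial b G p a d - mpartial d G p a b)).
Proof.
move=> Up.
pose L := \matrix_(b, d) (mpartial a G p b d + mpartial b G p a d - mpartial d G p a b).
have -> : chris a p = 2^-1 *: (L *m invmx (G p)).
  apply/matrixP => b c; rewrite chrisE [RHS]mxE [X in _ * X]mxE /christoffel; congr (_ * _); apply: eq_bigr => d _.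
  rewrite [L b d]mxE !mpartialE mulrC; congr (_ * _).
  by have /matrixP/(_ d c) := kahler_inv_sym Up; rewrite mxE.
rewrite -scalemxAl mulmxKV ?kahler_unit//.
by apply/matrixP => b d; rewrite [LHS]mxE [L _ _]mxE [RHS]mxE.
Qed.

Lemma chris_sym a b c p : U p -> chris a p b c = chris b p a c.
Proof.
move=> Up; rewrite !chrisE /christoffel; congr (_ * _); apply: eq_bigr => d _.
congr (_ * _); rewrite (mpartial_symE d a b Up); ring.
Qed.

Lemma chris_metric a p : U p -> mpartial a G p = chris a p *m G p + G p *m (chris a p)^T.
Proof.
move=> Up.
have -> : G p *m (chris a p)^T = (chris a p *m G p)^T by rewrite trmx_mul (kahler_sym kG).
rewrite chris_lower//; apply/matrixP => b d.
rewrite [RHS]mxE [_^T b d]mxE [X in _ = X + _]mxE [X in _ = _ + X]mxE.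
have /matrixP/(_ d b) := mpartial_sym a Up; rewrite mxE => ->.
by move: (mpartial a G p b d) (mpartial b G p a d) (mpartial d G p a b) => x y z; field.
Qed.

Definition dmetric p (X : 'rV[R]_m) : 'M[R]_m := \sum_a X 0 a *: mpartial a G p.

Lemma mpartial_herm a p : U p -> J *m mpartial a G p *m J^T = mpartial a G p.
Proof.
move=> Up; have dG := kahler_diff Up.
have dc (A : 'M[R]_m) : diff_mx (fun=> A : 'M[R]_m) p.
  by move=> i j; exact: differentiable_cst.
have dJG : diff_mx (fun q => J *m G q) p by apply: diff_mx_mul.
rewrite -[RHS](@near_mpartial _ _ _ _ _ (fun q => J *m G q *m J^T)).
  by rewrite mpartial_mul// mpartial_mul// !mpartial_cst mul0mx add0r mulmx0 addr0.
by apply: kahler_near => // q Uq; exact: (kahler_herm kG).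
Qed.

Lemma mpartial_J a b c p : U p ->
  partial a (fun q => (J *m G q) b c) p = (J *m mpartial a G p) b c.
Proof.
move=> Up; have dG := kahler_diff Up.
have dc : diff_mx (fun=> J : 'M[R]_m) p by move=> i j; exact: differentiable_cst.
have := mpartial_mul a dc dG; rewrite mpartial_cst mul0mx add0r => /matrixP/(_ b c) <-.
by rewrite mpartialE.
Qed.

Lemma deltaE (a c : 'I_m) : (delta_mx 0 a : 'rV[R]_m) 0 c = (c == a)%:R.
Proof. by rewrite mxE. Qed.

(** This is nabla J = 0: J has constant components in a holomorphic chart, so being parallel means
    commuting with the connection matrices. It is where closedness of the Kaehler form is used. *)
Lemma chris_J a p : U p -> J *m chris a p = chris a p *m J.
Proof.
move=> Up; have Gu := kahler_unit Up.
(* X(g(Y, Z)) for vector fields with constant coefficients. *)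
pose T (X Y Z : 'rV[R]_m) := (Y *m dmetric p X *m Z^T) 0 0.
have dsym X : (dmetric p X)^T = dmetric p X.
  by rewrite /dmetric linear_sum; apply: eq_bigr => b _; rewrite linearZ/= mpartial_sym.
have dherm X : J *m dmetric p X *m J^T = dmetric p X.
  rewrite /dmetric mulmx_sumr mulmx_suml; apply: eq_bigr => b _.
  by rewrite -scalemxAr -scalemxAl mpartial_herm.
have T1 X Y Z : T X Y Z = T X Z Y.
  rewrite /T -[in LHS](trmxK (Y *m _ *m _)) mxE !trmx_mul trmxK dsym.
  by rewrite mulmxA.
have TN1 X Y Z : T (- X) Y Z = - T X Y Z.
  rewrite /T (_ : dmetric p (- X) = - dmetric p X) ?mulmxN ?mulNmx ?mxE//.
  by rewrite /dmetric -sumrN; apply: eq_bigr => b _; rewrite mxE scaleNr.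
have TN2 X Y Z : T X (- Y) Z = - T X Y Z by rewrite /T !mulNmx mxE.
have TJ X Y Z : T X (Y *m J) (Z *m J) = T X Y Z.
  by rewrite /T trmx_mul -!mulmxA [J *m (_ *m _)]mulmxA [J *m _ *m _]mulmxA dherm.
have Te X Y Z : T X Y Z = \sum_b \sum_c \sum_d X 0 b * Y 0 c * Z 0 d * mpartial b G p c d.
  rewrite /T /dmetric mulmx_sumr mulmx_suml summxE; apply: eq_bigr => b _.
  rewrite -scalemxAr -scalemxAl mxE mxE mulr_sumr exchange_big/=; apply: eq_bigr => d _.
  rewrite !mxE mulr_suml mulr_sumr; apply: eq_bigr => c _; rewrite ?mxE; ring.
have TC X Y Z : T X (Y *m J) Z + T Y (Z *m J) X + T Z (X *m J) Y = 0.
  have TJe A B C : T A (B *m J) C = \sum_b \sum_c \sum_d A 0 b * B 0 c * C 0 d *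
      partial b (fun q => (J *m G q) c d) p.
    rewrite /T /dmetric mulmx_sumr mulmx_suml summxE; apply: eq_bigr => b _.
    rewrite -scalemxAr -scalemxAl mxE mxE mulr_sumr exchange_big/=; apply: eq_bigr => d _.
    rewrite -mulmxA !mxE mulr_suml mulr_sumr; apply: eq_bigr => c _.
    rewrite mpartial_J// ?mxE; ring.
  rewrite !TJe.
  have -> : \sum_b \sum_c \sum_d Y 0 b * Z 0 c * X 0 d * partial b (fun q => (J *m G q) c d) p
    = \sum_b \sum_c \sum_d X 0 b * Y 0 c * Z 0 d * partial c (fun q => (J *m G q) d b) p.
    rewrite [RHS](_ : _ = \sum_c \sum_d \sum_b X 0 b * Y 0 c * Z 0 d * partial c (fun q => (J *m G q) d b) p).
      by do 3 (apply: eq_bigr => ? _); ring.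
    rewrite exchange_big; apply: eq_bigr => c _ /=; exact: exchange_big.
  have -> : \sum_b \sum_c \sum_d Z 0 b * X 0 c * Y 0 d * partial b (fun q => (J *m G q) c d) p
    = \sum_b \sum_c \sum_d X 0 b * Y 0 c * Z 0 d * partial d (fun q => (J *m G q) b c) p.
    rewrite [RHS](_ : _ = \sum_d \sum_b \sum_c X 0 b * Y 0 c * Z 0 d * partial d (fun q => (J *m G q) b c) p).
      by do 3 (apply: eq_bigr => ? _); ring.
    rewrite [RHS]exchange_big; apply: eq_bigr => b _ /=; exact: exchange_big.
  rewrite -!big_split/= big1// => b _; rewrite -!big_split/= big1// => c _.
  rewrite -!big_split/= big1// => d _.
  by rewrite -!mulrDr (kahler_closed kG) ?mulr0.
have main := christoffel_form_J T1 TN1 TN2 TJ TC.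
have dE b X Z : T (delta_mx 0 b) X Z = (X *m mpartial b G p *m Z^T) 0 0.
  rewrite /T /dmetric (bigD1 b)//= big1 => [|c /negbTE cb].
    by rewrite deltaE eqxx scale1r addr0.
  by rewrite deltaE cb scale0r.
have low (X Y Z : 'rV[R]_m) : (Y *m (\sum_b X 0 b *: (chris b p *m G p)) *m Z^T) 0 0 =
    2^-1 * (T X Y Z + T Y X Z - T Z X Y).
  transitivity (\sum_b \sum_c \sum_d X 0 b * Y 0 c * Z 0 d * (chris b p *m G p) c d).
    rewrite mulmx_sumr mulmx_suml summxE; apply: eq_bigr => b _.
    rewrite -scalemxAr -scalemxAl mxE mxE mulr_sumr exchange_big/=; apply: eq_bigr => d _.
    rewrite !mxE mulr_suml mulr_sumr; apply: eq_bigr => c _; rewrite !mxE; ring.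
  have -> : T Y X Z = \sum_b \sum_c \sum_d X 0 b * Y 0 c * Z 0 d * mpartial c G p b d.
    rewrite Te exchange_big; do 3 (apply: eq_bigr => ? _); ring.
  have -> : T Z X Y = \sum_b \sum_c \sum_d X 0 b * Y 0 c * Z 0 d * mpartial d G p b c.
    rewrite Te exchange_big; apply: eq_bigr => b _; rewrite exchange_big.
    do 2 (apply: eq_bigr => ? _); ring.
  rewrite Te -!big_split -sumrB/= mulr_sumr; apply: eq_bigr => b _.
  rewrite -!big_split -sumrB/= mulr_sumr; apply: eq_bigr => c _.
  rewrite -!big_split -sumrB/= mulr_sumr; apply: eq_bigr => d _.
  rewrite chris_lower// !mxE; ring.
have lowd (Y Z : 'rV[R]_m) : (Y *m (chris a p *m G p) *m Z^T) 0 0 =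
    2^-1 * (T (delta_mx 0 a) Y Z + T Y (delta_mx 0 a) Z - T Z (delta_mx 0 a) Y).
  rewrite -low (bigD1 a)//= big1 => [|c /negbTE ca].
    by rewrite deltaE eqxx scale1r addr0.
  by rewrite deltaE ca scale0r.
(* The Gram matrix is invertible and commutes with J, so the claim may be checked with the index
   lowered. *)
suff h : J *m (chris a p *m G p) = chris a p *m G p *m J.
  apply: (can_inj (mulmxK Gu)); rewrite -mulmxA h -!mulmxA; congr (_ *m _).
  by rewrite kahler_commJ.
apply/matrixP => b c.
have eE (A : 'M[R]_m) i j : A i j = ((delta_mx 0 i : 'rV_m) *m A *m (delta_mx 0 j : 'rV_m)^T) 0 0.
  by rewrite -rowE trmx_delta -colE !mxE.
rewrite eE [RHS]eE.
have -> : (delta_mx 0 b : 'rV_m) *m (J *m (chris a p *m G p)) = (delta_mx 0 b *m J) *m (chris a p *m G p).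
  by rewrite mulmxA.
rewrite lowd main.
have -> : (delta_mx 0 b : 'rV_m) *m (chris a p *m G p *m J) *m (delta_mx 0 c : 'rV_m)^T
  = - ((delta_mx 0 b : 'rV_m) *m (chris a p *m G p) *m (delta_mx 0 c *m J : 'rV_m)^T).
  by rewrite trmx_mul trmx_Jmx mulNmx mulmxN opprK !mulmxA.
by rewrite [in RHS]mxE lowd mulrN.
Qed.

Definition chris_up c p : 'M[R]_m := \matrix_(a, b) chris a p b c.

(** [chris_J] and the symmetry in the lower indices carry both copies of J through the Christoffel
    symbol until they meet as J^2 = -1. In complex terms, the mixed Christoffel symbols of a Kaehler
    metric vanish. *)
Lemma chris_up_anti c p : U p -> J *m chris_up c p *m J^T = - chris_up c p.
Proof.
move=> Up; apply/matrixP => a b; rewrite mxE.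
have e1 d : (J *m chris_up c p) a d = (chris d p *m J) a c.
  rewrite -chris_J// [LHS]mxE [RHS]mxE; apply: eq_bigr => e _.
  by rewrite [chris_up _ _ _ _]mxE chris_sym.
transitivity (\sum_d \sum_e chris d p a e * J e c * J^T d b).
  by apply: eq_bigr => d _; rewrite e1 mxE mulr_suml.
rewrite exchange_big/=.
transitivity (\sum_e (J *m chris a p) b e * J e c).
  apply: eq_bigr => e _; rewrite [(J *m _) b e]mxE mulr_suml; apply: eq_bigr => d _.
  by rewrite chris_sym// [J^T d b]mxE; ring.
transitivity ((J *m chris a p *m J) b c); first by rewrite [RHS]mxE.
by rewrite chris_J// -mulmxA JmxJ mulmxN mulmx1 [RHS]mxE [chris_up c p a b]mxE [LHS]mxE.
Qed.

(** Holomorphic coordinates are harmonic functions, so the Laplacian has no first-order term in a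
    chart. *)
Lemma chris_trace c p : U p -> \sum_a \sum_b invmx (G p) a b * chris a p b c = 0.
Proof.
move=> Up; have h := trace_antiinvariant (kahler_inv_commJ Up) (chris_up_anti c Up).
rewrite -[RHS]h /mxtrace; apply: eq_bigr => a _.
rewrite [RHS](mxE _ _ a a); apply: eq_bigr => b _.
by rewrite [chris_up c p b a]mxE chris_sym.
Qed.
End KahlerChart.

(** The classical octahedron argument: the Bianchi identities at the four cyclic rotations of (a, b,
    c, d) are combined, after the two antisymmetries have identified their terms. *)
Lemma pair_symmetry (R : realType) (I : Type) (r : I -> I -> I -> I -> R) :
  (forall a b c d, r a b c d = - r b a c d) -> (forall a b c d, r a b c d = - r a b d c) ->
  (forall a b c d, r a b c d + r b c a d + r c a b d = 0) ->
  forall a b c d, r a b c d = r c d a b.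
Proof.
move=> r1 r2 B a b c d.
have := B a b c d; have := B b c d a; have := B c d a b; have := B d a b c.
rewrite (r2 b c d a) (r2 c d b a) (r1 d b c a) (r2 b d c a) (r2 d a c b) (r1 a c d b) (r2 c a d b).
rewrite (r2 a b d c); lra.
Qed.

Lemma addmxE (R : realType) k l (A B : 'M[R]_(k, l)) i j : (A + B) i j = A i j + B i j.
Proof. by rewrite mxE. Qed.

Lemma oppmxE (R : realType) k l (A : 'M[R]_(k, l)) i j : (- A) i j = - A i j.
Proof. by rewrite mxE. Qed.

Lemma trmx_add (R : realType) k l (A B : 'M[R]_(k, l)) : (A + B)^T = A^T + B^T.
Proof. exact: linearD. Qed.

Lemma trmx_opp (R : realType) k l (A : 'M[R]_(k, l)) : (- A)^T = - A^T.
Proof. exact: linearN. Qed.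

HB.lock Definition curv (R : realType) (m : nat) (G : 'rV[R]_m -> 'M[R]_m) (a b : 'I_m)
    (p : 'rV[R]_m) : 'M[R]_m :=
  \matrix_(c, d) riemann_endo G a b c d p.

Lemma curvEij (R : realType) m (G : 'rV[R]_m -> 'M[R]_m) a b p c d :
  curv G a b p c d = riemann_endo G a b c d p.
Proof. by rewrite curv.unlock mxE. Qed.

Opaque Jmx.

(* Antisymmetrising the second derivative of a metric g expressed through Christoffel matrices. *)
Lemma curvature_skew_aux (R : realType) m (P Q A B g : 'M[R]_m) : g^T = g ->
  P *m g + B *m (A *m g + g *m A^T) + ((A *m g + g *m A^T) *m B^T + g *m P^T)
  = Q *m g + A *m (B *m g + g *m B^T) + ((B *m g + g *m B^T) *m A^T + g *m Q^T) ->
  ((P - Q + (B *m A - A *m B)) *m g)^T = - ((P - Q + (B *m A - A *m B)) *m g).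
Proof.
move=> gs /eqP; rewrite -subr_eq0 => /eqP h.
apply/eqP; rewrite -addr_eq0 -[X in _ == X]h; apply/eqP.
rewrite trmx_mul gs 2!trmx_add trmx_opp [(B *m A - _)^T]trmx_add trmx_opp !trmx_mul.
rewrite !(mulmxDl, mulmxDr, mulmxN, mulNmx) !mulmxA.
by apply/matrixP => i j; rewrite !(addmxE, oppmxE); ring.
Qed.

(** * Symmetries of the curvature of a Kaehler metric *)

Section Curvature.
Context (R : realType) (n : nat).
Local Notation J := (Jmx R n).
Local Notation m := (n + n)%N.
Context (U : set 'rV[R]_m) (G : 'rV[R]_m -> 'M[R]_m) (kG : kahler_on U G).
Implicit Types (p : 'rV[R]_m) (a b c d : 'I_m).

Lemma chris_smooth a : smooth_mx U (chris G a).
Proof.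
have Uo := kahler_open kG.
move=> b c; apply: (@smooth_on_ext R m U Uo (christoffel G c a b)).
  by move=> p _; rewrite chrisE.
apply: smooth_onM => //; first exact: smooth_on_cst.
apply: smooth_on_sum => // d; apply: smooth_onM => //; first exact: (kahler_inv_smooth kG).
apply: smooth_onD => //; last by apply: smooth_onN => //; apply: smooth_on_partial; exact: (kahler_smooth kG).
by apply: smooth_onD => //; apply: smooth_on_partial; exact: (kahler_smooth kG).
Qed.

Lemma chris_diff a p : U p -> diff_mx (chris G a) p.
Proof. exact: smooth_mx_diff (chris_smooth a). Qed.

Local Notation curv := (curv G).

(** The product [chris G b p *m chris G a p] comes with the positive sign because matrices act on
    row vectors from the right, which reverses compositions. *)
Lemma curvE a b p : curv a b p = mpartial a (chris G b) p - mpartial b (chris G a) p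
  + (chris G b p *m chris G a p - chris G a p *m chris G b p).
Proof.
apply/matrixP => c d; rewrite curvEij /riemann_endo sumrB !(addmxE, oppmxE, mpartialE).
congr (partial a _ p - partial b _ p + (_ - _)).
- by apply: funext => q; rewrite chrisE.
- by apply: funext => q; rewrite chrisE.
- by rewrite [RHS]mxE; apply: eq_bigr => e _; rewrite !chrisE.
- by rewrite [RHS]mxE; apply: eq_bigr => e _; rewrite !chrisE.
Qed.

Lemma RmE a b c d p : Rm G a b c d p = (curv a b p *m G p) d c.
Proof. by rewrite /Rm [RHS]mxE; apply: eq_bigr => e _; rewrite curvEij. Qed.

Opaque Rm.

Lemma Rm_anti12 a b c d p : Rm G a b c d p = - Rm G b a c d p.
Proof.
suff h : curv a b p = - curv b a p by rewrite !RmE h mulNmx oppmxE.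
by rewrite !curvE opprD !opprB.
Qed.

(** Curvature acts by skew endomorphisms because the metric is parallel: [pp] expands a second
    derivative of the metric by compatibility, and [comm] exchanges the two derivatives. *)
Lemma Rm_anti34 a b c d p : U p -> Rm G a b c d p = - Rm G a b d c p.
Proof.
move=> Up; have dG := kahler_diff kG Up.
have dc e := chris_diff e Up.
suff h : (curv a b p *m G p)^T = - (curv a b p *m G p).
  by have /matrixP/(_ c d) := h; rewrite mxE oppmxE !RmE.
have pp e f : mpartial e (mpartial f G) p
   = mpartial e (chris G f) p *m G p + chris G f p *m (chris G e p *m G p + G p *m (chris G e p)^T)
   + ((chris G e p *m G p + G p *m (chris G e p)^T) *m (chris G f p)^T
      + G p *m (mpartial e (chris G f) p)^T).
  rewrite (@near_mpartial _ _ _ _ _ (mpartial f G)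
    (fun q => chris G f q *m G q + G q *m (chris G f q)^T)); last first.
    by apply: (kahler_near kG) => // q Uq; exact: (chris_metric kG).
  rewrite -(chris_metric kG e Up) -mpartial_tr -mpartial_mul//.
  rewrite -mpartial_mul//; last exact: diff_mx_tr.
  apply/matrixP => i j; rewrite addmxE !mpartialE -partialD.
  - by congr (partial e _ p); apply: funext => q; rewrite addmxE.
  - exact: diff_mx_mul.
  - by apply: diff_mx_mul => //; exact: diff_mx_tr.
have comm : mpartial a (mpartial b G) p = mpartial b (mpartial a G) p.
  apply/matrixP => i j; rewrite [LHS]mpartialE.
  rewrite [RHS]mpartialE.
  have me e : (fun q => mpartial e G q i j) = partial e (fun q => G q i j).
    by apply: funext => q; rewrite mpartialE.
  rewrite !me; apply: (@partial_comm _ _ U) => //; first exact: (kahler_open kG).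
  by move/smooth_on_Cn: (kahler_smooth kG i j); apply.
move: comm; rewrite !pp => comm.
by rewrite curvE; apply: curvature_skew_aux => //; exact: (kahler_sym kG).
Qed.

(** Symmetry of the Christoffel symbols in their lower indices makes the cyclic sum of curvature
    endomorphisms vanish. [Rm] keeps the vector acted upon in its fourth slot, hence the preliminary
    exchange of the last two. *)
Lemma Rm_bianchi a b c d p : U p ->
  Rm G a b c d p + Rm G b c a d p + Rm G c a b d p = 0.
Proof.
move=> Up.
have h : forall e, curv a b p c e + curv b c p a e + curv c a p b e = 0.
  move=> e; rewrite !curvE.
  have s x y z : mpartial x (chris G y) p z e = mpartial x (chris G z) p y e.
    rewrite [LHS]mpartialE.
    rewrite [RHS]mpartialE.
    apply: near_partial.
    apply: (kahler_near kG) => // q Uq.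
    exact: (chris_sym kG).
  have q x y z : (chris G x p *m chris G y p) z e = (chris G z p *m chris G y p) x e.
    by rewrite [LHS]mxE [RHS]mxE; apply: eq_bigr => f _; rewrite (chris_sym kG).
  rewrite !(addmxE, oppmxE) (s b a c) (s c b a) (s a c b) (q b a c) (q c b a) (q a c b).
  by move: (mpartial _ _ _ _ _) (mpartial _ _ _ _ _) (mpartial _ _ _ _ _) (mulmx _ _ _ _)
    (mulmx _ _ _ _) (mulmx _ _ _ _) => x y z u v w; ring.
rewrite (Rm_anti34 a b c d Up) (Rm_anti34 b c a d Up) (Rm_anti34 c a b d Up) !RmE -!opprD.
apply/eqP; rewrite oppr_eq0; apply/eqP.
have ex x y z : (curv x y p *m G p) z d = \sum_e curv x y p z e * G p e d by rewrite mxE.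
by rewrite !ex -!big_split/= big1// => e _; rewrite -!mulrDl h mul0r.
Qed.

Lemma Rm_pair a b c d p : U p -> Rm G a b c d p = Rm G c d a b p.
Proof.
move=> Up; apply: (@pair_symmetry R 'I_m (fun a b c d => Rm G a b c d p)).
- by move=> *; exact: Rm_anti12.
- by move=> *; exact: Rm_anti34.
- by move=> *; exact: Rm_bianchi.
Qed.

Lemma curv_J a b p : U p -> J *m curv a b p = curv a b p *m J.
Proof.
move=> Up; have dJ : diff_mx (fun=> J : 'M[R]_m) p by move=> i j; exact: differentiable_cst.
have pJ e f : J *m mpartial e (chris G f) p = mpartial e (chris G f) p *m J.
  have := mpartial_mul e dJ (chris_diff f Up); rewrite mpartial_cst mul0mx add0r => <-.
  have := mpartial_mul e (chris_diff f Up) dJ; rewrite mpartial_cst mulmx0 addr0 => <-.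
  by apply: near_mpartial; apply: (kahler_near kG) => // q Uq; exact: (chris_J kG).
have cJ e := chris_J kG e Up.
rewrite curvE.
rewrite mulmxDr.
rewrite mulmxDl.
rewrite !mulmxBr.
rewrite !mulmxBl.
rewrite !pJ.
congr (_ + (_ - _)).
  by rewrite mulmxA cJ -mulmxA cJ mulmxA.
by rewrite mulmxA cJ -mulmxA cJ mulmxA.
Qed.

Lemma Rm_bivectorE p A : Rm_bivector G p A
  = 2^-1 *: \sum_a \sum_b A a b *: (curv a b p *m G p)^T.
Proof.
apply/matrixP => c d; rewrite !mxE; congr (_ * _); rewrite summxE; apply: eq_bigr => a _.
by rewrite summxE; apply: eq_bigr => b _; rewrite mxE [(_^T) c d]mxE RmE.
Qed.

Lemma Rm_bivector_skew p A : U p -> (Rm_bivector G p A)^T = - Rm_bivector G p A.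
Proof.
move=> Up; apply/matrixP => c d; rewrite !mxE -mulrN -sumrN; congr (_ * _).
apply: eq_bigr => a _; rewrite -sumrN; apply: eq_bigr => b _.
by rewrite Rm_anti34// mulrN.
Qed.

Lemma Rm_bivector_commJ p A : U p -> J *m Rm_bivector G p A = Rm_bivector G p A *m J.
Proof.
move=> Up; apply: herm_commJ; rewrite Rm_bivectorE -scalemxAr -scalemxAl; congr (_ *: _).
rewrite mulmx_sumr mulmx_suml; apply: eq_bigr => a _.
rewrite mulmx_sumr mulmx_suml; apply: eq_bigr => b _.
rewrite -scalemxAr -scalemxAl; congr (_ *: _).
rewrite -{1}(trmxK J) -trmx_mul -trmx_mul; congr trmx.
rewrite !mulmxA curv_J//.
by rewrite -2!mulmxA [J *m (G p *m _)]mulmxA (kahler_herm kG).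
Qed.

(** The values lie in u(n) for every matrix A, so [vsproj] in [kahler_curvature_operator] discards
    nothing. *)
Lemma curvature_operator_in_u p A : U p -> curvature_operator G p A \in u_space (G p).
Proof.
move=> Up; have Gu := kahler_unit kG Up.
apply/u_spaceP; rewrite /curvature_operator; split.
  rewrite !trmx_mul (kahler_inv_sym kG)// Rm_bivector_skew//.
  by rewrite mulNmx mulmxN mulmxA.
rewrite !mulmxA mulmxV// mul1mx -[J *m G p *m _]mulmxA mulmxV// mulmx1.
by rewrite Rm_bivector_commJ// -!mulmxA (kahler_inv_commJ kG).
Qed.

Lemma curvature_operator_selfadjoint p A B : U p ->
  bivector_inner (G p) (curvature_operator G p A) B
  = bivector_inner (G p) (curvature_operator G p B) A.
Proof.
move=> Up; have Gu := kahler_unit kG Up.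
rewrite !curvature_operatorE//; congr (_ * _).
transitivity (\sum_a \sum_c \sum_b \sum_d A a b * B c d * Rm G a b c d p).
  by apply: eq_bigr => a _; exact: exchange_big.
rewrite exchange_big/=.
transitivity (\sum_c \sum_a \sum_d \sum_b A a b * B c d * Rm G a b c d p).
  by do 2 (apply: eq_bigr => ? _); exact: exchange_big.
apply: eq_bigr => c _; rewrite exchange_big/=; apply: eq_bigr => d _.
by apply: eq_bigr => a _; apply: eq_bigr => b _; rewrite Rm_pair//; ring.
Qed.

Lemma bivector_innerC (g A B : 'M[R]_m) : g^T = g -> bivector_inner g A B = bivector_inner g B A.
Proof.
move=> gs; rewrite /bivector_inner; congr (_ * _).
by rewrite -[LHS]mxtrace_tr !trmx_mul trmxK gs !mulmxA mxtrace_mulC !mulmxA.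
Qed.
End Curvature.

(** * Ricci curvature and eigenvalues *)

Section InnerProduct.
Context (R : realType) (V : vectType R) (B : V -> V -> R).
Hypotheses (BC : forall x y, B x y = B y x) (Blin : forall x, linear (B x : V -> R^o))
  (Bpos : forall x, x != 0 -> 0 < B x x).
Implicit Types (x y e : V) (W : {vspace V}) (s : seq V).

HB.instance Definition _ x := GRing.isLinear.Build R V R^o _ (B x : V -> R^o) (Blin x).

Lemma formDr x y z : B x (y + z) = B x y + B x z.
Proof. exact: (linearD (B x : {linear V -> R^o})). Qed.

Lemma form0r x : B x 0 = 0.
Proof. exact: (linear0 (B x : {linear V -> R^o})). Qed.

Lemma formZr x y (k : R) : B x (k *: y) = k * B x y.
Proof. by rewrite -[k *: y]addr0 Blin form0r addr0. Qed.

Lemma formBr x y z : B x (y - z) = B x y - B x z.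
Proof. exact: (linearB (B x : {linear V -> R^o})). Qed.

Lemma form_sumr x (I : Type) (r : seq I) (F : I -> V) :
  B x (\sum_(i <- r) F i) = \sum_(i <- r) B x (F i).
Proof. exact: (linear_sum (B x : {linear V -> R^o})). Qed.

Lemma form_ge0 x : 0 <= B x x.
Proof. by have [->|/Bpos/ltW//] := eqVneq x 0; rewrite form0r. Qed.

Lemma form_cauchy x y : B x y ^+ 2 <= B x x * B y y.
Proof.
have [->|x0] := eqVneq x 0; first by rewrite BC form0r expr0n mulr_ge0 ?form_ge0.
have ex a b : B (a *: y - b *: x) (a *: y - b *: x) =
    a ^+ 2 * B y y - 2 * (a * b * B x y) + b ^+ 2 * B x x.
  rewrite formBr !formZr (BC _ y) (BC _ x) !formBr !formZr (BC y x); ring.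
have bx := Bpos x0; have := form_ge0 (B x x *: y - B x y *: x).
rewrite ex.
have -> : B x x ^+ 2 * B y y - 2 * (B x x * B x y * B x y) + B x y ^+ 2 * B x x
  = B x x * (B x x * B y y - B x y ^+ 2) by ring.
by rewrite pmulr_rge0// subr_ge0.
Qed.

Definition orthonormal s := all (fun x => B x x == 1) s && pairwise (fun x y => B x y == 0) s.

Definition orth_in W e := (W :&: lker (linfun (B e : V -> R^o)))%VS.

Lemma mem_orth_in W e x : (x \in orth_in W e) = (x \in W) && (B e x == 0).
Proof. by rewrite memv_cap memv_ker lfunE. Qed.

Lemma dim_orth_in W e : e \in W -> B e e = 1 -> \dim W = (\dim (orth_in W e)).+1.
Proof.
move=> eW e1; rewrite -(limg_ker_dim (linfun (B e : V -> R^o)) W) -/(orth_in W e) -addn1.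
congr (_ + _)%N; apply/eqP; rewrite eqn_leq; apply/andP; split.
  by rewrite (leq_trans (dimvS (subvf _)))// dimvf /dim /= .
rewrite lt0n dimv_eq0; apply/negP => /eqP h.
have : linfun (B e : V -> R^o) e \in (linfun (B e : V -> R^o) @: W)%VS by apply: memv_img.
by rewrite h memv0 lfunE/= e1 oner_eq0.
Qed.

Lemma orthonormal_exists W : exists s,
  [/\ size s = \dim W, forall x, x \in s -> x \in W & orthonormal s].
Proof.
move: {2}(\dim W) (erefl (\dim W)) => k; elim: k W => [|k ih] W dW.
  by exists [::]; split.
have w0 : vpick W != 0 by rewrite vpick0 -dimv_eq0 dW.
pose e := (Num.sqrt (B (vpick W) (vpick W)))^-1 *: vpick W.
have eW : e \in W by rewrite memvZ ?memv_pick.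
have e1 : B e e = 1.
  rewrite /e formZr BC formZr mulrA -invfM -expr2 sqr_sqrtr ?form_ge0// mulVf//.
  by rewrite gt_eqF// Bpos.
have dW' : \dim (orth_in W e) = k by apply: succn_inj; rewrite -dim_orth_in.
have [s [ss sW /andP[s1 s2]]] := ih _ dW'.
exists (e :: s); split; first by rewrite /= ss dW' dW.
  move=> x; rewrite inE => /orP[/eqP->//|/sW].
  by rewrite mem_orth_in => /andP[].
rewrite /orthonormal/= e1 eqxx s1 s2 /= andbT; apply/allP => x /sW.
by rewrite mem_orth_in => /andP[].
Qed.

(** Induction on the family: removing its head lowers the dimension of the orthogonal complement by
    one, so the size bound persists. Spanning thus follows from counting. *)
Lemma orthonormal_expand W s : (forall x, x \in s -> x \in W) -> orthonormal s ->
  (\dim W <= size s)%N -> forall x, x \in W -> x = \sum_(e <- s) B e x *: e.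
Proof.
elim: s W => [|e s ih] W sW.
  rewrite leqn0 dimv_eq0 => _ /eqP -> x; rewrite memv0 => /eqP ->.
  by rewrite big_nil.
rewrite /orthonormal/= => /andP[/andP[/eqP e1 s1] /andP[se s2]] dW x xW.
have eW : e \in W by apply: sW; rewrite mem_head.
have sW' y : y \in s -> y \in orth_in W e.
  by move=> ys; rewrite mem_orth_in sW ?inE ?ys ?orbT//=; move/allP: se => ->.
have xW' : x - B e x *: e \in orth_in W e.
  rewrite mem_orth_in formBr formZr e1 mulr1 subrr eqxx andbT.
  by rewrite rpredB// rpredZ.
have := ih (orth_in W e) sW'; rewrite /orthonormal s1 s2 -ltnS -dim_orth_in// => /(_ isT dW _ xW').
rewrite big_cons => /eqP; rewrite subr_eq addrC => /eqP {1}->; congr (_ + _).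
rewrite !big_seq; apply: eq_bigr => y ys; congr (_ *: _).
move/allP: se => /(_ y ys)/eqP h.
by rewrite formBr formZr [B y e]BC h mulr0 subr0.
Qed.
End InnerProduct.

Section EigenFamily.
Context (R : realType) (V : vectType R) (B : V -> V -> R) (f : 'End(V)).
Hypotheses (BC : forall x y, B x y = B y x) (Blin : forall x, linear (B x : V -> R^o))
  (Bpos : forall x, x != 0 -> 0 < B x x) (fsa : forall x y, B (f x) y = B (f y) x).

Lemma eigen_orthogonal a b x y : f x = a *: x -> f y = b *: y -> a != b -> B x y = 0.
Proof.
move=> fx fy ab; have := fsa x y; rewrite fx fy BC (formZr Blin) BC [RHS]BC (formZr Blin).
move=> /eqP; rewrite -subr_eq0 -mulrBl mulf_eq0 subr_eq0 (negbTE ab)/= => /eqP //.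
Qed.

(** Orthonormal bases of the eigenspaces are concatenated; self-adjointness makes different
    eigenspaces orthogonal. Completeness is not claimed here: it comes later from comparing the
    length n^2 of the list with the dimension of u(n). *)
Lemma eigen_family (es : seq R) : uniq es -> exists L : seq (R * V),
  [/\ forall z, z \in L -> z.1 \in es /\ f z.2 = z.1 *: z.2,
      forall a, a \in es -> count_mem a (map fst L) = \dim (passmx.leigenspace f a) &
      orthonormal B (map snd L)].
Proof.
elim: es => [|a es ih] /=; first by move=> _; exists [::]; split.
move=> /andP[aes ues]; have [L [L1 L2 L3]] := ih ues.
have [s [ss sW so]] := orthonormal_exists BC Blin Bpos (passmx.leigenspace f a).
have sE x : x \in s -> f x = a *: x.
  move=> /sW; rewrite memv_ker !lfun_simp /= subr_eq0 => /eqP ->.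
  by [].
exists ([seq (a, x) | x <- s] ++ L); split.
- move=> z; rewrite mem_cat => /orP[/mapP[x xs ->]|/L1[h1 h2]].
    by rewrite inE eqxx; split=> //=; exact: sE.
  by rewrite inE h1 orbT.
- move=> b; rewrite inE map_cat count_cat -map_comp.
  have -> : map (fst \o (fun x => (a, x))) s = nseq (size s) a.
    by elim: s {ss sW so sE} => //= x s ->.
  rewrite count_nseq ss; have [->|ba] := eqVneq b a => /= [_|bes].
    rewrite eqxx mul1n [X in (_ + X)%N](_ : _ = 0%N) ?addn0//.
    apply/count_memPn; apply/mapP => -[z /L1[h _] e].
    by rewrite e h in aes.
  by rewrite [a == b]eq_sym (negbTE ba) mul0n add0n L2.
- rewrite map_cat -map_comp map_id.
  move: so L3 => /andP[s1 s2] /andP[l1 l2].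
  rewrite /orthonormal all_cat s1 l1 pairwise_cat s2 l2 !andbT/=.
  apply/allrelP => x y xs /mapP[z /L1[h1 h2] ->].
  apply/eqP; apply: (eigen_orthogonal (sE x xs) h2).
  by apply: contra aes => /eqP ->.
Qed.

Lemma eigen_family_ordered (s : seq R) : ordered_eigenvalues f s -> exists L : seq (R * V),
  [/\ forall z, z \in L -> f z.2 = z.1 *: z.2, perm_eq (map fst L) s & orthonormal B (map snd L)].
Proof.
move=> [_ hs]; have [L [L1 L2 L3]] := eigen_family (undup_uniq s).
exists L; split=> //; first by move=> z /L1[].
apply/allP => a _ /=; apply/eqP; have [as_|as_] := boolP (a \in undup s).
  by rewrite L2// hs.
rewrite mem_undup in as_; rewrite (count_memPn as_); apply/count_memPn.
apply/mapP => -[z /L1[h _] e]; move: as_; by rewrite -mem_undup e h.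
Qed.
End EigenFamily.

(* Comparison with the constant weight T on the N smallest eigenvalues, after shifting all
   eigenvalues by the N-th one. *)
Lemma weighted_eigenvalue_sum (R : realType) (I : eqType) (s : seq R) (L : seq (R * I)) (t : I -> R)
    (T : R) N : sorted <=%R s -> perm_eq (map fst L) s -> (0 < N <= size s)%N ->
  (forall z, z \in L -> 0 <= t z.2 <= T) -> \sum_(z <- L) t z.2 = N%:R * T ->
  (\sum_(j < N) s`_j) * T <= \sum_(z <- L) z.1 * t z.2.
Proof.
case: N => // k ss pL /= ks tT tsum; pose c := s`_k.
have T0 : 0 <= T.
  case/boolP: (has predT L) => [/hasP[z zL _]|].
    by have /andP[] := tT z zL; apply: le_trans.
  rewrite has_predT -leqNgt leqn0 => /eqP/size0nil L0.
  by move: pL; rewrite L0 => /perm_size /= s0; rewrite -s0 in ks.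
rewrite -subr_ge0.
have -> : \sum_(z <- L) z.1 * t z.2 = \sum_(z <- L) (z.1 - c) * t z.2 + c * (k.+1%:R * T).
  by rewrite -tsum mulr_sumr -big_split; apply: eq_bigr => z _ /=; ring.
(* Since 0 <= t <= T, each (lambda - c) t is at least T min(lambda - c, 0); these minima vanish from
   the N-th eigenvalue c on. *)
have h1 : T * \sum_(a <- s) Num.min (a - c) 0 <= \sum_(z <- L) (z.1 - c) * t z.2.
  rewrite -(perm_big _ pL) big_map mulr_sumr !big_seq; apply: ler_sum => z zL.
  have /andP[t0 tT'] := tT z zL.
  have [h|h] := leP 0 (z.1 - c); first by rewrite mulr0 mulr_ge0.
  by rewrite mulrC; apply: ler_wnM2l => //; exact: ltW.
have h2 : \sum_(a <- s) Num.min (a - c) 0 = \sum_(j < k.+1) s`_j - k.+1%:R * c.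
  rewrite (big_nth 0) big_mkord.
  rewrite (big_ord_widen_cond _ xpredT (fun j => s`_j) ks) /=.
  rewrite [in RHS]big_mkcond /=.
  have -> : k.+1%:R * c = \sum_(j < size s | (j < k.+1)%N) c.
    rewrite -(big_ord_widen_cond _ xpredT (fun=> c) ks) sumr_const card_ord.
    by rewrite mulr_natl.
  rewrite [X in _ - X]big_mkcond -sumrB; apply: eq_bigr => j _ /=.
  have mono := sorted_leq_nth (@le_trans _ R) (@lexx _ R) 0 ss.
  case: ltnP => jk.
    rewrite min_l// subr_le0; apply: mono; rewrite ?inE//.
  by rewrite subrr min_r// subr_ge0; apply: mono; rewrite ?inE// ltnW.
by move: h1; rewrite h2; lra.
Qed.

Section RicciBound.
Context (R : realType) (n : nat).
Local Notation J := (Jmx R n).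
Local Notation m := (n + n)%N.
Context (g : 'M[R]_m).
Hypotheses (gs : g^T = g) (gpos : posdef g) (gJ : J *m g = g *m J).
Implicit Types (v w : 'rV[R]_m) (A B xi : 'M[R]_m).

Local Notation "<< A , B >>" := (bivector_inner g A B).
Definition gform (h : 'M[R]_m) v w := (v *m h *m w^T) 0 0.

Lemma gformC (h : 'M[R]_m) v w : h^T = h -> gform h v w = gform h w v.
Proof.
by move=> hs; rewrite /gform -[in LHS](trmxK (v *m _ *m _)) mxE !trmx_mul trmxK hs mulmxA.
Qed.

Lemma gform_linear (h : 'M[R]_m) v : linear (gform h v : 'rV[R]_m -> R^o).
Proof. by move=> k x y; rewrite /gform linearP /= mulmxDr -scalemxAr !mxE. Qed.

Lemma gformNl (h : 'M[R]_m) v w : gform h (- v) w = - gform h v w.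
Proof. by rewrite /gform !mulNmx oppmxE. Qed.

(** An orthonormal basis for the dual form [invmx h] provides the rank-one summands. The
    decomposition serves as a substitute for a square root of h. *)
Lemma posdef_factor (h : 'M[R]_m) : h^T = h -> posdef h -> exists s : seq 'rV[R]_m,
  h = \sum_(x <- s) x^T *m x.
Proof.
move=> hs hpos; have hu := posdef_unit hpos; pose k := invmx h.
have ks : k^T = k by rewrite trmx_inv hs.
have kpos x : x != 0 -> 0 < gform k x x.
  move=> x0; have := hpos (x *m k); rewrite trmx_mul ks !mulmxA mulmxKV//; apply.
  by apply: contra x0 => /eqP h0; rewrite -(mulmxKV hu x) -/k h0 mul0mx.
have [s [ss sW so]] := orthonormal_exists (fun x y => gformC x y ks) (gform_linear k) kpos fullv.
exists s.
have ex := orthonormal_expand (fun x y => gformC x y ks) (gform_linear k) sW so.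
rewrite ss in ex; have {}ex x := ex (leqnn _) x (memvf x).
have : k *m (\sum_(x <- s) x^T *m x) = 1%:M.
  apply/row_matrixP => i; rewrite row_mul row1 [RHS]ex mulmx_sumr !big_seq.
  apply: eq_bigr => y _; rewrite mulmxA [row i k *m _]mx11_scalar mul_scalar_mx; congr (_ *: _).
  by rewrite rowE -/(gform k 'e_i y) gformC.
by move=> /(congr1 (mulmx h)); rewrite mulmx1 mulmxA mulmxV// mul1mx.
Qed.

Lemma bivector_inner_gt0 A : A != 0 -> 0 < <<A, A>>.
Proof.
move=> A0; have [s hs] := posdef_factor gs gpos.
have e : <<A, A>> = 2^-1 * \sum_(x <- s) gform g (x *m A) (x *m A).
  rewrite /bivector_inner -!mulmxA {1}hs mulmx_suml raddf_sum /=; congr (_ * _).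
  apply: eq_bigr => x _; rewrite -mulmxA mxtrace_mulC trace_mx11 /gform trmx_mul.
  by rewrite !mulmxA.
have ge0 x : 0 <= gform g (x *m A) (x *m A).
  have [->|/gpos/ltW//] := eqVneq (x *m A) 0; by rewrite /gform !mul0mx mxE.
rewrite e pmulr_rgt0 ?invr_gt0 ?ltr0n// lt_neqAle sumr_ge0 ?andbT//.
apply: contra A0; rewrite eq_sym psumr_eq0// => /allP h.
have gu := posdef_unit gpos; rewrite -(mulKmx gu A); apply/eqP.
rewrite {2}hs mulmx_suml big_seq big1 ?mulmx0// => x xs; rewrite -mulmxA.
have := h x xs; have [->|/gpos] := eqVneq (x *m A) 0; first by rewrite mulmx0.
by rewrite -/(gform _ _ _) => /gt_eqF ->.
Qed.

Lemma bivector_inner_linear A : linear (bivector_inner g A : 'M[R]_m -> R^o).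
Proof.
move=> k B C; rewrite /bivector_inner linearP /= mulmxDr -scalemxAr linearP /=.
by rewrite mulrDr mulrCA.
Qed.

Lemma wedge_inner v w xi : xi^T = - xi -> <<wedge v w, xi>> = gform (g *m xi *m g) v w.
Proof.
move=> xs; rewrite /bivector_inner /wedge xs mulmxN.
have tr (x y : 'rV[R]_m) : \tr (g *m (x^T *m y) *m g *m xi) = gform (g *m xi *m g) y x.
  rewrite -!mulmxA mxtrace_mulC -mulmxA mxtrace_mulC trace_mx11 /gform.
  by rewrite !mulmxA.
rewrite mulmxBr !mulmxBl linearN linearB /= !tr.
have -> : gform (g *m xi *m g) w v = - gform (g *m xi *m g) v w.
  rewrite /gform -[in LHS](trmxK (w *m _ *m _)) mxE !trmx_mul trmxK gs xs.
  by rewrite !(mulNmx, mulmxN) mxE !mulmxA.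
lra.
Qed.

(** A skew matrix commuting with J has blocks P, Q, -Q, P with P skew and Q symmetric, so the n by n
    matrix P + Q determines it. *)
Lemma u_space_dim : (\dim (u_space g) <= n ^ 2)%N.
Proof.
have gu := posdef_unit gpos.
pose F (A : 'M[R]_m) := ulsubmx A + ursubmx A.
have lF : linear F by move=> k A B; apply/matrixP => i j; rewrite !mxE; ring.
pose FL : {linear 'M[R]_m -> 'M[R]_n} := HB.pack F (GRing.isLinear.Build _ _ _ _ _ lF).
have k0 : (u_space g :&: lker (linfun FL) = 0)%VS.
  apply/eqP; rewrite -subv0; apply/subvP => A; rewrite memv_cap memv_ker lfunE /= memv0.
  move=> /andP[/u_spaceP[As AJ] /eqP FA].
  have {}AJ : J *m A = A *m J.
    apply: (can_inj (mulKmx gu)).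
    by rewrite mulmxA -gJ -mulmxA AJ mulmxA.
  have JE : J = block_mx 0 1%:M (- 1%:M) 0 by exact: erefl.
  move: AJ As FA; rewrite JE /F -(submxK A); move: (ulsubmx A) (ursubmx A) (dlsubmx A) (drsubmx A).
  move=> P Q S T; rewrite !mulmx_block tr_block_mx opp_block_mx block_mxKul block_mxKur.
  rewrite !(mul0mx, mulmx0, mul1mx, mulmx1, addr0, add0r, mulNmx, mulmxN).
  move=> /eq_block_mx[SQ TP _ _] /eq_block_mx[Ps Sq _ _] PQ.
  have QP : Q = - P by apply/eqP; rewrite -addr_eq0 addrC PQ.
  have Q0 : Q = 0.
    have : Q^T = Q.
      by move: Sq; rewrite SQ trmx_opp => /oppr_inj.
    rewrite {1}QP linearN /= Ps opprK => /eqP; rewrite -[P]opprK -QP -subr_eq0.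
    move=> /eqP/matrixP h; apply/matrixP => i j; have := h i j.
    rewrite !(addmxE, oppmxE) [X in _ = X -> _]mxE [X in _ -> _ = X]mxE; lra.
  by rewrite TP SQ Q0 (_ : P = 0) ?oppr0 ?block_mx0// -[P]opprK -QP Q0 oppr0.
rewrite -(limg_dim_eq k0) (leq_trans (dimvS (subvf _)))//.
by rewrite dimvf /dim /= mulnn.
Qed.

Lemma gform_cauchy v w : gform g v w ^+ 2 <= gform g v v * gform g w w.
Proof. exact: (form_cauchy (fun x y => gformC x y gs) (gform_linear g) (fun x h => gpos h)). Qed.

Lemma gform_J v w : gform g (v *m J) (w *m J) = gform g v w.
Proof.
rewrite /gform trmx_mul -!mulmxA [J *m (g *m _)]mulmxA [J *m g *m _]mulmxA.
by rewrite (commJ_herm gJ).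
Qed.

Lemma gform_Jv v : gform g (v *m J) v = 0.
Proof.
have h : gform g (v *m J) v = - gform g (v *m J) v.
  by rewrite -[in LHS]gform_J -mulmxA JmxJ mulmxN mulmx1 gformNl gformC.
lra.
Qed.

(** On skew matrices this average over conjugation by J is the orthogonal projection onto u(n). *)
Definition u_proj A := 2^-1 *: (A + J *m A *m J^T).

Lemma u_proj_in A : A^T = - A -> u_proj A \in u_space g.
Proof.
move=> As; apply/u_spaceP; split.
  rewrite /u_proj linearZ /= trmx_add !trmx_mul trmxK As mulNmx mulmxN -opprD scalerN.
  by rewrite mulmxA.
rewrite mulmxA gJ -!mulmxA; congr (_ *m _); rewrite /u_proj -scalemxAr -scalemxAl; congr (_ *: _).
rewrite mulmxDr mulmxDl addrC trmx_Jmx !mulmxN mulNmx !mulmxA JmxJ !mulNmx mul1mx opprK.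
by rewrite -!mulmxA JmxJ !mulmxN mulmx1 opprK.
Qed.

Lemma u_proj_inner A B : <<u_proj A, B>> = <<A, u_proj B>>.
Proof.
rewrite /u_proj !(formZr (bivector_inner_linear)) (bivector_innerC _ _ gs).
rewrite (formZr (bivector_inner_linear)) (bivector_innerC _ _ gs); congr (_ * _).
rewrite bivector_innerC// !(formDr (bivector_inner_linear)) (bivector_innerC _ _ gs); congr (_ + _).
rewrite bivector_innerC// /bivector_inner; congr (_ * _).
have e : \tr (g *m J *m A *m J *m g *m B^T) = \tr (g *m A *m g *m J *m B^T *m J).
  rewrite -gJ -!mulmxA mxtrace_mulC -!mulmxA; congr (\tr (_ *m (_ *m _))).
  by rewrite !mulmxA gJ.
by rewrite !trmx_mul trmxK trmx_Jmx !(mulNmx, mulmxN) !mulmxA !linearN /= e.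
Qed.

Lemma u_proj_id A : A \in u_space g -> u_proj A = A.
Proof.
move=> /u_spaceP[As AJ].
have {}AJ : J *m A = A *m J.
  apply: (can_inj (mulKmx (posdef_unit gpos))).
  by rewrite mulmxA -gJ -mulmxA AJ mulmxA.
by rewrite /u_proj (commJ_herm AJ); apply/matrixP => i j; rewrite mxE addmxE; lra.
Qed.

Lemma u_proj_wedge v w v' w' : <<u_proj (wedge v w), wedge v' w'>> =
  2^-1 * (gform g v v' * gform g w w' - gform g v w' * gform g w v'
    + (gform g (v *m J) v' * gform g (w *m J) w' - gform g (v *m J) w' * gform g (w *m J) v')).
Proof.
have wJ : J *m wedge v w *m J^T = wedge (v *m J) (w *m J).
  rewrite /wedge !trmx_mul trmx_Jmx mulmxBr mulmxBl.
  by rewrite !(mulmxN, mulNmx) !mulmxA.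
rewrite /u_proj wJ bivector_innerC// (formZr (bivector_inner_linear)); congr (_ * _).
rewrite (formDr (bivector_inner_linear)) -!(bivector_innerC _ (wedge v' w') gs).
by rewrite !bivector_inner_wedge.
Qed.

(** Let w be the image of v under xi. Then <v /\ w, xi> = |w|^2, and by Cauchy-Schwarz |w|^4 is at
    most the squared norm of the u(n)-part of v /\ w, namely (|v|^2 |w|^2 - <v, w>^2 + <Jv, w>^2) /
    2 <= |v|^2 |w|^2. *)
Lemma u_norm_le v xi : xi \in u_space g -> <<xi, xi>> = 1 ->
  gform g (v *m g *m xi) (v *m g *m xi) <= gform g v v.
Proof.
move=> xu x1; have [xs _] := (u_spaceP g xi).1 xu.
set w := v *m g *m xi; pose t := gform g w w.
have e1 : <<wedge v w, xi>> = t.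
  by rewrite wedge_inner// /t /gform /w !mulmxA.
have h1 : t ^+ 2 <= <<u_proj (wedge v w), wedge v w>>.
  have sk : (wedge v w)^T = - wedge v w.
    by rewrite /wedge trmx_add trmx_opp !trmx_mul !trmxK opprB addrC.
  have e2 : <<u_proj (wedge v w), xi>> = t by rewrite u_proj_inner u_proj_id.
  have e3 : <<u_proj (wedge v w), wedge v w>> = <<u_proj (wedge v w), u_proj (wedge v w)>>.
    by rewrite -[RHS]u_proj_inner [in RHS](u_proj_id (u_proj_in sk)).
  rewrite e3 -e2.
  have := form_cauchy (fun x y => bivector_innerC x y gs) bivector_inner_linear
    bivector_inner_gt0 (u_proj (wedge v w)) xi.
  by rewrite x1 mulr1.
have h2 : <<u_proj (wedge v w), wedge v w>> <= gform g v v * t.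
  rewrite u_proj_wedge !gform_Jv mulr0 sub0r (gformC w v gs) -/t.
  have -> : gform g (w *m J) v = - gform g (v *m J) w.
    by rewrite -gform_J -mulmxA JmxJ mulmxN mulmx1 gformNl gformC.
  have c1 : gform g (v *m J) w ^+ 2 <= gform g v v * t.
    by rewrite -(gform_J v v); exact: gform_cauchy.
  have := sqr_ge0 (gform g v w); rewrite mulrN opprK -!expr2.
  by move: c1; move: (gform g v v * t) (_ ^+ 2) (_ ^+ 2) => x y z; lra.
have t0 : 0 <= t.
  by have [w0|/gpos/ltW//] := eqVneq w 0; rewrite /t w0 /gform !mul0mx mxE.
have [tz|tn] := eqVneq t 0.
  rewrite -/t tz; have [->|/gpos/ltW//] := eqVneq v 0; by rewrite /gform !mul0mx mxE.
have tp : 0 < t by rewrite lt_neqAle eq_sym tn.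
by have := le_trans h1 h2; rewrite expr2 ler_pM2r.
Qed.
End RicciBound.

Section RicciEigenvalues.
Context (R : realType) (n : nat).
Local Notation J := (Jmx R n).
Local Notation m := (n + n)%N.
Context (U : set 'rV[R]_m) (G : 'rV[R]_m -> 'M[R]_m) (kG : kahler_on U G).
Context (p : 'rV[R]_m) (Up : U p).
Implicit Types (v w : 'rV[R]_m).
Local Notation g := (G p).
Local Notation K := (invmx (G p)).
Local Notation e a := (delta_mx 0 a : 'rV[R]_m).

(** Ric(v, v) as the trace of Rm(v, ., v, .) with respect to the inverse metric; v is given by its
    contravariant components. *)
Definition ricci v := \sum_a \sum_b K a b * \sum_c \sum_d v 0 c * v 0 d * Rm G c a d b p.

Let gs : g^T = g := kahler_sym kG Up.
Let gpos : posdef g := kahler_pos kG Up.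
Let gJ : J *m g = g *m J := kahler_commJ kG Up.
Let gu : g \in unitmx := kahler_unit kG Up.
Let ks : K^T = K := kahler_inv_sym kG Up.

Lemma sum_wedge_delta v a (F : 'I_m -> 'I_m -> R) : (forall x y, F x y = - F y x) ->
  \sum_x \sum_y wedge v (e a) x y * F x y = 2 * \sum_x v 0 x * F x a.
Proof.
move=> hF.
have wE x y : wedge v (e a) x y = v 0 x * (y == a)%:R - (x == a)%:R * v 0 y.
  by rewrite /wedge addmxE oppmxE ![(_ *m _) x y]mxE !big_ord1 !mxE eqxx /=.
transitivity (\sum_x v 0 x * F x a - \sum_y v 0 y * F a y).
  transitivity (\sum_x (v 0 x * F x a - (x == a)%:R * \sum_y v 0 y * F x y)).
    apply: eq_bigr => x _; rewrite mulr_sumr.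
    rewrite -[v 0 x * F x a](_ : \sum_y v 0 x * (y == a)%:R * F x y = _); last first.
      rewrite (bigD1 a)//= eqxx mulr1 big1 ?addr0// => y /negbTE ->.
      by rewrite mulr0 mul0r.
    by rewrite -sumrB; apply: eq_bigr => y _; rewrite wE; ring.
  rewrite sumrB; congr (_ - _).
  rewrite (bigD1 a)//= eqxx mul1r [X in _ + X]big1 ?addr0// => x /negbTE ->.
  by rewrite mul0r.
rewrite -sumrB mulr_sumr; apply: eq_bigr => x _; rewrite (hF a x); ring.
Qed.

Lemma curvature_wedge v a b :
  bivector_inner g (curvature_operator G p (wedge v (e a))) (wedge v (e b))
  = \sum_c \sum_d v 0 c * v 0 d * Rm G c a d b p.
Proof.
rewrite curvature_operatorE//.
have -> : \sum_x \sum_y \sum_z \sum_w wedge v (e a) x y * wedge v (e b) z w * Rm G x y z w p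
  = \sum_x \sum_y wedge v (e a) x y * (2 * \sum_z v 0 z * Rm G x y z b p).
  apply: eq_bigr => x _; apply: eq_bigr => y _.
  rewrite -(sum_wedge_delta v b (F := fun z w : 'I_m => Rm G x y z w p)); last first.
    by move=> z w; exact: (Rm_anti34 kG).
  rewrite mulr_sumr; apply: eq_bigr => z _; rewrite mulr_sumr; apply: eq_bigr => w _.
  by rewrite mulrA.
rewrite (sum_wedge_delta v a (F := fun x y : 'I_m => 2 * \sum_z v 0 z * Rm G x y z b p)); last first.
  move=> x y; rewrite -mulrN -sumrN; congr (_ * _); apply: eq_bigr => z _.
  by rewrite Rm_anti12 mulrN.
rewrite !mulr_sumr; apply: eq_bigr => c _; rewrite !mulr_sumr; apply: eq_bigr => d _.
by field.
Qed.

Lemma trace_gram (z w : 'rV[R]_m) : \sum_a \sum_b K a b * (z 0 a * w 0 b) = (z *m K *m w^T) 0 0.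
Proof.
rewrite mxE exchange_big; apply: eq_bigr => b _; rewrite !mxE mulr_suml.
by apply: eq_bigr => a _; ring.
Qed.

Lemma gram_delta (h : 'M[R]_m) v a : gform h v (e a) = (v *m h) 0 a.
Proof. by rewrite /gform trmx_delta -colE mxE. Qed.

(** Ric(v, v) is the trace over a of <R(v /\ e_a), v /\ e_a>. Expanded in orthonormal eigenvectors
    xi of R on u(n), it becomes the sum of the eigenvalues weighted by |xi v|^2; [u_norm_le] bounds
    each weight and [tsum] gives their total. *)
Lemma ricci_ge (s : (n ^ 2).-tuple R) v :
  ordered_eigenvalues (kahler_curvature_operator G p) s ->
  (\sum_(k < n) s`_k) * gform g v v <= ricci v.
Proof.
move=> hs; have [n0|n0] := posnP n.
  have no (i : 'I_n) : False by case: i => i; rewrite {1}n0.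
  have no2 (i : 'I_m) : False by case: i => i; rewrite n0.
  rewrite [X in X * _]big1 => [|i]; last by case: (no i).
  by rewrite mul0r /ricci big1// => i; case: (no2 i).
pose B (x y : subvs_of (u_space g)) := bivector_inner g (vsval x) (vsval y).
have BC x y : B x y = B y x by exact: bivector_innerC.
have Bl x : linear (B x : subvs_of (u_space g) -> R^o).
  by move=> k y z; rewrite /B linearP bivector_inner_linear.
have Bp x : x != 0 -> 0 < B x x.
  move=> x0; apply: (bivector_inner_gt0 gs gpos); apply: contra x0 => /eqP h.
  by apply/eqP/val_inj.
have fE x : vsval (kahler_curvature_operator G p x) = curvature_operator G p (vsval x).
  by rewrite lfunE /= vsprojK// (curvature_operator_in_u kG).
have fsa x y : B (kahler_curvature_operator G p x) y = B (kahler_curvature_operator G p y) x.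
  by rewrite /B !fE; exact: (curvature_operator_selfadjoint kG).
have [L [L1 L2 L3]] := eigen_family_ordered BC Bl Bp fsa hs.
have sL : size L = (n ^ 2)%N by have := perm_size L2; rewrite size_map size_tuple.
(* The eigenvectors span because there are n^2 of them and u(n) has dimension at most n^2; the
   spectral theorem is not invoked. *)
have dW : (\dim (fullv : {vspace subvs_of (u_space g)}) <= size (map snd L))%N.
  by rewrite size_map sL dimvf; exact: (u_space_dim gpos gJ).
have ex := orthonormal_expand BC Bl (fun x _ => memvf x) L3 dW.
have exA A : A \in u_space g ->
    A = \sum_(z <- L) bivector_inner g (vsval z.2) A *: vsval z.2.
  move=> Au; rewrite -[in LHS](vsprojK Au) [in LHS](ex (vsproj _ A) (memvf _)) linear_sum big_map.
  by apply: eq_bigr => z _; rewrite linearZ /B /= vsprojK.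
have skew z : z \in L -> (vsval z.2)^T = - vsval z.2.
  by move=> _; have [] := (u_spaceP g (vsval z.2)).1 (subvsP z.2).
have inW z a : z \in L -> bivector_inner g (vsval z.2) (wedge v (e a)) = (v *m g *m vsval z.2 *m g) 0 a.
  move=> zL; rewrite bivector_innerC// wedge_inner// ?skew// gram_delta.
  by rewrite !mulmxA.
pose t (x : subvs_of (u_space g)) := gform g (v *m g *m vsval x) (v *m g *m vsval x).
have tE z : z \in L -> t z.2 = \sum_a \sum_b K a b *
    ((v *m g *m vsval z.2 *m g) 0 a * (v *m g *m vsval z.2 *m g) 0 b).
  by move=> zL; rewrite trace_gram /t /gform mulmxK// (trmx_mul (v *m g *m vsval z.2) g) gs mulmxA.
(* One trace formula for any self-adjoint operator into u(n) diagonalised by [L]. It is applied to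
   the curvature operator for Ric, and to the projection onto u(n), with all eigenvalues 1, for the
   total weight. *)
have dec (S : 'M[R]_m -> 'M[R]_m) : (forall A, S A \in u_space g) ->
    (forall A D, bivector_inner g (S A) D = bivector_inner g A (S D)) ->
    forall (lam : R * subvs_of (u_space g) -> R),
    (forall z, z \in L -> S (vsval z.2) = lam z *: vsval z.2) ->
    \sum_a \sum_b K a b * bivector_inner g (S (wedge v (e a))) (wedge v (e b))
    = \sum_(z <- L) lam z * t z.2.
  move=> Su Ssa lam Sl.
  have h a b : bivector_inner g (S (wedge v (e a))) (wedge v (e b)) =
      \sum_(z <- L) lam z * ((v *m g *m vsval z.2 *m g) 0 a * (v *m g *m vsval z.2 *m g) 0 b).
    rewrite (exA _ (Su _)) bivector_innerC// (form_sumr (@bivector_inner_linear _ _ g)).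
    rewrite !big_seq; apply: eq_bigr => z zL.
    rewrite (formZr (@bivector_inner_linear _ _ g)) -Ssa Sl// bivector_innerC//.
    rewrite (formZr (@bivector_inner_linear _ _ g)) bivector_innerC// inW//.
    by rewrite bivector_innerC// inW// mulrA.
  transitivity (\sum_a \sum_b \sum_(z <- L) lam z * (K a b *
      ((v *m g *m vsval z.2 *m g) 0 a * (v *m g *m vsval z.2 *m g) 0 b))).
    apply: eq_bigr => a _; apply: eq_bigr => b _; rewrite h mulr_sumr.
    by apply: eq_bigr => z _; rewrite mulrCA.
  under eq_bigr => a _ do rewrite exchange_big.
  rewrite exchange_big /= !big_seq; apply: eq_bigr => z zL; rewrite tE// mulr_sumr.
  by apply: eq_bigr => a _; rewrite mulr_sumr.
have ricE : ricci v = \sum_(z <- L) z.1 * t z.2.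
  rewrite -(dec (curvature_operator G p)).
  - by apply: eq_bigr => a _; apply: eq_bigr => b _; rewrite curvature_wedge.
  - by move=> A; exact: (curvature_operator_in_u kG).
  - move=> A D; rewrite [RHS]bivector_innerC//; exact: (curvature_operator_selfadjoint kG).
  - by move=> z /L1 /(congr1 vsval); rewrite fE linearZ.
(* The trace of the projection formula for v /\ e_a is (2n |v|^2 - |v|^2 + |Jv|^2) / 2 = n |v|^2. *)
have tsum : \sum_(z <- L) t z.2 = n%:R * gform g v v.
  transitivity (\sum_(z <- L) 1 * t z.2); first by apply: eq_bigr => z _; rewrite mul1r.
  (* [dec] asks for values in u(n) on all matrices, so the skew part is taken before projecting. *)
  pose S A := u_proj (2^-1 *: (A - A^T)) : 'M[R]_m.
  have Sin A : S A \in u_space g.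
    apply: (u_proj_in gJ); rewrite linearZ /= trmx_add trmx_opp trmxK -scalerN opprB.
    by rewrite addrC.
  rewrite -(dec S).
  - have Sw a : S (wedge v (e a)) = u_proj (wedge v (e a)).
      have sk : (wedge v (e a))^T = - wedge v (e a).
        by rewrite /wedge trmx_add trmx_opp !trmx_mul !trmxK opprB addrC.
      congr u_proj; rewrite sk opprK; apply/matrixP => i j; rewrite mxE addmxE; lra.
    pose y := v *m J *m g; pose x := v *m g.
    have h a b : bivector_inner g (S (wedge v (e a))) (wedge v (e b)) =
       2^-1 * (gform g v v * g a b - x 0 a * x 0 b + y 0 a * y 0 b).
      rewrite Sw u_proj_wedge// gform_Jv// mul0r sub0r.
      rewrite (gformC (e a) v gs) !gram_delta.
      have -> : (e a *m g) 0 b = g a b by rewrite -rowE mxE.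
      have -> : gform g (e a *m J) v = - y 0 a.
        rewrite -(gform_J gJ) -mulmxA JmxJ mulmxN mulmx1 gformNl gformC//.
        by rewrite gram_delta.
      by rewrite /x /y; ring.
    transitivity (2^-1 * (gform g v v * \sum_a \sum_b K a b * g a b
      - \sum_a \sum_b K a b * (x 0 a * x 0 b) + \sum_a \sum_b K a b * (y 0 a * y 0 b))).
      rewrite !mulr_sumr -sumrB -big_split mulr_sumr; apply: eq_bigr => a _ /=.
      rewrite !mulr_sumr -sumrB -big_split mulr_sumr; apply: eq_bigr => b _ /=.
      rewrite h; ring.
    have -> : \sum_a \sum_b K a b * g a b = (n + n)%:R.
      transitivity (\tr (K *m g)); last by rewrite mulVmx// mxtrace1.
      apply: eq_bigr => a _; rewrite mxE; apply: eq_bigr => b _.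
      by have /matrixP/(_ a b) := gs; rewrite mxE => ->.
    rewrite !trace_gram.
    have -> : x *m K *m x^T = v *m g *m v^T by rewrite /x mulmxK// trmx_mul gs mulmxA.
    have -> : y *m K *m y^T = (v *m J) *m g *m (v *m J)^T by rewrite /y mulmxK// trmx_mul gs mulmxA.
    rewrite -/(gform g v v) -/(gform g (v *m J) (v *m J)) (gform_J gJ) natrD.
    by move: (gform g v v) => T; field.
  - exact: Sin.
  - have skE A D : bivector_inner g (2^-1 *: (A - A^T)) D = bivector_inner g A (2^-1 *: (D - D^T)).
      rewrite bivector_innerC// !(formZr (@bivector_inner_linear _ _ g)); congr (_ * _).
      rewrite !(formBr (@bivector_inner_linear _ _ g)) bivector_innerC//; congr (_ - _).
      rewrite /bivector_inner trmxK; congr (_ * _).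
      by rewrite trmxK -[X in \tr X = _]mulmxA mxtrace_mulC !mulmxA.
    move=> A D; rewrite /S (u_proj_inner gs gJ) skE; congr bivector_inner.
    rewrite /u_proj; apply/matrixP => i j.
    have TJ (E : 'M[R]_m) : (J *m E *m J^T)^T = J *m E^T *m J^T.
      by rewrite !trmx_mul trmxK mulmxA.
    rewrite linearZ /= trmx_add TJ -!scalemxAr -!scalemxAl mulmxBr mulmxBl.
    by rewrite !mxE; ring.
  - move=> z zL; rewrite scale1r /S skew// opprK.
    rewrite (_ : 2^-1 *: _ = vsval z.2) ?(u_proj_id gpos gJ) ?subvsP//.
    by apply/matrixP => i j; rewrite mxE addmxE; lra.
rewrite ricE; apply: (weighted_eigenvalue_sum hs.1 L2 _ _ tsum).
  by rewrite size_tuple n0 -mulnn leq_pmulr.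
move=> z zL; apply/andP; split.
  rewrite /t; have [->|/gpos/ltW//] := eqVneq (v *m g *m vsval z.2) 0.
  by rewrite /gform !mul0mx mxE.
apply: (u_norm_le gs gpos gJ); first exact: subvsP.
have /andP[/allP /(_ z.2) h _] := L3.
by apply/eqP/h/map_f.
Qed.
End RicciEigenvalues.

HB.lock Definition nabla (R : realType) (m : nat) (G : 'rV[R]_m -> 'M[R]_m) (a : 'I_m)
    (be : 'rV[R]_m -> 'rV[R]_m) (p : 'rV[R]_m) : 'rV[R]_m :=
  mpartial a be p - be p *m (chris G a p)^T.

Lemma nablaE (R : realType) (m : nat) (G : 'rV[R]_m -> 'M[R]_m) a be p :
  nabla G a be p = mpartial a be p - be p *m (chris G a p)^T.
Proof. by rewrite nabla.unlock. Qed.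

HB.lock Definition grad_row (R : realType) (m : nat) (h : 'rV[R]_m -> R) (p : 'rV[R]_m) : 'rV[R]_m :=
  \row_a partial a h p.

Lemma grad_rowE (R : realType) (m : nat) (h : 'rV[R]_m -> R) p a : grad_row h p 0 a = partial a h p.
Proof. by rewrite grad_row.unlock mxE. Qed.

HB.lock Definition chart_dot (R : realType) (m : nat) (G : 'rV[R]_m -> 'M[R]_m)
    (h k : 'rV[R]_m -> R) (p : 'rV[R]_m) : R :=
  (grad_row h p *m invmx (G p) *m (grad_row k p)^T) 0 0.

(** The Laplace-Beltrami operator in holomorphic coordinates; its first-order term is zero by
    [chris_trace]. *)
HB.lock Definition chart_lap (R : realType) (m : nat) (G : 'rV[R]_m -> 'M[R]_m)
    (h : 'rV[R]_m -> R) (p : 'rV[R]_m) : R :=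
  \sum_a \sum_b invmx (G p) a b * partial a (partial b h) p.

Lemma chart_dotE (R : realType) (m : nat) (G : 'rV[R]_m -> 'M[R]_m) h k p :
  chart_dot G h k p = (grad_row h p *m invmx (G p) *m (grad_row k p)^T) 0 0.
Proof. by rewrite chart_dot.unlock. Qed.

Lemma chart_lapE (R : realType) (m : nat) (G : 'rV[R]_m -> 'M[R]_m) h p :
  chart_lap G h p = \sum_a \sum_b invmx (G p) a b * partial a (partial b h) p.
Proof. by rewrite chart_lap.unlock. Qed.

(** The covariant Hessian nabla df, in contrast to the matrix [hess] of plain second derivatives. *)
HB.lock Definition chess (R : realType) (m : nat) (G : 'rV[R]_m -> 'M[R]_m)
    (f : 'rV[R]_m -> R) (p : 'rV[R]_m) : 'M[R]_m :=
  \matrix_(a, b) nabla G a (grad_row f) p 0 b.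

(** * Bochner inequality *)

Section Bochner.
Context (R : realType) (n : nat).
Local Notation J := (Jmx R n).
Local Notation m := (n + n)%N.
Context (U : set 'rV[R]_m) (G : 'rV[R]_m -> 'M[R]_m) (kG : kahler_on U G).
Context (f : 'rV[R]_m -> R) (sf : smooth_on U f).
Implicit Types (p q : 'rV[R]_m) (a b c d : 'I_m) (be ga : 'rV[R]_m -> 'rV[R]_m).
Local Notation K := (fun p => invmx (G p)).

Let Uo : open U := kahler_open kG.

Local Notation chart_dot := (chart_dot G).
Local Notation chart_lap := (chart_lap G).

Definition hess p : 'M[R]_m := \matrix_(a, b) partial a (partial b f) p.

Lemma smooth_grad_row h : smooth_on U h -> smooth_mx U (grad_row h).
Proof.
move=> sh i a; apply: (smooth_on_ext Uo) (smooth_on_partial a sh) => p _.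
by rewrite (ord1 i) grad_rowE.
Qed.

Local Notation nabla := (nabla G).

Lemma smooth_nabla a be : smooth_mx U be -> smooth_mx U (nabla a be).
Proof.
move=> sb i j.
apply: (@smooth_on_ext R m U Uo (fun p => mpartial a be p i j + - (be p *m (chris G a p)^T) i j)).
  by move=> p _; rewrite nablaE addmxE oppmxE.
apply: (smooth_onD Uo); first exact: (smooth_mx_partial a Uo sb).
apply: (smooth_onN Uo); apply: (smooth_mx_mul Uo) => //.
by apply: (smooth_mx_tr Uo); exact: (chris_smooth kG).
Qed.

Lemma mpartial_K a p : U p ->
  mpartial a K p = - (K p *m chris G a p) - (chris G a p)^T *m K p.
Proof.
move=> Up; have Gu := kahler_unit kG Up.
rewrite (mpartial_inv a Uo (kahler_pos kG) (kahler_smooth kG) Up) (chris_metric kG)//.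
by rewrite mulmxDr mulmxDl !mulmxA mulmxK// mulVmx// mul1mx opprD.
Qed.

Lemma partial_ip a be ga p : smooth_mx U be -> smooth_mx U ga -> U p ->
  partial a (fun q => (be q *m K q *m (ga q)^T) 0 0) p
  = (nabla a be p *m K p *m (ga p)^T) 0 0 + (be p *m K p *m (nabla a ga p)^T) 0 0.
Proof.
move=> sb sg Up.
have sK := kahler_inv_smooth kG.
have db := smooth_mx_diff sb Up; have dg := smooth_mx_diff sg Up; have dK := smooth_mx_diff sK Up.
rewrite -(mpartialE a (fun q => be q *m K q *m (ga q)^T)).
rewrite mpartial_mul; [|exact: diff_mx_mul|exact: diff_mx_tr].
rewrite mpartial_mul// mpartial_tr mpartial_K// !nablaE trmx_add trmx_opp trmx_mul trmxK.
rewrite -addmxE; congr (fun_of_matrix _ 0 0).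
move: (mpartial a be p) (mpartial a ga p) (chris G a p) (invmx (G p)) (be p) (ga p) => x y C k z t.
rewrite !(mulmxDl, mulmxDr, mulmxN, mulNmx) !mulmxA.
by apply/matrixP => i j; rewrite !(addmxE, oppmxE); ring.
Qed.

(** The Ricci identity for 1-forms. Coordinate fields commute, so no bracket term appears. *)
Lemma nabla_comm a b be p : smooth_mx U be -> U p ->
  nabla a (nabla b be) p - nabla b (nabla a be) p = - (be p *m (curv G a b p)^T).
Proof.
move=> sb Up.
have h c d : nabla c (nabla d be) p = mpartial c (mpartial d be) p
    - (mpartial c be p *m (chris G d p)^T + be p *m (mpartial c (chris G d) p)^T)
    - (mpartial d be p - be p *m (chris G d p)^T) *m (chris G c p)^T.
  rewrite nablaE; congr (_ - _); last by rewrite nablaE.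
  have sC := smooth_mx_diff (smooth_mx_tr Uo (chris_smooth kG d)) Up.
  rewrite -mpartial_tr -mpartial_mul//; last exact: smooth_mx_diff sb Up.
  apply/matrixP => i j; rewrite addmxE oppmxE !mpartialE -partialB.
  - by congr (partial c _ p); apply: funext => q; rewrite nablaE addmxE oppmxE.
  - exact: (smooth_mx_diff (smooth_mx_partial d Uo sb) Up).
  - by apply: diff_mx_mul => //; exact: smooth_mx_diff sb Up.
have comm : mpartial a (mpartial b be) p = mpartial b (mpartial a be) p.
  apply/matrixP => i j; rewrite [LHS]mpartialE [RHS]mpartialE.
  have me e : (fun q => mpartial e be q i j) = partial e (fun q => be q i j).
    by apply: funext => q; rewrite mpartialE.
  rewrite !me; apply: (@partial_comm _ _ U) => //.
  by move/smooth_on_Cn: (sb i j); apply.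
rewrite !h comm curvE.
move: (mpartial b (mpartial a be) p) (mpartial a be p) (mpartial b be p) (mpartial a (chris G b) p)
  (mpartial b (chris G a) p) (chris G a p) (chris G b p) (be p) => X x y P Q A B z.
rewrite !(trmx_add, trmx_opp, trmx_mul) !(mulmxDl, mulmxDr, mulmxN, mulNmx) !mulmxA.
by apply/matrixP => i j; rewrite !(addmxE, oppmxE); ring.
Qed.

Local Notation du := (grad_row f).
Let sdu : smooth_mx U du := smooth_grad_row sf.

Local Notation chess := (chess G f).

Lemma nabla_duE a b p : nabla a du p 0 b =
  partial a (partial b f) p - \sum_c partial c f p * chris G a p b c.
Proof.
rewrite nablaE addmxE oppmxE mpartialE; congr (partial a _ p - _).
  by apply: funext => q; rewrite grad_rowE.
by rewrite mxE; apply: eq_bigr => c _; rewrite grad_rowE [_^T c b]mxE.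
Qed.

Lemma chessE a b p : chess p a b = nabla a du p 0 b.
Proof. by rewrite chess.unlock mxE. Qed.

Lemma row_chess a p : row a (chess p) = nabla a du p.
Proof. by apply/rowP => b; rewrite mxE chessE. Qed.

Lemma chess_sym p : U p -> (chess p)^T = chess p.
Proof.
move=> Up; apply/matrixP => a b; rewrite [LHS]mxE !chessE (nabla_duE a b) (nabla_duE b a).
rewrite (@partial_comm _ _ U f p a b Uo)//; last by move/smooth_on_Cn: sf; apply.
by congr (_ - _); apply: eq_bigr => c _; rewrite (chris_sym kG).
Qed.

Lemma smooth_chess : smooth_mx U chess.
Proof.
move=> a b; apply: (smooth_on_ext Uo) (smooth_nabla a sdu 0 b) => p _.
by rewrite chessE.
Qed.

(** Real form of pluriharmonicity: the J-invariant part of the Hessian, that is its (1,1)-part, is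
    zero. *)
Hypothesis fJ : forall p, U p -> J *m hess p *m J^T = - hess p.

Lemma chess_J p : U p -> J *m chess p *m J^T = - chess p.
Proof.
move=> Up.
have -> : chess p = hess p - \sum_c partial c f p *: chris_up G c p.
  apply/matrixP => a b; rewrite chessE nabla_duE addmxE oppmxE summxE mxE.
  by congr (_ - _); apply: eq_bigr => c _; rewrite !mxE.
rewrite mulmxBr mulmxBl fJ// opprB [RHS]addrC; congr (_ + _).
rewrite mulmx_sumr mulmx_suml -sumrN; apply: eq_bigr => c _.
by rewrite -scalemxAr -scalemxAl (chris_up_anti kG)// scalerN opprK.
Qed.

Lemma chess_trace p : U p -> \tr (K p *m chess p) = 0.
Proof. by move=> Up; apply: (trace_antiinvariant (kahler_inv_commJ kG Up) (chess_J Up)). Qed.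

Lemma sum_trace (A B : 'M[R]_m) : \sum_a \sum_b A a b * B a b = \tr (A *m B^T).
Proof.
by rewrite /mxtrace; apply: eq_bigr => a _; rewrite mxE; apply: eq_bigr => b _; rewrite mxE.
Qed.

(** The divergence of the Hessian is a pure curvature term: the Hessian is symmetric, the Ricci
    identity exchanges the derivatives, and the gradient of the Laplacian vanishes because f is
    harmonic. *)
Lemma div_hess c p : U p ->
  \sum_a \sum_b K p a b * nabla a (nabla b du) p 0 c
  = - \sum_a \sum_b K p a b * (du p *m (curv G a c p)^T) 0 b.
Proof.
(* [nabla a] treats the index b of [nabla b] as a mere label, so Christoffel corrections for it are
   left over. One of them, [t1], vanishes by [chris_trace]; the others, [t2] and [t3], both equal
   [X] and cancel. *)
move=> Up; have sK := kahler_inv_smooth kG.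
have ks := kahler_inv_sym kG Up.
pose X := \tr (K p *m (chris G c p *m chess p)).
have n1 a b d : nabla a (nabla b du) p 0 d =
    mpartial a chess p b d - (chess p *m (chris G a p)^T) b d.
  rewrite nablaE addmxE oppmxE; congr (_ - _).
    by rewrite !mpartialE; congr (partial a _ p); apply: funext => q; rewrite chessE.
  by rewrite -row_chess -row_mul mxE.
have swap a b : nabla a (nabla b du) p 0 c = nabla a (nabla c du) p 0 b
    + (\sum_e chess p c e * chris G a p b e) - (chess p *m (chris G c p)^T) b a.
  rewrite !n1.
  have -> : mpartial a chess p b c = mpartial a chess p c b.
    rewrite !mpartialE; apply: near_partial; apply: (kahler_near kG) => // q Uq.
    by have /matrixP/(_ c b) := chess_sym Uq; rewrite mxE.
  have -> : (chess p *m (chris G a p)^T) b c = (chess p *m (chris G c p)^T) b a.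
    by rewrite [LHS]mxE [RHS]mxE; apply: eq_bigr => e _; rewrite !mxE (chris_sym kG).
  have -> : (chess p *m (chris G a p)^T) c b = \sum_e chess p c e * chris G a p b e.
    by rewrite mxE; apply: eq_bigr => e _; rewrite [_^T e b]mxE.
  ring.
have comm a b : nabla a (nabla c du) p 0 b = nabla c (nabla a du) p 0 b
    - (du p *m (curv G a c p)^T) 0 b.
  have /matrixP/(_ 0 b) := nabla_comm a c sdu Up.
  rewrite addmxE !oppmxE => h; rewrite -h; ring.
have t1 : \sum_a \sum_b K p a b * (\sum_e chess p c e * chris G a p b e) = 0.
  transitivity (\sum_e chess p c e * \sum_a \sum_b K p a b * chris G a p b e).
    transitivity (\sum_a \sum_e \sum_b chess p c e * (K p a b * chris G a p b e)).
      apply: eq_bigr => a _; rewrite exchange_big; apply: eq_bigr => b _ /=.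
      by rewrite mulr_sumr; apply: eq_bigr => e _; rewrite mulrCA.
    rewrite exchange_big; apply: eq_bigr => e _ /=; rewrite mulr_sumr.
    by apply: eq_bigr => a _; rewrite mulr_sumr.
  by rewrite big1// => e _; rewrite (chris_trace kG)// mulr0.
have t2 : \sum_a \sum_b K p a b * (chess p *m (chris G c p)^T) b a = X.
  transitivity (\tr (K p *m (chess p *m (chris G c p)^T))).
    rewrite -[X in \tr (_ *m X)]trmxK -sum_trace.
    by apply: eq_bigr => a _; apply: eq_bigr => b _; rewrite [in RHS]mxE.
  rewrite -mxtrace_tr !trmx_mul trmxK chess_sym// ks /X mulmxA mxtrace_mulC.
  by rewrite !mulmxA.
have t3 : \sum_a \sum_b K p a b * nabla c (nabla a du) p 0 b = X.
  have -> : \sum_a \sum_b K p a b * nabla c (nabla a du) p 0 b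
     = \tr (K p *m mpartial c chess p) - \tr (K p *m (chris G c p *m chess p)).
    have -> : mpartial c chess p = (mpartial c chess p)^T.
      rewrite -mpartial_tr; apply: near_mpartial; apply: (kahler_near kG) => // q Uq.
      by rewrite chess_sym.
    have -> : chris G c p *m chess p = (chess p *m (chris G c p)^T)^T.
      by rewrite trmx_mul trmxK chess_sym.
    rewrite -!sum_trace -sumrB; apply: eq_bigr => a _; rewrite -sumrB; apply: eq_bigr => b _.
    by rewrite n1 mulrBr.
  (* The vanishing trace of the Hessian is differentiated. *)
  have : partial c (fun q => \tr (K q *m chess q)) p = 0.
    rewrite -(partial_cst c 0 p); apply: near_partial; apply: (kahler_near kG) => // q.
    exact: chess_trace.
  have dK := smooth_mx_diff sK Up; have dH := smooth_mx_diff smooth_chess Up.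
  have -> : partial c (fun q => \tr (K q *m chess q)) p = \tr (mpartial c (fun q => K q *m chess q) p).
    rewrite /mxtrace partial_sum => [|a]; last exact: diff_mx_mul.
    by apply: eq_bigr => a _; rewrite mpartialE.
  rewrite mpartial_mul// mpartial_K// mxtraceD mulmxBl mulNmx !linearB !linearN /=.
  have -> : \tr ((chris G c p)^T *m K p *m chess p) = X.
    rewrite -mxtrace_tr !trmx_mul trmxK chess_sym// ks /X mxtrace_mulC.
    by rewrite -!mulmxA.
  rewrite -!mulmxA -/X; lra.
transitivity (\sum_a \sum_b (K p a b * nabla c (nabla a du) p 0 b
    + K p a b * (\sum_e chess p c e * chris G a p b e)
    - K p a b * (chess p *m (chris G c p)^T) b a - K p a b * (du p *m (curv G a c p)^T) 0 b)).
  by apply: eq_bigr => a _; apply: eq_bigr => b _; rewrite swap comm; ring.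
under eq_bigr => a _ do rewrite 2!sumrB big_split /=.
by rewrite 2!sumrB big_split /= t1 t2 t3; ring.
Qed.

Lemma sum3_mull (F : 'I_m -> 'I_m -> 'I_m -> R) (v : 'I_m -> R) :
  \sum_c (\sum_a \sum_b F a b c) * v c = \sum_a \sum_b \sum_c F a b c * v c.
Proof.
under eq_bigr => c _ do rewrite mulr_suml.
rewrite exchange_big; apply: eq_bigr => a _ /=.
by under eq_bigr => c _ do rewrite mulr_suml; rewrite exchange_big.
Qed.

Local Notation w := (chart_dot f f).

Lemma smooth_chart_dot h k : smooth_on U h -> smooth_on U k -> smooth_on U (chart_dot h k).
Proof.
move=> /smooth_grad_row sh /smooth_grad_row sk; rewrite chart_dot.unlock.
apply: (smooth_mx_mul Uo (smooth_mx_mul Uo sh (kahler_inv_smooth kG)) (smooth_mx_tr Uo sk)).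
Qed.

Lemma form_sym (A : 'M[R]_m) (x y : 'rV[R]_m) : A^T = A -> (x *m A *m y^T) 0 0 = (y *m A *m x^T) 0 0.
Proof. exact: gformC. Qed.

Lemma partial_w a p : U p -> partial a w p = 2 * (chess p *m K p *m (du p)^T) a 0.
Proof.
move=> Up; rewrite chart_dot.unlock (partial_ip a sdu sdu Up) (form_sym _ (nabla a du p)) ?(kahler_inv_sym kG)//.
rewrite -row_chess -!row_mul [row _ _ 0 0]mxE; ring.
Qed.

(** Bochner's formula; the term <grad f, grad lap f> is absent because f is harmonic. *)
Lemma lap_w p : U p -> 2^-1 * chart_lap w p =
  \tr (K p *m chess p *m K p *m (chess p)^T) + ricci G p (du p *m K p).
Proof.
move=> Up; have ks := kahler_inv_sym kG Up.
have sn b := smooth_nabla b sdu.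
have pp a b : partial a (partial b w) p =
    2 * ((nabla a (nabla b du) p *m K p *m (du p)^T) 0 0
         + (nabla b du p *m K p *m (nabla a du p)^T) 0 0).
  rewrite -(partial_ip a (sn b) sdu Up).
  rewrite -partialZ; last first.
    apply: (smooth_on_diff _ Up).
    exact: (smooth_mx_mul Uo (smooth_mx_mul Uo (sn b) (kahler_inv_smooth kG)) (smooth_mx_tr Uo sdu)).
  apply: near_partial; apply: (kahler_near kG) => // q Uq.
  by rewrite partial_w// -row_chess -!row_mul [row _ _ 0 0]mxE.
have -> : 2^-1 * chart_lap w p =
    \sum_a \sum_b K p a b * (nabla a (nabla b du) p *m K p *m (du p)^T) 0 0
    + \sum_a \sum_b K p a b * (nabla b du p *m K p *m (nabla a du p)^T) 0 0.
  rewrite chart_lapE mulr_sumr -big_split; apply: eq_bigr => a _ /=.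
  rewrite mulr_sumr -big_split; apply: eq_bigr => b _ /=.
  by rewrite pp; move: (K p a b) (fun_of_matrix _ _ _) (fun_of_matrix _ _ _) => x y z; field.
rewrite addrC; congr (_ + _).
  transitivity (\tr (K p *m (chess p *m K p *m (chess p)^T)^T)).
    rewrite -sum_trace; apply: eq_bigr => a _; apply: eq_bigr => b _; congr (_ * _).
    rewrite -!row_chess (form_sym _ _ ks) -!row_mul tr_row.
    by rewrite mxE colE mulmxA -colE mxE.
  by rewrite !trmx_mul trmxK ks !mulmxA.
set v := du p *m K p.
have dv : (K p *m (du p)^T) = v^T by rewrite /v trmx_mul ks.
transitivity (\sum_c (\sum_a \sum_b K p a b * nabla a (nabla b du) p 0 c) * v 0 c).
  rewrite sum3_mull; apply: eq_bigr => a _; apply: eq_bigr => b _.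
  rewrite -mulmxA dv mxE mulr_sumr; apply: eq_bigr => c _.
  by rewrite [v^T c 0]mxE mulrA.
under eq_bigr => c _ do rewrite div_hess// mulNr.
rewrite sumrN sum3_mull -sumrN /ricci; apply: eq_bigr => a _.
rewrite -sumrN; apply: eq_bigr => b _; rewrite -sumrN mulr_sumr; apply: eq_bigr => c _.
have -> : (du p *m (curv G a c p)^T) 0 b = \sum_d v 0 d * Rm G a c d b p.
  have -> : du p = v *m G p by rewrite /v mulmxKV// (kahler_unit kG).
  rewrite -mulmxA -[X in v *m (X *m _)](kahler_sym kG Up) -trmx_mul mxE.
  by apply: eq_bigr => d _; rewrite [_^T d b]mxE RmE.
rewrite -!mulrA -mulrN; congr (_ * _).
rewrite mulr_suml -sumrN; apply: eq_bigr => d _.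
by rewrite (Rm_anti12 G c a); ring.
Qed.

(** With v = grad f and y = Hess f (v), the gradient of |v|^2 is 2 y. The Hessian S is paired with T
    = v (x) y - Jv (x) Jy: by anti-invariance both summands contribute equally, while they are
    orthogonal since <v, Jv> = 0. Cauchy-Schwarz for S and T thus saves a factor 2 over the choice T
    = v (x) y. *)
Lemma kato p : U p ->
  chart_dot w w p <= 2 * w p * \tr (K p *m chess p *m K p *m (chess p)^T).
Proof.
move=> Up; have ks := kahler_inv_sym kG Up; have gs := kahler_sym kG Up.
have gu := kahler_unit kG Up; have gpos := kahler_pos kG Up; have gJ := kahler_commJ kG Up.
pose g := G p; pose v := du p *m K p; pose y := v *m chess p *m K p.
have wv : w p = gform g v v.
  by rewrite chart_dotE /gform /v mulmxKV// trmx_mul ks mulmxA.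
have dw : grad_row w p = 2 *: (v *m chess p).
  apply/rowP => a; rewrite grad_rowE partial_w// [RHS]mxE; congr (_ * _).
  rewrite -[in RHS](trmxK (v *m chess p)) [RHS]mxE trmx_mul chess_sym// /v trmx_mul ks.
  by rewrite mulmxA.
have dwy : chart_dot w w p = 4 * gform g y y.
  rewrite chart_dotE dw -!scalemxAl linearZ /= -scalemxAr scalerA mxE -natrM.
  congr (_ * _); by rewrite /gform /y mulmxKV// [in RHS]trmx_mul ks mulmxA.
pose S := K p *m chess p *m K p.
pose T := v^T *m y - (v *m J)^T *m (y *m J).
have tens (x z x' z' : 'rV[R]_m) : bivector_inner g (x^T *m z) (x'^T *m z')
    = 2^-1 * (gform g x x' * gform g z z').
  rewrite /bivector_inner trmx_mul trmxK; congr (_ * _).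
  rewrite -!mulmxA mxtrace_mulC -!mulmxA.
  rewrite [\tr _](_ : _ = \tr ((z *m g *m z'^T) *m (x' *m g *m x^T))).
    rewrite trace_mx11 mxE big_ord1 mulrC -/(gform g z z') -/(gform g x' x).
    by rewrite (gformC x x' gs).
  by rewrite mxtrace_mulC !mulmxA.
have bl := @bivector_inner_linear R n g.
have ST (x z : 'rV[R]_m) : bivector_inner g S (x^T *m z) = 2^-1 * (x *m chess p *m z^T) 0 0.
  rewrite /bivector_inner /S trmx_mul trmxK; congr (_ * _).
  rewrite !mulmxA mulmxV// mul1mx mulmxKV// mxtrace_mulC.
  by rewrite trace_mx11 !mulmxA.
have vhy : (v *m chess p *m y^T) 0 0 = gform g y y.
  by rewrite /gform {1}/y mulmxKV.
have e1 : bivector_inner g S T = gform g y y.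
  rewrite /T (formBr bl) !ST vhy.
  have -> : v *m J *m chess p *m (y *m J)^T = - (v *m chess p *m y^T).
    transitivity (v *m (J *m chess p *m J^T) *m y^T); first by rewrite trmx_mul !mulmxA.
    by rewrite chess_J// mulmxN mulNmx.
  rewrite oppmxE vhy; lra.
have e2 : bivector_inner g T T = gform g v v * gform g y y.
  rewrite {2}/T (formBr bl) ![bivector_inner g T _](bivector_innerC _ _ gs) /T !(formBr bl) !tens.
  have jv z : gform g (z *m J) z = 0 by exact: gform_Jv.
  by rewrite !(gform_J gJ) (gformC v (v *m J) gs) !jv; lra.
have e3 : 2 * bivector_inner g S S = \tr (K p *m chess p *m K p *m (chess p)^T).
  rewrite /bivector_inner mulrA mulfV ?pnatr_eq0// mul1r /S !trmx_mul ks.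
  rewrite !mulmxA mulmxV// mul1mx mulmxKV// mxtrace_mulC !mulmxA.
  by rewrite !chess_sym.
have cs := form_cauchy (fun x z => bivector_innerC x z gs) bl (bivector_inner_gt0 gs gpos) S T.
rewrite dwy wv -e3; move: cs; rewrite e1 e2.
have s0 := form_ge0 bl (bivector_inner_gt0 gs gpos) S.
have v0 : 0 <= gform g v v by have [->|/gpos/ltW//] := eqVneq v 0; rewrite /gform !mul0mx mxE.
have [->|y0] := eqVneq (gform g y y) 0.
  by move=> _; rewrite mulr0; apply: mulr_ge0; apply: mulr_ge0.
have yp : 0 < gform g y y.
  rewrite lt_neqAle eq_sym y0 /=.
  by have [->|/gpos/ltW//] := eqVneq y 0; rewrite /gform !mul0mx mxE.
by rewrite expr2 mulrA ler_pM2r// => h; lra.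
Qed.

Lemma chart_bochner p (s : (n ^ 2).-tuple R) (eps : R) : U p -> 0 < eps ->
  ordered_eigenvalues (kahler_curvature_operator G p) s ->
  (\sum_(k < n) s`_k) * w p + chart_dot w w p / (2 * (w p + eps)) <= 2^-1 * chart_lap w p.
Proof.
move=> Up e0 hs; rewrite lap_w// addrC.
have gpos := kahler_pos kG Up; have ks := kahler_inv_sym kG Up; have gs := kahler_sym kG Up.
have wv : w p = gform (G p) (du p *m K p) (du p *m K p).
  by rewrite chart_dotE /gform mulmxKV ?(kahler_unit kG)// trmx_mul ks mulmxA.
have w0 : 0 <= w p.
  by rewrite wv; have [->|/gpos/ltW//] := eqVneq (du p *m K p) 0; rewrite /gform !mul0mx mxE.
have we : 0 < w p + eps by rewrite ltr_wpDl.
apply: lerD; last by have := ricci_ge kG Up (du p *m K p) hs; rewrite -wv.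
have h0 : 0 <= \tr (K p *m chess p *m K p *m (chess p)^T).
  pose S := K p *m chess p *m K p.
  have -> : \tr (K p *m chess p *m K p *m (chess p)^T) = 2 * bivector_inner (G p) S S.
    have gu := kahler_unit kG Up.
    rewrite /bivector_inner mulrA mulfV ?pnatr_eq0// mul1r /S !trmx_mul ks.
    rewrite !mulmxA mulmxV// mul1mx mulmxKV// [RHS]mxtrace_mulC !mulmxA.
    by rewrite !chess_sym.
  rewrite mulr_ge0//; apply: form_ge0; first exact: bivector_inner_linear.
  exact: (bivector_inner_gt0 gs gpos).
rewrite ler_pdivrMr ?mulr_gt0// (le_trans (kato Up))//.
have := mulr_ge0 (ltW e0) h0; move: (w p) (\tr _) => x y; nra.
Qed.
End Bochner.

(** The algebra of the second-order chain rule for a Laplacian: H is the Hessian in the new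
    coordinates, P the Jacobian, and D holds the second derivatives of the coordinate change, on
    which the trace by k vanishes. *)
Lemma trace_chain (R : realType) m (k P : 'M[R]_m) (H : 'I_m -> 'I_m -> R) (v : 'I_m -> R)
    (D : 'I_m -> 'I_m -> 'I_m -> R) (L : 'I_m -> 'I_m -> R) :
  (forall a b, L a b = \sum_c \sum_d H d c * P a d * P b c + \sum_c v c * D a b c) ->
  (forall c, \sum_a \sum_b k a b * D a b c = 0) ->
  \sum_a \sum_b k a b * L a b = \sum_d \sum_c (P^T *m k *m P) d c * H d c.
Proof.
move=> hL hD.
transitivity (\sum_a \sum_b (\sum_c \sum_d k a b * (H d c * P a d * P b c)
   + \sum_c v c * (k a b * D a b c))).
  apply: eq_bigr => a _; apply: eq_bigr => b _; rewrite hL mulrDr; congr (_ + _).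
    by rewrite mulr_sumr; apply: eq_bigr => c _; rewrite mulr_sumr.
  by rewrite mulr_sumr; apply: eq_bigr => c _; rewrite mulrCA.
under eq_bigr => a _ do rewrite big_split /=.
rewrite big_split /= [X in _ + X](_ : _ = 0) ?addr0.
  under eq_bigr => a _ do rewrite exchange_big.
  rewrite exchange_big [RHS]exchange_big; apply: eq_bigr => c _ /=.
  under eq_bigr => a _ do rewrite exchange_big.
  rewrite exchange_big; apply: eq_bigr => d _ /=.
  rewrite mxE mulr_suml exchange_big; apply: eq_bigr => b _ /=.
  rewrite mxE !mulr_suml; apply: eq_bigr => a _.
  by rewrite [P^T d a]mxE; ring.
under eq_bigr => a _ do rewrite exchange_big.
rewrite exchange_big big1//= => c _.
under eq_bigr => a _ do rewrite -mulr_sumr.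
by rewrite -mulr_sumr hD mulr0.
Qed.

(** * Calculus on the manifold *)

Section ManifoldCalculus.
Context (R : realType) (n : nat) (M : topologicalType) (X : complexManifold R n M).
Local Notation m := (n + n)%N.
Local Notation J := (Jmx R n).
Implicit Types (i j : chart_index X) (x y : M) (p q : 'rV[R]_m) (f h : M -> R).

Lemma chart_im_at i x : chart_dom i x -> chart_im i (chart i x).
Proof. by move=> dx; exists x. Qed.

Lemma chart_im_inv i p : chart_im i p -> chart_dom i (chart_inv i p) /\ chart i (chart_inv i p) = p.
Proof. by move=> [x dx <-]; rewrite chartK. Qed.

Lemma open_chart_im i : open (chart_im i).
Proof. exact: chart_im_open. Qed.
Arguments open_chart_im : clear implicits.

Definition tdom i j : set 'rV[R]_m := chart i @` (chart_dom i `&` chart_dom j).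

Lemma tdomP i j p : tdom i j p <-> chart_im i p /\ chart_dom j (chart_inv i p).
Proof.
split=> [[x [dx dy] <-]|[/chart_im_inv[dx e] dy]].
  by split; [exists x|rewrite chartK].
by exists (chart_inv i p).
Qed.

Lemma chart_inv_nbhs i p (A : set M) : chart_im i p -> nbhs (chart_inv i p) A ->
  nbhs p (chart_inv i @^-1` A).
Proof. by move=> [x dx <-]; rewrite chartK// => nA; apply: chart_inv_continuous; rewrite // chartK. Qed.

Lemma chart_im_nbhs i p : chart_im i p -> nbhs p (chart_im i).
Proof. by move=> ip; apply: open_nbhs_nbhs; split=> //; exact: chart_im_open. Qed.

Lemma open_tdom i j : open (tdom i j).
Proof.
rewrite openE => p /tdomP[ip dj]; rewrite /interior.
have h1 := chart_im_nbhs ip.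
have h2 : nbhs p (chart_inv i @^-1` (chart_dom j)).
  by apply: chart_inv_nbhs => //; apply: open_nbhs_nbhs; split=> //; exact: chart_dom_open.
by apply: filterS2 h1 h2 => q qi qj; apply/tdomP.
Qed.

Arguments open_tdom : clear implicits.

Local Notation T := (transition (X := X)).

Lemma transition_smooth_mx i j : smooth_mx (tdom i j) (T i j).
Proof. by move=> a b; rewrite (ord1 a); exact: transition_smooth. Qed.

Arguments transition_smooth_mx : clear implicits.

Lemma transition_im i j p : tdom i j p -> chart_im j (T i j p).
Proof. by move=> /tdomP[ip dj]; exact: chart_im_at. Qed.

Lemma rep_transition i j f p : tdom i j p ->
  (f \o chart_inv i) p = (f \o chart_inv j) (T i j p).
Proof. by move=> /tdomP[ip dj]; rewrite /= /transition /= chartK. Qed.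

Lemma transition_diff i j p c : tdom i j p -> differentiable (fun q => T i j q 0 c) p.
Proof. by move=> tp; exact: smooth_on_diff (transition_smooth_mx i j 0 c) tp. Qed.

Lemma transition_continuous i j p : tdom i j p -> {for p, continuous (T i j)}.
Proof.
move=> tp; apply: differentiable_continuous; apply: differentiable_mx => c.
exact: transition_diff.
Qed.

(** Gluing, and division by functions that are positive only locally, need a pointwise notion. It is
    tested in the preferred chart; [smooth_at_intro] and [smooth_at_elim] pass to any other. *)
Definition smooth_at f x := exists (V : set 'rV[R]_m),
  [/\ open V, V `<=` chart_im (chart_at X x), V (chart (chart_at X x) x) &
      smooth_on V (f \o chart_inv (chart_at X x))].

Lemma smooth_change i j (V : set 'rV[R]_m) f p : open V -> smooth_on V (f \o chart_inv i) ->
  tdom j i p -> V (T j i p) -> exists W : set 'rV[R]_m,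
  [/\ open W, W `<=` chart_im j, W p & smooth_on W (f \o chart_inv j)].
Proof.
move=> Vo sV tp Vp; pose W := tdom j i `&` (T j i @^-1` V).
have Wo : open W.
  rewrite openE => q [tq Vq]; apply: filterI.
    by apply: open_nbhs_nbhs; split=> //; exact: open_tdom.
  by apply: (transition_continuous tq); apply: open_nbhs_nbhs.
exists W; split=> //; first by move=> q [/tdomP[]].
apply: (@smooth_on_ext _ _ W Wo (fun q => (f \o chart_inv i) (T j i q))).
  by move=> q [tq _]; rewrite (rep_transition f tq).
apply: (smooth_on_comp Wo (V := V)) => // [c|q []//].
apply: smooth_on_sub (transition_smooth_mx j i 0 c).
by move=> q [].
Qed.

Lemma smooth_at_intro i (V : set 'rV[R]_m) f x : chart_dom i x -> open V -> V (chart i x) ->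
  smooth_on V (f \o chart_inv i) -> smooth_at f x.
Proof.
move=> dx Vo Vx sV; have da := chart_dom_at X x.
apply: (smooth_change Vo sV).
  by apply/tdomP; split; [exact: chart_im_at|rewrite chartK].
by rewrite /transition /= chartK.
Qed.

Lemma smooth_at_elim i f x : chart_dom i x -> smooth_at f x -> exists V : set 'rV[R]_m,
  [/\ open V, V `<=` chart_im i, V (chart i x) & smooth_on V (f \o chart_inv i)].
Proof.
move=> dx [V [Vo Vi Vx sV]]; have da := chart_dom_at X x.
apply: (smooth_change Vo sV).
  by apply/tdomP; split; [exact: chart_im_at|rewrite chartK].
by rewrite /transition /= chartK.
Qed.

Lemma smoothP f : smooth X f <-> forall x, smooth_at f x.
Proof.
split=> [sf x|sf i s p ip].
  apply: (smooth_at_intro (chart_dom_at X x) (open_chart_im _) _ (sf (chart_at X x))).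
  by apply: chart_im_at; exact: chart_dom_at.
have [dx e] := chart_im_inv ip.
have [V [_ _ Vp sV]] := smooth_at_elim dx (sf (chart_inv i p)).
by move: Vp; rewrite e; exact: sV.
Qed.

Lemma smooth_at_near f h x : (\forall y \near x, f y = h y) -> smooth_at f x -> smooth_at h x.
Proof.
move=> fh sf; have da := chart_dom_at X x.
have [V [Vo Vi Vx sV]] := smooth_at_elim da sf.
pose A := [set y | f y = h y]^°.
pose W := V `&` (chart_inv (chart_at X x) @^-1` A).
have Wo : open W.
  rewrite openE => q [Vq Aq]; apply: filterI; first exact: open_nbhs_nbhs.
  by apply: chart_inv_nbhs; [exact: Vi|apply: open_nbhs_nbhs; split=> //; exact: open_interior].
apply: (smooth_at_intro da Wo).
  by split=> //; rewrite /= chartK.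
apply: (smooth_on_ext Wo) (smooth_on_sub _ sV) => [p [_ /interior_subset]//|p []//].
Qed.

Lemma smooth_at_cst (c : R) x : smooth_at (fun=> c) x.
Proof.
apply: (@smooth_at_intro _ setT _ _ (chart_dom_at X x) openT) => //.
exact: (@smooth_on_cst R m setT c).
Qed.

Lemma smooth_at2 f h (op : R -> R -> R) x :
  (forall (V : set 'rV[R]_m) F H, open V -> smooth_on V F -> smooth_on V H ->
     smooth_on V (fun q => op (F q) (H q))) ->
  smooth_at f x -> smooth_at h x -> smooth_at (fun y => op (f y) (h y)) x.
Proof.
move=> hop [V [Vo Vi Vx sV]] [W [Wo Wi Wx sW]].
apply: (smooth_at_intro (chart_dom_at X x) (openI Vo Wo)) => //.
apply: hop; first exact: openI.
  by apply: smooth_on_sub sV => q [].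
by apply: smooth_on_sub sW => q [].
Qed.

Lemma smooth_atD f h x : smooth_at f x -> smooth_at h x -> smooth_at (fun y => f y + h y) x.
Proof. by apply: (@smooth_at2 f h (fun u v => u + v)) => *; exact: smooth_onD. Qed.

Lemma smooth_atM f h x : smooth_at f x -> smooth_at h x -> smooth_at (fun y => f y * h y) x.
Proof. by apply: (@smooth_at2 f h (fun u v => u * v)) => *; exact: smooth_onM. Qed.

Lemma smooth_atN f x : smooth_at f x -> smooth_at (fun y => - f y) x.
Proof.
by move=> sf; apply: (@smooth_at2 f f (fun u v => - u)) => // *; exact: smooth_onN.
Qed.

Lemma smooth_at_flat f x : smooth_at f x -> smooth_at (fun y => flat 1 (f y)) x.
Proof.
by move=> sf; apply: (@smooth_at2 f f (fun u v => flat 1 u)) => // *; exact: smooth_on_flat.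
Qed.

Lemma smoothD f h : smooth X f -> smooth X h -> smooth X (fun y => f y + h y).
Proof. by move=> /smoothP sf /smoothP sh; apply/smoothP => x; exact: smooth_atD. Qed.

Lemma smoothM f h : smooth X f -> smooth X h -> smooth X (fun y => f y * h y).
Proof. by move=> /smoothP sf /smoothP sh; apply/smoothP => x; exact: smooth_atM. Qed.

Lemma smooth_cst (c : R) : smooth X (fun=> c).
Proof. by apply/smoothP => x; exact: smooth_at_cst. Qed.

Lemma smooth_sum (I : Type) (s : seq I) (F : I -> M -> R) :
  (forall k, smooth X (F k)) -> smooth X (fun y => \sum_(k <- s) F k y).
Proof.
by move=> sF k; apply: (smooth_on_sum (open_chart_im k)) => l; exact: sF.
Qed.

Lemma smooth_powR f (r : R) : smooth X f -> (forall x, 0 < f x) -> smooth X (fun y => f y `^ r).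
Proof. by move=> sf f0 i; exact: (smooth_on_powR r (open_chart_im i) (sf i) (fun p _ => f0 _)). Qed.

Lemma smooth_at_inv f x : smooth_at f x -> 0 < f x -> smooth_at (fun y => (f y)^-1) x.
Proof.
move=> [V [Vo Vi Vx sV]] f0; set i := chart_at X x in V Vo Vi Vx sV *.
have cV q : V q -> {for q, continuous (f \o chart_inv i)}.
  by move=> Vq; exact: (smooth_on_continuous sV Vq).
pose W := V `&` ((f \o chart_inv i) @^-1` [set t | 0 < t]).
have Wo : open W.
  rewrite openE => q [Vq q0]; apply: filterI; first exact: open_nbhs_nbhs.
  by apply: (cV q Vq); apply: open_nbhs_nbhs; split=> //; exact: open_gt.
apply: (smooth_at_intro (chart_dom_at X x) Wo).
  by split=> //=; rewrite chartK//; exact: chart_dom_at.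
apply: (smooth_on_inv Wo); first by apply: smooth_on_sub sV => q [].
by move=> q [].
Qed.

Lemma smooth_at_continuous f x : smooth_at f x -> {for x, continuous f}.
Proof.
move=> [V [Vo Vi Vx sV]]; have da := chart_dom_at X x.
have c1 : {for chart (chart_at X x) x, continuous (f \o chart_inv (chart_at X x))}.
  exact: (smooth_on_continuous sV Vx).
have c2 := continuous_comp (chart_continuous da) c1.
have nr : \forall y \near x, (f \o chart_inv (chart_at X x)) (chart (chart_at X x) y) = f y.
  have := open_nbhs_nbhs (conj (chart_dom_open (chart_at X x)) da).
  by apply: filterS => y dy /=; rewrite chartK.
have fx := nbhs_singleton nr.
have c3 : (f \o chart_inv (chart_at X x)) (chart (chart_at X x) y) @[y --> x] --> f x.
  by rewrite -fx; exact: c2.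
by apply: cvg_trans c3; apply: near_eq_cvg.
Qed.

Lemma smooth_continuous f : smooth X f -> continuous f.
Proof. by move=> /smoothP sf x; exact: smooth_at_continuous. Qed.

Lemma jacobianE i j p a c : tdom i j p ->
  jacobian (T i j) p a c = partial a (fun q => T i j q 0 c) p.
Proof.
move=> tp; have dT : differentiable (T i j) p.
  by apply: differentiable_mx => b; exact: transition_diff.
rewrite /jacobian mxE diff_mx_coord// partialE//.
exact: transition_diff.
Qed.

Context (g : kahlerMetric X).

Lemma metric_kahler i : kahler_on (chart_im i) (metric g i).
Proof.
split.
- exact: chart_im_open.
- by move=> a b; exact: metric_smooth.
- by move=> p ip; exact: (@Defs.metric_sym _ _ _ _ g i p ip).
- by move=> p ip v v0; exact: (@Defs.metric_pos _ _ _ _ g i p v ip v0).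
- by move=> p ip; exact: (@metric_hermitian _ _ _ _ g i p ip).
- by move=> p a b c ip; exact: (@kahler_form_closed _ _ _ _ g i p a b c ip).
Qed.

Lemma metric_inv_transition i j p : tdom i j p ->
  (jacobian (T i j) p)^T *m invmx (metric g i p) *m jacobian (T i j) p
  = invmx (metric g j (T i j p)).
Proof.
move=> tp; have mt := metric_transition g tp.
have ip : chart_im i p by have [] := (tdomP i j p).1 tp.
have ui := kahler_unit (metric_kahler i) ip.
have uj := kahler_unit (metric_kahler j) (transition_im tp).
move: mt ui uj; move: (jacobian _ _) (metric g j _) (metric g i p) => P A B -> u uA.
have uP : P \in unitmx by move: u; rewrite !unitmx_mul => /andP[/andP[]].
have uPT : P^T \in unitmx by rewrite unitmx_tr.
apply: (can_inj (mulmxK uA)); apply: (can_inj (mulmxK uPT)).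
rewrite mulVmx// mul1mx -!mulmxA [P *m (A *m _)]mulmxA.
by rewrite mulVmx// mulmx1.
Qed.

Section ChartChange.
Context (i j : chart_index X) (p : 'rV[R]_m) (tp : tdom i j p).

Lemma grad_row_transition f : smooth_at f (chart_inv i p) ->
  grad_row (f \o chart_inv i) p
  = grad_row (f \o chart_inv j) (T i j p) *m (jacobian (T i j) p)^T.
Proof.
move=> sf; apply/rowP => a; rewrite grad_rowE mxE.
transitivity (partial a (fun q => (f \o chart_inv j) (T i j q)) p).
  apply: near_partial; apply: (near_open (open_tdom i j)) => // q tq.
  exact: rep_transition.
rewrite partial_comp => [|c|].
- by apply: eq_bigr => c _; rewrite grad_rowE [_^T c a]mxE jacobianE.
- exact: transition_diff.
- have [_ dj] := (tdomP i j p).1 tp.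
  by have [V [_ _ Vx sV]] := smooth_at_elim dj sf; exact: smooth_on_diff sV Vx.
Qed.

Lemma chart_dot_transition f h : smooth_at f (chart_inv i p) -> smooth_at h (chart_inv i p) ->
  chart_dot (metric g i) (f \o chart_inv i) (h \o chart_inv i) p
  = chart_dot (metric g j) (f \o chart_inv j) (h \o chart_inv j) (T i j p).
Proof.
move=> sf sh; rewrite 2!chart_dotE !grad_row_transition// -(metric_inv_transition tp).
by rewrite trmx_mul trmxK !mulmxA.
Qed.

(** The components of a holomorphic map are pluriharmonic: [CR] differentiates the Cauchy-Riemann
    equations once, and applying it in both slots of the symmetric second derivative produces
    J^2. *)
Lemma hess_transition_anti c :
  J *m hess (fun q => T i j q 0 c) p *m J^T = - hess (fun q => T i j q 0 c) p.
Proof.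
have to := open_tdom i j.
pose D a b d := partial a (partial b (fun q => T i j q 0 d)) p.
have Dsym a b d : D a b d = D b a d.
  apply: (@partial_comm _ _ (tdom i j)) => //.
  by move/smooth_on_Cn: (transition_smooth_mx i j 0 d); apply.
have sT b d : differentiable (partial b (fun q => T i j q 0 d)) p.
  exact: smooth_on_diff (smooth_on_partial b (transition_smooth_mx i j 0 d)) tp.
have CR e b d : \sum_f J b f * D e f d = \sum_f D e b f * J f d.
  transitivity (partial e (fun q => \sum_f J b f * partial f (fun q => T i j q 0 d) q) p).
    rewrite partial_sum => [|f]; first by apply: eq_bigr => f _; rewrite partialZ.
    by apply: differentiableM => //; exact: differentiable_cst.
  transitivity (partial e (fun q => \sum_f J f d * partial b (fun q => T i j q 0 f) q) p).
    apply: near_partial; apply: (near_open to) => // q tq.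
    have /matrixP/(_ b d) := transition_holomorphic tq; rewrite !mxE => h.
    transitivity (\sum_f J b f * jacobian (T i j) q f d).
      by apply: eq_bigr => f _; rewrite jacobianE.
    by rewrite h; apply: eq_bigr => f _; rewrite jacobianE// mulrC.
  rewrite partial_sum => [|f]; first by apply: eq_bigr => f _; rewrite partialZ// mulrC.
  by apply: differentiableM => //; exact: differentiable_cst.
apply/matrixP => a b; rewrite mxE.
transitivity (\sum_e J a e * (\sum_f J b f * D e f c)).
  transitivity (\sum_f \sum_e J a e * (J b f * D e f c)).
    apply: eq_bigr => f _; rewrite [(J *m _) a f]mxE mulr_suml; apply: eq_bigr => e _.
    by rewrite [hess _ _ e f]mxE [J^T f b]mxE -/(D e f c); ring.
  by rewrite exchange_big; apply: eq_bigr => e _; rewrite mulr_sumr.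
transitivity (\sum_f (\sum_e J a e * D b e f) * J f c).
  under eq_bigr => e _ do rewrite CR mulr_sumr.
  rewrite exchange_big; apply: eq_bigr => f _; rewrite mulr_suml; apply: eq_bigr => e _.
  by rewrite Dsym mulrA.
under eq_bigr => f _ do rewrite CR mulr_suml.
rewrite exchange_big.
transitivity (\sum_e D b a e * (J *m J) e c).
  by apply: eq_bigr => e _; rewrite mxE mulr_sumr; apply: eq_bigr => f _; rewrite mulrA.
rewrite JmxJ (bigD1 c)//= big1 ?addr0 => [|e /negbTE ec].
  by rewrite !mxE eqxx mulrN1 Dsym.
by rewrite !mxE ec oppr0 mulr0.
Qed.

(* The second derivatives of a holomorphic transition drop out of the trace. *)
Lemma chart_lap_transition f : smooth X f ->
  chart_lap (metric g i) (f \o chart_inv i) p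
  = chart_lap (metric g j) (f \o chart_inv j) (T i j p).
Proof.
move=> sf; have to := open_tdom i j; set F := f \o chart_inv j.
have ip : chart_im i p by have [] := (tdomP i j p).1 tp.
pose D a b d := partial a (partial b (fun q => T i j q 0 d)) p.
pose Tc c q := T i j q 0 c.
have dT c q : tdom i j q -> differentiable (Tc c) q by exact: transition_diff.
have dT2 a c : differentiable (partial a (Tc c)) p.
  exact: smooth_on_diff (smooth_on_partial a (transition_smooth_mx i j 0 c)) tp.
have dF c : differentiable (partial c F) (T i j p).
  exact: smooth_on_diff (smooth_on_partial c (sf j)) (transition_im tp).
have e a b : partial a (partial b (f \o chart_inv i)) p =
    \sum_c \sum_d partial d (partial c F) (T i j p) * partial a (Tc d) p * partial b (Tc c) p
    + \sum_c partial c F (T i j p) * D a b c.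
  transitivity (partial a (fun q => \sum_c partial c F (T i j q) * partial b (Tc c) q) p).
    apply: near_partial; apply: (near_open to) => // q tq.
    transitivity (partial b (fun q => F (T i j q)) q).
      apply: near_partial; apply: (near_open to) => // r tr; exact: rep_transition.
    by rewrite partial_comp => [|c|]//; [exact: dT|exact: smooth_on_diff (sf j) (transition_im tq)].
  have dFT c : differentiable (fun q => partial c F (T i j q)) p.
    by apply: differentiable_comp_mx => [d|]; [exact: dT|exact: dF].
  rewrite partial_sum => [|c]; last exact: differentiableM.
  rewrite -big_split; apply: eq_bigr => c _ /=.
  rewrite partialM// partial_comp => [|d|]//; last exact: dT.
  by congr (_ + _); rewrite mulr_suml.
rewrite 2!chart_lapE -(metric_inv_transition tp).
apply: (trace_chain (P := jacobian (T i j) p) (v := fun c => partial c F (T i j p)) (D := D)).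
  by move=> a b; rewrite e; congr (_ + _); apply: eq_bigr => c _; apply: eq_bigr => d _; rewrite !jacobianE.
move=> c; have := trace_antiinvariant (kahler_inv_commJ (metric_kahler i) ip) (hess_transition_anti c).
move=> h; rewrite -[RHS]h /mxtrace; apply: eq_bigr => a _; rewrite mxE; apply: eq_bigr => b _.
congr (_ * _); rewrite mxE; apply: (@partial_comm _ _ (tdom i j)) => //.
by move/smooth_on_Cn: (transition_smooth_mx i j 0 c); apply.
Qed.
End ChartChange.

Definition dot f h x : R :=
  chart_dot (metric g (chart_at X x)) (f \o chart_inv (chart_at X x))
    (h \o chart_inv (chart_at X x)) (chart (chart_at X x) x).

Definition lap f x : R :=
  chart_lap (metric g (chart_at X x)) (f \o chart_inv (chart_at X x)) (chart (chart_at X x) x).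

Lemma dotE_at i f h x : smooth_at f x -> smooth_at h x -> chart_dom i x ->
  dot f h x = chart_dot (metric g i) (f \o chart_inv i) (h \o chart_inv i) (chart i x).
Proof.
move=> sf sh dx; have K := chartK (chart_dom_at X x).
rewrite /dot (chart_dot_transition (j := i)) ?K//.
  by rewrite /transition /= chartK//; exact: chart_dom_at.
by exists x => //; split=> //; exact: chart_dom_at.
Qed.

Lemma dotE i f h x : smooth X f -> smooth X h -> chart_dom i x ->
  dot f h x = chart_dot (metric g i) (f \o chart_inv i) (h \o chart_inv i) (chart i x).
Proof. by move=> /smoothP sf /smoothP sh; exact: dotE_at. Qed.

Lemma lapE i f x : smooth X f -> chart_dom i x ->
  lap f x = chart_lap (metric g i) (f \o chart_inv i) (chart i x).
Proof.
move=> sf dx; rewrite /lap (chart_lap_transition (j := i))//.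
  by rewrite /transition /= chartK//; exact: chart_dom_at.
by exists x => //; split=> //; exact: chart_dom_at.
Qed.

Lemma smooth_dot f h : smooth X f -> smooth X h -> smooth X (dot f h).
Proof.
move=> sf sh i; apply: (smooth_on_ext (open_chart_im i))
  (smooth_chart_dot (metric_kahler i) (sf i) (sh i)) => p ip.
by have [dx e] := chart_im_inv ip; rewrite /= (dotE sf sh dx) e.
Qed.

Lemma smooth_lap f : smooth X f -> smooth X (lap f).
Proof.
move=> sf i; have io := open_chart_im i.
apply: (smooth_on_ext io (f := chart_lap (metric g i) (f \o chart_inv i))).
  by move=> p ip; have [dx e] := chart_im_inv ip; rewrite /= (lapE sf dx) e.
apply: (@smooth_on_ext _ _ _ io (fun p => \sum_a \sum_b invmx (metric g i p) a b *
  partial a (partial b (f \o chart_inv i)) p)); first by move=> p _; rewrite chart_lapE.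
apply: (smooth_on_sum io) => a; apply: (smooth_on_sum io) => b; apply: (smooth_onM io).
  exact: (kahler_inv_smooth (metric_kahler i)).
by apply: smooth_on_partial; apply: smooth_on_partial; exact: sf.
Qed.
End ManifoldCalculus.

Arguments open_chart_im {R n M} X i _ _.

Section GradientAlgebra.
Context (R : realType) (n : nat) (M : topologicalType) (X : complexManifold R n M).
Context (g : kahlerMetric X).
Local Notation m := (n + n)%N.
Local Notation J := (Jmx R n).
Implicit Types (i j : chart_index X) (x y : M) (p q : 'rV[R]_m) (f h k : M -> R).
Local Notation dot := (dot g).
Local Notation lap := (lap g).

Definition gr f x : 'rV[R]_m :=
  grad_row (f \o chart_inv (chart_at X x)) (chart (chart_at X x) x).

Definition cometric x : 'M[R]_m := invmx (metric g (chart_at X x) (chart (chart_at X x) x)).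

Lemma dot_gr f h x : dot f h x = gform (cometric x) (gr f x) (gr h x).
Proof. by rewrite /dot chart_dotE. Qed.

Lemma chart_at_im x : chart_im (chart_at X x) (chart (chart_at X x) x).
Proof. by apply: chart_im_at; exact: chart_dom_at. Qed.

Lemma cometric_sym x : (cometric x)^T = cometric x.
Proof. exact: (kahler_inv_sym (metric_kahler g _) (chart_at_im x)). Qed.

Lemma posdef_inv l (A : 'M[R]_l) : A^T = A -> posdef A -> posdef (invmx A).
Proof.
move=> As Apos v v0; have Au := posdef_unit Apos.
have := Apos (v *m invmx A); rewrite trmx_mul trmx_inv As !mulmxA mulmxKV//; apply.
by apply: contra v0 => /eqP h; rewrite -(mulmxKV Au v) h mul0mx.
Qed.

Lemma cometric_pos x : posdef (cometric x).
Proof.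
have k := metric_kahler g (chart_at X x).
by apply: posdef_inv; [exact: (kahler_sym k (chart_at_im x))|exact: (kahler_pos k (chart_at_im x))].
Qed.

Lemma dotC f h x : dot f h x = dot h f x.
Proof. by rewrite !dot_gr gformC// cometric_sym. Qed.

Lemma gform_ge0 l (A : 'M[R]_l) (v : 'rV[R]_l) : posdef A -> 0 <= (v *m A *m v^T) 0 0.
Proof.
by move=> Apos; have [->|/Apos/ltW//] := eqVneq v 0; rewrite !mul0mx mxE.
Qed.

Lemma dot_ge0 f x : 0 <= dot f f x.
Proof. by rewrite dot_gr; apply: gform_ge0; exact: cometric_pos. Qed.

Lemma smooth_at_diff f x : smooth_at X f x ->
  differentiable (f \o chart_inv (chart_at X x)) (chart (chart_at X x) x).
Proof. by move=> [V [Vo _ Vx sV]]; exact: smooth_on_diff sV Vx. Qed.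

Lemma gr_near f h x : (\forall y \near x, f y = h y) -> gr f x = gr h x.
Proof.
move=> fh; apply/rowP => a; rewrite /gr !grad_rowE; apply: near_partial.
apply: (chart_inv_nbhs (chart_at_im x) (A := fun y => f y = h y)).
by rewrite chartK//; exact: chart_dom_at.
Qed.

Lemma grD f h x : smooth_at X f x -> smooth_at X h x -> gr (fun y => f y + h y) x = gr f x + gr h x.
Proof.
move=> /smooth_at_diff df /smooth_at_diff dh; apply/rowP => a.
by rewrite addmxE /gr !grad_rowE -partialD.
Qed.

Lemma grM f h x : smooth_at X f x -> smooth_at X h x ->
  gr (fun y => f y * h y) x = h x *: gr f x + f x *: gr h x.
Proof.
move=> /smooth_at_diff df /smooth_at_diff dh; apply/rowP => a.
rewrite addmxE [X in _ = X + _]mxE [X in _ = _ + X]mxE /gr !grad_rowE.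
rewrite (_ : _ \o _ = fun q => (f \o chart_inv (chart_at X x)) q * (h \o chart_inv (chart_at X x)) q)//.
rewrite partialM; [|exact: df|exact: dh].
rewrite /= chartK; last exact: chart_dom_at.
by rewrite [X in X + _]mulrC.
Qed.

Lemma gr_cst (c : R) x : gr (fun=> c) x = 0.
Proof. by apply/rowP => a; rewrite /gr grad_rowE mxE partial_cst. Qed.

Lemma gr_comp1 (phi : R -> R) (d : R) f x : smooth_at X f x -> is_derive (f x) 1 phi d ->
  gr (fun y => phi (f y)) x = d *: gr f x.
Proof.
move=> /smooth_at_diff df dphi; apply/rowP => a; rewrite [RHS]mxE /gr !grad_rowE.
rewrite (_ : _ \o _ = fun q => phi ((f \o chart_inv (chart_at X x)) q))//.
apply: partial_comp1 => //=.
by rewrite chartK//; exact: chart_dom_at.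
Qed.

Lemma dot_near f h k x : (\forall y \near x, f y = h y) -> dot f k x = dot h k x.
Proof. by move=> /gr_near e; rewrite !dot_gr e. Qed.

Lemma gformDl l (A : 'M[R]_l) (u v w : 'rV[R]_l) :
  ((u + v) *m A *m w^T) 0 0 = (u *m A *m w^T) 0 0 + (v *m A *m w^T) 0 0.
Proof. by rewrite !mulmxDl addmxE. Qed.

Lemma gformZl l (A : 'M[R]_l) (c : R) (u w : 'rV[R]_l) :
  ((c *: u) *m A *m w^T) 0 0 = c * (u *m A *m w^T) 0 0.
Proof. by rewrite -!scalemxAl mxE. Qed.

Lemma dotDl f h k x : smooth_at X f x -> smooth_at X h x ->
  dot (fun y => f y + h y) k x = dot f k x + dot h k x.
Proof. by move=> sf sh; rewrite !dot_gr grD// /gform gformDl. Qed.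

(** Cauchy-Schwarz between the vector v and the vector [a *m invmx A] dual to the covector a. It
    yields both coordinate bounds and the bound of a directional derivative by speed times slope. *)
Lemma gform_dual_cauchy l (A : 'M[R]_l) (v a : 'rV[R]_l) : A^T = A -> posdef A ->
  ((v *m a^T) 0 0) ^+ 2 <= (v *m A *m v^T) 0 0 * (a *m invmx A *m a^T) 0 0.
Proof.
move=> As Apos; have Au := posdef_unit Apos.
have sym (x y : 'rV[R]_l) : (x *m A *m y^T) 0 0 = (y *m A *m x^T) 0 0.
  by rewrite -[in LHS](trmxK (x *m _ *m _)) mxE !trmx_mul trmxK As mulmxA.
have lin (x : 'rV[R]_l) : linear ((fun y : 'rV[R]_l => (x *m A *m y^T) 0 0) : 'rV[R]_l -> R^o).
  by move=> c y z; rewrite linearP /= mulmxDr -scalemxAr !mxE.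
have := form_cauchy sym lin (fun z (z0 : z != 0) => Apos z z0) v (a *m invmx A).
rewrite trmx_mul trmx_inv As !mulmxA mulmxK// mulmxKV//.
Qed.

Lemma gradient_norm2 f x : grad_norm g f x ^+ 2 = dot f f x.
Proof.
rewrite /grad_norm sqr_sqrtr.
  by rewrite dot_gr /gform /gr grad_row.unlock.
apply: gform_ge0; exact: cometric_pos.
Qed.

Lemma gradient_norm_ge0 f x : 0 <= grad_norm g f x.
Proof. exact: sqrtr_ge0. Qed.

Lemma near_chart_dot (U : set 'rV[R]_m) (G : 'rV[R]_m -> 'M[R]_m) (F F' : 'rV[R]_m -> R) p :
  open U -> U p -> (forall q, U q -> F q = F' q) -> chart_dot G F F p = chart_dot G F' F' p.
Proof.
move=> Uo Up FF; rewrite !chart_dotE (_ : grad_row F p = grad_row F' p)//.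
apply/rowP => a; rewrite !grad_rowE; by apply: near_partial; apply: (near_open Uo Up).
Qed.

Lemma near_chart_lap (U : set 'rV[R]_m) (G : 'rV[R]_m -> 'M[R]_m) (F F' : 'rV[R]_m -> R) p :
  open U -> U p -> (forall q, U q -> F q = F' q) -> chart_lap G F p = chart_lap G F' p.
Proof.
move=> Uo Up FF; rewrite !chart_lapE; apply: eq_bigr => a _; apply: eq_bigr => b _.
apply: (congr1 (fun z => _ * z)).
apply: near_partial; apply: (near_open Uo Up) => q Uq.
by apply: near_partial; apply: (near_open Uo Uq).
Qed.

Lemma anti_of_blocks (H : 'M[R]_m) : (forall a b : 'I_n,
    H (lshift n a) (lshift n b) = - H (rshift n a) (rshift n b) /\
    H (lshift n a) (rshift n b) = H (rshift n a) (lshift n b)) ->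
  J *m H *m J^T = - H.
Proof.
move=> key; have JE : J = block_mx 0 1%:M (- 1%:M) 0 by exact: erefl.
have PT : ulsubmx H = - drsubmx H by apply/matrixP => a b; rewrite !mxE; case: (key a b).
have QS : ursubmx H = dlsubmx H by apply/matrixP => a b; rewrite !mxE; case: (key a b).
rewrite trmx_Jmx mulmxN JE -(submxK H) !mulmx_block PT QS.
rewrite !(mul0mx, mulmx0, mul1mx, mulmx1, addr0, add0r, mulNmx, mulmxN) !opp_block_mx.
by rewrite !opprK.
Qed.

(** Four times d^2 u / dz_j dzbar_k has real part u_(xj xk) + u_(yj yk) and imaginary part u_(xj yk)
    - u_(yj xk). *)
Lemma pluriharmonic_hess u i p : pluriharmonic X u -> chart_im i p ->
  J *m hess (u \o chart_inv i) p *m J^T = - hess (u \o chart_inv i) p.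
Proof.
move=> [su hu] ip; set f := u \o chart_inv i.
pose D a b := partial a (partial b f) p.
have Dsym a b : D a b = D b a.
  apply: (@partial_comm _ _ (chart_im i)) => //; first exact: chart_im_open.
  by move/smooth_on_Cn: (su i); apply.
have d2 a : differentiable (partial a f) p.
  exact: smooth_on_diff (smooth_on_partial a (su i)) ip.
have key (a b : 'I_n) : D (lshift n a) (lshift n b) = - D (rshift n a) (rshift n b) /\
    D (lshift n a) (rshift n b) = D (rshift n a) (lshift n b).
  have := hu i p ip a b.
  have e1 : dzbar b (fun q => (u (chart_inv i q))%:C%C) = fun q =>
      ((2^-1 * partial (lshift n b) f q) +i* (2^-1 * partial (rshift n b) f q))%C.
    apply: funext => q; rewrite /dzbar /partialC /=.
    rewrite !partial_cst; apply/eqP; rewrite eq_complex /=; apply/andP; split; apply/eqP.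
    - by rewrite /f /comp; field.
    - by rewrite /f /comp; field.
  rewrite e1 /dz /partialC /=.
  have pZ a' b' : partial a' (fun q => 2^-1 * partial b' f q) p = 2^-1 * D a' b'.
    by rewrite partialZ.
  rewrite !pZ.
  move: (D (lshift n a) (lshift n b)) (D (rshift n a) (rshift n b))
    (D (lshift n a) (rshift n b)) (D (rshift n a) (lshift n b)) => x y z t.
  move=> /eqP; rewrite mulf_eq0 invr_eq0 pnatr_eq0 /= eq_complex /= => /andP[/eqP h1 /eqP h2].
  by split; lra.
apply: anti_of_blocks => a b; rewrite ![hess f p _ _]mxE; exact: key.
Qed.

Lemma manifold_bochner u x (s : (n ^ 2).-tuple R) (eps : R) : pluriharmonic X u -> 0 < eps ->
  kahler_eigenvalues g x s ->
  (\sum_(k < n) s`_k) * dot u u x + dot (dot u u) (dot u u) x / (2 * (dot u u x + eps))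
   <= 2^-1 * lap (dot u u) x.
Proof.
move=> hu e0 hs; have [su _] := hu.
set i := chart_at X x; set p := chart i x; have ip : chart_im i p := chart_at_im x.
have io := open_chart_im X i.
have e q : chart_im i q -> (dot u u \o chart_inv i) q =
    chart_dot (metric g i) (u \o chart_inv i) (u \o chart_inv i) q.
  by move=> iq; have [dx eq] := chart_im_inv iq; rewrite /= (dotE g su su dx) eq.
have := chart_bochner (metric_kahler g i) (su i) (fun q => pluriharmonic_hess hu) ip e0 hs.
rewrite -(near_chart_lap (metric g i) io ip e) -(near_chart_dot (metric g i) io ip e).
by [].
Qed.

Lemma zero_gradient_cst u x0 : smooth X u -> (forall x, dot u u x = 0) -> forall x, u x = u x0.
Proof.
move=> su h0.
have pz i p a : chart_im i p -> partial a (u \o chart_inv i) p = 0.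
  move=> ip; have [dx e] := chart_im_inv ip.
  have k := metric_kahler g i.
  have := h0 (chart_inv i p); rewrite (dotE g su su dx) e chart_dotE => hz.
  have : grad_row (u \o chart_inv i) p = 0.
    apply/eqP/negPn/negP => gn.
    have := posdef_inv (kahler_sym k ip) (kahler_pos k ip) gn.
    by rewrite hz ltxx.
  by move=> /rowP/(_ a); rewrite grad_rowE mxE.
have loc x : \forall y \near x, u y = u x.
  set i := chart_at X x; set p := chart i x; have ip : chart_im i p := chart_at_im x.
  have dx : chart_dom i x := chart_dom_at X x.
  have /nbhs_ballP[r /= r0 hr] := chart_im_nbhs ip.
  have nb : nbhs x (chart_dom i `&` (chart i @^-1` ball p r)).
    apply: filterI; first by apply: open_nbhs_nbhs; split=> //; exact: chart_dom_open.
    by apply: (chart_continuous dx); exact: nbhsx_ballx.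
  apply: filterS nb => y [dy by_].
  pose v := chart i y - p; pose F (t : R) := (u \o chart_inv i) (p + t *: v).
  have inb (t : R) : 0 <= t <= 1 -> chart_im i (p + t *: v).
    move=> /andP[t0 t1]; apply: hr; move: by_; rewrite -!ball_normE /= opprD addrA subrr sub0r normrN.
    rewrite normrZ ger0_norm// distrC => by_; apply: le_lt_trans by_.
    by rewrite ler_piMl.
  have dF (t : R) : 0 <= t <= 1 -> is_derive t 1 F 0.
    move=> ht; have := is_derive_line (v := v) (smooth_on_diff (su i) (inb t ht)).
    by rewrite big1// => a _; rewrite pz ?mulr0//; exact: inb.
  have [t|t ht|t _] := @MVT_segment R F (fun=> 0) 0 1 ler01.
  - by rewrite in_itv/= => /andP[t0 t1]; apply: dF; rewrite !ltW.
  - apply: derivable_within_continuous => s; rewrite in_itv/= => hs.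
    by apply: (@ex_derive _ _ _ _ _ _ _ (dF s hs)).
  have F1 : F 1 = u y by rewrite /F scale1r /v addrC subrK /= chartK.
  have F0 : F 0 = u x by rewrite /F scale0r addr0 /= chartK.
  rewrite mul0r F1 F0 => /eqP.
  by rewrite subr_eq0 => /eqP.
pose S := [set x | u x = u x0].
have So : open S.
  by rewrite openE => x Sx; apply: filterS (loc x) => y e; rewrite /S /= e.
have Sc : open (~` S).
  by rewrite openE => x Sx; apply: filterS (loc x) => y e; rewrite /S /= e.
have ST : S = setT.
  apply: (manifold_connected X) => //; first by exists x0.
    by exists S => //; rewrite setTI.
  by exists S; [rewrite -(setCK S); apply: open_closedC|rewrite setTI].
by move=> x; have : S x by rewrite ST.
Qed.
End GradientAlgebra.

(** * Distance and cutoff functions *)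

Section CurvesAndDistance.
Context (R : realType) (n : nat) (M : topologicalType) (X : complexManifold R n M).
Context (g : kahlerMetric X).
Local Notation m := (n + n)%N.
Implicit Types (i j : chart_index X) (x y z : M) (p q v : 'rV[R]_m) (f h : M -> R) (l r t : R).
Local Notation dot := (dot g).

Lemma gform_coord_bound (A : 'M[R]_m) v a : A^T = A -> posdef A ->
  v 0 a ^+ 2 <= gform A v v * invmx A a a.
Proof.
move=> As Apos; have := gform_dual_cauchy v (delta_mx 0 a) As Apos.
rewrite trmx_delta -colE mxE.
rewrite [X in _ <= _ * X](_ : _ = invmx A a a)//.
by rewrite -rowE -colE !mxE.
Qed.

(** The estimate proved is B <= 2 A; the weaker factor 4 is stated for its square root 2, which
    later compares lengths. *)
Lemma form_perturb (A : 'M[R]_m) : A^T = A -> posdef A -> exists2 de : R, 0 < de &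
  forall B : 'M[R]_m, (forall a b, `|A a b - B a b| < de) ->
  forall v, gform B v v <= 4 * gform A v v.
Proof.
move=> As Apos; have Ipos := posdef_inv As Apos.
have Iaa a : 0 <= invmx A a a.
  have := gform_ge0 (delta_mx 0 a) Ipos; rewrite -rowE trmx_delta -colE !mxE; exact.
pose C := \sum_a invmx A a a.
have C0 : 0 <= C by apply: sumr_ge0.
(* Each |v_a v_b| is at most C times the form, with C the trace of the inverse, so m^2 entries of
   size 1/D contribute at most one more copy of the form. *)
pose D := (m%:R * m%:R * C + 1 : R).
have D0 : 0 < D by rewrite ltr_wpDl// !mulr_ge0.
exists D^-1 => [|B AB v]; first by rewrite invr_gt0.
have Q0 := gform_ge0 v Apos; rewrite -/(gform A v v) in Q0.
have vb a b : `|v 0 a * v 0 b| <= gform A v v * C.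
  have h c : v 0 c ^+ 2 <= gform A v v * C.
    apply: le_trans (gform_coord_bound v c As Apos) _; apply: ler_wpM2l => //.
    by rewrite /C (bigD1 c)//= lerDl sumr_ge0.
  have := h a; have := h b; rewrite normrM; rewrite -!(real_normK (num_real (v 0 _))).
  have := sqr_ge0 (`|v 0 a| - `|v 0 b|); nra.
have -> : gform B v v = gform A v v + gform (B - A) v v.
  by rewrite /gform mulmxBr mulmxBl addmxE oppmxE addrC subrK.
have : gform (B - A) v v <= \sum_(a < m) \sum_(b < m) D^-1 * (gform A v v * C).
  rewrite /gform mxE exchange_big; apply: ler_sum => b _.
  rewrite mxE mulr_suml; apply: ler_sum => a _.
  rewrite [v^T b 0]mxE mulrAC mulrC.
  apply: le_trans (ler_norm _) _; rewrite normrM; apply: ler_pM => //.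
  by rewrite addmxE oppmxE distrC ltW.
move=> /le_trans h; have {h} := h (gform A v v).
have s2 (c : R) : \sum_(a < m) \sum_(b < m) c = m%:R * (m%:R * c).
  by rewrite !sumr_const !card_ord mulr_natl mulr_natl.
rewrite s2.
have -> : m%:R * (m%:R * (D^-1 * (gform A v v * C))) = (m%:R * m%:R * C / D) * gform A v v by ring.
have c1 : m%:R * m%:R * C / D <= 1 by rewrite ler_pdivrMr// mul1r /D lerDl.
have -> : (m%:R * m%:R * C / D * gform A v v <= gform A v v) by rewrite ler_piMl.
by move=> /(_ isT); lra.
Qed.

Definition sqdist x q : R :=
  gform (metric g (chart_at X x) (chart (chart_at X x) x)) (q - chart (chart_at X x) x)
    (q - chart (chart_at X x) x).

(** [sqdist] uses the metric frozen at x, so this describes a coordinate ellipsoid. On it the metric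
    is bounded for estimating lengths of curves, the inverse metric for estimating gradients. *)
Definition good_radius x r := 0 < r /\ forall q, sqdist x q <= r ^+ 2 ->
  [/\ chart_im (chart_at X x) q,
      forall v, gform (metric g (chart_at X x) q) v v
        <= 4 * gform (metric g (chart_at X x) (chart (chart_at X x) x)) v v &
      forall v, gform (invmx (metric g (chart_at X x) q)) v v
        <= 4 * gform (cometric g x) v v].

Lemma good_radius_exists x : exists r, good_radius x r.
Proof.
set i := chart_at X x; set p := chart i x; have ip : chart_im i p := chart_at_im X x.
have k := metric_kahler g i; pose A := metric g i p.
have As : A^T = A := kahler_sym k ip; have Apos : posdef A := kahler_pos k ip.
have Ipos := posdef_inv As Apos.
have [d1 d10 h1] := form_perturb As Apos.
have [d2 d20 h2] := form_perturb (cometric_sym g x) (cometric_pos g x).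
have n1 a b : \forall q \near p, `|A a b - metric g i q a b| < d1.
  have := smooth_on_continuous (kahler_smooth k a b) ip.
  by move/cvgrPdist_lt => /(_ _ d10).
have n2 a b : \forall q \near p, `|cometric g x a b - invmx (metric g i q) a b| < d2.
  have := smooth_on_continuous (kahler_inv_smooth k a b) ip.
  by move/cvgrPdist_lt => /(_ _ d20).
have nn : \forall q \near p, [/\ chart_im i q,
    forall a b, `|A a b - metric g i q a b| < d1 &
    forall a b, `|cometric g x a b - invmx (metric g i q) a b| < d2].
  have n1' : \forall q \near p, forall a b, `|A a b - metric g i q a b| < d1.
    exact: (@filter_forall _ 'I_m _ _ _ (fun a => @filter_forall _ 'I_m _ _ _ (n1 a))).
  have n2' : \forall q \near p, forall a b, `|cometric g x a b - invmx (metric g i q) a b| < d2.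
    exact: (@filter_forall _ 'I_m _ _ _ (fun a => @filter_forall _ 'I_m _ _ _ (n2 a))).
  by apply: filterS3 (chart_im_nbhs ip) n1' n2' => q.
move/nbhs_ballP: nn => [r /= r0 hr].
have Iaa a : 0 <= invmx A a a.
  have := gform_ge0 (delta_mx 0 a) Ipos; rewrite -rowE trmx_delta -colE !mxE; exact.
pose C := \sum_a invmx A a a.
have C0 : 0 <= C by apply: sumr_ge0.
have C1 : 0 < C + 1 by rewrite ltr_wpDl.
(* Squared coordinates of q - p are at most C times [sqdist], so this radius keeps the ellipsoid
   inside the ball of radius r. *)
exists (r / (2 * (C + 1))); split; first by rewrite divr_gt0// mulr_gt0.
move=> q hq.
have inb : ball p r q.
  split=> // a b; rewrite (ord1 a) -ball_normE /= distrC.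
  have := gform_coord_bound (q - p) b As Apos; rewrite addmxE oppmxE => h.
  have sq : (q 0 b - p 0 b) ^+ 2 < r ^+ 2.
    apply: le_lt_trans h _; apply: (@le_lt_trans _ _ ((r / (2 * (C + 1))) ^+ 2 * (C + 1))).
      apply: ler_pM => //; first exact: gform_ge0.
      rewrite /C (bigD1 b)//= -addrA lerDl addr_ge0// sumr_ge0//.
    rewrite (_ : (r / (2 * (C + 1))) ^+ 2 * (C + 1) = r ^+ 2 / (4 * (C + 1))); last by field; rewrite gt_eqF.
    rewrite ltr_pdivrMr ?mulr_gt0// ltr_pMr ?exprn_gt0//; lra.
  by rewrite -(ltr_pXn2r (n := 2))// ?nnegrE ?(ltW r0)// real_normK ?num_real.
have [iq hA hK] := hr q inb.
by split=> // v; [exact: h1|exact: h2].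
Qed.

Lemma speed_bound i (c : R -> 'rV[R]_m) f t : derivable c t 1 -> chart_im i (c t) ->
  smooth X f -> (forall x, dot f f x <= 1) ->
  \sum_a (c^`()%classic t) 0 a * partial a (f \o chart_inv i) (c t)
  <= Num.sqrt ((c^`()%classic t *m metric g i (c t) *m (c^`()%classic t)^T) 0 0).
Proof.
move=> dc ic sf f1; have k := metric_kahler g i; have [dx e] := chart_im_inv ic.
have := f1 (chart_inv i (c t)); rewrite (dotE g sf sf dx) e chart_dotE => h1.
have h2 := gform_dual_cauchy (c^`()%classic t) (grad_row (f \o chart_inv i) (c t))
  (kahler_sym k ic) (kahler_pos k ic).
have q0 := gform_ge0 (c^`()%classic t) (kahler_pos k ic).
have -> : \sum_a (c^`()%classic t) 0 a * partial a (f \o chart_inv i) (c t)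
   = (c^`()%classic t *m (grad_row (f \o chart_inv i) (c t))^T) 0 0.
  by rewrite mxE; apply: eq_bigr => a _; rewrite [_^T a 0]mxE grad_rowE.
apply: le_trans (ler_norm _) _; rewrite -sqrtr_sqr; apply: ler_wsqrtr.
apply: le_trans h2 _; by rewrite ler_piMr.
Qed.

Lemma curve_length_ge0 x y l : piecewise_C1_curve g x y l -> 0 <= l.
Proof.
elim=> // i c z l' _ _ _ _ l0; apply: addr_ge0 => //.
by apply: Rintegral_ge0 => t _; exact: sqrtr_ge0.
Qed.

Lemma coord_continuous (c : R -> 'rV[R]_m) t a : {for t, continuous c} ->
  {for t, continuous (fun s => c s 0 a)}.
Proof.
move=> cc; apply: (@continuous_comp _ _ _ c (fun N : 'rV[R]_m => N 0 a) t cc).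
by apply: differentiable_continuous; exact: differentiable_coord.
Qed.

Lemma continuous_bigsum (T : topologicalType) (I : Type) (s : seq I) (F : I -> T -> R) (t : T) :
  (forall k, {for t, continuous (F k)}) -> {for t, continuous (fun u => \sum_(k <- s) F k u)}.
Proof.
move=> cF; elim: s => [|k s ih].
  rewrite (_ : (fun=> _) = fun=> 0); first exact: cst_continuous.
  by apply: funext => u; rewrite big_nil.
rewrite (_ : (fun=> _) = fun u => F k u + \sum_(j <- s) F j u).
  by apply: continuousD => //; exact: cF.
by apply: funext => u; rewrite big_cons.
Qed.

Lemma speed_continuous i (c : R -> 'rV[R]_m) t : {for t, continuous c} ->
  {for t, continuous (c^`()%classic)} -> chart_im i (c t) ->
  {for t, continuous (fun s => Num.sqrt
     ((c^`()%classic s *m metric g i (c s) *m (c^`()%classic s)^T) 0 0))}.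
Proof.
move=> cc cd ic; have k := metric_kahler g i.
pose Q s := \sum_b \sum_a (c^`()%classic s) 0 a * metric g i (c s) a b * (c^`()%classic s) 0 b.
rewrite (_ : (fun=> _) = fun s => Num.sqrt (Q s)); last first.
  apply: funext => s; congr Num.sqrt; rewrite mxE; apply: eq_bigr => b _.
  by rewrite mxE mulr_suml; apply: eq_bigr => a _; rewrite [_^T b 0]mxE.
have cQ : {for t, continuous Q}.
  apply: continuous_bigsum => b; apply: continuous_bigsum => a.
  apply: continuousM; last exact: coord_continuous.
  apply: continuousM; first exact: coord_continuous.
  apply: (@continuous_comp _ _ _ c (fun q => metric g i q a b) t cc).
  exact: smooth_on_continuous (kahler_smooth k a b) ic.
by apply: (continuous_comp cQ); exact: sqrt_continuous.
Qed.

Lemma segment_gradient_bound i (c : R -> 'rV[R]_m) f :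
  (forall t, derivable c t 1) -> continuous (c^`()%classic) ->
  (forall t, 0 <= t <= 1 -> chart_im i (c t)) -> smooth X f -> (forall x, dot f f x <= 1) ->
  f (chart_inv i (c 1)) - f (chart_inv i (c 0)) <=
  \int[@lebesgue_measure R]_(t in `[0, 1])
     Num.sqrt ((c^`()%classic t *m metric g i (c t) *m (c^`()%classic t)^T) 0 0).
Proof.
move=> dc cd ic sf f1; pose F t := (f \o chart_inv i) (c t).
pose dF t := \sum_a (c^`()%classic t) 0 a * partial a (f \o chart_inv i) (c t).
have cc t : {for t, continuous c}.
  by apply: differentiable_continuous; apply/derivable1_diffP.
have hF t : 0 <= t <= 1 -> is_derive t 1 F (dF t).
  by move=> ht; apply: is_derive_along => //; exact: smooth_on_diff (sf i) (ic t ht).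
have cF t : 0 <= t <= 1 -> {for t, continuous dF}.
  move=> ht; apply: continuous_bigsum => a; apply: continuousM.
    by apply: coord_continuous; exact: cd.
  apply: (@continuous_comp _ _ _ c (partial a (f \o chart_inv i)) t (cc t)).
  exact: smooth_on_continuous (smooth_on_partial a (sf i)) (ic t ht).
have cFw : {within `[0, 1], continuous dF}.
  by apply: continuous_in_subspaceT => t; rewrite inE /= in_itv /=; exact: cF.
have cSw : {within `[0, 1], continuous (fun t => Num.sqrt
    ((c^`()%classic t *m metric g i (c t) *m (c^`()%classic t)^T) 0 0))}.
  apply: continuous_in_subspaceT => t; rewrite inE /= in_itv /= => ht.
  by apply: speed_continuous; [exact: cc|exact: cd|exact: ic].
have FTC := @continuous_FTC2 R dF F 0 1 ltr01 cFw.
have -> : f (chart_inv i (c 1)) - f (chart_inv i (c 0)) = \int[@lebesgue_measure R]_(t in `[0, 1]) dF t.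
  rewrite /Rintegral FTC//.
    split.
    - move=> t; rewrite in_itv /= => /andP[t0 t1].
      by apply: (@ex_derive _ _ _ _ _ _ _ (hF t _)); rewrite !ltW.
    - apply: cvg_at_right_filter; apply: differentiable_continuous; apply/derivable1_diffP.
      by apply: (@ex_derive _ _ _ _ _ _ _ (hF 0 _)); rewrite lexx ler01.
    - apply: cvg_at_left_filter; apply: differentiable_continuous; apply/derivable1_diffP.
      by apply: (@ex_derive _ _ _ _ _ _ _ (hF 1 _)); rewrite lexx ler01.
  move=> t; rewrite in_itv /= => /andP[t0 t1].
  by rewrite derive1E (@derive_val _ _ _ _ _ _ _ (hF t _))// !ltW.
apply: le_Rintegral => //.
- by apply: continuous_compact_integrable => //; exact: segment_compact.
- by apply: continuous_compact_integrable => //; exact: segment_compact.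
- by move=> t; rewrite /= in_itv /= => ht; apply: speed_bound => //; exact: ic.
Qed.

Lemma curve_gradient_bound x y l f : piecewise_C1_curve g x y l -> smooth X f ->
  (forall x, dot f f x <= 1) -> f y <= f x + l.
Proof.
move=> cxy sf f1; elim: cxy => [z|i c z l' dc cd ic _ ih]; first by rewrite addr0.
have := segment_gradient_bound dc cd ic sf f1; lra.
Qed.

Lemma curve_cat x y z l l' : piecewise_C1_curve g x y l -> piecewise_C1_curve g y z l' ->
  piecewise_C1_curve g x z (l + l').
Proof.
elim=> [x'|i c y' l1 dc cd ic _ ih] h; first by rewrite add0r.
by rewrite -addrA; apply: curve_cons => //; exact: ih.
Qed.

Lemma integral_flip (S : R -> R) : {within `[0, 1], continuous S} ->
  \int[@lebesgue_measure R]_(t in `[0, 1]) S t = \int[@lebesgue_measure R]_(t in `[0, 1]) S (1 - t).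
Proof.
move=> cS; have h01 : 0 <= (1 : R) <= 1 by apply/andP; split; [exact: ler01|exact: lexx].
by rewrite (Rintegration_by_substitution_onem h01 cS) unstable.onem1.
Qed.

Lemma segment_rev i (c : R -> 'rV[R]_m) :
  (forall t, derivable c t 1) -> continuous (c^`()%classic) ->
  (forall t, 0 <= t <= 1 -> chart_im i (c t)) ->
  piecewise_C1_curve g (chart_inv i (c 1)) (chart_inv i (c 0))
   (\int[@lebesgue_measure R]_(t in `[0, 1])
     Num.sqrt ((c^`()%classic t *m metric g i (c t) *m (c^`()%classic t)^T) 0 0)).
Proof.
move=> dc cd ic; pose c' (t : R) := c (1 - t).
have d' t : is_derive t 1 c' (- c^`()%classic (1 - t)).
  have h1 : is_derive t 1 (fun s : R => 1 - s) (-1).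
    by have := is_deriveB (is_derive_cst (1 : R) t 1) (is_derive_id t 1); rewrite sub0r.
  have dc1 : differentiable c (1 - t) by apply/derivable1_diffP.
  have dh1 : differentiable (fun s : R => 1 - s) t.
    by apply/derivable1_diffP; apply: (@ex_derive _ _ _ _ _ _ _ h1).
  have dcc : differentiable c' t by apply: (@differentiable_comp _ _ _ _ (fun s : R => 1 - s) c).
  apply: DeriveDef; first exact/derivable1_diffP.
  rewrite deriveE// (diff_comp dh1 dc1) /= !diff1E// !derive1E /=.
  by rewrite (@derive_val _ _ _ _ _ _ _ h1) scale1r scaleN1r.
have e' t : c'^`()%classic t = - c^`()%classic (1 - t).
  by rewrite derive1E (@derive_val _ _ _ _ _ _ _ (d' t)).
pose S t := Num.sqrt ((c^`()%classic t *m metric g i (c t) *m (c^`()%classic t)^T) 0 0).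
have cc t : {for t, continuous c}.
  by apply: differentiable_continuous; apply/derivable1_diffP.
have -> : \int[@lebesgue_measure R]_(t in `[0, 1]) S t = \int[@lebesgue_measure R]_(t in `[0, 1])
   Num.sqrt ((c'^`()%classic t *m metric g i (c' t) *m (c'^`()%classic t)^T) 0 0) + 0.
  rewrite addr0.
  transitivity (\int[@lebesgue_measure R]_(t in `[0, 1]) S (1 - t)).
    apply: integral_flip.
    apply: continuous_in_subspaceT => t; rewrite inE /= in_itv /= => ht.
    by apply: speed_continuous; [exact: cc|exact: cd|exact: ic].
  apply: eq_Rintegral => t _; rewrite /S e' /c'; congr Num.sqrt.
  by rewrite !mulNmx trmx_opp mulmxN opprK.
have c0 : c 0 = c' 1 by rewrite /c' subrr.
have c1 : c 1 = c' 0 by rewrite /c' subr0.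
rewrite c1 c0; apply: curve_cons.
- by move=> t; apply: (@ex_derive _ _ _ _ _ _ _ (d' t)).
- move=> t; rewrite (_ : c'^`()%classic = fun s => - c^`()%classic (1 - s)); last exact: funext.
  have h : (fun s : R => 1 - s) @ t --> 1 - t by apply: cvgB; [exact: cvg_cst|exact: cvg_id].
  by apply: cvgN; exact: (cvg_comp _ _ h (cd (1 - t))).
- by move=> t /andP[t0 t1]; apply: ic; rewrite subr_ge0 t1 lerBlDr lerDl.
- exact: curve_nil.
Qed.
End CurvesAndDistance.

Section Distance.
Context (R : realType) (n : nat) (M : topologicalType) (X : complexManifold R n M).
Context (g : kahlerMetric X).
Local Notation m := (n + n)%N.
Implicit Types (i j : chart_index X) (x y z : M) (p q v : 'rV[R]_m) (f h : M -> R) (l r t : R).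
Local Notation dot := (dot g).
Local Notation curve := (piecewise_C1_curve g).
Local Notation d := (riemannian_dist g).

Lemma curve_rev x y l : curve x y l -> curve y x l.
Proof.
elim=> [z|i c z l' dc cd ic _ ih]; first exact: curve_nil.
rewrite addrC; apply: curve_cat ih _; exact: segment_rev.
Qed.

Lemma sqdist_ge0 x q : 0 <= sqdist g x q.
Proof. exact: gform_ge0 _ (kahler_pos (metric_kahler g _) (chart_at_im X x)). Qed.

Lemma sqdist_line x q t : let p := chart (chart_at X x) x in
  sqdist g x (p + t *: (q - p)) = t ^+ 2 * sqdist g x q.
Proof.
rewrite /sqdist /=; move: (chart _ x) (metric _ _ _) => p A.
have -> : p + t *: (q - p) - p = t *: (q - p) by rewrite addrAC subrr add0r.
move: (q - p) => v; rewrite /gform gformZl linearZ /= -scalemxAr.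
by move: (v *m A *m v^T) => B; rewrite mxE mulrA expr2.
Qed.

Lemma ball_curve x r q : good_radius g x r -> sqdist g x q <= r ^+ 2 ->
  exists2 l, l <= 2 * Num.sqrt (sqdist g x q) & curve x (chart_inv (chart_at X x) q) l.
Proof.
move=> [r0 gr] hq; set i := chart_at X x; set p := chart i x; pose v := q - p.
pose c (t : R) := p + t *: v.
have dc (t : R) : is_derive t 1 c v.
  have h1 : is_derive t 1 (fun s : R => s *: v) v.
    apply: DeriveDef; first by apply/derivable1_diffP; apply: differentiableZl.
    rewrite deriveE; last exact: differentiableZl.
    by rewrite (@diff_val _ _ _ _ _ _ _ (is_diff_scalel t v)) scale1r.
  by have := is_deriveD (is_derive_cst p t 1) h1; rewrite add0r.
have dE : c^`()%classic = fun=> v.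
  by apply: funext => t; rewrite derive1E (@derive_val _ _ _ _ _ _ _ (dc t)).
have cq (t : R) : 0 <= t <= 1 -> sqdist g x (c t) <= r ^+ 2.
  move=> /andP[t0 t1]; rewrite sqdist_line; apply: le_trans hq.
  by rewrite ler_piMl ?sqdist_ge0// exprn_ile1.
have ic (t : R) : 0 <= t <= 1 -> chart_im i (c t) by move=> ht; have [] := gr _ (cq t ht).
have dc' (t : R) : derivable c t 1 by exact: (@ex_derive _ _ _ _ _ _ _ (dc t)).
have cd : continuous c^`()%classic by rewrite dE; exact: cst_continuous.
have := curve_cons dc' cd ic (curve_nil g _).
rewrite /c scale0r addr0 scale1r addrC subrK [chart_inv i p](chartK (chart_dom_at X x)) addr0 -/c.
set L := Rintegral _ _ _ => hc; exists L => //.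
have cc t : {for t, continuous c}.
  by apply: differentiable_continuous; apply/derivable1_diffP.
have cSw : {within `[0, 1], continuous (fun t => Num.sqrt
    ((c^`()%classic t *m metric g i (c t) *m (c^`()%classic t)^T) 0 0))}.
  apply: continuous_in_subspaceT => t; rewrite inE /= in_itv /= => ht.
  by apply: speed_continuous; [exact: cc|exact: cd|exact: ic].
have cst2 : \int[@lebesgue_measure R]_(t in `[0, 1]) (2 * Num.sqrt (sqdist g x q)) = 2 * Num.sqrt (sqdist g x q).
  rewrite Rintegral_cst//= lebesgue_measure_itv/= lte_fin ltr01 -EFinD subr0 /=.
  by rewrite mulr1.
rewrite -cst2; apply: le_Rintegral => //.
- by apply: continuous_compact_integrable => //; exact: segment_compact.
- apply: continuous_compact_integrable; first exact: segment_compact.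
  by apply: continuous_subspaceT; exact: cst_continuous.
- move=> t; rewrite /= in_itv /= => ht; rewrite dE.
  have [_ h _] := gr _ (cq t ht); have := h v.
  rewrite /gform => /ler_wsqrtr /le_trans; apply.
  rewrite -/(gform _ _ _) -/(sqdist g x q) sqrtrM// (_ : Num.sqrt 4 = 2)//.
  by rewrite (_ : 4 = 2 ^+ 2) ?sqrtr_sqr ?ger0_norm//; ring.
Qed.

Lemma near_good_ball x r : good_radius g x r -> \forall y \near x,
  chart_dom (chart_at X x) y /\ sqdist g x (chart (chart_at X x) y) <= r ^+ 2.
Proof.
move=> [r0 gr]; set i := chart_at X x; set p := chart i x.
have dx : chart_dom i x := chart_dom_at X x.
have cs : {for p, continuous (sqdist g x)}.
  apply: smooth_on_continuous (I : [set: 'rV[R]_m] p).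
  rewrite (_ : sqdist g x = fun q => \sum_b \sum_a ((q 0 a - p 0 a) *
     metric g i p a b) * (q 0 b - p 0 b)); last first.
    apply: funext => q; rewrite /sqdist /gform mxE; apply: eq_bigr => b _.
    rewrite mxE mulr_suml; apply: eq_bigr => a _.
    by rewrite [_^T b 0]mxE !addmxE !oppmxE.
  have To : open [set: 'rV[R]_m] := openT.
  apply: (smooth_on_sum To) => b; apply: (smooth_on_sum To) => a.
  have cc c : smooth_on [set: 'rV[R]_m] (fun q : 'rV[R]_m => q 0 c - p 0 c).
    by apply: (smooth_onD To); [exact: (smooth_on_coord To)|exact: smooth_on_cst].
  apply: (smooth_onM To); last exact: cc.
  by apply: (smooth_onM To); [exact: cc|exact: smooth_on_cst].
have s0 : sqdist g x p = 0.
  by rewrite /sqdist -/i -/p subrr /gform mul0mx mul0mx mxE.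
have n1 : \forall q \near p, sqdist g x q <= r ^+ 2.
  have : sqdist g x q @[q --> p] --> (0 : R) by rewrite -s0; exact: cs.
  move=> /cvgrPdist_le /(_ _ (exprn_gt0 2 r0)).
  by apply: filterS => q; rewrite sub0r normrN ger0_norm// sqdist_ge0.
have n2 : \forall y \near x, chart_dom i y.
  by apply: open_nbhs_nbhs; split=> //; exact: chart_dom_open.
have n3 : \forall y \near x, sqdist g x (chart i y) <= r ^+ 2 by exact: (chart_continuous dx n1).
exact: filterI n2 n3.
Qed.

(** [riemannian_dist] is an [inf], which would take a meaningless default value on an empty set of
    lengths. Connectedness excludes this: points joined to x form a set that is open with open
    complement. *)
Lemma curve_exists x y : exists l, curve x y l.
Proof.
pose S := [set y | exists l, curve x y l].
have loc z : \forall w \near z, exists l, curve z w l.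
  have [r gr] := good_radius_exists g z.
  apply: filterS (near_good_ball gr) => w [dw hw].
  by have [l _] := ball_curve gr hw; rewrite chartK// => c; exists l.
have So : open S.
  rewrite openE => z [l hl]; apply: filterS (loc z) => w [l' hl'].
  by exists (l + l'); exact: curve_cat hl hl'.
have Sc : open (~` S).
  rewrite openE => z Sz; apply: filterS (loc z) => w [l' hl'] [l hl]; apply: Sz.
  by exists (l + l'); apply: curve_cat hl _; exact: curve_rev.
have ST : S = setT.
  apply: (manifold_connected X) => //; first by exists x; exists 0; exact: curve_nil.
    by exists S => //; rewrite setTI.
  by exists S; [rewrite -(setCK S); apply: open_closedC|rewrite setTI].
by have : S y by rewrite ST.
Qed.

Lemma dist_le x y l : curve x y l -> d x y <= l.
Proof.
move=> h; apply: ge_inf => //.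
by exists 0 => l'; exact: curve_length_ge0.
Qed.

Lemma dist_approx x y (e : R) : 0 < e -> exists2 l, curve x y l & l < d x y + e.
Proof.
move=> e0; have hi : has_inf [set l | curve x y l].
  split; first by have [l] := curve_exists x y; exists l.
  by exists 0 => l'; exact: curve_length_ge0.
by have [l cl hl] := inf_adherent e0 hi; exists l.
Qed.

Lemma dist_lb x y (a : R) : (forall l, curve x y l -> a <= l) -> a <= d x y.
Proof.
move=> h; apply/ler_addgt0Pr => e e0; have [l cl hl] := dist_approx x y e0.
by apply: le_trans (h _ cl) _; exact: ltW.
Qed.

Lemma dist_ge0 x y : 0 <= d x y.
Proof. by apply: dist_lb => l; exact: curve_length_ge0. Qed.

Lemma dist_refl x : d x x = 0.
Proof. by apply/eqP; rewrite eq_le dist_ge0 dist_le//; exact: curve_nil. Qed.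

Lemma dist_sym x y : d x y = d y x.
Proof. by apply/eqP; rewrite eq_le !dist_lb// => l /curve_rev; exact: dist_le. Qed.

Lemma dist_triangle x y z : d x z <= d x y + d y z.
Proof.
rewrite -lerBlDr; apply: dist_lb => l hl; rewrite lerBlDr -lerBlDl; apply: dist_lb => l' hl'.
by rewrite lerBlDl; apply: dist_le; exact: curve_cat hl hl'.
Qed.

Lemma contraction_dist f x y : smooth X f -> (forall z, dot f f z <= 1) -> f y <= f x + d x y.
Proof.
move=> sf f1; rewrite -lerBlDl; apply: dist_lb => l hl; rewrite lerBlDl.
exact: curve_gradient_bound hl sf f1.
Qed.

Lemma dist_ball x r q : good_radius g x r -> sqdist g x q <= r ^+ 2 ->
  d x (chart_inv (chart_at X x) q) <= 2 * Num.sqrt (sqdist g x q).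
Proof. by move=> gr /(ball_curve gr)[l hl /dist_le h]; exact: le_trans h hl. Qed.

(** Each step of the iteration moves within {z | s z + th d(x, z) <= s x} at least half way down to
    the infimum of s there. Distances telescope against the values of s, so the sequence is Cauchy,
    and its limit is the required point. *)
Lemma ekeland (s : M -> R) (th : R) (x0 : M) : complete_metric g -> 0 < th ->
  (forall x, 0 <= s x) -> (forall x y, s y <= s x + d x y) ->
  exists x, forall z, s x <= s z + th * d x z.
Proof.
move=> cm th0 s0 sL.
pose I x := inf [set s z | z in [set z | s z + th * d x z <= s x]].
have nI x : has_inf [set s z | z in [set z | s z + th * d x z <= s x]].
  split; first by exists (s x); exists x => //=; rewrite dist_refl mulr0 addr0.
  by exists 0 => _ [z _ <-].
have step x : {z | s z + th * d x z <= s x /\ 2 * s z <= s x + I x}.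
  apply: cid; have Ile : I x <= s x.
    apply: ge_inf; first by have [] := nI x.
    by exists x => //=; rewrite dist_refl mulr0 addr0.
  have [e|ne] := eqVneq (I x) (s x).
    by exists x; rewrite dist_refl mulr0 addr0; split => //; rewrite e; lra.
  have lt : I x < s x by rewrite lt_neqAle ne.
  have e0 : 0 < (s x - I x) / 2 by lra.
  have [_ [z hz <-] hl] := inf_adherent e0 (nI x).
  by exists z; split=> //; move: hl; rewrite -/(I x); lra.
pose a k := iter k (fun x => sval (step x)) x0.
have aS k : s (a k.+1) + th * d (a k) (a k.+1) <= s (a k) /\ 2 * s (a k.+1) <= s (a k) + I (a k).
  exact: (svalP (step (a k))).
have aD k (l : nat) : s (a (k + l)%N) + th * d (a k) (a (k + l)%N) <= s (a k).
  elim: l => [|l ih]; first by rewrite addn0 dist_refl mulr0 addr0.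
  rewrite addnS; have [h1 _] := aS (k + l)%N; have := dist_triangle (a k) (a (k + l)%N) (a (k + l).+1).
  move=> h2; have := ler_wpM2l (ltW th0) h2; lra.
have smon k (l : nat) : (k <= l)%N -> s (a l) <= s (a k).
  by move=> kl; have := aD k (l - k)%N; rewrite subnKC//; have := mulr_ge0 (ltW th0) (dist_ge0 (a k) (a l)); lra.
pose L := inf (range (s \o a)).
have LE k : L <= s (a k).
  by apply: ge_inf; [exists 0 => _ [l _ <-] /=|exists k].
have sL' (e : R) : 0 < e -> exists N, s (a N) < L + e.
  move=> e0; have [|_ [N _ <-] h] := @inf_adherent _ (range (s \o a)) e e0; last by exists N.
  by split; [exists (s (a 0%N)); exists 0%N|exists 0 => _ [l _ <-] /=].
have ca : forall e : R, 0 < e -> exists N : nat, forall j k : nat,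
       (N <= j)%N -> (N <= k)%N -> d (a j) (a k) < e.
  move=> e e0; have te : 0 < th * e / 2 by rewrite divr_gt0// mulr_gt0.
  have [N hN] := sL' _ te.
  have dN (j : nat) : (N <= j)%N -> d (a N) (a j) < e / 2.
    move=> Nj; have := aD N (j - N)%N; rewrite subnKC// => h.
    rewrite -(ltr_pM2l th0); have := LE j; lra.
  exists N => j k Nj Nk; have := dist_triangle (a j) (a N) (a k); rewrite (dist_sym (a j) (a N)).
  have := dN j Nj; have := dN k Nk; lra.
have [x hx] := cm a ca.
exists x => z.
have dx k (e : R) : 0 < e -> exists2 l, (k <= l)%N & d (a l) x < e.
  move=> e0; move/cvgrPdist_lt : hx => /(_ _ e0)[N _ hN].
  exists (maxn k N); first exact: leq_maxl.
  have := hN (maxn k N) (leq_maxr _ _); rewrite /= sub0r normrN ger0_norm ?dist_ge0//.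
have xk k : s x + th * d (a k) x <= s (a k).
  apply/ler_addgt0Pr => e e0; have e1 : 0 < e / (1 + th) by rewrite divr_gt0// addr_gt0.
  have [l kl hl] := dx k _ e1.
  have := aD k (l - k)%N; rewrite subnKC// => h.
  have := sL (a l) x; have := dist_triangle (a k) (a l) x => h3 h4.
  have h5 := ler_wpM2l (ltW th0) h3.
  have h6 : (1 + th) * d (a l) x < e by rewrite mulrC -ltr_pdivlMr// addr_gt0.
  lra.
rewrite leNgt; apply/negP => hlt.
have zS k : s z + th * d (a k) z <= s (a k).
  have := xk k; have := ler_wpM2l (ltW th0) (dist_triangle (a k) x z); lra.
have Iz k : I (a k) <= s z.
  by apply: ge_inf; [have [] := nI (a k)|exists z => //; exact: zS].
(* If s z < L, then from a term below 2 L - s z the halving step would land below L. *)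
have Lz : L <= s z.
  rewrite leNgt; apply/negP => zL; have e0 : 0 < L - s z by rewrite subr_gt0.
  have [N hN] := sL' _ e0.
  have := aS N => -[_]; have := Iz N; have := LE N.+1; lra.
have xL : s x <= L.
  apply/ler_addgt0Pr => e e0; have [N hN] := sL' _ e0.
  have := xk N; have := mulr_ge0 (ltW th0) (dist_ge0 (a N) x); lra.
have := mulr_ge0 (ltW th0) (dist_ge0 x z); lra.
Qed.
End Distance.

Section SmoothMax.
Context (R : realType).
Implicit Types (t : R).

(* [softplus] vanishes on (-oo, 0], is at least [t - 1], and has slope in [0, 1]; so
   f + k * softplus ((h - f) / k) is a smooth substitute for the maximum of f and h. *)
Definition softplus t := t * flat 1 t.

Lemma is_derive_softplus t : exists2 c, 0 <= c <= 1 & is_derive t 1 softplus c.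
Proof.
have h := is_deriveM (is_derive_id t 1) (is_derive_flat 1 t).
exists (t *: flat ((1 - 1^`()) * 'X^2) t + flat 1 t *: 1); last exact: h.
have [t0|t0] := leP t 0; first by rewrite !flat_le0// scaler0 scale0r addr0 lexx ler01.
have e1 : flat 1 t = expR (- t^-1) by rewrite /flat t0 hornerC mul1r.
have e2 : flat ((1 - 1^`()) * 'X^2) t = t^-1 ^+ 2 * expR (- t^-1).
  by rewrite /flat t0 derivC subr0 mul1r hornerXn.
have -> : t *: flat ((1 - 1^`()) * 'X^2) t + flat 1 t *: 1 = (1 + t^-1) * expR (- t^-1).
  rewrite e1 e2 [t *: _](_ : _ = t * (t^-1 ^+ 2 * expR (- t^-1)))// [_ *: 1]mulr1.
  by move: (expR _) => e; field; rewrite gt_eqF.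
have v0 : 0 < t^-1 by rewrite invr_gt0.
rewrite mulr_ge0 ?expR_ge0 ?addr_ge0 ?(ltW v0)//=.
by rewrite expRN ler_pdivrMr ?expR_gt0// mul1r expR_ge1Dx.
Qed.

Lemma softplus_le0 t : t <= 0 -> softplus t = 0.
Proof. by move=> t0; rewrite /softplus flat_le0// mulr0. Qed.

Lemma softplus_ge0 t : 0 <= softplus t.
Proof.
have [/softplus_le0->//|t0] := leP t 0.
by rewrite mulr_ge0 ?flat1_ge0// ltW.
Qed.

Lemma softplus_ge t : t - 1 <= softplus t.
Proof.
have [t0|t0] := leP t 0; first by rewrite softplus_le0//; lra.
have e1 : flat 1 t = expR (- t^-1) by rewrite /flat t0 hornerC mul1r.
rewrite /softplus e1.
have h := expR_ge1Dx (- t^-1).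
by have := ler_wpM2l (ltW t0) h; rewrite mulrDr mulr1 mulrN mulfV ?gt_eqF.
Qed.
End SmoothMax.

Section CompactCover.
Context (T : ptopologicalType).

Lemma compact_cover_seq (K : set T) (U : T -> set T) : compact K ->
  (forall x, K x -> open (U x) /\ U x x) ->
  exists s : seq T, (forall x, x \in s -> K x) /\ forall y, K y -> exists2 x, x \in s & U x y.
Proof.
move=> cK hU; move: cK; rewrite compact_cover => /(_ T K U).
case=> [x /hU[]//|x Kx|D' sD cD]; first by exists x => //; have [] := hU x Kx.
exists (finmap.enum_fset D'); split; first by move=> x xs; have /= := sD x xs; rewrite inE.
by move=> y /cD [x /= xD Ux]; exists x.
Qed.
End CompactCover.

(** * Compactly supported functions of slope at most one *)

Section Contractions.
Context (R : realType) (n : nat) (M : ptopologicalType) (X : complexManifold R n M).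
Context (g : kahlerMetric X).
Local Notation m := (n + n)%N.
Implicit Types (i j : chart_index X) (x y z : M) (p q v : 'rV[R]_m) (f h : M -> R).
Local Notation dot := (dot g).
Local Notation d := (riemannian_dist g).

Lemma gform_comb (A : 'M[R]_m) (a b : R) (u w : 'rV[R]_m) : A^T = A ->
  gform A (a *: u + b *: w) (a *: u + b *: w) =
  a ^+ 2 * gform A u u + 2 * a * b * gform A u w + b ^+ 2 * gform A w w.
Proof.
move=> As; have e (y z1 z2 : 'rV[R]_m) (b1 b2 : R) : gform A y (b1 *: z1 + b2 *: z2) =
    b1 * gform A y z1 + b2 * gform A y z2.
  by rewrite !(gformC y _ As) /gform gformDl !gformZl.
rewrite e !(gformC (a *: u + b *: w) _ As) !e (gformC w u As).
by move: (gform A u u) (gform A u w) (gform A w w) => p q r; ring.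
Qed.

Definition smoothmax (k : R) f h y := f y + k * softplus ((h y - f y) / k).

Lemma smoothmax_ge k f h y : 0 < k -> f y <= smoothmax k f h y.
Proof. by move=> k0; rewrite lerDl mulr_ge0 ?softplus_ge0// ltW. Qed.

Lemma smoothmax_ge2 k f h y : 0 < k -> h y - k <= smoothmax k f h y.
Proof.
move=> k0; rewrite /smoothmax; have := ler_wpM2l (ltW k0) (softplus_ge ((h y - f y) / k)).
rewrite mulrBr mulr1 mulrC mulfVK ?gt_eqF//; lra.
Qed.

Lemma smoothmax_id k f h y : 0 < k -> h y <= f y -> smoothmax k f h y = f y.
Proof.
move=> k0 hf; rewrite /smoothmax softplus_le0 ?mulr0 ?addr0//.
by rewrite pmulr_lle0 ?invr_gt0// subr_le0.
Qed.

Lemma smooth_at_smoothmax k f h x : smooth_at X f x -> smooth_at X h x ->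
  smooth_at X (smoothmax k f h) x.
Proof.
move=> sf sh; apply: smooth_atD => //; apply: smooth_atM; first exact: smooth_at_cst.
have st : smooth_at X (fun y => (h y - f y) / k) x.
  apply: smooth_atM; last exact: smooth_at_cst.
  by apply: smooth_atD => //; exact: smooth_atN.
by apply: smooth_atM => //; exact: smooth_at_flat.
Qed.

Lemma grN f x : smooth_at X f x -> gr X (fun y => - f y) x = - gr X f x.
Proof. by move=> /smooth_at_diff df; apply/rowP => a; rewrite oppmxE /gr !grad_rowE -partialN. Qed.

(** As the slope c of [softplus] lies in [0, 1], the gradient is the convex combination (1 - c) grad
    f + c grad h. *)
Lemma dot_smoothmax k f h x : 0 < k -> smooth_at X f x -> smooth_at X h x ->
  dot f f x <= 1 -> dot h h x <= 1 -> dot (smoothmax k f h) (smoothmax k f h) x <= 1.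
Proof.
move=> k0 sf sh; have sN : smooth_at X (fun y => - f y) x by exact: smooth_atN.
have st : smooth_at X (fun y => (h y - f y) / k) x.
  apply: smooth_atM; last exact: smooth_at_cst.
  exact: smooth_atD.
have [c /andP[c0 c1] dc] := is_derive_softplus ((h x - f x) / k).
have gk : gr X (fun y => softplus ((h y - f y) / k)) x = (c / k) *: (gr X h x - gr X f x).
  rewrite (gr_comp1 st dc) grM ?gr_cst; [|exact: smooth_atD|exact: smooth_at_cst].
  by rewrite grD// grN// scaler0 addr0 scalerA.
have e : gr X (smoothmax k f h) x = gr X f x + c *: (gr X h x - gr X f x).
  have ss : smooth_at X (fun y => softplus ((h y - f y) / k)) x.
    by apply: smooth_atM => //; exact: smooth_at_flat.
  rewrite /smoothmax grD//; last by apply: smooth_atM => //; exact: smooth_at_cst.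
  rewrite grM ?gr_cst//; last exact: smooth_at_cst.
  by rewrite scaler0 add0r gk scalerA mulrC mulfVK ?gt_eqF.
have K0 := cometric_pos g x; have Ks := cometric_sym g x.
rewrite !dot_gr e; move: (gr X f x) (gr X h x) (cometric g x) K0 Ks => u w A A0 As.
have uw := gform_ge0 (w - u) A0.
have wu : gform A u w = gform A w u by exact: gformC.
have -> : u + c *: (w - u) = (1 - c) *: u + c *: w.
  by rewrite scalerBr scalerBl scale1r addrA addrAC.
have e1 : w - u = 1 *: w + (- 1) *: u by rewrite scale1r scaleN1r.
move: uw; rewrite e1 -/(gform A _ _) gform_comb// gform_comb//.
move: (gform A u u) (gform A w w) (gform A w u) (gform A u w) wu => U W V V' <- hV hU hW.
have h1 := mulr_ge0 (mulr_ge0 c0 (_ : 0 <= 1 - c)) hV.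
have c2 : 0 <= 1 - c by rewrite subr_ge0.
have := h1 c2; have := ler_wpM2l c0 hW; have := ler_wpM2l c2 hU; lra.
Qed.

Definition contraction f := [/\ smooth X f, compact (closure [set x | f x != 0]) &
  forall x, dot f f x <= 1].

Lemma contraction0 : contraction (fun=> 0).
Proof.
split; first exact: smooth_cst.
- rewrite (_ : [set x | _] = set0) ?closure0; first exact: compact0.
  by rewrite -subset0 => x /=; rewrite eqxx.
- by move=> x; rewrite dot_gr gr_cst /gform !mul0mx mxE.
Qed.

Lemma contraction_smoothmax k f h : 0 < k -> contraction f -> contraction h ->
  contraction (smoothmax k f h).
Proof.
move=> k0 [/smoothP sf cf f1] [/smoothP sh ch h1]; split.
- by apply/smoothP => x; exact: smooth_at_smoothmax.
- apply: subclosed_compact (compactU cf ch) _; first exact: closed_closure.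
  rewrite -closureU; apply: closure_subset => y /=; apply: contraNP => /not_orP[/=].
  move=> /negP/negPn/eqP fy /negP/negPn/eqP hy; apply/eqP.
  by rewrite smoothmax_id ?fy ?hy.
- by move=> x; apply: dot_smoothmax.
Qed.

(** The loss k is not accumulated: [smoothmax] never falls below its first argument, so each F i
    pays only when it is inserted. *)
Lemma contraction_family (I : eqType) (s : seq I) (F : I -> M -> R) (k : R) : 0 < k ->
  (forall i : I, i \in s -> contraction (F i)) ->
  exists2 f, contraction f & forall (i : I) y, i \in s -> F i y - k <= f y.
Proof.
move=> k0; elim: s => [|i s ih] hF; first by exists (fun=> 0) => //; exact: contraction0.
have [f cf hf] : exists2 f, contraction f & forall (i : I) y, i \in s -> F i y - k <= f y.
  by apply: ih => j js; apply: hF; rewrite inE js orbT.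
exists (smoothmax k f (F i)).
  by apply: contraction_smoothmax => //; apply: hF; exact: mem_head.
move=> j y; rewrite inE => /predU1P[->|js]; first exact: smoothmax_ge2.
exact: le_trans (hf j y js) (smoothmax_ge _ _ _ _).
Qed.

Section Unbounded.
Context (z0 : M) (r : R) (gr0 : good_radius g z0 r).
Let i0 := chart_at X z0.
Let p0 := chart i0 z0.
Let A0 := metric g i0 p0.

Let A0s : A0^T = A0. Proof. exact: (kahler_sym (metric_kahler g i0) (chart_at_im X z0)). Qed.
Let A0pos : posdef A0. Proof. exact: (kahler_pos (metric_kahler g i0) (chart_at_im X z0)). Qed.

Lemma smooth_sqdist : smooth_on [set: 'rV[R]_m] (sqdist g z0).
Proof.
have To : open [set: 'rV[R]_m] := openT.
rewrite (_ : sqdist g z0 = fun q => \sum_b \sum_a ((q 0 a - p0 0 a) *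
     A0 a b) * (q 0 b - p0 0 b)); last first.
  apply: funext => q; rewrite /sqdist /gform mxE; apply: eq_bigr => b _.
  rewrite mxE mulr_suml; apply: eq_bigr => a _.
  by rewrite [_^T b 0]mxE !addmxE !oppmxE.
apply: (smooth_on_sum To) => b; apply: (smooth_on_sum To) => a.
have cc c : smooth_on [set: 'rV[R]_m] (fun q : 'rV[R]_m => q 0 c - p0 0 c).
  by apply: (smooth_onD To); [exact: (smooth_on_coord To)|exact: smooth_on_cst].
apply: (smooth_onM To); last exact: cc.
by apply: (smooth_onM To); [exact: cc|exact: smooth_on_cst].
Qed.

Lemma partial_sqdist a q : partial a (sqdist g z0) q = 2 * ((q - p0) *m A0) 0 a.
Proof.
have dN : differentiable (sqdist g z0) (q + 0 *: basis_vec R a).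
  exact: smooth_on_diff smooth_sqdist _.
have h1 := is_derive_line dN; rewrite scale0r addr0 in h1.
have h2 : is_derive (0 : R) 1 (fun s => sqdist g z0 (q + s *: basis_vec R a))
    (2 * ((q - p0) *m A0) 0 a).
  pose P : {poly R} := (gform A0 (q - p0) (q - p0))%:P
    + (2 * gform A0 (q - p0) (basis_vec R a))%:P * 'X + (gform A0 (basis_vec R a) (basis_vec R a))%:P * 'X^2.
  have -> : (fun s => sqdist g z0 (q + s *: basis_vec R a)) = horner P.
    apply: funext => s; rewrite /sqdist -/i0 -/p0 -/A0 addrAC -[q - p0](scale1r).
    rewrite gform_comb// /P !hornerE /=; move: (gform _ _ _) (gform _ _ _) (gform _ _ _) => x y z; ring.
  have e : gform A0 (q - p0) (basis_vec R a) = ((q - p0) *m A0) 0 a.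
    by rewrite /gform /basis_vec trmx_delta -colE mxE.
  have -> : 2 * ((q - p0) *m A0) 0 a = (deriv P).[0].
    rewrite /P e; move: (gform _ _ _) (gform _ _ _) (_ 0 a) => x y z.
    rewrite !(derivD, derivM, derivC, derivX, derivXn) !mul0r !add0r mulr1.
    by rewrite hornerD hornerC hornerM hornerMn !hornerE mul0rn mulr0 addr0.
  exact: is_derive_poly.
have e1 := @derive_val _ _ _ _ _ _ _ h1; have e2 := @derive_val _ _ _ _ _ _ _ h2.
rewrite -e2 e1 (bigD1 a)//= big1 => [|b ba].
  by rewrite addr0 mxE !eqxx mul1r.
by rewrite mxE eqxx (negbTE ba) mul0r.
Qed.

Let ball : set M := [set y | chart_dom i0 y /\ sqdist g z0 (chart i0 y) <= r ^+ 2].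
Let sphere : set M := [set y | chart_dom i0 y /\ sqdist g z0 (chart i0 y) = r ^+ 2].

Let continuous_sqdist q : {for q, continuous (sqdist g z0)}.
Proof. exact: smooth_on_continuous smooth_sqdist _. Qed.

(** Compactness is read off in coordinates, from a closed bounded subset of R^m carried over by
    [chart_inv]. The parameter C serves the ball and its boundary sphere alike. *)
Lemma chart_compact (C : set R) : closed C -> (forall t, C t -> t <= r ^+ 2) ->
  compact [set y | chart_dom i0 y /\ C (sqdist g z0 (chart i0 y))].
Proof.
have [r0 hr] := gr0; move=> Ccl Cr.
rewrite (_ : [set y | _] = chart_inv i0 @` [set q | C (sqdist g z0 q)]); last first.
  apply/seteqP; split=> [y [dy hy]|_ [q hq <-]].
    by exists (chart i0 y) => //; rewrite chartK.
  have [iq _ _] := hr q (Cr _ hq); have [dq e] := chart_im_inv iq.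
  by split=> //; rewrite e.
apply: continuous_compact.
  apply: continuous_in_subspaceT => q; rewrite inE /= => hq.
  have [iq _ _] := hr q (Cr _ hq); have [dq e] := chart_im_inv iq.
  by have := chart_inv_continuous dq; rewrite e.
pose b a := r * Num.sqrt (invmx A0 a a).
have cK : compact [set v : 'rV[R]_m | forall a, `[p0 0 a - b a, p0 0 a + b a]%classic (v ord0 a)].
  by apply: (@rV_compact R m (fun a => `[p0 0 a - b a, p0 0 a + b a]%classic)) => a; exact: segment_compact.
apply: subclosed_compact cK _.
  apply: (closed_comp (f := sqdist g z0) (D := C)) => // q _; exact: continuous_sqdist.
move=> q hq a; rewrite /= in_itv /= -ler_distlC distrC.
rewrite -(ler_pXn2r (n := 2))// ?nnegrE ?mulr_ge0 ?sqrtr_ge0 ?(ltW r0)//.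
have Iaa : 0 <= invmx A0 a a.
  have := gform_ge0 (delta_mx 0 a) (posdef_inv A0s A0pos).
  by rewrite -rowE trmx_delta -colE !mxE.
rewrite real_normK ?num_real// /b exprMn sqr_sqrtr//.
have := gform_coord_bound (q - p0) a A0s A0pos; rewrite addmxE oppmxE => /le_trans; apply.
by rewrite ler_wpM2r// Cr.
Qed.

Let dot_sqdist (c b : R) y : ball y -> 16 * b ^+ 2 * r ^+ 2 <= 1 ->
  let l y := c + b * sqdist g z0 (chart i0 y) in smooth_at X l y /\ dot l l y <= 1.
Proof.
have [r0 hr] := gr0; move=> [dy hy] hb l; set q := chart i0 y.
have iq : chart_im i0 q by exact: chart_im_at.
have To : open [set: 'rV[R]_m] := openT.
have io := open_chart_im X i0.
have sl : smooth_on [set: 'rV[R]_m] (fun q => c + b * sqdist g z0 q).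
  apply: (smooth_onD To); first exact: smooth_on_cst.
  by apply: (smooth_onM To); [exact: smooth_on_cst|exact: smooth_sqdist].
have le q' : chart_im i0 q' -> c + b * sqdist g z0 q' = (l \o chart_inv i0) q'.
  by move=> iq'; have [_ e] := chart_im_inv iq'; rewrite /l /= e.
have sy : smooth_at X l y.
  apply: (smooth_at_intro dy io iq).
  by apply: (smooth_on_ext io le); apply: smooth_on_sub sl.
split=> //; rewrite (dotE_at g sy sy dy) chart_dotE -/q.
have -> : grad_row (l \o chart_inv i0) q = (2 * b) *: ((q - p0) *m A0).
  apply/rowP => a; rewrite grad_rowE mxE.
  have <- : partial a (fun q => c + b * sqdist g z0 q) q = partial a (l \o chart_inv i0) q.
    by apply: near_partial; apply: (near_open io) => // q' /le.
  have dN := smooth_on_diff smooth_sqdist (I : [set: 'rV[R]_m] q).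
  rewrite partialD; [|exact: differentiable_cst|by apply: differentiableM => //; exact: differentiable_cst].
  rewrite partial_cst add0r partialZ// partial_sqdist.
  by rewrite mulrA [2 * b]mulrC.
rewrite gformZl linearZ /= -scalemxAr; move: (hr q hy) => [_ _ /(_ ((q - p0) *m A0))].
rewrite -/(gform _ _ _) [gform (cometric g z0) _ _](_ : _ = sqdist g z0 q); last first.
  rewrite /gform /cometric -/i0 -/p0 -/A0 mulmxK ?(posdef_unit A0pos)//.
  by rewrite trmx_mul A0s mulmxA.
rewrite /gform; move: (_ *m _ *m _) => B; rewrite mxE => hB.
have b0 : 0 <= 4 * b ^+ 2 by rewrite mulr_ge0 ?sqr_ge0.
have := ler_wpM2l b0 (le_trans hB (ler_wpM2l (ler0n _ 4) hy)).
move: (B 0 0) hb => x hb h; move: hb h; rewrite !expr2 => hb h; lra.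
Qed.

(** The paraboloid a - [sqdist] / (4 r) has slope at most 1, value a at the centre and a - r / 4 on
    the sphere. Being below F there, it is switched off by [smoothmax] before the boundary, so
    patching with F is smooth. *)
Lemma contraction_glue F (a k : R) : 0 < k -> contraction F ->
  (forall y, sphere y -> a - r / 4 < F y) -> exists2 f, contraction f & a - k <= f z0.
Proof.
have [r0 hr] := gr0; move=> k0 [sF cF F1] hF.
pose l y := a + - (4 * r)^-1 * sqdist g z0 (chart i0 y).
have hb : 16 * (- (4 * r)^-1) ^+ 2 * r ^+ 2 <= 1.
  by rewrite sqrrN (_ : _ * _ = 1)//; field; rewrite gt_eqF.
pose F' y := if `[< ball y >] then smoothmax k F l y else F y.
have bc : compact ball.
  by apply: (chart_compact (C := [set t | t <= r ^+ 2])) => //; exact: closed_le.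
have bcl : closed ball by apply: compact_closed bc; exact: (manifold_hausdorff X).
have nearF y : (ball y /\ \forall z \near y, smoothmax k F l z = F' z) \/
    \forall z \near y, F z = F' z.
  have [by_|nb] := pselect (ball y); last first.
    right; have : open_nbhs y (~` ball) by split=> //; exact: closed_openC.
    by move/open_nbhs_nbhs; apply: filterS => z nz; rewrite /F' asboolF.
  have [dy hy] := by_; have n1 : \forall z \near y, chart_dom i0 z.
    by apply: open_nbhs_nbhs; split=> //; exact: chart_dom_open.
  have cN : (fun z => sqdist g z0 (chart i0 z)) @ y --> sqdist g z0 (chart i0 y).
    exact: (@continuous_comp _ _ _ (chart i0) (sqdist g z0) y (chart_continuous dy) (@continuous_sqdist _)).
  move: hy; rewrite le_eqVlt => /predU1P[ey|ly].
    (* On the sphere the strict inequality extends to a neighbourhood, where [smoothmax] is just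
       F. *)
    right; have lF : l y < F y.
      apply: le_lt_trans (hF y _); last by split.
      by rewrite /l ey le_eqVlt; apply/orP; left; apply/eqP; field; rewrite gt_eqF.
    have cl : {for y, continuous (fun z => F z - l z)}.
      apply: cvgB; first exact: (smooth_continuous sF).
      apply: cvgD; first exact: cvg_cst.
      by apply: cvgM; first exact: cvg_cst.
    have : \forall z \near y, 0 < F z - l z.
      by apply: (cvgr_gt (F y - l y)) => //; rewrite subr_gt0.
    apply: filterS => z; rewrite subr_gt0 => hz; rewrite /F'; case: asboolP => // _.
    by rewrite smoothmax_id// ltW.
  left; split=> //; have n2 : \forall z \near y, sqdist g z0 (chart i0 z) < r ^+ 2.
    exact: (cvgr_lt (sqdist g z0 (chart i0 y))).
  apply: filterS2 n1 n2 => z dz hz.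
  by rewrite /F' asboolT//; split=> //; exact: ltW.
have sFx := (smoothP X F).1 sF.
exists F'; last first.
  rewrite /F' asboolT; last first.
    by split; [exact: chart_dom_at|rewrite /sqdist subrr /gform !mul0mx mxE exprn_ge0// ltW].
  apply: le_trans (smoothmax_ge2 F l z0 k0).
  by rewrite /l /sqdist subrr /gform !mul0mx mxE mulr0 addr0.
split.
- apply/smoothP => y; case: (nearF y) => [[by_ h]|h]; apply: smooth_at_near h _ => //.
  by apply: smooth_at_smoothmax => //; have [] := dot_sqdist a by_ hb.
- apply: subclosed_compact (compactU cF bc) _; first exact: closed_closure.
  rewrite ((closure_id ball).1 bcl) -closureU; apply: closure_subset => y /=.
  by rewrite /F'; case: asboolP => [by_ _|_ Fy]; [right|left].
- move=> y; case: (nearF y) => [[by_ h]|h].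
    have h' : \forall z \near y, F' z = smoothmax k F l z by apply: filterS h.
    rewrite (dot_near g _ h') dotC (dot_near g _ h').
    by have [sl l1] := dot_sqdist a by_ hb; exact: dot_smoothmax.
  have h' : \forall z \near y, F' z = F z by apply: filterS h.
  by rewrite (dot_near g _ h') dotC (dot_near g _ h').
Qed.

(** Finitely many of the given contractions cover the compact sphere; their smooth maximum F is a
    barrier there, and the paraboloid then raises the centre above c. *)
Lemma contraction_improve (c : R) : (forall y, ball y ->
    exists2 f, contraction f & c - 3 / 16 * r < f y) ->
  exists2 f, contraction f & c < f z0.
Proof.
have [r0 hr] := gr0; move=> hc.
have sc : compact sphere.
  by apply: (chart_compact (C := [set t | t = r ^+ 2])) => [|t ->//]; exact: closed_eq.
have sb y : sphere y -> ball y by move=> [dy e]; split=> //; rewrite e.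
pose f y : M -> R := if pselect (ball y) is left by_ then sval (cid2 (hc y by_)) else fun=> 0.
have fP y : ball y -> contraction (f y) /\ c - 3 / 16 * r < f y y.
  by move=> by_; rewrite /f; case: pselect => // h; case: cid2 => ? [].
pose U y : set M := [set z | c - 3 / 16 * r < f y z].
have [y /sb /fP [[sf _ _] h]|s [sS hs]] := @compact_cover_seq M sphere U sc.
  split=> //; rewrite openE => z hz; rewrite /interior.
  have cz : f y w @[w --> z] --> f y z by apply: (smooth_continuous sf).
  have := cvgr_gt (f y z) cz; apply; exact: hz.
have k0 : 0 < r / 64 by rewrite divr_gt0.
have [F cF hF] : exists2 F, contraction F & forall y z, y \in s -> f y z - r / 64 <= F z.
  by apply: contraction_family => // y /sS /sb /fP[].
(* On the sphere F > c - 3r/16 - r/64 = c - 13r/64, above the required c + r/32 - r/4 = c - 14r/64;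
   the centre gets at least c + r/32 - r/64 > c. *)
have [|f' cf' hf'] := @contraction_glue F (c + r / 32) (r / 64) k0 cF.
  move=> y /hs [z zs hz]; have := hF z y zs; rewrite /U /= in hz; lra.
exists f' => //; lra.
Qed.
End Unbounded.

(** Suppose contractions are bounded at x0. Their pointwise supremum s is then finite and
    1-Lipschitz, and Ekeland gives a point z from which s decreases at rate at most 1/16. So
    contractions nearly as large as s z exist all over a small ball around z, and
    [contraction_improve] produces one exceeding s z at z. Completeness enters only through
    Ekeland. *)
Lemma contraction_unbounded x0 (B : R) : complete_metric g ->
  exists2 f, contraction f & B < f x0.
Proof.
move=> cm; apply: contrapT => nex.
have hB f : contraction f -> f x0 <= B.
  by move=> cf; rewrite leNgt; apply/negP => h; apply: nex; exists f.
pose S x : set R := [set t | exists2 f, contraction f & t = f x].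
have S0 x : S x 0 by exists (fun=> 0) => //; exact: contraction0.
have Sub x : has_sup (S x).
  split; first by exists 0.
  exists (B + d x0 x) => _ [f cf ->]; have := hB f cf; have [sf _ f1] := cf.
  have := contraction_dist x0 x sf f1; lra.
pose s x := sup (S x).
have fs f x : contraction f -> f x <= s x.
  by move=> cf; apply: ub_le_sup; [have [] := Sub x|exists f].
have s0 x : 0 <= s x by apply: (fs (fun=> 0)); exact: contraction0.
have sL x y : s y <= s x + d x y.
  apply: ge_sup; first by exists 0.
  move=> _ [f cf ->]; have := fs f x cf; have [sf _ f1] := cf.
  have := contraction_dist x y sf f1; lra.
have th0 : 0 < 16^-1 :> R by rewrite invr_gt0.
have [z hz] := ekeland x0 cm th0 s0 sL.
have [r gr0] := good_radius_exists g z; have [r0 _] := gr0.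
(* Points of the ball are within distance 2 r, so s loses at most r/8 there; with r/32 for
   approximating the supremum the loss is 5r/32 < 3r/16. *)
have [y [dy hy]|f cf hf] := contraction_improve gr0 (c := s z).
  have dd := dist_ball gr0 hy; rewrite chartK// in dd.
  have dr : d z y <= 2 * r.
    apply: le_trans dd _; rewrite ler_pM2l// -(ger0_norm (ltW r0)) -sqrtr_sqr.
    exact: ler_wsqrtr.
  have e0 : 0 < r / 32 by rewrite divr_gt0.
  have [_ [f cf ->] h] := sup_adherent e0 (Sub y).
  exists f => //; have := hz y; rewrite -/(s y) in h; lra.
have := fs f z cf; lra.
Qed.
End Contractions.

(** * Riemannian volume *)

Section MeasurablePreimages.
Context (R : realType) d (T : measurableType d).
Local Open Scope classical_set_scope.

Lemma countable_union_measurable (I : countType) (F : I -> set T) :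
  (forall i, measurable (F i)) -> measurable (\bigcup_i F i).
Proof.
move=> mF; rewrite (_ : \bigcup_i F i = \bigcup_k (if unpickle k is Some i then F i else set0)).
  by apply: bigcup_measurable => k _; case: unpickle.
apply/seteqP; split=> [x [i _ Fx]|x [k _]].
  by exists (pickle i) => //; rewrite pickleK.
by case: unpickle => // i Fx; exists i.
Qed.

Lemma forall_measurable (I : countType) (F : I -> set T) :
  (forall i, measurable (F i)) -> measurable [set x | forall i, F i x].
Proof.
move=> mF; rewrite (_ : [set x | _] = ~` \bigcup_i ~` F i).
  by apply: measurableC; apply: countable_union_measurable => i; exact: measurableC.
apply/seteqP; split=> [x h [i _]|x h i]; first by apply; exact: h.
by apply: contrapT => nF; apply: h; exists i.
Qed.

Context (m : nat) (phi : T -> 'rV[R]_m).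
Hypothesis mphi : forall a, measurable_fun setT (fun x => phi x 0 a).

Lemma measurable_cube (p : 'rV[R]_m) (r : R) :
  measurable [set x | forall a, `|phi x 0 a - p 0 a| < r].
Proof.
apply: (@forall_measurable 'I_m (fun a => [set x | `|phi x 0 a - p 0 a| < r])) => a.
have mf : measurable_fun setT (fun x => `|phi x 0 a - p 0 a|).
  by apply: measurableT_comp => //; apply: measurable_funB => //; exact: mphi.
rewrite (_ : [set x | _] = setT `&` ((fun x => `|phi x 0 a - p 0 a|) @^-1` `]-oo, r[)).
  by apply: mf => //; exact: measurable_itv.
by rewrite setTI; apply/seteqP; split=> x /=; rewrite in_itv.
Qed.

(** Only the coordinates of [phi] are known to be measurable, so an open set is written as a
    countable union of cubes with rational centres. *)
Lemma measurable_preimage_open (U : set 'rV[R]_m) : open U -> measurable (phi @^-1` U).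
Proof.
move=> Uo; pose B (i : 'rV[rat]_m * nat) : set 'rV[R]_m :=
  [set p | forall a, `|p 0 a - (map_mx ratr i.1 : 'rV[R]_m) 0 a| < i.2.+1%:R^-1].
pose F i : set T := if pselect (B i `<=` U) is left _ then phi @^-1` B i else set0.
have -> : phi @^-1` U = \bigcup_i F i.
  apply/seteqP; split=> [x Ux|x [i _]]; last by rewrite /F; case: pselect => // h; exact: h.
  have /nbhs_ballP[e /= e0 he] : nbhs (phi x) U by exact: open_nbhs_nbhs.
  have [k hk] : exists k, k.+1%:R^-1 < e / 2 :> R.
    have e2 : 0 < e / 2 by rewrite divr_gt0.
    by have [k hk] := ltr_add_invr e2; exists k; rewrite add0r in hk.
  have k0 : 0 < k.+1%:R^-1 :> R by rewrite invr_gt0.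
  have hq (a : 'I_m) : exists q : rat, `|phi x 0 a - ratr q| < k.+1%:R^-1.
    have [|q] := @rat_in_itvoo R (phi x 0 a - k.+1%:R^-1) (phi x 0 a + k.+1%:R^-1).
      by rewrite ltrD2l gtrN.
    by rewrite in_itv /= => /andP[q1 q2]; exists q; rewrite distrC ltr_distl q1.
  pose q : 'rV[rat]_m := \row_a sval (cid (hq a)).
  exists (q, k) => //; rewrite /F; case: pselect => [_ a|[]].
    by rewrite !mxE; case: cid.
  move=> p hp; apply: he; split=> // a b; rewrite (ord1 a) -ball_normE /=.
  have h1 := hp b; have h2 : `|phi x 0 b - (map_mx ratr q : 'rV[R]_m) 0 b| < k.+1%:R^-1.
    by rewrite !mxE; case: cid.
  move: h1 h2; rewrite /=; move: (map_mx _ _ _ _) => y h1 h2.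
  have -> : phi x 0 b - p 0 b = (phi x 0 b - y) - (p 0 b - y) by ring.
  apply: le_lt_trans (ler_normB _ _) _; rewrite [e]splitr.
  by apply: ltrD; [exact: lt_trans h2 hk|exact: lt_trans h1 hk].
apply: countable_union_measurable => i; rewrite /F; case: pselect => // _.
exact: measurable_cube.
Qed.

Lemma measurable_comp_open (U : set 'rV[R]_m) (f : 'rV[R]_m -> R) : open U ->
  (forall p, U p -> {for p, continuous f}) ->
  measurable_fun (phi @^-1` U) (fun x => f (phi x)).
Proof.
move=> Uo cf; apply: (measurability _ (RGenOpens.measurableE R)).
move=> _ [_ [b [c ->]] <-]; set V : set R := `]b, c[%classic.
have Vo : open V by exact: interval_open.
rewrite (_ : _ `&` _ = phi @^-1` (U `&` f @^-1` V)).
  apply: measurable_preimage_open; rewrite openE => p [Up Vp]; apply: filterI.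
    exact: open_nbhs_nbhs.
  by apply: (cf p Up); exact: open_nbhs_nbhs.
by apply/seteqP; split.
Qed.
End MeasurablePreimages.

Section ProductMeasure.
Context (R : realType) d1 (T1 : measurableType d1) d2 (T2 : measurableType d2).
Context (m1 : {sigma_finite_measure set T1 -> \bar R}) (m2 : {sigma_finite_measure set T2 -> \bar R}).

Definition prod_measure : set (T1 * T2) -> \bar R := (m1 \x m2)%E.

HB.instance Definition _ := Measure.on prod_measure.

Lemma prod_measure_sigma_finite : sigma_finite setT prod_measure.
Proof.
have /sigma_finiteP[F [FT ndF Fy]] := sigma_finiteT m1.
have /sigma_finiteP[G [GT ndG Gy]] := sigma_finiteT m2.
exists (fun k => F k `*` G k) => [|k]; last first.
  have [mF hF] := Fy k; have [mG hG] := Gy k; split; first exact: measurableX.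
  by rewrite /prod_measure product_measure1E// lte_mul_pinfty// ge0_fin_numE.
apply/seteqP; split=> // -[x y] _.
have [k _ Fx] : (\bigcup_k F k) x by rewrite -FT.
have [l _ Gy'] : (\bigcup_k G k) y by rewrite -GT.
exists (maxn k l) => //; split => /=.
  exact: (subsetPset _ _ (ndF _ _ (leq_maxl k l))).
exact: (subsetPset _ _ (ndG _ _ (leq_maxr k l))).
Qed.

HB.instance Definition _ := Measure_isSigmaFinite.Build _ _ _ prod_measure
  prod_measure_sigma_finite.
End ProductMeasure.

(** * A measure space modelling Lebesgue measure on R^m *)

Section Euclid.
Context (R : realType).

(* A model of Lebesgue measure on R^m by an iterated product space [eT], mapped to
   row vectors by [ephi], for which [integral_rV] is the integral. *)
Record euclid (m : nat) := Euclid {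
  edisp : measure_display;
  eT : measurableType edisp;
  emu : {sigma_finite_measure set eT -> \bar R};
  ephi : eT -> 'rV[R]_m;
  ecoord : forall a, measurable_fun setT (fun x => ephi x 0 a);
  eint : forall f : 'rV[R]_m -> \bar R, (forall p, (0 <= f p)%E) ->
    measurable_fun [set: eT] (fun x : eT => f (ephi x)) -> integral_rV f = (\int[emu]_x f (ephi x))%E;
  ecube : forall (p : 'rV[R]_m) (r : R), 0 < r ->
    emu [set x | forall a, `|ephi x 0 a - p 0 a| < r] = ((2 * r) ^+ m)%:E;
  eibp : forall (a : 'I_m) (F : 'rV[R]_m -> R) (L C : R), 0 < L ->
    (forall p, differentiable F p) -> continuous (partial a F) ->
    (forall p, `|partial a F p| <= C) ->
    (forall (p : 'rV[R]_m) c, L <= `|p 0 c| -> F p = 0) ->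
    (\int[emu]_x (partial a F (ephi x))%:E)%E = 0%E
}.

Lemma euclid0 : inhabited (euclid 0).
Proof.
constructor; apply: (@Euclid 0 _ unit (dirac tt) (fun=> 0)).
- by case.
- move=> f f0 mf; rewrite /= integral_dirac; [|by []|exact: measurable_cst].
  by rewrite diracT mul1e.
- move=> p r r0; rewrite expr0 (_ : [set _ | _] = setT); first exact: diracT.
  by apply/seteqP; split=> // x _ [].
- by case.
Qed.

Lemma integral_derive_compact (f df : R -> R) (L : R) : 0 < L ->
  (forall t : R, is_derive t 1 f (df t)) -> continuous df ->
  (forall t, L <= `|t| -> f t = 0) -> (\int[@lebesgue_measure R]_t (df t)%:E)%E = 0%E.
Proof.
move=> L0 hf cdf f0.
have cf (t : R) : {for t, continuous f}.
  apply: differentiable_continuous; apply/derivable1_diffP.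
  exact: (@ex_derive _ _ _ _ _ _ _ (hf t)).
have df0 t : L < `|t| -> df t = 0.
  move=> Lt; have n : \forall s \near t, (fun=> 0) s = f s.
    have ct : `|s| @[s --> t] --> `|t| by apply: cvg_norm; exact: cvg_id.
    by apply: filterS (cvgr_gt _ ct _ Lt) => s hs; rewrite f0// ltW.
  have h := near_eq_is_derive n (is_derive_cst 0 t 1).
  by rewrite -(@derive_val _ _ _ _ _ _ _ (hf t)) (@derive_val _ _ _ _ _ _ _ h).
pose D : set R := `[- L, L]%classic.
have -> : (\int[@lebesgue_measure R]_t (df t)%:E = \int[@lebesgue_measure R]_(t in D) (df t)%:E)%E.
  rewrite [RHS]integral_mkcond; apply: eq_integral => t _; rewrite patchE.
  case: ifPn => // ht; rewrite df0// ltNge; apply: contra ht => ht.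
  by rewrite /D inE /= in_itv /= -ler_norml.
rewrite (@continuous_FTC2 _ df f) ?gtrN//.
- by rewrite !f0 ?subee// ?normrN ger0_norm// ltW.
- by apply: continuous_subspaceT.
- split.
  + by move=> t _; exact: (@ex_derive _ _ _ _ _ _ _ (hf t)).
  + by apply: cvg_at_right_filter; exact: cf.
  + by apply: cvg_at_left_filter; exact: cf.
- by move=> t _; rewrite derive1E (@derive_val _ _ _ _ _ _ _ (hf t)).
Qed.

Section Step.
Context (k : nat) (E : euclid k).
Let T : measurableType _ := (measurableTypeR R * eT E)%type.
Let phi (z : T) : 'rV[R]_k.+1 := row_mx ((z.1 : R)%:M : 'rV[R]_1) (ephi z.2).
Let mu : {sigma_finite_measure set T -> \bar R} :=
  prod_measure (@lebesgue_measure R) (emu E).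

Let coordl t (v : 'rV[R]_k) (j : 'I_1) : (row_mx (t%:M : 'rV[R]_1) v) 0 (lshift k j) = t.
Proof. by rewrite row_mxEl (ord1 j) mxE eqxx mulr1n. Qed.

Let coordr t (v : 'rV[R]_k) j : (row_mx (t%:M : 'rV[R]_1) v) 0 (rshift 1 j) = v 0 j.
Proof. by rewrite row_mxEr. Qed.

Let mcoord a : measurable_fun [set: T] (fun x => phi x 0 a).
Proof.
case: (@split_ordP 1 k a) => j ->.
  by under eq_fun do rewrite coordl; exact: measurable_fst.
under eq_fun do rewrite coordr.
exact: (measurableT_comp (ecoord j) (@measurable_snd _ _ _ _)).
Qed.

Let step_int (f : 'rV[R]_k.+1 -> \bar R) : (forall p, (0 <= f p)%E) ->
  measurable_fun [set: T] (fun x => f (phi x)) ->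
  integral_rV f = (\int[mu]_x f (phi x))%E.
Proof.
move=> f0 mf.
have h := @fubini_tonelli1 _ _ _ _ R (@lebesgue_measure R) (emu E) _ mf (fun z => f0 (phi z)).
apply/esym; apply: etrans h _; apply/esym; rewrite /fubini_F; apply: eq_integral => t _.
apply: (eint (e := E)) => //; exact: (measurable_fun_pair2 t mf).
Qed.

Let step_cube (p : 'rV[R]_k.+1) (r : R) : 0 < r ->
  mu [set x | forall a, `|phi x 0 a - p 0 a| < r] = ((2 * r) ^+ k.+1)%:E.
Proof.
move=> r0; pose q : 'rV[R]_k := \row_j p 0 (rshift 1 j).
rewrite (_ : [set x | _] = ball (p 0 0) r `*` [set x | forall a, `|ephi x 0 a - q 0 a| < r]); last first.
  apply/seteqP; split=> [[t x] h|[t x] [h1 h2] a].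
    split; last by move=> j; have := h (rshift 1 j); rewrite coordr mxE.
    have := h (lshift k (0 : 'I_1)); rewrite coordl /= -ball_normE /= distrC.
    by rewrite (_ : lshift k (0 : 'I_1) = 0 :> 'I_k.+1)//; exact: val_inj.
  case: (@split_ordP 1 k a) => j ->.
    rewrite coordl; move: h1; rewrite -ball_normE /= distrC.
    by rewrite (_ : lshift k j = 0 :> 'I_k.+1)//; apply: val_inj; rewrite /= (ord1 j).
  by rewrite coordr; have := h2 j; rewrite mxE.
have mQ := measurable_cube (@ecoord _ E) q r.
rewrite [LHS](product_measure1E (@lebesgue_measure R) (emu E) (measurable_ball _ _) mQ).
apply: (etrans (congr2 *%E (lebesgue_measure_ball (p 0 0) (ltW r0)) (@ecube _ E q r r0))).
rewrite -EFinM exprS; congr ((_ * _)%:E).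
by rewrite mulr_natl.
Qed.

(** By Fubini the variable of differentiation can be integrated first: for the new coordinate this
    is the fundamental theorem of calculus on the line, for an old one the induction hypothesis on
    slices. *)
Let step_ibp (a : 'I_k.+1) (F : 'rV[R]_k.+1 -> R) (L C : R) : 0 < L ->
  (forall p, differentiable F p) -> continuous (partial a F) ->
  (forall p, `|partial a F p| <= C) ->
  (forall (p : 'rV[R]_k.+1) c, L <= `|p 0 c| -> F p = 0) ->
  (\int[mu]_x (partial a F (phi x))%:E)%E = 0%E.
Proof.
move=> L0 dF cF bF F0.
have F0' (p : 'rV[R]_k.+1) c : L < `|p 0 c| -> partial a F p = 0.
  move=> Lp; rewrite -(partial_cst a (0 : R) p); apply: near_partial.
  have cc : {for p, continuous (fun q : 'rV[R]_k.+1 => q 0 c)}.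
    by apply: differentiable_continuous; exact: differentiable_coord.
  have cn : (fun q : 'rV[R]_k.+1 => `|q 0 c|) @ p --> `|p 0 c| 
    by apply: (@continuous_comp _ _ _ (fun q : 'rV[R]_k.+1 => q 0 c) (fun t : R => `|t|) p cc); exact: norm_continuous.
  have hn : nbhs p [set q : 'rV[R]_k.+1 | L < `|q 0 c|] by have := cvgr_gt _ cn; apply; exact: Lp.
  by apply: filterS hn => q hq; rewrite (F0 q c)// ltW.
pose Q : set T := [set x | forall c, `|phi x 0 c - (0 : 'rV[R]_k.+1) 0 c| < L + 1].
have L1 : 0 < L + 1 by rewrite addr_gt0.
have mQ : measurable Q by exact: (measurable_cube mcoord).
have mf : measurable_fun [set: T] (fun x => partial a F (phi x)).
  have := measurable_comp_open mcoord openT (fun p _ => cF p).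
  by rewrite preimage_setT.
(* The derivative vanishes only where some coordinate exceeds L strictly, hence the cube of
   half-side L + 1. Its finite measure and the bound C give the integrability that Fubini
   requires. *)
have fQ : (fun x => (partial a F (phi x))%:E) = (fun x => (partial a F (phi x))%:E) \_ Q.
  apply: funext => x; rewrite patchE; case: ifPn => // /negP nQ.
  have [c hc] : exists c, L + 1 <= `|phi x 0 c|.
    apply: contrapT => nc; apply: nQ; rewrite inE => c; rewrite [(0 : 'rV[R]_k.+1) 0 c]mxE subr0 ltNge.
    by apply/negP => h; apply: nc; exists c.
  by rewrite (F0' _ c)//; apply: lt_le_trans hc; rewrite ltrDl.
have fi : mu.-integrable setT (fun x => (partial a F (phi x))%:E).
  rewrite fQ; apply/(integrable_mkcond _ mQ).
  apply: measurable_bounded_integrable => //.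
  - by rewrite [X in (X < _)%E](step_cube 0 L1) ltry.
  - exact: measurable_funS mf.
  - exists C; split; first exact: num_real.
    by move=> c Cc x _ /=; apply: le_trans (bF _) _; exact: ltW.
have row_line t (v : 'rV[R]_k) j : row_mx (t%:M : 'rV[R]_1) v =
    row_mx (0 : 'rV[R]_1) v + t *: basis_vec R (lshift k j).
  apply/rowP => c; rewrite [RHS]mxE [X in _ = _ + X]mxE /basis_vec.
  case: (@split_ordP 1 k c) => i ->.
    by rewrite coordl row_mxEl !mxE (ord1 i) (ord1 j) !eqxx add0r mulr1.
  by rewrite coordr row_mxEr !mxE eqxx /= eq_rlshift mulr0 addr0.
move: fi (cF) F0' => fi cF' _; case: (@split_ordP 1 k a) => j aE.
  apply: (etrans (esym (integral21_prod_meas1 (m1 := @lebesgue_measure R) (m2 := emu E) fi))).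
  rewrite integral0_eq// => x _; rewrite /fubini_G.
  apply: (@integral_derive_compact (fun t => F (row_mx (t%:M : 'rV[R]_1) (ephi x))) _ L L0).
  - move=> t; rewrite (_ : (fun t => _) = fun t => F (row_mx (0 : 'rV[R]_1) (ephi x) + t *: basis_vec R a)); last first.
      by apply: funext => s; rewrite (row_line _ _ j) aE.
    have := is_derive_line (dF (row_mx (0 : 'rV[R]_1) (ephi x) + t *: basis_vec R a)).
    rewrite (bigD1 a)//= big1 => [|b ba]; last by rewrite /basis_vec mxE eqxx (negbTE ba) mul0r.
    by rewrite /basis_vec addr0 mxE !eqxx mul1r /phi /= (row_line _ _ j) aE.
  - rewrite (_ : (fun t => _) = (partial a F) \o (fun t => row_mx (0 : 'rV[R]_1) (ephi x) + t *: basis_vec R a)).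
      move=> t; apply: continuous_comp; last exact: cF'.
      apply: cvgD; first exact: cvg_cst.
      have dz : differentiable (fun s : R => s *: basis_vec R a) t by apply: differentiableZl.
      exact: (differentiable_continuous dz).
    by apply: funext => t; rewrite /phi /= (row_line _ _ j) aE.
  - by move=> t hL; apply: (F0 _ (lshift k j)); rewrite coordl.
apply: (etrans (esym (integral12_prod_meas1 (m1 := @lebesgue_measure R) (m2 := emu E) fi))).
rewrite integral0_eq// => t _; rewrite /fubini_F.
pose H (v : 'rV[R]_k) := F (row_mx (t%:M : 'rV[R]_1) v).
have dr v (c : 'I_k.+1) : differentiable (fun v : 'rV[R]_k => (row_mx (t%:M : 'rV[R]_1) v) 0 c) v.
  case: (@split_ordP 1 k c) => i ->.
    by under eq_fun do rewrite coordl; exact: differentiable_cst.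
  by under eq_fun do rewrite coordr; exact: differentiable_coord.
have pH v : partial j H v = partial a F (row_mx (t%:M : 'rV[R]_1) v).
  have e1 : partial j H v = 'D_(basis_vec R j) H v by [].
  have e2 p : partial a F p = 'D_(basis_vec R a) F p by [].
  pose w := row_mx (t%:M : 'rV[R]_1) v : 'rV[R]_k.+1.
  suff e3 : (fun h : R => h^-1 *: ((H \o shift v) (h *: basis_vec R j) - H v)) =
      (fun h : R => h^-1 *: ((F \o shift w) (h *: basis_vec R a) - F w)).
    by rewrite e1 e2 /derive e3.
  apply: funext => h; rewrite /H /= -/w; congr (_ *: (F _ - _)).
  apply/rowP => c; rewrite [RHS]mxE [X in _ = X + _]mxE /basis_vec aE.
  case: (@split_ordP 1 k c) => i ->.
    have e0 : (delta_mx 0 (rshift 1 j) : 'rV[R]_k.+1) 0 (lshift k i) = 0.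
      by rewrite mxE eqxx /= [_ == _](eq_lrshift i j).
    by rewrite /w !coordl e0 mulr0 add0r.
  have zE (B : 'rV[R]_k) : (h *: B) 0 i = h * B 0 i by rewrite mxE.
  rewrite /w !coordr addmxE zE; congr (_ * _ + _).
  by rewrite !mxE !eqxx /= [rshift 1 i == _](inj_eq (@rshift_inj 1 k)).
have dH v : differentiable H v by apply: differentiable_comp_mx => // c; exact: dr.
rewrite -[RHS](@eibp k E j H L C L0 dH).
- by apply: eq_integral => y _; rewrite pH.
- rewrite (_ : partial j H = partial a F \o (fun v => row_mx (t%:M : 'rV[R]_1) v)); last exact: funext.
  move=> v; apply: continuous_comp; last exact: cF'.
  by apply: differentiable_continuous; apply: differentiable_mx => c; exact: dr.
- by move=> v; rewrite pH; exact: bF.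
- by move=> v c hL; apply: (F0 _ (rshift 1 c)); rewrite coordr.
Qed.

Lemma euclidS : inhabited (euclid k.+1).
Proof.
by constructor; apply: (@Euclid k.+1 _ T mu phi mcoord step_int step_cube step_ibp).
Qed.
End Step.

Lemma euclid_exists m : inhabited (euclid m).
Proof. by elim: m => [|m [E]]; [exact: euclid0|exact: euclidS]. Qed.
End Euclid.

(** * Change of variables, from sets to functions *)

Section ChangeOfVariables.
Import HBNNSimple.
Context (R : realType) d1 (T1 : measurableType d1) d2 (T2 : measurableType d2).
Context (nu : {measure set T1 -> \bar R}) (mu : {measure set T2 -> \bar R}).
Context (D1 : set T1) (D2 : set T2) (psi : T2 -> T1) (w : T2 -> R).
Hypotheses (mD1 : measurable D1) (mD2 : measurable D2) (mpsi : measurable_fun D2 psi).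
Hypotheses (mw : measurable_fun D2 w) (w0 : forall x, D2 x -> 0 <= w x).
Hypothesis psiD : forall x, D2 x -> D1 (psi x).
Hypothesis nuE : forall A, measurable A -> A `<=` D1 ->
  nu A = (\int[mu]_(x in D2) ((w x)%:E * (\1_A (psi x))%:E))%E.
Local Open Scope ereal_scope.

Let change_indic (A : set T1) : measurable A ->
  \int[nu]_(y in D1) (\1_A y)%:E = \int[mu]_(x in D2) ((w x)%:E * (\1_A (psi x))%:E).
Proof.
move=> mA; rewrite integral_indic// nuE; [|exact: measurableI|by move=> y []].
apply: eq_integral => x; rewrite inE => Dx; rewrite !indicE; congr (_ * (_%:R)%:E).
by rewrite in_setI [X in _ && X]mem_set ?andbT//; exact: psiD.
Qed.

Let mcomp (A : set T1) : measurable A -> measurable_fun D2 (fun x => (\1_A (psi x) : R)).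
Proof. by move=> mA; apply: measurableT_comp mpsi; exact: measurable_indic. Qed.

Let change_nnsfun (h : {nnsfun T1 >-> R}) :
  \int[nu]_(y in D1) (h y)%:E = \int[mu]_(x in D2) ((w x)%:E * (h (psi x))%:E).
Proof.
have hE y : (h y)%:E = \sum_(k \in range h) k%:E * (\1_(h @^-1` [set k]) y)%:E.
  by rewrite fsumEFin //= fimfunE.
under eq_integral do rewrite hE.
rewrite ge0_integral_fsum//; last 2 first.
- by move=> k; apply/measurable_EFinP; apply: measurable_funM => //; apply: measurable_funTS; exact: measurable_indic.
- by move=> k y _; exact: nnfun_muleindic_ge0.
have -> : \int[mu]_(x in D2) ((w x)%:E * (h (psi x))%:E) =
   \int[mu]_(x in D2) \sum_(k \in range h) (k%:E * ((w x)%:E * (\1_(h @^-1` [set k]) (psi x))%:E)).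
  apply: eq_integral => x _; rewrite hE ge0_mule_fsumr.
    by apply: eq_fsbigr => k _; rewrite muleCA.
  by move=> k; exact: nnfun_muleindic_ge0.
have mk k : measurable_fun D2 (fun x => (w x)%:E * (\1_(h @^-1` [set k]) (psi x))%:E).
  by apply/measurable_EFinP; apply: measurable_funM => //; exact: mcomp.
rewrite ge0_integral_fsum//; last 2 first.
- by move=> k; exact: measurable_funeM.
- move=> k x Dx; rewrite muleCA; apply: mule_ge0; first by rewrite lee_fin w0.
  exact: nnfun_muleindic_ge0.
apply: eq_fsbigr => k; rewrite inE => -[y _ <-].
rewrite ge0_integralZl//; last 2 first.
- by apply/measurable_EFinP; apply: measurable_funTS; exact: measurable_indic.
- by rewrite lee_fin.
rewrite ge0_integralZl ?change_indic//; last by rewrite lee_fin.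
by move=> x Dx; apply: mule_ge0; rewrite lee_fin// w0.
Qed.

(** Simple functions and monotone convergence extend [nuE] from sets, the form in which
    [riemannian_volume] characterises the measure, to nonnegative functions. *)
Lemma integral_change (F : T1 -> \bar R) : (forall y, 0 <= F y) -> measurable_fun setT F ->
  \int[nu]_(y in D1) F y = \int[mu]_(x in D2) ((w x)%:E * F (psi x)).
Proof.
move=> F0 mF; pose h := nnsfun_approx measurableT mF.
have cF y : EFin \o h ^~ y @ \oo --> F y by apply: cvg_nnsfun_approx.
have ndh y : nondecreasing_seq (h ^~ y).
  by move=> k l kl; exact: (lefP _ _ (nd_nnsfun_approx measurableT mF kl)).
transitivity (limn (fun k => \int[nu]_(y in D1) (h k y)%:E)).
  rewrite -monotone_convergence//; last 3 first.
  - by move=> k; apply/measurable_EFinP; exact: measurable_funTS.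
  - by move=> k y _; rewrite lee_fin.
  - by move=> y _ k l kl; rewrite lee_fin; exact: ndh.
  by apply: eq_integral => y _; apply/esym/cvg_lim => //; exact: cF.
under eq_fun do rewrite change_nnsfun.
rewrite -monotone_convergence//; last 3 first.
- move=> k; apply/measurable_EFinP; apply: measurable_funM => //.
  exact: measurableT_comp.
- by move=> k x Dx; apply: mule_ge0; rewrite lee_fin// w0.
- by move=> x Dx k l kl; rewrite -!EFinM lee_fin ler_wpM2l ?w0//; exact: ndh.
by apply: eq_integral => x; rewrite inE => Dx; apply/cvg_lim => //; apply: cvgeZl => //; exact: cF.
Qed.
End ChangeOfVariables.

Section BorelMeasurability.
Context (R : realType) (M : ptopologicalType).

Lemma borel_open (U : set M) : open U -> measurable (U : set (borel M)).
Proof. by move=> Uo; apply: sub_sigma_algebra. Qed.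

Lemma continuous_borel (f : M -> R) : continuous f -> measurable_fun setT (f : borel M -> R).
Proof.
move=> cf; apply: (measurability _ (RGenOpens.measurableE R)).
move=> _ [_ [b [c ->]] <-]; rewrite setTI; apply: borel_open.
by apply: open_comp; [move=> x _; exact: cf|exact: interval_open].
Qed.
End BorelMeasurability.

Section Volume.
Context (R : realType) (n : nat) (M : ptopologicalType) (X : complexManifold R n M).
Context (g : kahlerMetric X) (vol : {measure set (borel M) -> \bar R}).
Hypothesis hvol : riemannian_volume g vol.
Context (E : euclid R (n + n)).
Local Notation m := (n + n)%N.
Local Notation mu := (emu E).
Implicit Types (i : chart_index X) (y z : M) (p q : 'rV[R]_m).

Definition density i p : R := Num.sqrt (\det (metric g i p)).
Definition chart_region i : set (eT E) := [set x | chart_im i (ephi x)].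

Lemma density_gt0 i p : chart_im i p -> 0 < density i p.
Proof. by move=> ip; rewrite sqrtr_gt0 posdef_det_gt0//; exact: (kahler_pos (metric_kahler g i) ip). Qed.

Lemma smooth_density i : smooth_on (chart_im i) (density i).
Proof.
have io := open_chart_im X i; apply: smooth_on_sqrt => //.
  apply: smooth_on_det => // a b; exact: metric_smooth.
by move=> p ip; apply: posdef_det_gt0; exact: (kahler_pos (metric_kahler g i) ip).
Qed.

Lemma measurable_region i : measurable (chart_region i).
Proof. exact: (measurable_preimage_open (@ecoord _ _ E) (open_chart_im X i)). Qed.

Lemma measurable_chart_inv i : measurable_fun (chart_region i)
  (fun x => chart_inv i (ephi x) : borel M).
Proof.
apply: (@measurability _ _ _ (borel M) _ _ (@open M)) => //.
move=> _ [U Uo <-].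
rewrite (_ : _ `&` _ = [set x | (chart_im i `&` chart_inv i @^-1` U) (ephi x)]); last first.
  by apply/seteqP; split.
apply: (measurable_preimage_open (@ecoord _ _ E)); rewrite openE => p [ip Up].
apply: filterI; first exact: chart_im_nbhs.
by apply: (chart_inv_nbhs ip); exact: open_nbhs_nbhs.
Qed.

Lemma measurable_region_comp i (f : 'rV[R]_m -> R) : (forall p, chart_im i p -> {for p, continuous f}) ->
  measurable_fun (chart_region i) (fun x => f (ephi x)).
Proof. by move=> cf; exact: (measurable_comp_open (@ecoord _ _ E) (open_chart_im X i) cf). Qed.

Lemma measurable_density i : measurable_fun (chart_region i) (fun x => density i (ephi x)).
Proof. by apply: measurable_region_comp => p ip; exact: smooth_on_continuous (smooth_density (i := i)) ip. Qed.

Lemma measurable_indic_chart i (A : set (borel M)) : measurable A ->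
  measurable_fun (chart_region i) (fun x : eT E => (\1_A (chart_inv i (ephi x)) : R)).
Proof.
move=> mA; have mI : measurable_fun setT (\1_A : borel M -> R) by exact: measurable_indic.
exact: (measurableT_comp mI (@measurable_chart_inv i)).
Qed.

Lemma vol_chart i (A : set (borel M)) : measurable A -> A `<=` chart_dom i ->
  vol A = (\int[mu]_(x in chart_region i) ((density i (ephi x))%:E * (\1_A (chart_inv i (ephi x)))%:E))%E.
Proof.
move=> mA Ai; rewrite (hvol mA Ai).
pose f p : \bar R := ((density i p)%:E * (\1_(chart i @` A) p)%:E)%E.
have e : (fun x : eT E => f (ephi x)) =
   (fun x => ((density i (ephi x))%:E * (\1_A (chart_inv i (ephi x)))%:E)%E) \_ (chart_region i).
  apply: funext => x; rewrite patchE /f; case: ifPn => [|/negP].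
    rewrite inE => ix; rewrite !indicE; congr (_ * (nat_of_bool _)%:R%:E)%E; apply/idP/idP; rewrite !inE.
      by move=> [y Ay <-]; rewrite chartK//; exact: Ai.
    by move=> Ay; have [dx ei] := chart_im_inv ix; exists (chart_inv i (ephi x)).
  move=> nx; rewrite indicE memNset ?mule0// => -[y Ay ey]; apply: nx; rewrite inE /chart_region /= -ey.
  by exists y => //; exact: Ai.
have mf : measurable_fun [set: eT E] (fun x => f (ephi x)).
  rewrite e; apply/(measurable_restrictT _ (measurable_region i)).
  apply/measurable_EFinP; apply: measurable_funM; first exact: measurable_density.
  exact: measurable_indic_chart.
rewrite [RHS]integral_mkcond -e (@eint _ _ E f)// => p; rewrite mule_ge0// lee_fin//.
exact: sqrtr_ge0.
Qed.

Lemma integral_chart i (F : borel M -> \bar R) : (forall y, (0 <= F y)%E) -> measurable_fun setT F ->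
  (\int[vol]_(y in (chart_dom i : set (borel M))) F y =
   \int[mu]_(x in chart_region i) ((density i (ephi x))%:E * F (chart_inv i (ephi x))))%E.
Proof.
move=> F0 mF; apply: integral_change => //.
- by apply: borel_open; exact: chart_dom_open.
- exact: measurable_region.
- exact: measurable_chart_inv.
- exact: measurable_density.
- by move=> x ix; exact: sqrtr_ge0.
- by move=> x ix; have [] := chart_im_inv ix.
- exact: vol_chart.
Qed.

(** Positive and negative parts are treated separately, so no integrability is required; the
    density, being nonnegative, passes through the maximum. *)
Lemma integral_chart_real i (H : M -> R) : measurable_fun setT (H : borel M -> R) ->
  (forall y, ~ chart_dom i y -> H y = 0) ->
  (\int[vol]_y (H y)%:E =
   \int[mu]_(x in chart_region i) (density i (ephi x) * H (chart_inv i (ephi x)))%:E)%E.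
Proof.
move=> mH H0.
have pos (K : M -> R) : (forall y, 0 <= K y) -> measurable_fun setT (K : borel M -> R) ->
  (forall y, ~ chart_dom i y -> K y = 0) -> (\int[vol]_y (K y)%:E =
   \int[mu]_(x in chart_region i) (density i (ephi x) * K (chart_inv i (ephi x)))%:E)%E.
  move=> K0 mK Ki; transitivity (\int[vol]_(y in (chart_dom i : set (borel M))) (K y)%:E)%E.
    rewrite [RHS]integral_mkcond; apply: eq_integral => y _; rewrite patchE; case: ifPn => // /negP ny.
    by rewrite Ki//; apply: contra_not ny => ny; rewrite inE.
  rewrite (@integral_chart i (fun y => (K y)%:E))//.
  exact/measurable_EFinP.
rewrite integralE [RHS]integralE; congr (_ - _)%E.
  transitivity (\int[vol]_y (Num.max (H y) 0)%:E)%E; first by apply: eq_integral => y _; rewrite funeposE EFin_max.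
  rewrite (pos (fun y => Num.max (H y) 0)); [|by move=> y; rewrite le_max lexx orbT| |by move=> y /H0 ->; rewrite maxxx].
    apply: eq_integral => x _; rewrite funeposE -EFin_max maxr_pMr ?mulr0//; exact: sqrtr_ge0.
  by apply: measurable_maxr => //; exact: measurable_cst.
transitivity (\int[vol]_y (Num.max (- H y) 0)%:E)%E; first by apply: eq_integral => y _; rewrite funenegE EFin_max.
rewrite (pos (fun y => Num.max (- H y) 0)); [|by move=> y; rewrite le_max lexx orbT| |by move=> y /H0 ->; rewrite oppr0 maxxx].
  by apply: eq_integral => x _; rewrite funenegE -EFinN -EFin_max maxr_pMr ?mulr0 ?mulrN//; exact: sqrtr_ge0.
by apply: measurable_maxr; [exact: measurable_funN|exact: measurable_cst].
Qed.

Lemma emu_cube_ltpinfty p (r : R) (D : set (eT E)) : measurable D ->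
  (forall x, D x -> forall a, `|ephi x 0 a - p 0 a| < r) -> (mu D < +oo)%E.
Proof.
(* For r <= 0 the condition makes [D] empty, except in dimension 0, where it is vacuous and r = 1 is
   used instead. *)
move=> mD hD; have [r0|r0] := ltP 0 r; last first.
  have [n0|n0] := posnP m; last first.
    rewrite (_ : D = set0) ?measure0//; rewrite -subset0 => x /hD /(_ (Ordinal n0)).
    by move=> h; have := le_lt_trans (normr_ge0 _) h; rewrite ltNge r0.
  have hz : forall x : eT E, [set x | forall a, `|ephi x 0 a - p 0 a| < 1] x.
    by move=> x [k kn]; exfalso; move: kn; rewrite n0.
  apply: (@le_lt_trans _ _ (mu [set x | forall a, `|ephi x 0 a - p 0 a| < 1])); last by rewrite ecube ?ltry.
  apply: le_measure => //; rewrite inE//; exact: (measurable_cube (@ecoord _ _ E)).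
apply: (@le_lt_trans _ _ (mu [set x | forall a, `|ephi x 0 a - p 0 a| < r])); last by rewrite ecube ?ltry.
apply: le_measure => //; rewrite inE//; exact: (measurable_cube (@ecoord _ _ E)).
Qed.

Lemma vol_locally_finite x : exists2 U : set M, open_nbhs x U & (vol (U : set (borel M)) < +oo)%E.
Proof.
set i := chart_at X x; set p := chart i x; have ip : chart_im i p := chart_at_im X x.
have dx : chart_dom i x := chart_dom_at X x.
have cd := smooth_on_continuous (@smooth_density i) ip.
have n1 : \forall q \near p, density i q < density i p + 1.
  by apply: (cvgr_lt _ cd); rewrite ltrDl.
have nn : \forall q \near p, chart_im i q /\ density i q < density i p + 1.
  exact: filterI (chart_im_nbhs ip) n1.
move/nbhs_ballP: nn => [r /= r0 hr].
pose B := (ball p r)°.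
have pB : B p by apply: nbhs_singleton; apply: nbhs_interior; exact: nbhsx_ballx.
pose U : set M := chart_dom i `&` chart i @^-1` B.
have Uo : open U.
  rewrite openE => y [dy By]; apply: filterI; first by apply: open_nbhs_nbhs; split=> //; exact: chart_dom_open.
  by apply: (chart_continuous dy); apply: open_nbhs_nbhs; split=> //; exact: open_interior.
exists U; first by split.
rewrite (@vol_chart i); [|exact: borel_open|by move=> y []].
pose D := [set z : eT E | B (ephi z)].
have mD : measurable D by apply: (measurable_preimage_open (@ecoord _ _ E)); exact: open_interior.
have Dr : D `<=` chart_region i by move=> z /interior_subset/hr[].
apply: (@le_lt_trans _ _ (\int[mu]_(z in chart_region i) ((density i p + 1) * \1_D z)%:E)%E).
  apply: ge0_le_integral => //.
  - exact: measurable_region.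
  - by move=> z iz; rewrite mule_ge0// lee_fin//; exact: sqrtr_ge0.
  - apply/measurable_EFinP; apply: measurable_funM; first exact: measurable_density.
    by apply: measurable_indic_chart; exact: borel_open.
  - apply/measurable_EFinP; apply: measurable_funM => //; exact: measurable_funTS.
  - move=> z iz; rewrite -EFinM lee_fin !indicE; have [_ ez] := chart_im_inv iz.
    have -> : (chart_inv i (ephi z) \in U) = (z \in D).
      apply/idP/idP; rewrite !inE; first by move=> [_]; rewrite /= ez.
      by move=> Dz; split; [have [] := chart_im_inv iz|rewrite /= ez].
    case: (boolP (z \in D)) => [|_]; last by rewrite !mulr0.
    by rewrite inE => /interior_subset/hr[_ h]; rewrite !mulr1 ltW.
under eq_integral do rewrite EFinM.
rewrite ge0_integralZl//.
- rewrite integral_indic//; last exact: measurable_region.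
  have := @emu_cube_ltpinfty p r (D `&` chart_region i).
  move=> h; apply: lte_mul_pinfty => //; first by rewrite lee_fin addr_ge0//; exact: sqrtr_ge0.
  apply: h; first by apply: measurableI => //; exact: measurable_region.
  move=> z [/interior_subset [_ hz] _] a; have := hz 0 a.
  by rewrite -ball_normE /= distrC.
- exact: measurable_region.
- by apply/measurable_EFinP; apply: measurable_funTS; exact: measurable_indic.
- by rewrite lee_fin addr_ge0//; exact: sqrtr_ge0.
Qed.

(** This is what makes continuous functions with compact support integrable. *)
Lemma vol_compact (K : set M) : compact K -> (vol (K : set (borel M)) < +oo)%E.
Proof.
move=> cK; pose U x := sval (cid2 (vol_locally_finite x)).
have hU x : open_nbhs x (U x) /\ (vol (U x : set (borel M)) < +oo)%E.
  by rewrite /U; case: cid2.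
have [x _|s [_ sK]] := @compact_cover_seq M K U cK; first by have [[]] := hU x.
have mU x : measurable (U x : set (borel M)) by apply: borel_open; have [[]] := hU x.
have mK : measurable (K : set (borel M)).
  rewrite -[K]setCK; apply: measurableC; apply: borel_open; apply: closed_openC.
  by apply: compact_closed cK; exact: (manifold_hausdorff X).
have : (vol (\big[setU/set0]_(x <- s) U x : set (borel M)) < +oo)%E.
  elim: s {sK} => [|x s ih]; first by rewrite big_nil measure0.
  rewrite big_cons; set B := \big[_/_]_(_ <- _) _ in ih *.
  have mB : measurable (B : set (borel M)) by exact: bigsetU_measurable.
  apply: (@le_lt_trans _ _ (vol (U x : set (borel M)) + vol (B : set (borel M)))%E).
    exact: measureU2.
  by apply: lte_add_pinfty => //; have [] := hU x.
apply: le_lt_trans; apply: le_measure; rewrite ?inE//; first exact: bigsetU_measurable.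
by move=> y /sK[x xs Uy]; rewrite -bigcup_seq; exists x.
Qed.

Lemma vol_open_gt0 (U : set M) x : open U -> U x -> (0 < vol (U : set (borel M)))%E.
Proof.
move=> Uo Ux; set i := chart_at X x; set p := chart i x.
have ip : chart_im i p := chart_at_im X x.
have dx : chart_dom i x := chart_dom_at X x.
have d0 := density_gt0 ip.
have cd := smooth_on_continuous (@smooth_density i) ip.
have n1 : \forall q \near p, density i p / 2 < density i q.
  by apply: (cvgr_gt _ cd); rewrite ltr_pdivrMr// ltr_pMr// ltr1n.
have n2 : \forall q \near p, U (chart_inv i q).
  by apply: (chart_inv_nbhs ip); rewrite chartK//; exact: open_nbhs_nbhs.
have nn : \forall q \near p, (chart_im i q /\ density i p / 2 < density i q) /\ U (chart_inv i q).
  exact: filterI (filterI (chart_im_nbhs ip) n1) n2.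
move/nbhs_ballP: nn => [r /= r0 hr].
pose D := [set z : eT E | forall a, `|ephi z 0 a - p 0 a| < r].
have mD : measurable D by exact: (measurable_cube (@ecoord _ _ E)).
have Db (z : eT E) : D z -> ball p r (ephi z).
  by move=> Dz; split=> // a b; rewrite (ord1 a) -ball_normE /= distrC.
pose A : set M := U `&` chart_dom i.
have mA : measurable (A : set (borel M)).
  by apply: borel_open; apply: openI => //; exact: chart_dom_open.
apply: (@lt_le_trans _ _ (vol (A : set (borel M)))); last first.
  by apply: le_measure; rewrite ?inE//; [exact: borel_open|move=> y []].
rewrite (@vol_chart i)//; last by move=> y [].
apply: (@lt_le_trans _ _ (\int[mu]_(z in chart_region i) ((density i p / 2) * \1_D z)%:E)%E).
  under eq_integral do rewrite EFinM.
  rewrite ge0_integralZl//.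
  - rewrite integral_indic//; last exact: measurable_region.
    rewrite (_ : D `&` _ = D); last first.
      by apply/seteqP; split=> [z []//|z Dz]; split=> //; have [[]] := hr _ (Db z Dz).
    apply: mule_gt0; first by rewrite lte_fin divr_gt0.
    by rewrite [X in (_ < X)%E](@ecube _ _ E p r r0) lte_fin exprn_gt0// mulr_gt0.
  - exact: measurable_region.
  - by apply/measurable_EFinP; apply: measurable_funTS; exact: measurable_indic.
  - by rewrite lee_fin divr_ge0// ltW.
apply: ge0_le_integral => //.
- exact: measurable_region.
- by move=> z iz; rewrite lee_fin mulr_ge0// divr_ge0// ltW.
- apply/measurable_EFinP; apply: measurable_funM => //; exact: measurable_funTS.
- apply/measurable_EFinP; apply: measurable_funM; first exact: measurable_density.
  exact: measurable_indic_chart.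
- move=> z iz; rewrite -EFinM lee_fin !indicE; case: (boolP (z \in D)) => [|_]; last first.
    by rewrite mulr0 mulr_ge0//; exact: sqrtr_ge0.
  rewrite inE => /Db/hr[[_ h1] h2]; rewrite mulr1 mem_set ?mulr1 1?ltW//.
  by split=> //; have [] := chart_im_inv iz.
Qed.
End Volume.

(** * Integration by parts *)

Section JacobiFormula.
Context (R : realType) (m : nat).
Implicit Types (p : 'rV[R]_m) (a : 'I_m).

Lemma partial_prod (I : eqType) (r : seq I) a (F : I -> 'rV[R]_m -> R) p : uniq r ->
  (forall i, differentiable (F i) p) ->
  partial a (fun q => \prod_(i <- r) F i q) p
  = \sum_(k <- r) \prod_(i <- r) (if i == k then partial a (F k) p else F i p).
Proof.
move=> ur dF; have dP (s : seq I) : differentiable (fun q => \prod_(i <- s) F i q) p.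
  elim: s => [|i s ih].
    by under eq_fun do rewrite big_nil; exact: differentiable_cst.
  by under eq_fun do rewrite big_cons; exact: differentiableM.
elim: r ur => [_|j r ih /= /andP[jr ur]].
  by under eq_fun do rewrite big_nil; rewrite partial_cst big_nil.
under eq_fun do rewrite big_cons; rewrite partialM// ih// big_cons big_cons eqxx.
congr (_ + _).
  congr (_ * _); apply: eq_big_seq => i ir.
  by case: eqP => // e; move: jr; rewrite -e ir.
rewrite mulr_sumr; apply: eq_big_seq => k kr; rewrite big_cons.
by case: eqP => // e; move: jr; rewrite e kr.
Qed.

(** Jacobi's formula. By the product rule the derivative is a sum over l of determinants with row l
    differentiated, each expanded along that row. *)
Lemma partial_det k a (G : 'rV[R]_m -> 'M[R]_k) p : diff_mx G p ->
  partial a (fun q => \det (G q)) p = \tr (mpartial a G p *m \adj (G p)).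
Proof.
move=> dG; pose B (l : 'I_k) : 'M[R]_k := \matrix_(i, j) if i == l then mpartial a G p l j else G p i j.
have dP (s : 'I_k -> 'I_k) : differentiable (fun q => \prod_(i <- index_enum 'I_k) G q i (s i)) p.
  elim: (index_enum _) => [|i r ih].
    by under eq_fun do rewrite big_nil; exact: differentiable_cst.
  by under eq_fun do rewrite big_cons; apply: differentiableM => //; exact: dG.
transitivity (\sum_l \det (B l)).
  rewrite /determinant partial_sum => [|s]; last first.
    by apply: differentiableM; [exact: differentiable_cst|exact: dP].
  rewrite exchange_big; apply: eq_bigr => s _; rewrite partialZ//.
  rewrite partial_prod => [||i]; [|exact: index_enum_uniq|exact: dG].
  rewrite mulr_sumr; apply: eq_bigr => l _; congr (_ * _); apply: eq_bigr => i _.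
  by rewrite mxE mpartialE; case: eqP => // ->.
rewrite /mxtrace; apply: eq_bigr => l _; rewrite (expand_det_row _ l) [RHS]mxE.
apply: eq_bigr => j _; rewrite [B l l j]mxE eqxx [\adj _ _ _]mxE; congr (_ * _).
rewrite /cofactor; congr (_ * \det _); apply/matrixP => c d; rewrite !mxE.
by rewrite eq_sym (negbTE (neq_lift _ _)).
Qed.

End JacobiFormula.

Section Divergence.
Context (R : realType) (n : nat) (U : set 'rV[R]_(n + n)).
Context (G : 'rV[R]_(n + n) -> 'M[R]_(n + n)) (kG : kahler_on U G).
Local Notation m := (n + n)%N.
Local Notation D := (fun q => Num.sqrt (\det (G q))).
Local Notation K := (fun q => invmx (G q)).

Let Uo : open U. Proof. exact: kahler_open kG. Qed.

Let det0 p : U p -> 0 < \det (G p).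
Proof. by move=> Up; apply: posdef_det_gt0; exact: (kahler_pos kG Up). Qed.

Lemma smooth_on_volume_form : smooth_on U D.
Proof. by apply: smooth_on_sqrt => //; apply: smooth_on_det => //; exact: kahler_smooth kG. Qed.

(** The square of the density is differentiated instead of the root; Jacobi's formula and metric
    compatibility give twice the trace of the Christoffel matrix. *)
Lemma partial_volume_form a p : U p -> partial a D p = D p * \tr (chris G a p).
Proof.
move=> Up; have d0 := det0 Up; have Gu := kahler_unit kG Up.
have dD := smooth_on_diff smooth_on_volume_form Up.
have e1 : partial a (fun q => D q * D q) p = partial a (fun q => \det (G q)) p.
  apply: near_partial; apply: (near_open Uo) => // q Uq.
  by rewrite -expr2 sqr_sqrtr// ltW// det0.
have dG : diff_mx G p by exact: smooth_mx_diff (kahler_smooth kG) Up.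
rewrite partialM// partial_det// in e1.
have Kadj : \adj (G p) = \det (G p) *: K p.
  by rewrite /invmx Gu scalerA mulfV ?scale1r// gt_eqF.
have tr2 : \tr (mpartial a G p *m \adj (G p)) = \det (G p) * (2 * \tr (chris G a p)).
  rewrite Kadj -scalemxAr mxtraceZ; congr (_ * _).
  rewrite (chris_metric kG)// mulmxDl mxtraceD mulmxK// mxtrace_mulC mulmxA mulVmx// mul1mx mxtrace_tr.
  by rewrite mulr_natl mulr2n.
have s0 : 0 < D p by rewrite sqrtr_gt0.
have ds : \det (G p) = D p * D p by rewrite -expr2 sqr_sqrtr// ltW.
rewrite tr2 in e1.
have gen (s de x t : R) : de = s * s -> x * s + s * x = de * (2 * t) -> 0 < s -> x = s * t.
  move=> -> e s1; apply: (mulfI (_ : 2 * s != 0)); first by rewrite gt_eqF// mulr_gt0.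
  lra.
exact: gen ds e1 s0.
Qed.

(** Harmonicity of the coordinates once more: of the two Christoffel terms in the derivative of the
    inverse metric, one is cancelled by the derivative of the density and the other is
    [chris_trace]. Hence density times g^(ab) d_a d_b is a divergence. *)
Lemma divergence_free b p : U p -> \sum_a partial a (fun q => D q * K q a b) p = 0.
Proof.
move=> Up; have Gu := kahler_unit kG Up.
have dD := smooth_on_diff smooth_on_volume_form Up.
have dK : diff_mx K p by exact: smooth_mx_diff (kahler_inv_smooth kG) Up.
have pK a : mpartial a K p = - (K p *m chris G a p) - (chris G a p)^T *m K p.
  rewrite (mpartial_inv a Uo (kahler_pos kG) (kahler_smooth kG) Up) (chris_metric kG)//.
  rewrite mulmxDr mulmxDl opprD !mulmxA mulmxK// mulVmx// mul1mx; congr (- _ - _).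
have h1 := chris_trace kG b Up.
transitivity (\sum_a (D p * \tr (chris G a p) * K p a b +
   D p * (- (K p *m chris G a p) - (chris G a p)^T *m K p) a b)).
  apply: eq_bigr => a _; rewrite partialM; [|exact: dD|exact: (dK a b)].
  by rewrite partial_volume_form// -pK mpartialE.
have e2 a : (- (K p *m chris G a p) - (chris G a p)^T *m K p) a b =
   - \sum_c K p a c * chris G a p c b - \sum_c chris G c p a a * K p c b.
  rewrite addmxE !oppmxE [(K p *m _) a b]mxE; congr (- _ - _).
  rewrite mxE; apply: eq_bigr => c _; rewrite [_^T a c]mxE.
  by rewrite (chris_sym kG).
under eq_bigr => a _ do rewrite e2 mulrBr mulrN.
rewrite big_split sumrB /= sumrN -mulr_sumr.
rewrite h1 mulr0 oppr0 add0r -mulr_sumr exchange_big /= mulr_sumr.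
apply/eqP; rewrite subr_eq0; apply/eqP; apply: eq_bigr => a _.
by rewrite -mulr_suml mulrA.
Qed.
End Divergence.

Section CompactFunctions.
Context (R : realType).

Lemma compact_fun_bound (T : topologicalType) (K : set T) (f : T -> R) : compact K ->
  (forall x, K x -> {for x, continuous f}) -> exists2 C, 0 < C & forall x, K x -> `|f x| < C.
Proof.
move=> cK cf; have : compact (f @` K).
  by apply: continuous_compact => //; apply: continuous_in_subspaceT => x; rewrite inE; exact: cf.
move=> /compact_bounded[C [_ hC]]; exists (`|C| + 2) => [|x Kx]; first by rewrite ltr_wpDl.
apply: (@le_lt_trans _ _ (`|C| + 1)); last by rewrite ltrD2l ltr1n.
by apply: hC; [apply: le_lt_trans (ler_norm _) _; rewrite ltrDl|exists x].
Qed.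

Context (m : nat) (E : euclid R m).

Lemma integral_divergence (K : set 'rV[R]_m) (F : 'I_m -> 'rV[R]_m -> R) : compact K ->
  (forall a, smooth_on setT (F a)) -> (forall a p, ~ K p -> F a p = 0) ->
  (\int[emu E]_x (\sum_a partial a (F a) (ephi x))%:E)%E = 0%E.
Proof.
move=> cK sF F0; have Kcl : closed K by apply: compact_closed cK; exact: norm_hausdorff.
have F0' a p : ~ K p -> partial a (F a) p = 0.
  move=> nK; rewrite -(partial_cst a (0 : R) p); apply: near_partial.
  have : open_nbhs p (~` K) by split=> //; exact: closed_openC.
  by move/open_nbhs_nbhs; apply: filterS => q nq; exact: F0.
have cp a p : {for p, continuous (partial a (F a))}.
  by apply: smooth_on_continuous (smooth_on_partial a (sF a)) _.
have [L L0 hL] : exists2 L, 0 < L & forall p a, K p -> `|p 0 a| < L.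
  have h (a : 'I_m) : exists2 C, 0 < C & forall p : 'rV[R]_m, K p -> `|p 0 a| < C.
    apply: (compact_fun_bound cK) => p _.
    by apply: differentiable_continuous; exact: differentiable_coord.
  pose C a := sval (cid2 (h a)); have C0 a : 0 < C a by rewrite /C; case: cid2.
  exists (1 + \sum_a C a) => [|p a Kp]; first by rewrite ltr_wpDr// sumr_ge0// => a _; exact: ltW.
  have : `|p 0 a| < C a by rewrite /C; case: cid2 => c c0 /=; apply.
  move=> /lt_le_trans; apply; rewrite (bigD1 a)//= addrCA lerDl addr_ge0// sumr_ge0// => b _; exact: ltW.
pose D := [set x : eT E | K (ephi x)].
have mD : measurable D.
  rewrite (_ : D = ~` [set x : eT E | (~` K) (ephi x)]).
    by apply: measurableC; apply: (measurable_preimage_open (@ecoord _ _ E)); exact: closed_openC.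
  by apply/seteqP; split=> [x /= h|x /= /contrapT].
have Dfin : (emu E D < +oo)%E.
  have := @ecube _ _ E 0 L L0; set Q := [set x | _] => hQ.
  apply: (@le_lt_trans _ _ (emu E Q)); last by rewrite hQ ltry.
  apply: le_measure; rewrite ?inE//; first exact: (measurable_cube (@ecoord _ _ E)).
  by move=> x Kx a; rewrite [(0 : 'rV[R]_m) 0 a]mxE subr0; exact: hL.
have fi a : (emu E).-integrable setT (fun x => (partial a (F a) (ephi x))%:E).
  rewrite (_ : (fun x => _) = (fun x => (partial a (F a) (ephi x))%:E) \_ D); last first.
    apply: funext => x; rewrite patchE; case: ifPn => // /negP nD; rewrite F0'//.
    by apply: contra_not nD => Kx; rewrite inE.
  apply/(integrable_mkcond _ mD); apply: measurable_bounded_integrable => //.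
    apply: measurable_funTS; have := measurable_comp_open (@ecoord _ _ E) openT (fun p _ => cp a p).
    by rewrite preimage_setT.
  have [C C0 hC] := compact_fun_bound cK (fun p _ => cp a p).
  exists C; split; first exact: num_real.
  by move=> c Cc x Dx /=; apply: le_trans (ltW (hC _ Dx)) (ltW Cc).
under eq_integral do rewrite -sumEFin.
rewrite integral_sum// big1// => a _.
have [C C0 hC] := compact_fun_bound cK (fun p _ => cp a p).
apply: (@eibp _ _ E a (F a) L C) => //.
- by move=> p; exact: smooth_on_diff (sF a) _.
- by move=> p; exact: cp.
- move=> p; have [/hC/ltW//|nK] := pselect (K p); by rewrite F0'// normr0 ltW.
- by move=> p c hc; apply: F0 => Kp; have := hL p c Kp; rewrite ltNge hc.
Qed.

Lemma smooth_extend (U K : set 'rV[R]_m) (f : 'rV[R]_m -> R) : open U -> closed K ->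
  smooth_on U f -> (forall p, U p -> ~ K p -> f p = 0) -> K `<=` U ->
  smooth_on setT (fun p => if `[< U p >] then f p else 0).
Proof.
move=> Uo Kcl sf f0 KU s p _; have [Up|nU] := pselect (U p).
  suff h : smooth_on U (fun p => if `[< U p >] then f p else 0) by exact: h.
  by apply: (smooth_on_ext Uo) sf => q Uq; rewrite asboolT.
have Ko : open (~` K) by exact: closed_openC.
suff h : smooth_on (~` K) (fun p => if `[< U p >] then f p else 0) by apply: h => /KU.
apply: (smooth_on_ext Ko (f := fun=> 0)); last exact: smooth_on_cst.
by move=> q nK; case: asboolP => // Uq; rewrite f0.
Qed.
End CompactFunctions.

Section IntegrationByParts.
Context (R : realType) (n : nat) (M : ptopologicalType) (X : complexManifold R n M).
Context (g : kahlerMetric X) (vol : {measure set (borel M) -> \bar R}).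
Hypothesis hvol : riemannian_volume g vol.
Context (E : euclid R (n + n)).
Local Notation m := (n + n)%N.
Local Notation dot := (dot g).
Local Notation lap := (lap g).
Implicit Types (i : chart_index X) (y z : M) (p q : 'rV[R]_m) (f h : M -> R).

Lemma dot_support f h (K : set M) y : closed K -> (forall z, ~ K z -> f z = 0) -> ~ K y -> dot f h y = 0.
Proof.
move=> Kcl f0 nK; have n0 : \forall z \near y, f z = (fun=> 0) z.
  have : open_nbhs y (~` K) by split=> //; exact: closed_openC.
  by move/open_nbhs_nbhs; apply: filterS => z; exact: f0.
by rewrite (dot_near g h n0) dot_gr gr_cst /gform !mul0mx mxE.
Qed.

Lemma integral_parts_chart i (K : set M) psi w : compact K -> K `<=` chart_dom i ->
  smooth X psi -> (forall y, ~ K y -> psi y = 0) -> smooth X w ->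
  (\int[vol]_y (psi y * lap w y + dot psi w y)%:E)%E = 0%E.
Proof.
move=> cK Ki spsi psi0 sw; have io := open_chart_im X i.
have Kcl : closed K by apply: compact_closed cK; exact: (manifold_hausdorff X).
have kG := metric_kahler g i.
pose H y := psi y * lap w y + dot psi w y.
have sH : smooth X H by apply: smoothD; [apply: smoothM => //; exact: smooth_lap|exact: smooth_dot].
have H0 y : ~ K y -> H y = 0 by move=> nK; rewrite /H psi0// mul0r add0r (dot_support w Kcl psi0).
have mH : measurable_fun setT (H : borel M -> R) by apply: continuous_borel; exact: smooth_continuous.
rewrite -[LHS]/(\int[vol]_y (H y)%:E)%E (integral_chart_real hvol E mH (i := i)); last first.
  by move=> y ny; apply: H0 => /Ki.
pose P := psi \o chart_inv i; pose W := w \o chart_inv i.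
(* The flux of grad w with its density, whose coordinate divergence is the density times [lap w]. *)
pose V a q := \sum_b (density g i q * invmx (metric g i q) a b) * partial b W q.
have sV a : smooth_on (chart_im i) (V a).
  apply: (smooth_on_sum io) => b; apply: (smooth_onM io); last exact: smooth_on_partial (sw i).
  by apply: (smooth_onM io); [exact: smooth_density|exact: (kahler_inv_smooth kG)].
pose L := chart i @` K.
have cL : compact L.
  apply: continuous_compact => //; apply: continuous_in_subspaceT => y; rewrite inE => /Ki.
  exact: chart_continuous.
have Lcl : closed L by apply: compact_closed cL; exact: norm_hausdorff.
have Li : L `<=` chart_im i by move=> _ [y Ky <-]; apply: chart_im_at; exact: Ki.
have nL p : chart_im i p -> ~ L p -> ~ K (chart_inv i p).
  by move=> ip nLp Kp; apply: nLp; exists (chart_inv i p) => //; have [_] := chart_im_inv ip.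
(* Extension by zero puts psi V on all of R^m, where the Euclidean divergence theorem applies. *)
pose F a p := if `[< chart_im i p >] then P p * V a p else 0.
have sF a : smooth_on setT (F a).
  apply: (smooth_extend io Lcl) => //; first by apply: (smooth_onM io) => //; exact: spsi.
  by move=> p ip /(nL p ip) nK; rewrite /P /= psi0// mul0r.
have F0 a p : ~ L p -> F a p = 0.
  move=> nLp; rewrite /F; case: asboolP => // ip.
  by rewrite /P /= psi0 ?mul0r//; exact: nL.
rewrite -[RHS](integral_divergence E cL sF F0) integral_mkcond; apply: eq_integral => x _.
rewrite patchE; case: ifPn => [|/negP nx]; last first.
  rewrite big1// => a _; have nLx : ~ L (ephi x) by move=> /Li h; apply: nx; rewrite inE.
  rewrite -(partial_cst a (0 : R) (ephi x)); apply: near_partial.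
  have : open_nbhs (ephi x) (~` L) by split=> //; exact: closed_openC.
  by move/open_nbhs_nbhs; apply: filterS => q nq; rewrite F0.
rewrite inE /chart_region /=; move: (ephi x) => p ip; congr (_%:E).
have [dp ep] := chart_im_inv ip.
have dP : differentiable P p by exact: smooth_on_diff (spsi i) ip.
have dV a : differentiable (V a) p by exact: smooth_on_diff (sV a) ip.
have pF a : partial a (F a) p = partial a P p * V a p + P p * partial a (V a) p.
  rewrite -partialM//; apply: near_partial; apply: (near_open io) => // q iq.
  by rewrite /F asboolT.
under eq_bigr => a _ do rewrite pF.
have dDK a b : differentiable (fun q => density g i q * invmx (metric g i q) a b) p.
  have sD := @smooth_density R n M X g i.
  exact: smooth_on_diff (smooth_onM io sD (kahler_inv_smooth kG a b)) ip.
have pV a : partial a (V a) p = \sum_b (partial a (fun q => density g i q * invmx (metric g i q) a b) p * partial b W p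
    + density g i p * invmx (metric g i p) a b * partial a (partial b W) p).
  rewrite /V partial_sum => [|b]; last first.
    by apply: differentiableM => //; exact: smooth_on_diff (smooth_on_partial b (sw i)) ip.
  apply: eq_bigr => b _; rewrite partialM//; exact: smooth_on_diff (smooth_on_partial b (sw i)) ip.
rewrite big_split /= -mulr_sumr.
have -> : \sum_a partial a (V a) p = density g i p * lap w (chart_inv i p).
  under eq_bigr => a _ do rewrite pV big_split /=.
  rewrite big_split /= exchange_big /= big1 ?add0r => [|b _]; last first.
    by rewrite -mulr_suml (divergence_free kG b ip) mul0r.
  rewrite (lapE g sw dp) ep chart_lapE mulr_sumr; apply: eq_bigr => a _.
  by rewrite mulr_sumr; apply: eq_bigr => b _; rewrite mulrA.
have -> : \sum_a partial a P p * V a p = density g i p * dot psi w (chart_inv i p).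
  rewrite (dotE g spsi sw dp) ep chart_dotE [X in _ * X](_ : _ =
     \sum_a \sum_b partial a P p * invmx (metric g i p) a b * partial b W p); last first.
    rewrite mxE exchange_big /=; apply: eq_bigr => b _; rewrite mxE mulr_suml; apply: eq_bigr => a _.
    by rewrite [_^T b 0]mxE !grad_rowE.
  rewrite mulr_sumr; apply: eq_bigr => a _; rewrite /V !mulr_sumr; apply: eq_bigr => b _.
  move: (partial a P p) (partial b W p) (density g i p) (invmx _ a b) => s1 s2 s3 s4; ring.
rewrite /H /P /=; move: (psi _) (lap _ _) (dot _ _ _) (density _ _ _) => s1 s2 s3 s4; ring.
Qed.

Lemma integrable_compact (K : set M) (H : M -> R) : compact K -> continuous H ->
  (forall y, ~ K y -> H y = 0) -> vol.-integrable setT (fun y => (H y)%:E).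
Proof.
move=> cK cH H0; have Kcl : closed K by apply: compact_closed cK; exact: (manifold_hausdorff X).
have mK : measurable (K : set (borel M)).
  by rewrite -[K]setCK; apply: measurableC; apply: borel_open; exact: closed_openC.
rewrite (_ : (fun y => _) = (fun y => (H y)%:E) \_ K); last first.
  apply: funext => y; rewrite patchE; case: ifPn => // /negP nK; rewrite H0//.
  by apply: contra_not nK => Ky; rewrite inE.
apply/(integrable_mkcond _ mK); apply: measurable_bounded_integrable => //.
- exact: (vol_compact hvol E cK).
- by apply: measurable_funTS; exact: continuous_borel.
have [C C0 hC] := compact_fun_bound cK (fun y _ => cH y).
exists C; split; first exact: num_real.
by move=> c Cc y Ky /=; apply: le_trans (ltW (hC _ Ky)) (ltW Cc).
Qed.

(** Positive exactly inside the coordinate ellipsoid; these functions are the raw material of a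
    partition of unity. *)
Definition chart_bump z0 r y : R :=
  if `[< chart_dom (chart_at X z0) y >] then flat 1 (r ^+ 2 - sqdist g z0 (chart (chart_at X z0) y)) else 0.

Definition chart_ball z0 (r : R) : set M :=
  [set y | chart_dom (chart_at X z0) y /\ sqdist g z0 (chart (chart_at X z0) y) <= r ^+ 2].

Lemma chart_ball_compact z0 r : good_radius g z0 r -> compact (chart_ball z0 r).
Proof. by move=> gr0; apply: (chart_compact gr0 (C := [set t | t <= r ^+ 2])) => //; exact: closed_le. Qed.

Lemma chart_bump_out z0 r y : ~ chart_ball z0 r y -> chart_bump z0 r y = 0.
Proof.
rewrite /chart_bump; case: asboolP => // dy nb; apply: flat_le0; rewrite subr_le0.
by rewrite leNgt; apply/negP => /ltW h; apply: nb.
Qed.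

Lemma chart_bump_ge0 z0 r y : 0 <= chart_bump z0 r y.
Proof. by rewrite /chart_bump; case: asboolP => // _; exact: flat1_ge0. Qed.

Lemma chart_bump_gt0 z0 r : 0 < r -> 0 < chart_bump z0 r z0.
Proof.
move=> r0; rewrite /chart_bump asboolT; last exact: chart_dom_at.
by apply: flat1_gt0; rewrite /sqdist subrr /gform !mul0mx mxE subr0 exprn_gt0.
Qed.

Lemma smooth_chart_bump z0 r : good_radius g z0 r -> smooth X (chart_bump z0 r).
Proof.
move=> gr0; apply/smoothP => y; have bc := chart_ball_compact gr0.
have bcl : closed (chart_ball z0 r) by apply: compact_closed bc; exact: (manifold_hausdorff X).
have [dy|ny] := pselect (chart_dom (chart_at X z0) y); last first.
  apply: (@smooth_at_near _ _ _ _ (fun=> 0)); last exact: smooth_at_cst.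
  have : open_nbhs y (~` chart_ball z0 r) by split; [exact: closed_openC|move=> []].
  by move/open_nbhs_nbhs; apply: filterS => z nz; rewrite chart_bump_out.
have io := open_chart_im X (chart_at X z0).
apply: (smooth_at_intro dy io (chart_im_at dy)).
apply: (smooth_on_ext io (f := fun q => flat 1 (r ^+ 2 - sqdist g z0 q))).
  move=> q iq; have [dq eq] := chart_im_inv iq.
  by rewrite /chart_bump /= asboolT// eq.
apply: smooth_on_flat => //; apply: (smooth_onD io); first exact: smooth_on_cst.
by apply: (smooth_onN io); apply: smooth_on_sub (smooth_sqdist g z0).
Qed.

Lemma dot_suml (I : Type) (s : seq I) (f : I -> M -> R) h y : (forall k, smooth X (f k)) ->
  dot (fun z => \sum_(k <- s) f k z) h y = \sum_(k <- s) dot (f k) h y.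
Proof.
move=> sf; elim: s => [|k s ih].
  by rewrite big_nil; under eq_fun do rewrite big_nil; rewrite dot_gr gr_cst /gform !mul0mx mxE.
rewrite big_cons -ih; under eq_fun do rewrite big_cons.
rewrite dotDl//; first exact: (smoothP X (f k)).1.
by apply: (smoothP X _).1; exact: smooth_sum.
Qed.

(** A partition of unity on the compact K splits psi into pieces supported in single charts, each
    handled by [integral_parts_chart]. *)
Lemma integration_by_parts_compact (K : set M) psi w : compact K ->
  smooth X psi -> (forall y, ~ K y -> psi y = 0) -> smooth X w ->
  (\int[vol]_y (psi y * lap w y + dot psi w y)%:E)%E = 0%E.
Proof.
move=> cK spsi psi0 sw.
have Kcl : closed K by apply: compact_closed cK; exact: (manifold_hausdorff X).
pose r z := sval (cid (good_radius_exists g z)).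
have gr0 z : good_radius g z (r z) by rewrite /r; case: cid.
have r0 z : 0 < r z by have [] := gr0 z.
pose b z := chart_bump z (r z); have sb z : smooth X (b z) by exact: smooth_chart_bump.
have [z _|s [_ hs]] := @compact_cover_seq M K (fun z => [set y | 0 < b z y]) cK.
  split; last exact: chart_bump_gt0.
  rewrite openE => y hy; rewrite /interior; have cy : b z x @[x --> y] --> b z y by apply: (smooth_continuous (sb z)).
  by have := cvgr_gt (b z y) cy; apply; exact: hy.
pose S y := \sum_(z <- s) b z y; have sS : smooth X S by exact: smooth_sum.
have S0 y : K y -> 0 < S y.
  move=> /hs[z zs bz]; rewrite /S (big_rem z zs)/= ltr_pwDl//.
  by apply: sumr_ge0 => z' _; exact: chart_bump_ge0.
(* The sum S may vanish off K, but there psi is zero near the point, so the quotient is smooth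
   everywhere. *)
pose f z y := psi y * b z y * (S y)^-1.
have sf z : smooth X (f z).
  apply/smoothP => y; have [Ky|nK] := pselect (K y).
    apply: smooth_atM; last by apply: smooth_at_inv; [exact: (smoothP X S).1|exact: S0].
    by apply: smooth_atM; [exact: (smoothP X psi).1|exact: (smoothP X (b z)).1].
  apply: (@smooth_at_near _ _ _ _ (fun=> 0)); last exact: smooth_at_cst.
  have : open_nbhs y (~` K) by split=> //; exact: closed_openC.
  by move/open_nbhs_nbhs; apply: filterS => x nx; rewrite /f psi0// !mul0r.
have psiE : psi = fun y => \sum_(z <- s) f z y.
  apply: funext => y; rewrite /f; have [Ky|nK] := pselect (K y); last first.
    by rewrite psi0// big1// => z _; rewrite !mul0r.
  by rewrite -mulr_suml -mulr_sumr mulfK// gt_eqF// S0.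
have f0 z y : ~ chart_ball z (r z) y -> f z y = 0.
  by move=> nb; rewrite /f /b chart_bump_out// mulr0 mul0r.
have fi z : (\int[vol]_y (f z y * lap w y + dot (f z) w y)%:E)%E = 0%E.
  apply: (@integral_parts_chart (chart_at X z) (chart_ball z (r z))) => //.
  - exact: chart_ball_compact.
  - by move=> y [].
  - exact: f0.
have ii z : vol.-integrable setT (fun y => (f z y * lap w y + dot (f z) w y)%:E).
  apply: (@integrable_compact (chart_ball z (r z))).
  - exact: chart_ball_compact.
  - apply: smooth_continuous; apply: smoothD; last exact: smooth_dot.
    by apply: smoothM => //; exact: smooth_lap.
  - move=> y nb; rewrite f0// mul0r add0r; apply: (dot_support w _ (f0 z)) nb.
    by apply: compact_closed (chart_ball_compact (gr0 z)); exact: (manifold_hausdorff X).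
transitivity (\int[vol]_y \sum_(z <- s) (f z y * lap w y + dot (f z) w y)%:E)%E.
  apply: eq_integral => y _; rewrite sumEFin big_split /= -mulr_suml -(dot_suml s w y sf).
  have e1 := congr1 (fun h => h y) psiE; have e2 := congr1 (fun h => dot h w y) psiE.
  by rewrite -e1 -e2.
by rewrite integral_sum// big1.
Qed.
End IntegrationByParts.

(** * Energy estimate *)

Section Caccioppoli.
Context (R : realType).

(* Here a, b, c are the inner products of z = grad phi and w = grad f, [h] is W^(p/4) and [v] is
   1 / W; the last hypothesis is |2 d X - h z|^2 >= 0 for X = grad (phi h). *)
Lemma caccioppoli_scalar (a b c phi h v W p d N L : R) : 0 < d -> 0 < p -> 0 <= v -> v * W = 1 ->
  c * v - 2 * N * W <= L ->
  0 <= ((2 * d - 1) * h) ^+ 2 * a + 2 * ((2 * d - 1) * h) * (2 * d * (p / 4 * phi * (h * v))) * b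
       + (2 * d * (p / 4 * phi * (h * v))) ^+ 2 * c ->
  (1 - d) * (h ^+ 2 * a + 2 * h * (p / 4 * phi * (h * v)) * b + (p / 4 * phi * (h * v)) ^+ 2 * c)
    - (4 * d)^-1 * (h ^+ 2 * a) - p / 4 * (N * (phi * h) ^+ 2)
  <= p / 8 * (phi ^+ 2 * (h ^+ 2 * v) * L +
       (2 * phi * (h ^+ 2 * v) * b + phi ^+ 2 * ((p / 2 - 1) * (h ^+ 2 * v) * v) * c)).
Proof.
move=> d0 p0 v0 vW hL hQ; set Q := (X in 0 <= X) in hQ.
have h1 : phi ^+ 2 * (h ^+ 2 * v) * (c * v - 2 * N * W) <= phi ^+ 2 * (h ^+ 2 * v) * L.
  by apply: ler_wpM2l => //; rewrite mulr_ge0 ?sqr_ge0// mulr_ge0 ?sqr_ge0.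
have h2 : 0 <= (4 * d)^-1 * Q by rewrite mulr_ge0// invr_ge0 mulr_ge0// ltW.
have h3 : p / 8 * (phi ^+ 2 * (h ^+ 2 * v) * (c * v - 2 * N * W) +
       (2 * phi * (h ^+ 2 * v) * b + phi ^+ 2 * ((p / 2 - 1) * (h ^+ 2 * v) * v) * c)) -
  ((1 - d) * (h ^+ 2 * a + 2 * h * (p / 4 * phi * (h * v)) * b + (p / 4 * phi * (h * v)) ^+ 2 * c)
    - (4 * d)^-1 * (h ^+ 2 * a) - p / 4 * (N * (phi * h) ^+ 2)) = (4 * d)^-1 * Q +
    p / 4 * N * (phi * h) ^+ 2 * (1 - v * W).
  by rewrite /Q; field; rewrite gt_eqF.
rewrite vW subrr mulr0 addr0 in h3.
rewrite -subr_ge0; apply: le_trans h2 _; rewrite -h3 lerD2r; apply: ler_wpM2l; last by rewrite lerD2r.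
by rewrite divr_ge0// ltW.
Qed.

Lemma powR_pred (x r : R) : 0 < x -> x `^ (r - 1) = x `^ r / x.
Proof. by move=> x0; rewrite powRD ?powR_inv1 ?(ltW x0)//; apply/implyP => _; rewrite gt_eqF. Qed.

Context (n : nat) (M : topologicalType) (X : complexManifold R n M) (g : kahlerMetric X).
Local Notation dot := (dot g).
Local Notation lap := (lap g).
Implicit Types (f phi N : M -> R) (y : M).

Lemma gr_powR f (r : R) y : smooth_at X f y -> 0 < f y ->
  gr X (fun z => f z `^ r) y = (r * (f y `^ r / f y)) *: gr X f y.
Proof.
by move=> sf f0; rewrite -powR_pred//; apply: (gr_comp1 (phi := fun t => t `^ r) sf); exact: is_derive1_powR.
Qed.

(** Let h = W^(p/4) and H = phi h. The exponent p/2 - 1 and the 1 from Kato add up to p/2, and p/8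
    times p/2 is (p/4)^2, the coefficient of |grad f|^2 in |grad H|^2. So the right side is at least
    <grad H, grad H - h grad phi> - (p/4) N H^2, and Young's inequality with weight d splits the
    mixed term. *)
Lemma caccioppoli_pointwise f W phi N (p d eps : R) y : 0 < d -> 0 < p ->
  smooth X f -> smooth X phi -> (forall z, W z = f z + eps) -> (forall z, 0 < W z) ->
  dot f f y / W y - 2 * N y * W y <= lap f y ->
  (1 - d) * dot (fun z => phi z * W z `^ (p / 4)) (fun z => phi z * W z `^ (p / 4)) y
   - (4 * d)^-1 * (W y `^ (p / 2) * dot phi phi y)
   - p / 4 * (N y * (phi y * W y `^ (p / 4)) ^+ 2)
  <= p / 8 * (phi y ^+ 2 * W y `^ (p / 2 - 1) * lap f y
        + dot (fun z => phi z ^+ 2 * W z `^ (p / 2 - 1)) f y).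
Proof.
move=> d0 p0 sf sphi WE W0 hN.
have sf' : smooth_at X f y by exact: (smoothP X f).1.
have sp' : smooth_at X phi y by exact: (smoothP X phi).1.
have eW : W = fun z => f z + eps by exact: funext.
have sW : smooth X W by rewrite eW; apply: smoothD => //; exact: smooth_cst.
have sWp r : smooth_at X (fun z => W z `^ r) y by apply: (smoothP X _).1; exact: smooth_powR.
have grW : gr X W y = gr X f y by rewrite eW grD ?gr_cst ?addr0//; exact: smooth_at_cst.
have h2 : W y `^ (p / 2) = (W y `^ (p / 4)) ^+ 2.
  by rewrite -powR_mulrn ?powR_ge0// -powRrM; congr (_ `^ _); field.
have gH : gr X (fun z => phi z * W z `^ (p / 4)) y =
    W y `^ (p / 4) *: gr X phi y + (p / 4 * phi y * (W y `^ (p / 4) * (W y)^-1)) *: gr X f y.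
  rewrite grM// gr_powR//; last exact: (smoothP X W).1.
  by rewrite grW scalerA; congr (_ + _ *: _); field; rewrite gt_eqF.
have gP : gr X (fun z => phi z ^+ 2 * W z `^ (p / 2 - 1)) y =
    (2 * phi y * ((W y `^ (p / 4)) ^+ 2 * (W y)^-1)) *: gr X phi y +
    (phi y ^+ 2 * ((p / 2 - 1) * ((W y `^ (p / 4)) ^+ 2 * (W y)^-1) * (W y)^-1)) *: gr X f y.
  rewrite (grM (f := fun z => phi z ^+ 2)) //; last exact: smooth_atM.
  rewrite (grM (f := phi) (h := phi))// gr_powR//; last exact: (smoothP X W).1.
  rewrite grW -scalerDl !scalerA powR_pred// h2; congr (_ *: _ + _ *: _); by field; rewrite gt_eqF.
have As := cometric_sym g y.
rewrite !dot_gr gH gP (gform_comb _ _ _ _ As) powR_pred// h2 /gform gformDl !gformZl -!/(gform _ _ _).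
rewrite dot_gr in hN.
apply: (caccioppoli_scalar (W := W y)) => //; first by rewrite invr_ge0 ltW.
  by rewrite mulVf// gt_eqF.
rewrite -(gform_comb _ _ _ _ As); apply: gform_ge0; exact: cometric_pos.
Qed.

End Caccioppoli.

(** The integral of a nonnegative function is a supremum over simple functions below it, so
    monotonicity holds without measurability. This admits [|kappa|] as an upper bound. *)
Lemma ge0_le_integralT d (T : measurableType d) (R : realType) (mu : {measure set T -> \bar R})
    (F G : T -> \bar R) :
  (forall x, 0 <= F x)%E -> (forall x, F x <= G x)%E -> (\int[mu]_x F x <= \int[mu]_x G x)%E.
Proof.
move=> F0 FG; have G0 x : (0 <= G x)%E by exact: le_trans (FG x).
rewrite !ge0_integralTE//; apply: le_ereal_sup => _ [h /= hF <-]; exists h => // x /=.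
exact: le_trans (hF x) (FG x).
Qed.

(** Of the share 1 - r c left by the curvature term, d spends half on the mixed term; this is the
    optimal split and produces the constant (1 - r c)^-2. *)
Lemma energy_absorb (R : realType) (i1 i2 i3 r c d : R) :
  0 < r -> 0 < 1 - r * c -> i3 <= c * i1 -> d = (1 - r * c) / 2 ->
  (1 - d) * i1 - (4 * d)^-1 * i2 - r * i3 <= 0 -> i1 <= i2 / (1 - r * c) ^+ 2.
Proof.
move=> r0; set e := 1 - r * c => e0 hc -> hh.
have h5 : r * i3 <= r * (c * i1) by rewrite ler_wpM2l// ltW.
have h6 : e * i1 <= i2 / e.
  have e1 : (4 * (e / 2))^-1 * i2 = (i2 / e) / 2 by field; rewrite gt_eqF.
  rewrite e1 in hh; have -> : e * i1 = 2 * (1 - e / 2) * i1 - 2 * (r * (c * i1)) by rewrite /e; field.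
  lra.
by rewrite expr2 invfM mulrA ler_pdivlMr// mulrC.
Qed.

Section EnergyEstimate.
Context (R : realType) (n : nat) (M : ptopologicalType) (X : complexManifold R n M).
Context (g : kahlerMetric X) (vol : {measure set (borel M) -> \bar R}).
Hypothesis hvol : riemannian_volume g vol.
Context (E : euclid R (n + n)) (nu CS : R).
Hypotheses (nu2 : 2 < nu) (CS0 : 0 < CS) (hS : sobolev_inequality g vol nu CS).
Context (kappa : M -> R).
Local Notation dot := (dot g).
Local Notation lap := (lap g).
Implicit Types (f phi N H : M -> R) (y : M) (K : set M).

Lemma sobolev_support H K : compact K -> smooth X H -> (forall y, ~ K y -> H y = 0) ->
  ((\int[vol]_y (`|H y| `^ (2 * nu / (nu - 2)))%:E) `^ ((nu - 2) / nu)
       <= CS%:E * \int[vol]_y (dot H H y)%:E)%E.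
Proof.
move=> cK sH H0; have Kcl : closed K by apply: compact_closed cK; exact: (manifold_hausdorff X).
have e y : (grad_norm g H y ^+ 2)%:E = (dot H H y)%:E by rewrite gradient_norm2.
rewrite -(@eq_integral _ (borel M) _ vol setT (fun y => (dot H H y)%:E) (fun y => (grad_norm g H y ^+ 2)%:E) (fun y _ => e y)).
apply: (hS sH); apply: subclosed_compact cK _; first exact: closed_closure.
rewrite [X in _ `<=` X]((closure_id K).1 Kcl); apply: closure_subset => y /= /eqP hy.
by apply: contrapT => /H0.
Qed.

(** The exponents nu/2 and nu/(nu - 2) are conjugate, and the second turns H^2 into the power 2
    nu/(nu - 2) of |H| on the left of the Sobolev inequality. *)
Lemma sobolev_hoelder N H K : compact K -> smooth X H -> (forall y, ~ K y -> H y = 0) ->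
  continuous N -> (forall y, 0 <= N y <= `|kappa y|) ->
  (\int[vol]_y (N y * H y ^+ 2)%:E <= kappa_norm vol nu kappa * (CS%:E * \int[vol]_y (dot H H y)%:E))%E.
Proof.
move=> cK sH H0 cN N0; have n0 : 0 < nu by exact: lt_trans nu2.
have n2 : 0 < nu - 2 by rewrite subr_gt0.
have cH := smooth_continuous sH.
have mN : measurable_fun setT (N : borel M -> R) by exact: continuous_borel.
have mH : measurable_fun setT (fun y : borel M => H y ^+ 2).
  by apply: continuous_borel => y; apply: cvgM; exact: cH.
have pq : (nu / 2)^-1 + (nu / (nu - 2))^-1 = 1.
  by rewrite !invf_div; field; rewrite gt_eqF.
have := hoelder vol mN mH (divr_gt0 n0 (ltr0Sn _ 1)) (divr_gt0 n0 n2) pq.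
rewrite Lnorm1 [X in (X <= _)%E -> _](_ : _ = \int[vol]_y (N y * H y ^+ 2)%:E)%E; last first.
  apply: eq_integral => y _; rewrite /= ger0_norm// mulr_ge0 ?sqr_ge0//.
  by have /andP[] := N0 y.
move/le_trans; apply; rewrite unlock !invf_div; apply: lee_pmul; rewrite ?poweR_ge0//.
  rewrite /kappa_norm; apply: gt0_ler_poweR; first by rewrite divr_ge0 ?ltW.
  - by rewrite in_itv/= leey andbT; apply: integral_ge0 => y _; rewrite lee_fin powR_ge0.
  - by rewrite in_itv/= leey andbT; apply: integral_ge0 => y _; rewrite lee_fin powR_ge0.
  apply: ge0_le_integralT => y; rewrite /= lee_fin ?powR_ge0//; have /andP[a b] := N0 y.
  by apply: ge0_ler_powR; rewrite ?nnegrE ?normr_ge0// ?(ger0_norm a)// divr_ge0// ltW.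
apply: le_trans (sobolev_support cK sH H0); rewrite le_eqVlt; apply/orP; left; apply/eqP.
congr (_ `^ _)%E; apply: eq_integral => y _; rewrite /=; congr (_%:E).
rewrite normrX -powR_mulrn// -powRrM; congr (_ `^ _); by rewrite mulrA.
Qed.

Section Cutoff.
Context (p kn : R) (p0 : 0 < p) (kn0 : 0 <= kn) (hkn : kappa_norm vol nu kappa = kn%:E).
Local Notation q := (p / 4 * (n.+1%:R * (kn * CS))).
Hypothesis q1 : q < 1.
Context (f W N : M -> R) (eps : R) (sf : smooth X f) (WE : forall y, W y = f y + eps).
Hypotheses (W0 : forall y, 0 < W y) (cN : continuous N).
Hypothesis hN : forall y, 0 <= N y <= n.+1%:R * `|kappa y|.
Hypothesis hL : forall y, dot f f y / W y - 2 * N y * W y <= lap f y.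

(* [q] is the fraction of the energy taken up by the curvature term. *)
Lemma cutoff_energy phi K : compact K -> smooth X phi -> (forall y, ~ K y -> phi y = 0) ->
  \int[vol]_y dot (fun z => phi z * W z `^ (p / 4)) (fun z => phi z * W z `^ (p / 4)) y <= \int[vol]_y (W y `^ (p / 2) * dot phi phi y) / (1 - q) ^+ 2.
Proof.
move=> cK sphi phi0; pose H y := phi y * W y `^ (p / 4); have Kcl : closed K by apply: compact_closed cK; exact: (manifold_hausdorff X).
have sW : smooth X W by rewrite (funext WE : W = _); apply: smoothD => //; exact: smooth_cst.
have sWr r : smooth X (fun y => W y `^ r) by exact: smooth_powR.
have sH : smooth X H by exact: smoothM.
have H0 y : ~ K y -> H y = 0 by move=> nK; rewrite /H phi0 ?mul0r.
pose psi y := phi y ^+ 2 * W y `^ (p / 2 - 1).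
have spsi : smooth X psi by apply: smoothM => //; exact: smoothM.
have psi0 y : ~ K y -> psi y = 0 by move=> nK; rewrite /psi phi0// expr0n mul0r.
have int (G : M -> R) : continuous G -> (forall y, ~ K y -> G y = 0) -> vol.-integrable setT (EFin \o G).
  exact: (integrable_compact hvol E cK).
have intZ (c : R) (G : M -> R) : vol.-integrable setT (EFin \o G) ->
    vol.-integrable setT (EFin \o (fun y => c * G y)).
  by move=> iG; exact: (integrableZl measurableT c iG).
pose F1 := dot H H; pose F2 y := W y `^ (p / 2) * dot phi phi y.
pose F3 y := N y * H y ^+ 2; pose F4 y := psi y * lap f y + dot psi f y.
have i1 : vol.-integrable setT (EFin \o F1).
  apply: int; first by apply: smooth_continuous; exact: smooth_dot.
  by move=> y; exact: dot_support.
have i2 : vol.-integrable setT (EFin \o F2).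
  apply: int; first by apply: smooth_continuous; apply: smoothM => //; exact: smooth_dot.
  by move=> y nK; rewrite /F2 (dot_support g _ Kcl phi0) ?mulr0.
have i3 : vol.-integrable setT (EFin \o F3).
  apply: int; last by move=> y nK; rewrite /F3 H0// expr0n mulr0.
  have cH := smooth_continuous sH.
  by move=> y; apply: cvgM; [exact: cN|apply: cvgM; exact: cH].
have i4 : vol.-integrable setT (EFin \o F4).
  apply: int; last by move=> y nK; rewrite /F4 psi0// (dot_support g _ Kcl psi0)// mul0r addr0.
  apply: smooth_continuous; apply: smoothD; last exact: smooth_dot.
  by apply: smoothM => //; exact: smooth_lap.
set I1 := \int[vol]_y _; set I2 := \int[vol]_y _.
have I10 : 0 <= I1 by apply: Rintegral_ge0 => y _; exact: dot_ge0.
have I20 : 0 <= I2 by apply: Rintegral_ge0 => y _; rewrite mulr_ge0 ?powR_ge0 ?dot_ge0.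
have h3 : \int[vol]_y F3 y <= n.+1%:R * (kn * CS) * I1.
  have := @sobolev_hoelder (fun y => N y / n.+1%:R) H K cK sH H0.
  have c1 : continuous (fun y => N y / n.+1%:R).
    by move=> y; apply: cvgM; [exact: cN|exact: cvg_cst].
  have b1 y : 0 <= N y / n.+1%:R <= `|kappa y|.
    have /andP[a b] := hN y; rewrite divr_ge0//=.
    by rewrite ler_pdivrMr// mulrC.
  move=> /(_ c1 b1); rewrite hkn.
  rewrite (_ : (\int[vol]_y (dot H H y)%:E)%E = I1%:E); last first.
    by rewrite /I1 /Rintegral fineK//; exact: integrable_fin_num.
  have i3' : vol.-integrable setT (EFin \o (fun y => n.+1%:R^-1 * F3 y)) by exact: intZ.
  rewrite (_ : (\int[vol]_y _)%E = (\int[vol]_y (n.+1%:R^-1 * F3 y))%:E); last first.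
    rewrite /Rintegral fineK; last exact: integrable_fin_num.
    by apply: eq_integral => y _; rewrite /F3 mulrAC mulrC.
  rewrite RintegralZl// -!EFinM lee_fin mulrC ler_pdivrMr// => h; apply: le_trans h _.
  rewrite le_eqVlt; apply/orP; left; apply/eqP; ring.
pose d := (1 - q) / 2; have d0 : 0 < d by rewrite divr_gt0// subr_gt0.
have h4 : \int[vol]_y (p / 8 * F4 y) = 0.
  rewrite RintegralZl// /Rintegral (integration_by_parts_compact hvol E cK spsi psi0 sf) /=.
  by rewrite mulr0.
have j1 : vol.-integrable setT (EFin \o (fun y => (1 - d) * F1 y)) by exact: intZ.
have j2 : vol.-integrable setT (EFin \o (fun y => (4 * d)^-1 * F2 y)) by exact: intZ.
have j3 : vol.-integrable setT (EFin \o (fun y => p / 4 * F3 y)) by exact: intZ.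
have j4 : vol.-integrable setT (EFin \o (fun y => p / 8 * F4 y)) by exact: intZ.
have j12 : vol.-integrable setT (EFin \o (fun y => (1 - d) * F1 y - (4 * d)^-1 * F2 y)) by exact: (integrableB measurableT j1 j2).
have j123 : vol.-integrable setT (EFin \o (fun y => (1 - d) * F1 y - (4 * d)^-1 * F2 y - p / 4 * F3 y)).
  exact: (integrableB measurableT j12 j3).
have := le_Rintegral measurableT j123 j4 (fun y _ => caccioppoli_pointwise d0 p0 sf sphi WE W0 (hL y)).
rewrite h4 RintegralB// RintegralB// !RintegralZl// -/I1 -/I2.
by apply: energy_absorb => //; rewrite ?subr_gt0// divr_gt0.
Qed.

Lemma cutoff_sobolev phi K : compact K -> smooth X phi -> (forall y, ~ K y -> phi y = 0) ->
  ((\int[vol]_y (`|phi y * W y `^ (p / 4)| `^ (2 * nu / (nu - 2)))%:E) `^ ((nu - 2) / nu)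
    <= (CS / (1 - q) ^+ 2)%:E * \int[vol]_y (W y `^ (p / 2) * dot phi phi y)%:E)%E.
Proof.
move=> cK sphi phi0; have Kcl : closed K by apply: compact_closed cK; exact: (manifold_hausdorff X).
have sW : smooth X W by rewrite (funext WE : W = _); apply: smoothD => //; exact: smooth_cst.
have sWr r : smooth X (fun y => W y `^ r) by exact: smooth_powR.
pose H y := phi y * W y `^ (p / 4); have sH : smooth X H by exact: smoothM.
have H0 y : ~ K y -> H y = 0 by move=> nK; rewrite /H phi0 ?mul0r.
have i1 : vol.-integrable setT (fun y => (dot H H y)%:E).
  apply: (integrable_compact hvol E cK); first by apply: smooth_continuous; exact: smooth_dot.
  by move=> y; exact: dot_support.
have i2 : vol.-integrable setT (fun y => (W y `^ (p / 2) * dot phi phi y)%:E).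
  apply: (integrable_compact hvol E cK); first by apply: smooth_continuous; apply: smoothM => //; exact: smooth_dot.
  by move=> y nK; rewrite (dot_support g _ Kcl phi0) ?mulr0.
apply: le_trans (sobolev_support cK sH H0) _.
have e1 : (\int[vol]_y (dot H H y)%:E)%E = (\int[vol]_y dot H H y)%:E.
  by rewrite /Rintegral fineK//; exact: integrable_fin_num.
have e2 : (\int[vol]_y (W y `^ (p / 2) * dot phi phi y)%:E)%E = (\int[vol]_y (W y `^ (p / 2) * dot phi phi y))%:E.
  by rewrite /Rintegral fineK//; exact: integrable_fin_num.
rewrite e1 e2 -!EFinM lee_fin; apply: le_trans (ler_wpM2l (ltW CS0) (cutoff_energy cK sphi phi0)) _.
have gen (a b c : R) : a * (b * c) <= a * c * b by rewrite mulrA mulrAC.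
exact: gen.
Qed.
End Cutoff.
End EnergyEstimate.

Lemma powR_add_le (R : realType) (a b s : R) : 0 <= a -> 0 <= b -> 0 <= s ->
  (a + b) `^ s <= 2 `^ s * (a `^ s + b `^ s).
Proof.
wlog ab : a b / a <= b => [hw|] a0 b0 s0.
  have [ab|/ltW ba] := leP a b; first exact: hw.
  by rewrite addrC [X in _ * X]addrC; exact: hw.
apply: (@le_trans _ _ ((2 * b) `^ s)).
  by apply: ge0_ler_powR; rewrite ?nnegrE ?addr_ge0 ?mulr_ge0// mulr_natl mulr2n lerD2r.
by rewrite powRM// ler_wpM2l ?powR_ge0// lerDr powR_ge0.
Qed.

(** * Vanishing of the gradient *)

Section Vanishing.
Context (R : realType) (n : nat) (M : ptopologicalType) (X : complexManifold R n M).
Context (g : kahlerMetric X) (vol : {measure set (borel M) -> \bar R}).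
Hypothesis hvol : riemannian_volume g vol.
Context (E : euclid R (n + n)).
Local Notation dot := (dot g).
Local Notation lap := (lap g).
Implicit Types (f phi : M -> R) (y : M) (K : set M).

(* The negative part of the Bochner term replaces kappa in the integrals: it is continuous,
   whereas kappa need not be measurable. *)
Lemma bochner_potential (kappa : M -> R) (mu : M -> (n ^ 2).-tuple R) u eps :
  (forall x, kahler_eigenvalues g x (mu x)) -> (forall x, kappa x <= 0) ->
  (forall x, kappa x <= (\sum_(k < n) (mu x)`_k) / n.+1%:R) ->
  pluriharmonic X u -> 0 < eps ->
  let f := dot u u in exists2 N : M -> R, continuous N & forall y,
    0 <= N y <= n.+1%:R * `|kappa y| /\
    dot f f y / (f y + eps) - 2 * N y * (f y + eps) <= lap f y.
Proof.
move=> hmu k0 hk hu e0 f; have su := hu.1.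
have sf : smooth X f by exact: smooth_dot.
have f0 y : 0 <= f y by exact: dot_ge0.
pose W y := f y + eps; have W0 y : 0 < W y by rewrite ltr_wpDl.
have sW : smooth X W by apply: smoothD => //; exact: smooth_cst.
have cW := smooth_continuous sW.
pose b y := dot f f y / (2 * W y) - 2^-1 * lap f y.
have cb : continuous b.
  have c1 := smooth_continuous (smooth_dot g sf sf).
  have c2 := smooth_continuous (smooth_lap g sf).
  move=> y; apply: cvgB; last by apply: cvgM; [exact: cvg_cst|exact: c2].
  apply: cvgM; first exact: c1.
  apply: cvgV; first by rewrite gt_eqF// mulr_gt0.
  by apply: cvgM; [exact: cvg_cst|exact: cW].
(* The positive part of b over W, with the maximum written so that continuity is evident. *)
exists (fun y => (b y + `|b y|) / 2 / W y) => [y|y].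
  apply: cvgM; last by apply: cvgV; [rewrite gt_eqF|exact: cW].
  apply: cvgM; last exact: cvg_cst.
  apply: cvgD; first exact: cb.
  by apply: cvg_norm; exact: cb.
have bn : b y + `|b y| = 2 * Num.max (b y) 0.
  have [bp|bn] := leP 0 (b y); first by rewrite ger0_norm//; ring.
  by rewrite ltr0_norm// subrr mulr0.
have hb : b y <= n.+1%:R * `|kappa y| * W y.
  have := manifold_bochner hu e0 (hmu y); rewrite -/f -/(W y).
  have := hk y; rewrite ler_pdivlMr// => hs.
  have h1 : kappa y * n.+1%:R * f y <= (\sum_(k < n) (mu y)`_k) * f y by rewrite ler_wpM2r.
  have h2 : n.+1%:R * `|kappa y| * f y <= n.+1%:R * `|kappa y| * W y.
    by rewrite ler_wpM2l ?mulr_ge0// lerDl ltW.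
  rewrite /b (ler0_norm (k0 y)) in h2 *.
  move: h1 h2; move: (\sum_(k < n) _) (W y) (f y) (kappa y) (n.+1%:R) (lap f y) (dot f f y / _).
  move=> s1 s2 s3 s4 s5 s6 s7 h1 h2 h3.
  have h4 : s5 * - s4 * s3 = - (s4 * s5 * s3) by ring.
  lra.
split.
  have m0 : 0 <= Num.max (b y) 0 by rewrite le_max lexx orbT.
  rewrite bn [2 * _]mulrC mulfK// divr_ge0 ?(ltW (W0 y))//=; change (Num.max (b y) 0 / W y <= n.+1%:R * `|kappa y|).
  rewrite ler_pdivrMr// ge_max hb.
  by rewrite !mulr_ge0// ltW.
have hB : b y <= Num.max (b y) 0 by rewrite le_max lexx.
rewrite bn [2 * Num.max _ _]mulrC mulfK// -[2 * _ * _]mulrA -/(W y) mulfVK ?gt_eqF//.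
apply: (@le_trans _ _ (dot f f y / W y - 2 * b y)); first by rewrite lerD2l lerN2 ler_wpM2l.
rewrite /b le_eqVlt; apply/orP; left; apply/eqP; by field; rewrite gt_eqF.
Qed.

Lemma mass_lower (V : set M) phi W (c s r : R) : open V -> 0 <= c -> 0 <= s -> 0 <= r ->
  (forall y, V y -> 1 <= phi y /\ c <= W y) ->
  ((c `^ s `^ r)%:E * vol (V : set (borel M)) <= \int[vol]_y (`|phi y * W y `^ s| `^ r)%:E)%E.
Proof.
move=> Vo c0 s0 r0 hV; have mV := borel_open Vo.
have := @ge0_le_integralT _ (borel M) R vol (fun y => ((c `^ s `^ r)%:E * (\1_V y)%:E)%E)
   (fun y => (`|phi y * W y `^ s| `^ r)%:E).
rewrite ge0_integralZl_EFin ?powR_ge0//; last 1 first.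
  by apply/measurable_EFinP; exact: measurable_indic.
rewrite integral_indic// setIT; apply=> y; first by rewrite -EFinM lee_fin mulr_ge0 ?powR_ge0.
rewrite -EFinM lee_fin indicE; have [|] := boolP (y \in (V : set M)); last by rewrite mulr0 powR_ge0.
rewrite inE mulr1 => /hV[h1 h2].
apply: ge0_ler_powR; rewrite ?nnegrE ?normr_ge0 ?powR_ge0//.
apply: le_trans (ler_norm _); apply: (@le_trans _ _ (W y `^ s)).
  by apply: ge0_ler_powR; rewrite ?nnegrE// (le_trans c0).
by rewrite ler_peMl ?powR_ge0.
Qed.

(** The slope of phi vanishes off K, so eps contributes only eps^s times the volume of K. *)
Lemma gradient_upper f phi (eps s k : R) K : compact K -> continuous f -> (forall y, 0 <= f y) ->
  0 <= eps -> 0 <= s -> 0 <= k ->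
  (forall y, dot phi phi y <= k) -> (forall y, ~ K y -> dot phi phi y = 0) ->
  (\int[vol]_y ((f y + eps) `^ s * dot phi phi y)%:E <=
   (k * 2 `^ s)%:E * (\int[vol]_y (f y `^ s)%:E + (eps `^ s)%:E * vol (K : set (borel M))))%E.
Proof.
move=> cK cf f0 e0 s0 k0 hk hK.
have Kcl : closed K by apply: compact_closed cK; exact: (manifold_hausdorff X).
have mK : measurable (K : set (borel M)).
  by rewrite -[K]setCK; apply: measurableC; apply: borel_open; exact: closed_openC.
have mi : measurable_fun setT (fun y : borel M => (\1_K y : R)%:E).
  by apply/measurable_EFinP; exact: measurable_indic.
have mf : measurable_fun setT (fun y : borel M => (f y `^ s)%:E).
  apply/measurable_EFinP; apply: (measurableT_comp (measurable_powR _)) => //.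
  exact: continuous_borel.
have e : (\int[vol]_y ((k * 2 `^ s)%:E * ((f y `^ s)%:E + (eps `^ s)%:E * (\1_K y)%:E)) =
   (k * 2 `^ s)%:E * (\int[vol]_y (f y `^ s)%:E + (eps `^ s)%:E * vol (K : set (borel M))))%E.
  have mi2 : measurable_fun setT (fun y : borel M => ((eps `^ s)%:E * (\1_K y : R)%:E)%E).
    exact: measurable_funeM.
  rewrite ge0_integralZl_EFin ?mulr_ge0 ?powR_ge0//; first last.
  - exact: emeasurable_funD.
  - by move=> y _; rewrite -EFinM -EFinD lee_fin addr_ge0 ?mulr_ge0 ?powR_ge0.
  rewrite ge0_integralD//; first last.
  - by move=> y _; rewrite -EFinM lee_fin mulr_ge0 ?powR_ge0.
  - by move=> y _; rewrite lee_fin powR_ge0.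
  by rewrite ge0_integralZl_EFin ?powR_ge0// integral_indic// setIT.
rewrite -e; apply: ge0_le_integralT => y.
  by rewrite lee_fin mulr_ge0 ?powR_ge0 ?dot_ge0.
change (((f y + eps) `^ s * dot phi phi y)%:E <= (k * 2 `^ s * (f y `^ s + eps `^ s * \1_K y))%:E)%E.
rewrite lee_fin indicE; have [Ky|nK] := pselect (K y).
  rewrite (mem_set Ky) mulr1 [leRHS]mulrAC [k * _]mulrC [leRHS]mulrAC; apply: ler_pM; rewrite ?powR_ge0 ?dot_ge0//.
  by rewrite mulrC; exact: powR_add_le.
by rewrite hK// (memNset nK) !mulr0 addr0 !mulr_ge0 ?powR_ge0.
Qed.
(** By contradiction at a point where f > 0; the order of choices matters. The set V and the lower
    bound l depend on f only; then comes k > B / l; then the cutoff F / k and its support K; last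
    eps, in terms of K. The estimates give l <= B / k^2 with k >= 1, against l k > B. *)
Lemma gradient_zero (nu CS p kn : R) (kappa : M -> R) (mu : M -> (n ^ 2).-tuple R) u :
  complete_metric g -> 2 < nu -> 0 < CS -> sobolev_inequality g vol nu CS ->
  (forall x, kahler_eigenvalues g x (mu x)) -> (forall x, kappa x <= 0) ->
  (forall x, kappa x <= (\sum_(k < n) (mu x)`_k) / n.+1%:R) ->
  1 < p -> kappa_norm vol nu kappa = kn%:E -> p / 4 * (n.+1%:R * (kn * CS)) < 1 ->
  pluriharmonic X u -> (grad_norm g u : borel M -> R) \in Lfun vol p%:E ->
  forall x, dot u u x = 0.
Proof.
move=> hc nu2 CS0 hS hmu k0 hk p1 hkn q1 hu hLp x0; have p0 : 0 < p by exact: lt_trans p1.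
have su := hu.1; pose f := dot u u; have sf : smooth X f by exact: smooth_dot.
have cf := smooth_continuous sf.
have f0 y : 0 <= f y by exact: dot_ge0.
apply/eqP; rewrite eq_le dot_ge0 andbT leNgt; apply/negP => fx0; rewrite -/(f x0) in fx0.
have [r gr0] := good_radius_exists g x0; have r0 : 0 < r by have [] := gr0.
pose c := f x0 / 2; have c0 : 0 < c by rewrite divr_gt0.
pose V := interior [set y | c < f y /\ riemannian_dist g x0 y <= 2 * r].
have Vo : open V by exact: open_interior.
have Vx0 : V x0.
  apply: filterI; first by apply: (cvgr_gt (f x0) (cf x0)); rewrite /c ltr_pdivrMr// ltr_pMr// ltr1n.
  apply: filterS (near_good_ball gr0) => y [dy hy].
  have := dist_ball gr0 hy; rewrite chartK// => /le_trans; apply; rewrite ler_pM2l//.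
  by rewrite -(ger0_norm (ltW r0)) -sqrtr_sqr ler_wsqrtr.
have v0 := vol_open_gt0 hvol E Vo Vx0.
pose s := (nu - 2) / nu; pose t := 2 * nu / (nu - 2).
have nu0 : 0 < nu by exact: lt_trans nu2.
have nu20 : 0 < nu - 2 by rewrite subr_gt0.
have s0 : 0 < s by rewrite divr_gt0.
have t0 : 0 < t by rewrite divr_gt0// mulr_gt0.
(* [V] might have infinite volume, so a finite positive bound is extracted from the extended
   real. *)
have [l l0 hl] : exists2 l : R, 0 < l &
    (l%:E <= ((c `^ (p / 4) `^ t)%:E * vol (V : set (borel M))) `^ s)%E.
  have : (0 < ((c `^ (p / 4) `^ t)%:E * vol (V : set (borel M))) `^ s)%E.
    by apply: poweR_gt0; rewrite mule_gt0// lte_fin !powR_gt0.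
  case: (_ `^ s)%E => [b b0|_|//]; last by exists 1; rewrite ?leey.
  by exists b.
have iA := Lfun_integrable (ltW p1) hLp.
have eA y : `|grad_norm g u y| `^ p = f y `^ (p / 2).
  rewrite ger0_norm ?gradient_norm_ge0// /f -gradient_norm2 -powR_mulrn ?gradient_norm_ge0// -powRrM.
  by congr (_ `^ _); field.
have [A hA] : exists A : R, (\int[vol]_y (f y `^ (p / 2))%:E)%E = A%:E.
  exists (fine (\int[vol]_y (f y `^ (p / 2))%:E)%E); rewrite fineK//.
  rewrite (_ : (\int[vol]_y _)%E = (\int[vol]_y (`|grad_norm g u y| `^ p)%:E)%E).
    exact: integrable_fin_num.
  by apply: eq_integral => y _; rewrite eA.
have A0 : 0 <= A.
  by rewrite -lee_fin -hA; apply: integral_ge0 => y _; rewrite lee_fin powR_ge0.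
pose C := CS / (1 - p / 4 * (n.+1%:R * (kn * CS))) ^+ 2.
have C0 : 0 <= C by rewrite divr_ge0 ?sqr_ge0// ltW.
(* The summand 1 next to the integral A of f^(p/2) is room for eps^(p/2) times the volume of K. *)
pose B := C * (2 `^ (p / 2) * (A + 1)).
have B0 : 0 <= B by apply: mulr_ge0 => //; apply: mulr_ge0; [exact: powR_ge0|exact: addr_ge0].
pose k := 1 + B / l; have k1 : 1 <= k by rewrite lerDl divr_ge0// ltW.
have kp : 0 < k by exact: lt_le_trans k1.
(* F is 1-Lipschitz and V lies within distance 2 r of x0, so this margin keeps F above k on V. *)
have [F [sF cF dF] hF] := contraction_unbounded x0 (k + 2 * r) hc.
set K := closure _ in cF.
have Kcl : closed K by exact: closed_closure.
have F0 y : ~ K y -> F y = 0.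
  by move=> nK; apply/eqP/negPn/negP => h; apply: nK; exact: subset_closure.
pose phi y := k^-1 * F y.
have sphi : smooth X phi by apply: smoothM => //; exact: smooth_cst.
have phi0 y : ~ K y -> phi y = 0 by move=> nK; rewrite /phi F0 ?mulr0.
have dphi y : dot phi phi y <= k^-1 ^+ 2.
  have gp : gr X phi y = k^-1 *: gr X F y.
    rewrite /phi grM ?gr_cst ?scaler0 ?add0r//; first exact: smooth_at_cst.
    exact: (smoothP X F).1.
  rewrite dot_gr gp /gform gformZl -/(gform _ _ _) gformC; last exact: cometric_sym.
  rewrite /gform gformZl -/(gform _ _ _) -dot_gr mulrA -expr2 ler_piMr ?sqr_ge0//.
have hV y : V y -> 1 <= phi y /\ c <= f y.
  move=> /interior_subset[/= /ltW cy dy]; split=> //.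
  have := contraction_dist y x0 sF dF; rewrite dist_sym => h.
  rewrite /phi mulrC ler_pdivlMr// mul1r.
  have gen (a b d : R) : k + 2 * r < a -> a <= b + d -> d <= 2 * r -> k <= b by lra.
  exact: gen hF h dy.
have vK := vol_compact hvol E cF.
pose v := fine (vol (K : set (borel M))).
have vE : vol (K : set (borel M)) = v%:E by rewrite /v fineK// ge0_fin_numE.
have v00 : 0 <= v by rewrite fine_ge0.
(* Then eps^(p/2) v = v / (v + 1) <= 1. *)
pose eps := (v + 1)^-1 `^ (2 / p).
have w0 : 0 < v + 1 by rewrite ltr_wpDl.
have e0 : 0 < eps by apply: powR_gt0; rewrite invr_gt0.
have hev : eps `^ (p / 2) * v <= 1.
  rewrite /eps -powRrM (_ : 2 / p * (p / 2) = 1); last by field; rewrite gt_eqF.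
  by rewrite powRr1 ?invr_ge0 ?(ltW w0)// mulrC ler_pdivrMr// mul1r lerDl.
have [N cN hN] := bochner_potential hmu k0 hk hu e0.
pose W y := f y + eps; have W0 y : 0 < W y by rewrite ltr_wpDl.
have := cutoff_sobolev hvol E nu2 CS0 hS p0 hkn q1 sf (fun y => erefl (W y)) W0 cN
  (fun y => (hN y).1) (fun y => (hN y).2) cF sphi phi0.
have hcW y : V y -> 1 <= phi y /\ c <= W y.
  by move=> /hV[h1 h2]; split=> //; apply: le_trans h2 _; rewrite lerDl ltW.
have p4 : 0 <= p / 4 by rewrite divr_ge0 ?ltW.
have p2 : 0 <= p / 2 by rewrite divr_ge0 ?ltW.
have := mass_lower Vo (ltW c0) p4 (ltW t0) hcW.
move=> /(gt0_ler_poweR (ltW s0)) low.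
have k20 : 0 <= k^-1 ^+ 2 by exact: sqr_ge0.
have := gradient_upper cF cf f0 (ltW e0) p2 k20 dphi
  (fun y => dot_support g phi Kcl phi0 (y := y)).
rewrite -/C -/t -/s hA vE => up main.
have low2 := le_trans hl (low _ _).
have up2 : (l%:E <= C%:E * (k^-1 ^+ 2 * 2 `^ (p / 2) * (A + eps `^ (p / 2) * v))%:E)%E.
  apply: (@le_trans _ _ (C%:E * \int[vol]_y (W y `^ (p / 2) * dot phi phi y)%:E)%E).
    apply: le_trans main; apply: low2.
    - by rewrite in_itv/= leey andbT mule_ge0 ?lee_fin ?powR_ge0// measure_ge0.
    - by rewrite in_itv/= leey andbT; apply: integral_ge0 => y _; rewrite lee_fin powR_ge0.
  by apply: lee_wpmul2l => //; rewrite lee_fin.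
have {}up2 : l <= C * (k^-1 ^+ 2 * 2 `^ (p / 2) * (A + eps `^ (p / 2) * v)) by rewrite -lee_fin.
have up3 : l <= k^-1 ^+ 2 * B.
  apply: le_trans up2 _; rewrite /B -[X in _ * X]mulrA mulrCA ler_wpM2l// ler_wpM2l//.
  by rewrite ler_wpM2l ?powR_ge0// lerD2l.
have : l * k <= B.
  apply: (@le_trans _ _ (l * k ^+ 2)); first by rewrite ler_pM2l// expr2 ler_peMr// ltW.
  by move: up3; rewrite exprVn mulrC ler_pdivlMr// exprn_gt0.
by rewrite /k mulrDr mulr1 mulrCA divff ?gt_eqF// mulr1 leNgt => /negP; apply; rewrite ltrDr.
Qed.
End Vanishing.

Theorem theorem1p9 (R : realType) (n : nat) (M : ptopologicalType)
    (X : complexManifold R n M) (g : kahlerMetric X)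
    (vol : {measure set (borel M) -> \bar R})
    (hvol : riemannian_volume g vol)
    (hcomplete : complete_metric g)
    (nu CS : R) (hnu : 2 < nu) (hCS : 0 < CS)
    (hSobolev : sobolev_inequality g vol nu CS)
    (mu : M -> (n ^ 2).-tuple R)
    (hmu : forall x : M, kahler_eigenvalues g x (mu x))
    (kappa : M -> R)
    (hkappa_le0 : forall x : M, kappa x <= 0)
    (hkappa : forall x : M,
       kappa x <= (\sum_(k < n) (mu x)`_k) / n.+1%:R)
    (p : R) (hp : 1 < p)
    (u : M -> R)
    (hu : pluriharmonic X u)
    (huLp : (grad_norm g u : borel M -> R) \in Lfun vol p%:E)
    (hp_ge2 : 2 <= p ->
       (kappa_norm vol nu kappa < (4 / (p * CS * n.+1%:R))%:E)%E)
    (hp_lt2 : p < 2 ->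
       (kappa_norm vol nu kappa
          < (4 * p / ((4 - p) ^+ 2 * CS * n.+1%:R))%:E)%E) :
  exists c : R, forall x : M, u x = c.
Proof.
have [E] := euclid_exists R (n + n).
have p0 : 0 < p by exact: lt_trans hp.
have n0 : 0 < n.+1%:R :> R by rewrite ltr0n.
(* For p < 2 one has p < 4 - p, hence 4 p / (4 - p)^2 < 4 / p, so both ranges of p lead to this
   bound. *)
have hk : (kappa_norm vol nu kappa < (4 / (p * CS * n.+1%:R))%:E)%E.
  have [p2|p2] := leP 2 p; first exact: hp_ge2.
  apply: lt_le_trans (hp_lt2 p2) _; rewrite lee_fin.
  have q0 : 0 < (4 - p) ^+ 2 by rewrite exprn_gt0// subr_gt0; apply: lt_trans p2 _; rewrite ltr_nat.
  have d1 : 0 < p * CS * n.+1%:R by rewrite !mulr_gt0.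
  have d2 : 0 < (4 - p) ^+ 2 * CS * n.+1%:R by apply: mulr_gt0 => //; exact: mulr_gt0.
  rewrite ler_pdivrMr// mulrAC ler_pdivlMr//.
  have -> : 4 * p * (p * CS * n.+1%:R) = 4 * (p ^+ 2 * (CS * n.+1%:R)) by ring.
  rewrite ler_pM2l// -mulrA ler_wpM2r ?mulr_ge0 ?(ltW hCS)//.
  rewrite ler_pXn2r// ?nnegrE; lra.
have kn0 : (0 <= kappa_norm vol nu kappa)%E by exact: poweR_ge0.
have hkn : kappa_norm vol nu kappa = (fine (kappa_norm vol nu kappa))%:E.
  by rewrite fineK// ge0_fin_numE// (lt_trans hk)// ltry.
exists (u point); apply: (@zero_gradient_cst _ _ _ _ g); first exact: hu.1.
apply: (gradient_zero hvol E hcomplete hnu hCS hSobolev hmu hkappa_le0 hkappa hp hkn _ hu huLp).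
move: hk; rewrite {1}hkn lte_fin ltr_pdivlMr ?mulr_gt0//.
have gen (a b c d e : R) : a * (b * c * d) < 4 -> b / 4 * (d * (a * c)) < 1 by lra.
exact: gen.
Qed.
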